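(* Let $d\ge2$, $T > 0$, let $\alpha_0, \beta_0 \in L^\infty(\mathbb{R}^d;\mathbb{R}^d)$ be divergence-free and let $(\alpha, \beta) \in C^0([0, T[ ; L^\infty)$. Define $(u, b) = \frac{1}{2}(\alpha + \beta, \alpha - \beta)$ and $(u_0, b_0) = \frac12(\alpha_0+\beta_0,\alpha_0-\beta_0)$. The assertions below are true. 1. Assume that $(u, b)$ is a bounded weak solution of the ideal MHD system related to the initial data $(u_0, b_0)$, with MHD pressure $\pi$. Then $(\alpha, \beta)$ is a bounded weak solution of the Elsässer system with initial data $(\alpha_0, \beta_0)$ and $\pi_1 = \pi_2 = \pi$. 2. Assume that $(\alpha, \beta)$ is a bounded weak solution of the Elsässer system for the initial data $(\alpha_0, \beta_0)$, with pressures $\pi_1,\pi_2$. Then the following statements are equivalent: (i) $(u, b)$ is a bounded weak solution of the ideal MHD system with initial data $(u_0, b(0))$, and the difference $b(0) - b_0$ is a constant function; (ii) for all times $t \in [0, T[$, we have $b(t) - b(0) \in \mathcal{S}'_h$. In addition, if one of these equivalent conditions is fulfilled, then the pressure gradients $\nabla \pi_1$ and $\nabla \pi_2$ are equal.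
   Context: $\mathcal{D}([0,T[\times\mathbb{R}^d)$ is the space of smooth functions with compact support in $[0,T[\times\mathbb{R}^d$ (not necessarily vanishing at $t=0$), and $\mathcal{D}'([0,T[\times\mathbb{R}^d)$ is its dual, with derivatives defined by duality. For $f\in L^\infty$, $\delta_0(t)\otimes f(x)$ is defined by $\langle\delta_0(t)\otimes f(x),\phi\rangle=\int f(x)\cdot\phi(0,x)\,dx$. For a matrix field $A$, $(\mathrm{div}\,A)_l=\sum_k\partial_kA_{kl}$, and $(v\otimes w)_{kl}=v_kw_l$, so that $\mathrm{div}(v\otimes w)=(v\cdot\nabla)w$ if $\mathrm{div}(v)=0$. Ideal MHD system. Given divergence-free $u_0,b_0\in L^\infty$, a couple $(u,b)\in L^2_{\rm loc}([0,T[;L^\infty)$ is a bounded weak solution related to the initial data $(u_0,b_0)$ if there is a (MHD) pressure $\pi\in\mathcal{D}'([0,T[\times\mathbb{R}^d)$ such that $\partial_tu+\mathrm{div}(u\otimes u-b\otimes b)+\nabla\pi=\delta_0(t)\otimes u_0(x)$ and $\partial_tb+\mathrm{div}(u\otimes b-b\otimes u)=\delta_0(t)\otimes b_0(x)$ in $\mathcal{D}'([0,T[\times\mathbb{R}^d)$, and $\mathrm{div}(u)=0$ in $\mathcal{D}'(]0,T[\times\mathbb{R}^d)$. Elsässer system. Given divergence-free $\alpha_0,\beta_0\in L^\infty$, a couple $(\alpha,\beta)\in L^2_{\rm loc}([0,T[;L^\infty)$ is a bounded weak solution related to the initial data $(\alpha_0,\beta_0)$ if there are pressures $\pi_1,\pi_2\in\mathcal{D}'([0,T[\times\mathbb{R}^d)$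 such that $\partial_t\alpha+\mathrm{div}(\beta\otimes\alpha)+\nabla\pi_1=\delta_0(t)\otimes\alpha_0(x)$ and $\partial_t\beta+\mathrm{div}(\alpha\otimes\beta)+\nabla\pi_2=\delta_0(t)\otimes\beta_0(x)$ in $\mathcal{D}'([0,T[\times\mathbb{R}^d)$, and $\mathrm{div}(\alpha)=\mathrm{div}(\beta)=0$ in $\mathcal{D}'(]0,T[\times\mathbb{R}^d)$. In these definitions the initial data need not coincide with the values of the solution at $t=0$. $\mathcal{S}'_h$ is the set of $f\in\mathcal{S}'(\mathbb{R}^d)$ (componentwise for vector fields) such that $\chi(\lambda D)f\to0$ in $\mathcal{S}'$ as $\lambda\to+\infty$, where $\chi(\lambda D)$ is the Fourier multiplier with symbol $\chi(\lambda\xi)$ and $\chi$ is a fixed smooth radial function supported in $B(0,2)$, equal to $1$ for $|\xi|\le1$ and radially non-increasing.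
   Formalization: Equality of ∇π1 and ∇π2 is stated in D'(]0,T[×R^d); up to t=0 it fails: α=β=0, α0=c≠0 constant, β0=0, π1=δ0(t)⊗c·x, π2=0 satisfies (i) and (ii), yet ∇π1−∇π2=δ0⊗c. *)

(* Defs.v *)
From HB Require Import structures.
From mathcomp Require Import all_boot all_order all_algebra.
From mathcomp Require Import all_classical all_reals all_analysis.
From mathcomp Require Import complex.
Set Implicit Arguments.
Unset Strict Implicit.
Unset Printing Implicit Defensive.
Import Order.TTheory GRing.Theory Num.Theory.
Import numFieldNormedType.Exports.
Local Open Scope classical_set_scope.
Local Open Scope ring_scope.

(* R^d is the normed module 'rV[R]_d, here given the
   sigma-algebra generated by the coordinates, i.e. the Borel sets. *)
Section measurable_rV.
Context {R : realType} {n : nat}.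

Definition rV_coord (i : 'I_n) (x : 'rV[R]_n) : R := x 0 i.

Let rV_measurable : set (set 'rV[R]_n) := g_sigma_preimage rV_coord.

Let rV_set0 : rV_measurable set0.
Proof. exact: sigma_algebra0. Qed.

Let rV_setC A : rV_measurable A -> rV_measurable (~` A).
Proof. exact: sigma_algebraC. Qed.

Let rV_bigcup (F : (set 'rV[R]_n)^nat) : (forall i, rV_measurable (F i)) ->
  rV_measurable (\bigcup_i (F i)).
Proof. exact: sigma_algebra_bigcup. Qed.

HB.instance Definition _ := @isMeasurable.Build default_measure_display
  'rV[R]_n rV_measurable rV_set0 rV_setC rV_bigcup.

End measurable_rV.


Section lebesgue_rV.
Context {R : realType}.

Definition rV_cons n (p : measurableTypeR R * 'rV[R]_n) : 'rV[R]_n.+1 :=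
  \row_i oapp (p.2 0) p.1 (unlift ord0 i).

Definition rV_uncons n (x : 'rV[R]_n.+1) : measurableTypeR R * 'rV[R]_n :=
  (x 0 ord0, \row_(i < n) x 0 (lift ord0 i)).

Lemma rV_cons0 n p : @rV_cons n p 0 ord0 = p.1.
Proof. by rewrite mxE unlift_none. Qed.

Lemma rV_consS n p i : @rV_cons n p 0 (lift ord0 i) = p.2 0 i.
Proof. by rewrite mxE liftK. Qed.

Lemma rV_consK n : cancel (@rV_cons n) (@rV_uncons n).
Proof.
move=> [x y]; rewrite /rV_uncons rV_cons0; congr pair.
by apply/rowP => i; rewrite mxE rV_consS.
Qed.

Lemma measurable_rV_coord n (i : 'I_n) :
  measurable_fun [set: 'rV[R]_n] (@rV_coord R n i).
Proof.
move=> _ Y mY; rewrite setTI; apply: sub_sigma_algebra => /=.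
rewrite -bigcup_seq/=; exists i => /=; first by rewrite mem_index_enum.
by exists Y => //; rewrite setTI.
Qed.

Lemma measurable_fun_rVP d (T : measurableType d) n (f : T -> 'rV[R]_n) :
  (forall i, measurable_fun [set: T] (fun x => f x 0 i)) ->
  measurable_fun [set: T] f.
Proof.
move=> mf _ A mA; rewrite setTI.
have : preimage_set_system [set: T] f
    (<<s \big[setU/set0]_(i < n)
       preimage_set_system setT (@rV_coord R n i) measurable >>)
    (f @^-1` A) by exists A => //; rewrite setTI.
rewrite -g_sigma_preimageE => /(_ _); apply: smallest_sub; last first.
  move=> _ [B + <-]; rewrite -bigcup_seq => -[i _ [C mC <-]].
  by rewrite !setTI -comp_preimage -[X in measurable X]setTI; exact: mf.
exact: sigma_algebra_measurable.
Qed.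

Lemma measurable_rV_cons n : measurable_fun setT (@rV_cons n).
Proof.
apply: measurable_fun_rVP => i.
case: (unliftP ord0 i) => [j|] ->.
- under eq_fun do rewrite rV_consS.
  exact: (measurableT_comp (measurable_rV_coord j) measurable_snd).
- by under eq_fun do rewrite rV_cons0; exact: measurable_fst.
Qed.

Lemma measurable_rV_uncons n : measurable_fun setT (@rV_uncons n).
Proof.
apply/measurable_fun_pairP; split.
  exact: (measurable_rV_coord ord0).
apply: measurable_fun_rVP => i.
under eq_fun do rewrite mxE.
exact: (measurable_rV_coord (lift ord0 i)).
Qed.

Section step.
Variables (n : nat) (mu : {sigma_finite_measure set 'rV[R]_n -> \bar R}).
Local Open Scope ereal_scope.

Let prod_mu : {measure set (measurableTypeR R * 'rV[R]_n)%type -> \bar R} :=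
  @lebesgue_measure R \x mu.

Definition lebesgue_step : set 'rV[R]_n.+1 -> \bar R :=
  pushforward prod_mu (@rV_cons n).

Let step_measure : {measure set 'rV[R]_n.+1 -> \bar R} :=
  measure_function_pushforward__canonical__measure_function_Measure
    prod_mu (@measurable_rV_cons n).

Let step0 : lebesgue_step set0 = 0.
Proof. exact: (measure0 step_measure). Qed.

Let step_ge0 A : 0 <= lebesgue_step A.
Proof. exact: (measure_ge0 step_measure). Qed.

Let step_semi_sigma_additive : semi_sigma_additive lebesgue_step.
Proof. exact: (@measure_semi_sigma_additive _ _ _ step_measure). Qed.

HB.instance Definition _ := isMeasure.Build _ _ _ lebesgue_step
  step0 step_ge0 step_semi_sigma_additive.

Let step_sigma_finite : sigma_finite setT lebesgue_step.
Proof.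
have /sigma_finiteP[F [TF ndF Foo]] := sigma_finiteT (@lebesgue_measure R).
have /sigma_finiteP[G [TG ndG Goo]] := sigma_finiteT mu.
exists (fun k => @rV_uncons n @^-1` (F k `*` G k)).
  rewrite -preimage_bigcup predeqE => x; split=> // _.
  have [i _ Fi] : (\bigcup_i F i) (rV_uncons x).1 by rewrite -TF.
  have [j _ Gj] : (\bigcup_i G i) (rV_uncons x).2 by rewrite -TG.
  exists (maxn i j) => //; split.
  - by move: Fi; exact/subsetPset/ndF/leq_maxl.
  - by move: Gj; exact/subsetPset/ndG/leq_maxr.
move=> k; have [mF Fk] := Foo k; have [mG Gk] := Goo k; split.
  rewrite -[X in measurable X]setTI; apply: measurable_rV_uncons => //.
  exact: measurableX.
rewrite /lebesgue_step /pushforward -comp_preimage.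
rewrite (_ : _ \o _ = idfun); last first.
  by apply/funext => p /=; rewrite rV_consK.
by rewrite /= product_measure1E// lte_mul_pinfty// ge0_fin_numE.
Qed.

HB.instance Definition _ := Measure_isSigmaFinite.Build _ _ _ lebesgue_step
  step_sigma_finite.

End step.

(* Lebesgue measure on R^n, as the n-fold product of Lebesgue measures on R. *)
Fixpoint lebesgue_rV n : {sigma_finite_measure set 'rV[R]_n -> \bar R} :=
  if n is n'.+1 then lebesgue_step (lebesgue_rV n') else \d_(0 : 'rV[R]_0).

Lemma lebesgue_rV_box n (A : 'I_n -> set R) : (forall i, measurable (A i)) ->
  (lebesgue_rV n [set x | forall i, A i (x 0%R i)] =
   \prod_(i < n) @lebesgue_measure R (A i))%E.
Proof.
elim: n => [|n IHn] in A * => mA; rewrite /lebesgue_rV -/lebesgue_rV /=.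
  by rewrite big_ord0 diracE mem_set// => -[].
rewrite big_ord_recl -IHn; last by move=> i; exact: mA.
have mB : measurable [set x : 'rV[R]_n | forall i, A (lift ord0 i) (x 0%R i)].
  rewrite (_ : [set _ | _] = \bigcap_(i in [set: 'I_n])
      (@rV_coord R n i @^-1` A (lift ord0 i))); last first.
    by apply/seteqP; split => x /= Ax i; [move=> _|]; exact: Ax.
  apply: fin_bigcap_measurable => // i _.
  by rewrite -[X in measurable X]setTI; exact: measurable_rV_coord.
rewrite /lebesgue_step /pushforward -product_measure1E//=; last exact: mA.
congr (_ _); apply/seteqP; split => -[x y] /=.
- move=> Axy; split; first by have := Axy ord0; rewrite rV_cons0.
  by move=> i; have := Axy (lift ord0 i); rewrite rV_consS.
- move=> [Ax Ay] i; case: (unliftP ord0 i) => [j|] ->.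
    by rewrite rV_consS; exact: Ay.
  by rewrite rV_cons0.
Qed.

End lebesgue_rV.

Section smooth.
Context {R : realType} {V : normedModType R}.

(* On a finite-dimensional V this is the usual C^k: all iterated directional
   derivatives up to order k exist and are continuous. *)
Fixpoint class_C (k : nat) (f : V -> R) : Prop :=
  continuous f /\
  if k is k'.+1 then
    forall v : V, (forall x, derivable f x v) /\ class_C k' (fun x => 'D_v f x)
  else True.

Definition smooth (f : V -> R) : Prop := forall k, class_C k f.

Definition iter_derive (vs : seq V) (f : V -> R) : V -> R :=
  foldr (fun v (g : V -> R) => (fun x => 'D_v g x)) f vs.

End smooth.

Section distributions.
Context {R : realType} {d : nat}.
Local Notation E := 'rV[R]_d.
Local Notation mu := (@lebesgue_rV R d).
Local Notation leb := (@lebesgue_measure R).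

Definition dot (x y : E) : R := \sum_i x 0 i * y 0 i.

(* The norm of the normed module E is the sup norm; this is the Euclidean one. *)
Definition enorm (x : E) : R := Num.sqrt (dot x x).

Definition unit_vec (i : 'I_d) : E := delta_mx 0 i.

Definition Linfty_norm (f : E -> E) : \bar R :=
  Lnorm mu +oo (fun x => (enorm (f x))%:E).

Definition in_Linfty (f : E -> E) : Prop :=
  measurable_fun [set: E] f /\ (Linfty_norm f < +oo)%E.

Definition divergence_free (f : E -> E) : Prop :=
  forall psi : E -> R, smooth psi ->
    (exists2 K : set E, compact K & forall x, ~ K x -> psi x = 0) ->
    \sum_k (- \int[mu]_x (f x 0 k * 'D_(unit_vec k) psi x)) = 0.

Definition C0_Linfty (T : R) (f : R -> E -> E) : Prop :=
  forall t, 0 <= t < T ->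
    in_Linfty (f t) /\
    Linfty_norm (f s \- f t) @[s --> within `[0, T[ (nbhs t)] --> 0%E.

Definition simple_Linfty (f : R -> E -> E) : Prop :=
  exists (n : nat) (A : 'I_n -> set R) (g : 'I_n -> E -> E),
    (forall i, measurable (A i) /\ in_Linfty (g i)) /\
    forall t x, f t x = \sum_i \1_(A i) t *: g i x.

(* Bochner space L^2_loc([0,T[; L^oo): strong measurability (a.e. limit in L^oo
   of simple functions) and square integrability of the norm on every [0,T']. *)
Definition L2loc_Linfty (T : R) (f : R -> E -> E) : Prop :=
  [/\ {ae leb, forall t, 0 <= t < T -> in_Linfty (f t)},
      exists2 s : nat -> R -> E -> E, (forall n, simple_Linfty (s n)) &
        {ae leb, forall t, 0 <= t < T ->
          Linfty_norm (s n t \- f t) @[n --> \oo] --> 0%E} &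
      forall T', T' < T ->
        (\int[leb]_(t in `[0%R, T']) (Linfty_norm (f t) ^+ 2) < +oo)%E].

Definition dir_t : R * E := (1, 0).
Definition dir_x (i : 'I_d) : R * E := (0, unit_vec i).

(* A smooth function on [0,T[ x R^d is represented by a smooth extension to
   R x R^d; only the values at times t >= 0 are meaningful. *)
Definition supported_in (K : set (R * E)) (phi : R * E -> R) : Prop :=
  forall z, 0 <= z.1 -> ~ K z -> phi z = 0.

Definition test_function (T : R) (phi : R * E -> R) : Prop :=
  smooth phi /\
  exists K : set (R * E),
    [/\ compact K, K `<=` [set z | 0 <= z.1 < T] & supported_in K phi].

(* Test functions on the open slab ]0,T[ x R^d. *)
Definition test_function_pos (T : R) (phi : R * E -> R) : Prop :=
  smooth phi /\
  exists K : set (R * E),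
    [/\ compact K, K `<=` [set z | 0 < z.1 < T] &
        forall z, ~ K z -> phi z = 0].

Definition functional : Type := (R * E -> R) -> R.

Definition dir (j : option 'I_d) : R * E :=
  if j is Some i then dir_x i else dir_t.

(* D'([0,T[ x R^d).  Since the seminorms only involve times t >= 0, the
   continuity estimate forces L phi to depend only on phi restricted to
   [0,T[ x R^d. *)
Definition distribution_on (T : R) (L : functional) : Prop :=
  (forall (a : R) phi psi, test_function T phi -> test_function T psi ->
     L (fun z => a * phi z + psi z) = a * L phi + L psi) /\
  (forall K : set (R * E), compact K -> K `<=` [set z | 0 <= z.1 < T] ->
     exists (N : nat) (C : R), forall (phi : R * E -> R) (M : R),
       smooth phi -> supported_in K phi ->
       (forall js : seq (option 'I_d), (size js <= N)%N ->
          forall z, 0 <= z.1 -> `|iter_derive (map dir js) phi z| <= M) ->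
       `|L phi| <= C * M).

(* As an iterated integral, this depends only on the a.e. class of each f t. *)
Definition regular_dist (T : R) (f : R -> E -> R) : functional := fun phi =>
  \int[leb]_(t in `[0, T[) \int[mu]_x (f t x * phi (t, x)).

Definition delta0 (f : E -> R) : functional := fun phi =>
  \int[mu]_x (f x * phi (0, x)).

Definition ddiff (v : R * E) (L : functional) : functional := fun phi =>
  - L (fun z => 'D_v phi z).

Definition tensor (v w : R -> E -> E) : R -> E -> 'M[R]_d := fun t x =>
  \matrix_(k, l) (v t x 0 k * w t x 0 l).

Definition component (f : R -> E -> E) (l : 'I_d) : R -> E -> R :=
  fun t x => f t x 0 l.

Definition ddt (T : R) (f : R -> E -> E) (l : 'I_d) : functional :=
  ddiff dir_t (regular_dist T (component f l)).

Definition div_mx (T : R) (A : R -> E -> 'M[R]_d) (l : 'I_d) : functional :=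
  fun phi => \sum_k ddiff (dir_x k) (regular_dist T (fun t x => A t x k l)) phi.

Definition div_vec (T : R) (f : R -> E -> E) : functional :=
  fun phi => \sum_k ddiff (dir_x k) (regular_dist T (component f k)) phi.

Definition grad (p : functional) (l : 'I_d) : functional := ddiff (dir_x l) p.

Definition initial_datum (f : E -> E) : Prop :=
  in_Linfty f /\ divergence_free f.

Record MHD_with_pressure (T : R) (u0 b0 : E -> E) (u b : R -> E -> E)
    (p : functional) : Prop := {
  MHD_u0 : initial_datum u0;
  MHD_b0 : initial_datum b0;
  MHD_u : L2loc_Linfty T u;
  MHD_b : L2loc_Linfty T b;
  MHD_p : distribution_on T p;
  MHD_momentum : forall l phi, test_function T phi ->
    ddt T u l phi
    + div_mx T (fun t x => tensor u u t x - tensor b b t x) l phi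
    + grad p l phi
    = delta0 (fun x => u0 x 0 l) phi;
  MHD_induction : forall l phi, test_function T phi ->
    ddt T b l phi
    + div_mx T (fun t x => tensor u b t x - tensor b u t x) l phi
    = delta0 (fun x => b0 x 0 l) phi;
  MHD_div : forall phi, test_function_pos T phi -> div_vec T u phi = 0
}.

Definition MHD_weak_solution (T : R) (u0 b0 : E -> E) (u b : R -> E -> E) :
    Prop :=
  exists p, MHD_with_pressure T u0 b0 u b p.

Record Elsasser_with_pressures (T : R) (a0 b0 : E -> E) (a b : R -> E -> E)
    (p1 p2 : functional) : Prop := {
  Els_a0 : initial_datum a0;
  Els_b0 : initial_datum b0;
  Els_a : L2loc_Linfty T a;
  Els_b : L2loc_Linfty T b;
  Els_p1 : distribution_on T p1;
  Els_p2 : distribution_on T p2;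
  Els_eq1 : forall l phi, test_function T phi ->
    ddt T a l phi + div_mx T (tensor b a) l phi + grad p1 l phi
    = delta0 (fun x => a0 x 0 l) phi;
  Els_eq2 : forall l phi, test_function T phi ->
    ddt T b l phi + div_mx T (tensor a b) l phi + grad p2 l phi
    = delta0 (fun x => b0 x 0 l) phi;
  Els_div1 : forall phi, test_function_pos T phi -> div_vec T a phi = 0;
  Els_div2 : forall phi, test_function_pos T phi -> div_vec T b phi = 0
}.

End distributions.

Section tempered.
Context {R : realType} {d : nat}.
Local Notation E := 'rV[R]_d.
Local Notation mu := (@lebesgue_rV R d).
Local Notation C := R[i].

Definition Re_fun (phi : E -> C) : E -> R := fun x => complex.Re (phi x).
Definition Im_fun (phi : E -> C) : E -> R := fun x => complex.Im (phi x).

Definition weighted_le (k : nat) (M : R) (f : E -> R) : Prop :=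
  forall (js : seq 'I_d), (size js <= k)%N -> forall x,
    (1 + enorm x) ^+ k * `|iter_derive (map unit_vec js) f x| <= M.

Definition schwartz (phi : E -> C) : Prop :=
  [/\ smooth (Re_fun phi), smooth (Im_fun phi) &
      forall k, exists M,
        weighted_le k M (Re_fun phi) /\ weighted_le k M (Im_fun phi)].

Definition tempered (L : (E -> C) -> C) : Prop :=
  (forall (a : C) phi psi, schwartz phi -> schwartz psi ->
     L (fun x => a * phi x + psi x) = a * L phi + L psi) /\
  exists (k : nat) (A : R), forall phi M, schwartz phi ->
    weighted_le k M (Re_fun phi) -> weighted_le k M (Im_fun phi) ->
    Normc.normc (L phi) <= A * M.

Definition integralC (f : E -> C) : C :=
  ((\int[mu]_x complex.Re (f x)) +i* (\int[mu]_x complex.Im (f x)))%C.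

Definition expi (theta : R) : C := (cos theta +i* sin theta)%C.

Definition fourier (phi : E -> C) : E -> C := fun xi =>
  integralC (fun x => expi (- dot x xi) * phi x).

Definition fourier_inv (phi : E -> C) : E -> C := fun x =>
  (((2 * pi) ^+ d)^-1)%:C%C * integralC (fun xi => expi (dot x xi) * phi xi).

(* The Fourier multiplier m(D) on S', i.e. F^-1 (m . F L), where F, F^-1 and the
   multiplication by m act on tempered distributions by duality. *)
Definition fourier_multiplier (m : E -> R) (L : (E -> C) -> C) :
    (E -> C) -> C :=
  let dual (P : (E -> C) -> E -> C) (G : (E -> C) -> C) := fun phi => G (P phi) in
  dual fourier_inv
    (dual (fun phi xi => (m xi)%:C%C * phi xi) (dual fourier L)).

Definition tempered_of (g : E -> R) : (E -> C) -> C := fun phi =>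
  integralC (fun x => (g x)%:C%C * phi x).

Record cutoff (chi : E -> R) : Prop := {
  cutoff_smooth : smooth chi;
  cutoff_radial : forall xi eta, enorm xi = enorm eta -> chi xi = chi eta;
  cutoff_supp : closure [set xi | chi xi != 0] `<=` [set xi | enorm xi < 2];
  cutoff_one : forall xi, enorm xi <= 1 -> chi xi = 1;
  cutoff_nincr : forall xi eta, enorm xi <= enorm eta -> chi eta <= chi xi
}.

(* Convergence in S' is weak-*. *)
Definition Sh (chi : E -> R) (L : (E -> C) -> C) : Prop :=
  tempered L /\
  forall phi, schwartz phi ->
    Normc.normc (fourier_multiplier (fun xi => chi (lambda *: xi)) L phi)
      @[lambda --> +oo] --> (0 : R).

Definition Sh_field (chi : E -> R) (f : E -> E) : Prop :=
  forall i, Sh chi (tempered_of (fun x => f x 0 i)).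

End tempered.

(* Main.v *)
Require Import Defs.
From mathcomp Require Import all_boot all_order all_algebra.
From mathcomp Require Import all_classical all_reals all_analysis.
From HB Require Import structures.
From mathcomp Require Import measurable_realfun ess_sup_inf complex ring lra.
Set Implicit Arguments.
Unset Strict Implicit.
Unset Printing Implicit Defensive.
Import Order.TTheory GRing.Theory Num.Theory.
Import numFieldNormedType.Exports.
Local Open Scope classical_set_scope.
Local Open Scope ring_scope.

(** Subtracting the two Elsasser equations shows that each component [b_l] of
    the magnetic field satisfies the induction equation up to [D_l P], where
    [P] is half the difference of the two pressures; adding them gives the
    momentum equation.  The equivalence of the two systems therefore amounts to
    the vanishing of [grad P], and the whole proof consists in studying the
    functionals [Q_l phi] obtained by testing the induction equation for [b_l]
    ([Qf] below, with density [b_l] and flux [u_k b_l - b_k u_l]).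

    From MHD to Elsasser only one thing is missing, namely [div b = 0].  It is
    propagated by the induction equation: the flux is antisymmetric, so testing
    the equation for [b_l] with [D_l psi] and summing over [l] leaves only
    [div b] tested with [D_t psi], and [psi] may be a primitive in time of any
    test function ([induction_divergence]).

    Conversely [Q_l phi = P (D_l phi)].  The same antisymmetry, together with
    the divergence constraints, gives [sum_l Q_l (D_l phi) = 0], so that [P] is
    harmonic in space.  The translates [y |-> Q_l (phi (. + y))] are then
    bounded harmonic functions, and Liouville's theorem, proved by Bernstein's
    gradient estimate, shows that [Q_l] annihilates all space derivatives
    ([pressure_trivial], [Qf_liouville]); equivalently [Q_l] is invariant under
    translations.  At time 0 this says that [b(0) - b0] has zero gradient,
    hence is constant ([magnetic_offset]), and [b0] can be replaced by [b(0)]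
    without losing the invariance.

    What is left is a function of time alone, which the low-frequency condition
    detects.  The multiplier [chi (lambda D)] is the convolution with an
    integrable kernel [K_lambda] whose mass does not depend on [lambda] and is
    not zero, and whose gradient has an [L^1] norm of order [1 / lambda]
    ([multiplier_kernel], [kernel_int_neq0], [kernel_derive]).  By invariance,
    averaging the translates of [phi] against [K_lambda] multiplies [Q_l phi]
    by the mass of the kernel; the flux terms of the average are of order
    [1 / lambda], and the remaining one is the pairing of [b(t) - b(0)], cut to
    low frequencies, with [D_t phi].  If [b(t) - b(0)] is in [S'_h] the average
    tends to 0, so that [Q_l = 0] ([Qf_zero]).  If conversely [Q_l = 0], then
    testing with [K_lambda] a time step yields
    [|chi (lambda D) (b(t) - b(0))| <= C / lambda] ([Qf_zero_conv]).  Finally,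
    once the induction equation holds exactly, comparing it with the difference
    of the Elsasser equations gives [grad P = 0]. *)

(** * Smooth functions on normed modules *)

Section smooth_calculus.
Context {R : realType}.
Implicit Types V W : normedModType R.

Lemma class_C_continuous V k (f : V -> R) : class_C k f -> continuous f.
Proof. by case: k => [|k] []. Qed.

Lemma class_CW V k (f : V -> R) : class_C k.+1 f -> class_C k f.
Proof.
elim: k f => [|k IH] f [cf df]; first by split.
by split=> // v; split; [exact: (df v).1|exact: (IH _ (df v).2)].
Qed.

Lemma smooth_continuous V (f : V -> R) : smooth f -> continuous f.
Proof. by move=> /(_ 0%N) []. Qed.

Lemma smooth_derivable V (f : V -> R) x v : smooth f -> derivable f x v.
Proof. by move=> /(_ 1%N) [_ /(_ v) []]. Qed.

Lemma smooth_derive V (f : V -> R) v : smooth f -> smooth (fun x => 'D_v f x).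
Proof. by move=> sf k; have [_ /(_ v) []] := sf k.+1. Qed.

(** Smoothness is the largest family of continuous functions stable under
    directional derivatives, which gives proofs by coinduction. *)
Lemma smooth_coind V (P : (V -> R) -> Prop) :
  (forall f, P f -> continuous f) ->
  (forall f v, P f -> (forall x, derivable f x v) /\ P (fun x => 'D_v f x)) ->
  forall f, P f -> smooth f.
Proof.
move=> Pc PD f + k; elim: k f => [|k IH] f Pf; split=> //; try exact: Pc.
by move=> v; have [df PDf] := PD f v Pf; split=> //; exact: IH.
Qed.

(** Smoothness is local; this allows functions glued from two formulas. *)
Lemma class_C_near V k (f : V -> R) :
  (forall x : V, exists2 g, class_C k g & \forall y \near x, f y = g y) ->
  class_C k f.
Proof.
elim: k f => [|k IH] f fg; split=> //.
- move=> x; have [g [cg _] e] := fg x.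
  have e' : {near nbhs x, g =1 f} by apply: filterS e => y ->.
  apply: cvg_trans (near_eq_cvg e') _.
  by rewrite (nbhs_singleton e); exact: cg.
- move=> x; have [g [cg _] e] := fg x.
  have e' : {near nbhs x, g =1 f} by apply: filterS e => y ->.
  apply: cvg_trans (near_eq_cvg e') _.
  by rewrite (nbhs_singleton e); exact: cg.
- move=> v; have [->|v0] := eqVneq v 0.
    split=> [x|]; first exact: derivable0.
    under eq_fun do rewrite derive0.
    apply: IH => x; exists (cst 0); last exact: nearW.
    move: {+}k; elim => [|m H]; split=> //; try exact: cst_continuous.
    move=> w; split=> [y|]; first exact: derivable_cst.
    by under eq_fun do rewrite derive_cst.
  split=> [x|].
    have [g [cg /(_ v) [dg _]] e] := fg x.
    have e' : {near x, g =1 f} by apply: filterS e => y ->.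
    by apply: near_eq_derivable e' _.
  apply: IH => x; have [g [cg /(_ v) [dg Cg]] e] := fg x.
  exists (fun y => 'D_v g y) => //.
  near=> y; apply: near_eq_derive => //.
  by near: y; exact: (near_join e).
Unshelve. all: by end_near. Qed.

Lemma smooth_near V (f : V -> R) :
  (forall x : V, exists2 g, smooth g & \forall y \near x, f y = g y) -> smooth f.
Proof.
by move=> fg k; apply: class_C_near => x; have [g sg e] := fg x; exists g.
Qed.

Lemma smooth_cst V (c : R) : smooth (fun _ : V => c).
Proof.
apply: (@smooth_coind V (fun f => exists c, f = fun=> c)); last by exists c.
- by move=> _ [a ->]; exact: cst_continuous.
- move=> _ v [a ->]; split=> [x|]; first exact: derivable_cst.
  by exists 0; apply/funext => x; rewrite derive_cst.
Qed.

Lemma smoothD V (f g : V -> R) :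
  smooth f -> smooth g -> smooth (fun x => f x + g x).
Proof.
move=> sf sg.
apply: (@smooth_coind V (fun h => exists f g, [/\ smooth f, smooth g &
  h = fun x => f x + g x])); last by exists f, g.
- move=> _ [{sf}f [{sg}g [sf sg ->]]] x.
  by apply: cvgD; exact: smooth_continuous.
- move=> _ v [{sf}f [{sg}g [sf sg ->]]]; split=> [x|].
    by apply: derivableD; exact: smooth_derivable.
  exists (fun x => 'D_v f x), (fun x => 'D_v g x).
  split; try exact: smooth_derive.
  by apply/funext => x; rewrite deriveD//; exact: smooth_derivable.
Qed.

Lemma class_CD V k (f g : V -> R) :
  class_C k f -> class_C k g -> class_C k (fun x => f x + g x).
Proof.
elim: k f g => [|k IH] f g [cf df] [cg dg]; split=> //.
- by move=> x; apply: cvgD; [exact: cf|exact: cg].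
- by move=> x; apply: cvgD; [exact: cf|exact: cg].
- move=> v; have [Df Cf] := df v; have [Dg Cg] := dg v.
  split=> [x|]; first exact: derivableD.
  rewrite (_ : (fun x => _) = fun x => 'D_v f x + 'D_v g x); first exact: IH.
  by apply/funext => x; rewrite deriveD.
Qed.

Lemma class_CM V k (f g : V -> R) :
  class_C k f -> class_C k g -> class_C k (fun x => f x * g x).
Proof.
elim: k f g => [|k IH] f g Cf Cg.
  split=> // x; apply: cvgM; [exact: (class_C_continuous Cf)|
                              exact: (class_C_continuous Cg)].
split; first by move=> x; apply: cvgM; [exact: (class_C_continuous Cf)|
                              exact: (class_C_continuous Cg)].
move=> v; have [_ /(_ v) [Df DCf]] := Cf; have [_ /(_ v) [Dg DCg]] := Cg.
split=> [x|]; first exact: derivableM.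
rewrite (_ : (fun x => _) = fun x => f x * 'D_v g x + g x * 'D_v f x).
  by apply: class_CD; apply: IH => //; exact: class_CW.
by apply/funext => x; rewrite deriveM.
Qed.

Lemma smoothM V (f g : V -> R) :
  smooth f -> smooth g -> smooth (fun x => f x * g x).
Proof. by move=> sf sg k; exact: class_CM. Qed.

Lemma smoothZ V (c : R) (f : V -> R) : smooth f -> smooth (fun x => c * f x).
Proof. by move=> sf; apply: smoothM => //; exact: smooth_cst. Qed.

Lemma smoothB V (f g : V -> R) :
  smooth f -> smooth g -> smooth (fun x => f x - g x).
Proof.
move=> sf sg; rewrite (_ : (fun x => _) = fun x => f x + (-1) * g x).
  by apply: smoothD => //; exact: smoothZ.
by apply/funext => x; rewrite mulN1r.
Qed.

Lemma smooth_prod V (I : Type) (s : seq I) (P : pred I) (f : I -> V -> R) :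
  (forall i, smooth (f i)) -> smooth (fun x => \prod_(i <- s | P i) f i x).
Proof.
move=> sf; elim: s => [|i s IH].
  by under eq_fun do rewrite big_nil; exact: smooth_cst.
under eq_fun do rewrite big_cons.
by case: (P i) => //; exact: smoothM.
Qed.

(** Composition with an affine map whose linear part is [L0]:
    differentiating it along [v] is differentiating along [L0 v]. *)
Lemma derive_comp_affine V W (L L0 : V -> W) (f : W -> R) x v :
  (forall h y w, L (h *: w + y) = h *: L0 w + L y) ->
  'D_v (fun y => f (L y)) x = 'D_(L0 v) f (L x).
Proof.
by move=> LE; rewrite /derive; under eq_fun do rewrite /= LE.
Qed.

Lemma derivable_comp_affine V W (L L0 : V -> W) (f : W -> R) x v :
  (forall h y w, L (h *: w + y) = h *: L0 w + L y) ->
  derivable f (L x) (L0 v) -> derivable (fun y => f (L y)) x v.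
Proof.
by move=> LE; rewrite /derivable; under [in X in _ -> X]eq_fun do rewrite /= LE.
Qed.

Lemma class_C_comp_affine V W (L L0 : V -> W) k (f : W -> R) :
  (forall h y w, L (h *: w + y) = h *: L0 w + L y) -> continuous L ->
  class_C k f -> class_C k (fun x => f (L x)).
Proof.
move=> LE cL; elim: k f => [|k IH] f Cf.
  split=> // x.
  by apply: (@continuous_comp _ _ _ L f); [exact: cL|exact: (class_C_continuous Cf)].
split.
  move=> x.
  by apply: (@continuous_comp _ _ _ L f); [exact: cL|exact: (class_C_continuous Cf)].
move=> v; have [_ /(_ (L0 v)) [Df DCf]] := Cf; split=> [x|].
  exact: (derivable_comp_affine LE).
under eq_fun do rewrite (derive_comp_affine _ _ _ LE).
exact: (IH _ DCf).
Qed.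

Lemma smooth_comp_affine V W (L L0 : V -> W) (f : W -> R) :
  (forall h y w, L (h *: w + y) = h *: L0 w + L y) -> continuous L ->
  smooth f -> smooth (fun x => f (L x)).
Proof. by move=> LE cL sf k; exact: (class_C_comp_affine LE). Qed.

#[local] Opaque derive.

Lemma derive_line V (f : V -> R) x v (s : R) :
  'D_1 (fun s : R => f (x + s *: v)) s = 'D_v f (x + s *: v).
Proof.
rewrite (@derive_comp_affine _ _ (fun s : R => x + s *: v) (fun s => s *: v)).
  by rewrite scale1r.
by move=> h y w; rewrite scalerDl -scalerA addrCA.
Qed.

Lemma is_derive_line V (f : V -> R) x v (s : R) :
  derivable f (x + s *: v) v ->
  is_derive s 1 (fun s : R => f (x + s *: v)) ('D_v f (x + s *: v)).
Proof.
move=> df; apply: DeriveDef; last exact: derive_line.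
apply: (@derivable_comp_affine _ _ (fun s : R => x + s *: v) (fun s => s *: v)).
  by move=> h y w; rewrite scalerDl -scalerA addrCA.
by rewrite scale1r.
Qed.

Lemma MVT_line V (f : V -> R) x v (s : R) :
  (forall y, derivable f y v) ->
  exists2 c : R, `|c| <= `|s| & f (x + s *: v) - f x = s * 'D_v f (x + c *: v).
Proof.
move=> df.
pose F (r : R) := f (x + r *: v); pose F' (r : R) := 'D_v f (x + r *: v).
have dF (r : R) : is_derive r 1 F (F' r) by exact: is_derive_line.
have cF a b : {within `[a, b], continuous F}.
  by apply: derivable_within_continuous => r _; have [] := dF r.
have F0 : F 0 = f x by rewrite /F scale0r addr0.
have [s0|s0] := leP 0 s.
  have [c] := MVT_segment s0 (fun y _ => dF y) (cF 0 s).
  rewrite in_itv/= => /andP[c0 cs] e.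
  exists c; first by rewrite !ger0_norm.
  by rewrite -F0 e subr0 mulrC.
have [c] := MVT_segment (ltW s0) (fun y _ => dF y) (cF s 0).
rewrite in_itv/= => /andP[sc c0] e.
exists c; first by rewrite !ler0_norm ?lerN2// ltW.
by rewrite -F0 -[LHS]opprB e sub0r mulrN opprK mulrC.
Qed.

End smooth_calculus.

#[local] Opaque derive.

(** * Symmetry of second derivatives *)

Section schwarz.
Context {R : realType} {V : normedModType R}.
Implicit Types (f : V -> R) (x v w : V).

(** Applying the mean value theorem twice writes the second difference as a
    mixed derivative at an intermediate point, in either order. *)
Lemma second_difference f x v w (s : R) : smooth f ->
  exists c c' : R, [/\ `|c| <= `|s|, `|c'| <= `|s| &
    f (x + s *: v + s *: w) - f (x + s *: v) - (f (x + s *: w) - f x) =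
    s * (s * 'D_w (fun y => 'D_v f y) (x + c *: v + c' *: w))].
Proof.
move=> sf; pose g y := f (y + s *: w) - f y.
have sg : smooth g.
  apply: smoothB => //.
  apply: (@smooth_comp_affine _ _ _ (fun y => y + s *: w) id) => //.
    by move=> h y z; rewrite addrA.
  by move=> y; apply: cvgD; [exact: cvg_id|exact: cvg_cst].
have [c cs e] := @MVT_line _ _ g x v s (fun y => smooth_derivable sg).
have Dg y : 'D_v g y = 'D_v f (y + s *: w) - 'D_v f y.
  rewrite /g deriveB; last exact: smooth_derivable.
    congr (_ - _); rewrite (@derive_comp_affine _ _ _ (fun y => y + s *: w) id)//.
    by move=> h z z'; rewrite addrA.
  apply: (@derivable_comp_affine _ _ _ (fun y => y + s *: w) id).
    by move=> h z z'; rewrite addrA.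
  exact: smooth_derivable.
have [c' cs' e'] := @MVT_line _ _ (fun y => 'D_v f y) (x + c *: v) w s
  (fun y => smooth_derivable (smooth_derive v sf)).
exists c, c'; split=> //.
by rewrite -[LHS]/(g _ - g _) e Dg e'.
Qed.

Lemma eq_at_limit (S : R -> R) (A B : V -> R) v w x :
  continuous A -> continuous B ->
  (forall s : R, exists c c' : R, [/\ `|c| <= `|s|, `|c'| <= `|s| &
      S s = s * (s * B (x + c *: v + c' *: w))]) ->
  (forall s : R, exists c c' : R, [/\ `|c| <= `|s|, `|c'| <= `|s| &
      S s = s * (s * A (x + c *: w + c' *: v))]) ->
  A x = B x.
Proof.
move=> cA cB H H'.
apply/eqP; rewrite -subr_eq0 -normr_le0; apply/ler_addgt0Pl => e e0.
rewrite addr0.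
have e2 : 0 < e / 2 by rewrite divr_gt0.
have /cvgrPdist_le/(_ _ e2)/nbhs_ballP[a/= a0 Aa] := cA x.
have /cvgrPdist_le/(_ _ e2)/nbhs_ballP[b/= b0 Bb] := cB x.
pose m := Num.min a b; have m0 : 0 < m by rewrite lt_min a0.
pose N := `|v| + `|w| + 1; have N0 : 0 < N by rewrite ltr_wpDl ?addr_ge0.
pose s := m / (2 * N); have s0 : 0 < s by rewrite divr_gt0// mulr_gt0.
have near_x c c' v' w' : `|v'| + `|w'| = `|v| + `|w| ->
    `|c| <= `|s| -> `|c'| <= `|s| -> ball x m (x + c *: v' + c' *: w').
  move=> e' cs cs'; rewrite -ball_normE/= -addrA opprD addNKr normrN.
  rewrite (le_lt_trans (ler_normD _ _))// !normrZ.
  rewrite (@le_lt_trans _ _ (s * (`|v| + `|w|)))//.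
    by rewrite (gtr0_norm s0) in cs cs'; rewrite -e' mulrDr lerD// ler_wpM2r.
  rewrite (@lt_le_trans _ _ (s * N))//.
    by rewrite ltr_pM2l// /N ltrDl.
  rewrite /s invfM mulrA -mulrA mulVf ?gt_eqF// mulr1.
  by move: m0; clear; lra.
have [c [c' [cs cs' e1]]] := H s; have [d [d' [ds ds' e3]]] := H' s.
have AB : A (x + d *: w + d' *: v) = B (x + c *: v + c' *: w).
  have s00 := lt0r_neq0 s0.
  by apply: (mulfI s00); apply: (mulfI s00); rewrite -e1 -e3.
have -> : A x - B x = (A x - A (x + d *: w + d' *: v)) -
   (B x - B (x + c *: v + c' *: w)).
  by rewrite AB opprB addrA subrK.
rewrite (le_trans (ler_normB _ _))// [leRHS]splitr lerD//.
  apply: Aa; apply: (@le_ball _ _ _ m); first by rewrite ge_min lexx.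
  by apply: near_x => //; rewrite addrC.
apply: Bb; apply: (@le_ball _ _ _ m); first by rewrite ge_min lexx orbT.
exact: near_x.
Qed.

(** Both mixed derivatives are limits of the same second difference
    quotient. *)
Lemma derive_comm f v w : smooth f ->
  (fun y => 'D_v (fun z => 'D_w f z) y) = (fun y => 'D_w (fun z => 'D_v f z) y).
Proof.
move=> sf; apply/funext => x.
have H w' := smooth_continuous (smooth_derive w' (smooth_derive _ sf)).
apply: (eq_at_limit (H _ _) (H _ _)).
  by move=> s; exact: second_difference.
move=> s; have [c [c' [cs cs' e]]] := second_difference x w v s sf.
exists c, c'; split; [exact: cs|exact: cs'|rewrite -e].
rewrite (addrAC x (s *: w)); move: (f _) (f _) (f _) (f _) => p q r t.
by rewrite !opprB addrACA [RHS]addrACA [X in _ + X]addrC.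
Qed.

End schwarz.

(** * Functions of bounded support *)

Section bounded_support.
Context {R : realType} {V : normedModType R}.
Implicit Types (f : V -> R).

Definition bsupp f := exists A : R, forall z, A < `|z| -> f z = 0.

(** The compactness property of the normed modules R^n and R x R^n under
    which uniform continuity arguments apply. *)
Definition heine_borel := forall A : R, compact [set z : V | `|z| <= A].

Lemma bsupp_derive f v : bsupp f -> bsupp (fun x => 'D_v f x).
Proof.
move=> [A fA]; exists A => z Az.
rewrite -(derive_cst (0 : R) z v); apply: near_eq_derive.
have : \forall y \near z, A < `|y|.
  by apply: (@cvgr_gt _ _ _ _ (fun y => `|y|) `|z|) => //; exact: norm_continuous.
by apply: filterS => y /fA.
Qed.

Lemma bsuppMl f g : bsupp f -> bsupp (fun x => f x * g x).
Proof. by move=> [A fA]; exists A => z /fA ->; rewrite mul0r. Qed.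

Lemma bsuppMr f g : bsupp g -> bsupp (fun x => f x * g x).
Proof. by move=> [A fA]; exists A => z /fA ->; rewrite mulr0. Qed.

Lemma bsuppD f g : bsupp f -> bsupp g -> bsupp (fun x => f x + g x).
Proof.
move=> [A fA] [B gB]; exists (Num.max A B) => z.
by rewrite gt_max => /andP[/fA -> /gB ->]; rewrite addr0.
Qed.

Lemma bsupp_bounded f : heine_borel -> continuous f -> bsupp f ->
  exists2 M, 0 <= M & forall x, `|f x| <= M.
Proof.
move=> hb cf [A fA].
have /compact_near_coveringP K := hb A.
have : \forall M \near +oo, [set z : V | `|z| <= A] `<=` (fun x => `|f x| <= M).
  apply: (K _ (+oo : set_system R) (fun M x => `|f x| <= M)) => x _.
  exists ([set y | `|f y| <= `|f x| + 1], [set M | `|f x| + 1 <= M]); last first.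
    by move=> [y M]/= [yx xM]; exact: le_trans xM.
  split=> /=; last exact: nbhs_pinfty_ge.
  have /cvgrPdist_le/(_ _ ltr01) := cf x.
  apply: filterS => y xy /=; rewrite -[f y](subrK (f x)).
  by rewrite (le_trans (ler_normD _ _))// addrC lerD2l distrC.
move=> [M [_ /(_ (Num.max M 0 + 1))]] H.
have M0 : 0 <= Num.max M 0 + 1 by rewrite addr_ge0// le_max lexx orbT.
exists (Num.max M 0 + 1) => // x.
have [xA|Ax] := leP `|x| A; last by rewrite fA// normr0.
by apply: H => //; rewrite ltr_pwDr// le_max lexx.
Qed.

Lemma bsupp_unif_continuous f : heine_borel -> continuous f -> bsupp f ->
  forall e : R, 0 < e -> exists2 d : R, 0 < d &
    forall x y, `|x - y| <= d -> `|f x - f y| <= e.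
Proof.
move=> hb cf [A fA] e e0.
have /compact_near_coveringP K := hb (A + 1).
have : \forall d \near 0^'+, [set z : V | `|z| <= A + 1] `<=`
    (fun x => forall y, `|x - y| <= d -> `|f x - f y| <= e).
  apply: (K _ (0^'+ : set_system R)
    (fun d x => forall y, `|x - y| <= d -> `|f x - f y| <= e)) => x _.
  have e2 : 0 < e / 2 by rewrite divr_gt0.
  have /cvgrPdist_le/(_ _ e2)/nbhs_ballP[a/= a0 H] := cf x.
  have a2 : 0 < a / 2 by rewrite divr_gt0.
  exists (ball x (a / 2), [set d | d < a / 2]).
    by split=> /=; [exact: nbhsx_ballx|exact: nbhs_right_lt].
  move=> [x' d]/= [xx' da] y x'y.
  rewrite (_ : f x' - f y = (f x - f y) - (f x - f x')); last by ring.
  rewrite (le_trans (ler_normB _ _))// [leRHS]splitr lerD//.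
    apply: H; rewrite [a]splitr; apply: (ball_triangle xx').
    by rewrite -ball_normE/=; exact: le_lt_trans da.
  by apply: H; apply: le_ball xx'; lra.
move=> H; near (0 : R)^'+ => d.
have d0 : 0 < d by [].
have d1 : d <= 1 by near: d; exact: nbhs_right_le.
exists d => // x y xyd.
have [xA|Ax] := leP `|x| (A + 1); first exact: (near H d).
have Ay : A < `|y|.
  have := ler_normD (x - y) y; rewrite subrK; lra.
by rewrite fA ?(fA y)// ?subrr ?normr0 ?ltW//; lra.
Unshelve. all: by end_near. Qed.

End bounded_support.

(** * Integrals along a line *)

Section line_integrals.
Context {R : realType} {V : normedModType R}.
Local Notation leb := (@lebesgue_measure R).
Implicit Types (f : V -> R) (e v z : V) (a b : R).

Lemma continuous_itv_integrable (g : R -> R) a b :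
  continuous g -> leb.-integrable `[a, b] (EFin \o g).
Proof.
move=> cg; apply: continuous_compact_integrable; first exact: segment_compact.
exact: continuous_subspaceT.
Qed.

Lemma itv_measure a b : a <= b -> leb `[a, b]%classic = (b - a)%:E.
Proof.
move=> ab; rewrite lebesgue_measure_itv/= lte_fin EFinB; case: ltP => // ba.
by rewrite (_ : b = a) -?EFinB ?subrr//; apply/eqP; rewrite eq_le ab ba.
Qed.

Lemma Rintegral_itv_le (g : R -> R) a b (M : R) : a <= b -> continuous g ->
  (forall r, a <= r <= b -> `|g r| <= M) ->
  `|\int[leb]_(r in `[a, b]) g r| <= M * (b - a).
Proof.
move=> ab cg gM; have ig := continuous_itv_integrable a b cg.
have mab : measurable `[a, b]%classic by exact: measurable_itv.
apply: le_trans; first exact: le_normr_Rintegral.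
have -> : M * (b - a) = \int[leb]_(r in `[a, b]) M.
  rewrite Rintegral_cst//; congr (_ * _).
  by rewrite -[LHS]/(fine (b - a)%:E); congr fine; exact/esym/itv_measure.
apply: le_Rintegral => //.
- apply: (continuous_itv_integrable (g := fun r => `|g r|)) => r.
  by apply: cvg_norm; exact: cg.
- by apply: (continuous_itv_integrable (g := fun=> M)) => r; exact: cvg_cst.
Qed.

(** A primitive along [e]: it turns translations and differences into
    derivatives. *)
Definition lineint f e a b z : R := \int[leb]_(r in `[a, b]) f (z + r *: e).

Lemma continuous_line f e z : continuous f -> continuous (fun r : R => f (z + r *: e)).
Proof.
move=> cf r; apply: (@continuous_comp _ _ _ (fun r : R => z + r *: e) f); last exact: cf.
by apply: cvgD; [exact: cvg_cst|apply: cvgZr_tmp; exact: cvg_id].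
Qed.

Lemma line_uniform f e a b z (eps : R) : continuous f -> 0 < eps ->
  \forall z' \near z, forall r, a <= r <= b ->
    `|f (z' + r *: e) - f (z + r *: e)| <= eps.
Proof.
move=> cf eps0.
have /compact_near_coveringP K := @segment_compact R a b.
have : \forall z' \near z, `[a, b]%classic `<=`
    (fun r => `|f (z' + r *: e) - f (z + r *: e)| <= eps).
  apply: (K _ (nbhs z) (fun z' r => `|f (z' + r *: e) - f (z + r *: e)| <= eps)).
  move=> r0 _.
  have e2 : 0 < eps / 2 by rewrite divr_gt0.
  have c1 : (fun p : R * V => f (p.2 + p.1 *: e)) @ (r0, z) --> f (z + r0 *: e).
    apply: (@cvg_comp _ _ _ (fun p : R * V => p.2 + p.1 *: e) f); last exact: cf.
    apply: cvgD; first exact: cvg_snd.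
    by apply: cvgZr_tmp; exact: cvg_fst.
  have /cvgrPdist_le/(_ _ e2) H1 := c1.
  have /cvgrPdist_le/(_ _ e2) H2 := @continuous_line f e z cf r0.
  case: H1 => -[P Q] /= [Pr Qz] PQ.
  exists (P `&` (fun r => `|f (z + r0 *: e) - f (z + r *: e)| <= eps / 2), Q).
    by split=> //; exact: filterI.
  move=> [r z'] /= [[Pr' H] Qz'].
  have /= H' := PQ (r, z') (conj Pr' Qz').
  rewrite -(subrKA (f (z + r0 *: e))) (le_trans (ler_normD _ _))//.
  by rewrite [leRHS]splitr lerD// distrC.
by apply: filterS => z' H r ab; apply: H; rewrite /= in_itv/=.
Qed.

Lemma lineint_continuous f e a b : a <= b -> continuous f ->
  continuous (lineint f e a b).
Proof.
move=> ab cf z; apply/cvgrPdist_le => eps eps0.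
have d0 : 0 < b - a + 1 by rewrite ltr_wpDl// subr_ge0.
have eps1 : 0 < eps / (b - a + 1) by rewrite divr_gt0.
apply: filterS (line_uniform e a b z cf eps1) => z' H.
have mab : measurable `[a, b]%classic by exact: measurable_itv.
rewrite /lineint -RintegralB//; try
  by apply: continuous_itv_integrable; exact: continuous_line.
apply: (@le_trans _ _ (eps / (b - a + 1) * (b - a))).
  apply: Rintegral_itv_le => //.
    by move=> r; apply: cvgB; exact: continuous_line.
  by move=> r /H; rewrite distrC.
by rewrite mulrAC ler_pdivrMr// ler_pM2l// lerDl.
Qed.

(** Differentiation under the integral, by uniform continuity of the
    derivative on the compact segment. *)
Lemma lineint_is_derive f e a b z v : a <= b -> smooth f ->
  is_derive z v (lineint f e a b) (lineint (fun y => 'D_v f y) e a b z).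
Proof.
move=> ab sf.
suff H : h^-1 *: (lineint f e a b (h *: v + z) - lineint f e a b z)
    @[h --> (0 : R)^'] --> lineint (fun y => 'D_v f y) e a b z.
  by apply: DeriveDef; [apply: cvgP H|exact: cvg_lim H].
apply/cvgrPdist_le => eps eps0.
have mab : measurable `[a, b]%classic by exact: measurable_itv.
have d0 : 0 < b - a + 1 by rewrite ltr_wpDl// subr_ge0.
have eps1 : 0 < eps / (b - a + 1) by rewrite divr_gt0.
have cDf := smooth_continuous (smooth_derive v sf).
have /nbhs_ballP[d /= d1 U] := line_uniform e a b z cDf eps1.
near=> h.
have h0 : h != 0 by near: h; exact: nbhs_dnbhs_neq.
have hv : `|h| * `|v| < d.
  have v1 : 0 < `|v| + 1 by rewrite ltr_wpDl.
  have hd : `|h| < d / (`|v| + 1) by near: h; apply: dnbhs0_lt; rewrite divr_gt0.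
  rewrite (@le_lt_trans _ _ (`|h| * (`|v| + 1)))//; last by rewrite -ltr_pdivlMr.
  by rewrite ler_wpM2l// lerDl.
have cl y : continuous (fun r : R => f (y + r *: e)).
  exact/continuous_line/smooth_continuous.
have il y : leb.-integrable `[a, b] (EFin \o (fun r : R => f (y + r *: e))).
  exact: continuous_itv_integrable.
have clD := @continuous_line _ e z cDf.
have cdiff : continuous (fun r : R => f (h *: v + z + r *: e) - f (z + r *: e)).
  by move=> r; apply: cvgB; exact: cl.
rewrite /lineint -RintegralB// -[_ *: _]RintegralZl//; last first.
  exact: (continuous_itv_integrable (g := fun r : R => _)).
have cq : continuous (fun r : R => h^-1 * (f (h *: v + z + r *: e) - f (z + r *: e))).
  by move=> r; apply: cvgM; [exact: cvg_cst|exact: cdiff].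
rewrite -RintegralB//; try exact: (continuous_itv_integrable (g := fun r : R => _)).
apply: (@le_trans _ _ (eps / (b - a + 1) * (b - a))); last first.
  by rewrite mulrAC ler_pdivrMr// ler_pM2l// lerDl.
apply: Rintegral_itv_le => //.
  by move=> r; apply: cvgB; [exact: clD|exact: cq].
move=> r rab.
have [c ch E] := @MVT_line _ _ f (z + r *: e) v h (fun y => smooth_derivable sf).
rewrite (_ : h *: v + z + r *: e = z + r *: e + h *: v); last first.
  by rewrite -addrA addrC.
rewrite E mulKf// distrC addrAC; apply: U => //.
rewrite -ball_normE/= opprD addNKr normrN normrZ.
by apply: le_lt_trans hv; rewrite ler_wpM2r.
Unshelve. all: by end_near. Qed.

Lemma smooth_lineint f e a b : a <= b -> smooth f -> smooth (lineint f e a b).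
Proof.
move=> ab sf.
apply: (@smooth_coind _ _ (fun F => exists2 f, smooth f & F = lineint f e a b));
  last by exists f.
  by move=> _ [g sg ->]; apply: lineint_continuous => //; exact: smooth_continuous.
move=> _ v [g sg ->]; split=> [x|].
  by have [] := lineint_is_derive e x v ab sg.
exists (fun y => 'D_v g y); first exact: smooth_derive.
by apply/funext => x; have [_] := lineint_is_derive e x v ab sg.
Qed.

Lemma lineint_derive f e a b z v : a <= b -> smooth f ->
  'D_v (lineint f e a b) z = lineint (fun y => 'D_v f y) e a b z.
Proof. by move=> ab sf; have [_] := lineint_is_derive e z v ab sf. Qed.

Lemma FTC_line f e a b z : a < b -> smooth f ->
  lineint (fun y => 'D_e f y) e a b z = f (z + b *: e) - f (z + a *: e).
Proof.
move=> ab sf; rewrite /lineint /Rintegral.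
have dF (r : R) := is_derive_line (smooth_derivable sf : derivable f (z + r *: e) e).
have cF := @continuous_line f e z (smooth_continuous sf).
have cDF := @continuous_line _ e z (smooth_continuous (smooth_derive e sf)).
have -> : (\int[leb]_(x in `[a, b]) ('D_e f (z + x *: e))%:E =
    (f (z + b *: e))%:E - (f (z + a *: e))%:E)%E; last by [].
apply: (@continuous_FTC2 _ (fun r => 'D_e f (z + r *: e)) (fun r => f (z + r *: e)) _ _ ab).
- exact: continuous_subspaceT cDF.
- split.
  + by move=> r _; have [] := dF r.
  + by apply: cvg_at_right_filter; exact: cF.
  + by apply: cvg_at_left_filter; exact: cF.
- by move=> r _; rewrite derive1E; have [_ ->] := dF r.
Qed.

End line_integrals.

(** * Borel sets of R^n *)

Section borel_rV.
Context {R : realType}.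
Implicit Types n : nat.

Lemma rV_norm_le n (x : 'rV[R]_n) (A : R) : 0 <= A ->
  (`|x| <= A) <-> (forall i, `|x 0 i| <= A).
Proof.
move=> A0; rewrite {1}/Num.Def.normr/= mx_normrE; split=> [/bigmax_leP[_ H] i|H].
  exact: (H (0, i)).
by apply/bigmax_leP; split=> // -[i j] _; rewrite /= ord1.
Qed.

Lemma rV_norm_lt n (x : 'rV[R]_n) (A : R) : 0 < A ->
  (`|x| < A) <-> (forall i, `|x 0 i| < A).
Proof.
move=> A0; rewrite {1}/Num.Def.normr/= mx_normrE; split=> [/bigmax_ltP[_ H] i|H].
  exact: (H (0, i)).
by apply/bigmax_ltP; split=> // -[i j] _; rewrite /= ord1.
Qed.

Lemma le_rV_coord n (x : 'rV[R]_n) i : `|x 0 i| <= `|x|.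
Proof. by move: (rV_norm_le x (normr_ge0 x)) => [H _]; exact: H. Qed.

Lemma heine_borel_rV n : @heine_borel R 'rV[R]_n.
Proof.
move=> A; apply: bounded_closed_compact.
  by exists A; split; [exact: num_real|move=> M AM x /= xA; exact/(le_trans xA)/ltW].
apply: (@preimage_closed _ _ (fun x : 'rV[R]_n => `|x|) [set y | y <= A]).
  by move=> x _; exact: norm_continuous.
exact: closed_le.
Qed.

Lemma heine_borel_prod n : @heine_borel R (R * 'rV[R]_n)%type.
Proof.
move=> A.
have -> : [set z : R * 'rV[R]_n | `|z| <= A] =
    [set t | `|t| <= A] `*` [set x | `|x| <= A].
  apply/seteqP; split=> -[t x]/=; rewrite prod_normE/= ge_max.
    by move=> /andP[].
  by move=> [-> ->].
apply: compact_setX; last exact: heine_borel_rV.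
rewrite (_ : [set _ | _] = `[- A, A]%classic); first exact: segment_compact.
by apply/seteqP; split=> x /=; rewrite in_itv/= ler_norml.
Qed.

Lemma measurable_rV_box n (c : 'rV[R]_n) (r : R) :
  measurable [set x : 'rV[R]_n | forall i, `|c 0 i - x 0 i| < r].
Proof.
rewrite (_ : [set _ | _] = \bigcap_(i in [set: 'I_n])
    (@rV_coord R n i @^-1` [set y | `|c 0 i - y| < r])); last first.
  by apply/seteqP; split => x /= Ax i; [move=> _|]; exact: Ax.
apply: fin_bigcap_measurable => // i _.
rewrite -[X in measurable X]setTI; apply: measurable_rV_coord => //.
rewrite (_ : [set _ | _] = ball (c 0 i : R) r); first exact: (measurable_realfun.open_measurable (ball_open _ _)).
by rewrite -ball_normE.
Qed.

(** Open sets are countable unions of boxes with rational coordinates, so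
    that they belong to the product sigma-algebra. *)
Lemma open_measurable_rV n (U : set 'rV[R]_n) : open U -> measurable U.
Proof.
move=> oU.
pose B (p : 'rV[rat]_n * nat) : set 'rV[R]_n :=
  [set x | forall i, `|(map_mx ratr p.1 : 'rV[R]_n) 0 i - x 0 i| < p.2.+1%:R^-1].
have -> : U = \bigcup_(p in [set: 'rV[rat]_n * nat])
    (if `[< B p `<=` U >] then B p else set0).
  apply/seteqP; split=> [x Ux|x [p _]]; last by case: asboolP => // + Bx; apply.
  have /nbhs_ballP[e /= e0 eU] := open_nbhs_nbhs (conj oU Ux).
  pose k := Num.trunc (2 / e).
  have ke : 2 * k.+1%:R^-1 < e.
    have := truncnS_gt (2 / e); rewrite -/k => H.
    by rewrite ltr_pdivrMr// mulrC -ltr_pdivrMr.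
  have H i : exists q : rat, `|x 0 i - ratr q| < k.+1%:R^-1.
    have := dense_rat; move=> /(_ R (ball (x 0 i) k.+1%:R^-1)).
    case; [exists (x 0 i); exact: ballxx|exact: ball_open|].
    by move=> y [By [q _ qy]]; exists q; move: By; rewrite -qy -ball_normE.
  have [q Hq] := choice H.
  pose Q : 'rV[rat]_n := \row_i q i.
  have xB : B (Q, k) x by move=> i; rewrite !mxE distrC; exact: Hq.
  exists (Q, k) => //; case: asboolP => // -[] y By; apply: eU.
  rewrite -ball_normE/=; apply/rV_norm_lt => // i; rewrite !mxE.
  rewrite -(subrKA (ratr (q i))) (le_lt_trans (ler_normD _ _))//.
  apply: le_lt_trans ke; rewrite mulr_natl mulr2n lerD// ltW//.
  by have := By i; rewrite !mxE.
apply: countable_bigcupT_measurable => [|p].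
  exact: countableP.
by case: asboolP => // _; exact: measurable_rV_box.
Qed.

Lemma continuous_measurable_rV n (f : 'rV[R]_n -> R) :
  continuous f -> measurable_fun [set: 'rV[R]_n] f.
Proof.
move=> /continuousP cf; apply: (measurability _ (measurable_realfun.RGenOpens.measurableE R)).
move=> _ [_ [a [b ->] <-]]; rewrite setTI; apply: open_measurable_rV.
exact/cf/interval_open.
Qed.

End borel_rV.

Notation L1 mu f := (integrable mu setT (EFin \o f)).

(** * Integrable real functions *)

Section real_integrals.
Context d (T : measurableType d) (R : realType).
Variable mu : {measure set T -> \bar R}.
Implicit Types f g h : T -> R.

Lemma L1_measurable f : L1 mu f -> measurable_fun setT f.
Proof. by move=> /integrableP[/measurable_EFinP]. Qed.

Lemma L1D f g : L1 mu f -> L1 mu g -> L1 mu (fun x => f x + g x).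
Proof. by move=> lf lg; exact: (integrableD measurableT lf lg). Qed.

Lemma L1B f g : L1 mu f -> L1 mu g -> L1 mu (fun x => f x - g x).
Proof. by move=> lf lg; exact: (integrableB measurableT lf lg). Qed.

Lemma L1Z (c : R) f : L1 mu f -> L1 mu (fun x => c * f x).
Proof. by move=> lf; exact: (integrableZl measurableT c lf). Qed.

Lemma L1N f : L1 mu f -> L1 mu (fun x => - f x).
Proof. by move=> lf; exact: (integrableN lf). Qed.

Lemma L1_norm f : L1 mu f -> L1 mu (fun x => `|f x|).
Proof. by move=> lf; exact: (integrable_abse lf). Qed.

Lemma L1_cst0 : L1 mu (fun _ : T => 0 : R).
Proof. exact: integrable0. Qed.

Lemma L1_sum (I : Type) (s : seq I) (P : pred I) (F : I -> T -> R) :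
  (forall i, P i -> L1 mu (F i)) -> L1 mu (fun x => \sum_(i <- s | P i) F i x).
Proof.
move=> lF; elim: s => [|i s IH].
  by under [X in L1 mu X]eq_fun do rewrite big_nil; exact: L1_cst0.
under [X in L1 mu X]eq_fun do rewrite big_cons.
by case Pi : (P i) => //; apply: L1D => //; exact: lF.
Qed.

Lemma L1_ae_le g f : measurable_fun setT f -> L1 mu g ->
  {ae mu, forall x, `|f x| <= g x} -> L1 mu f.
Proof.
move=> mf lg fg; apply/integrableP; split; first exact/measurable_EFinP.
have /integrableP[_] := L1_norm lg; apply: le_lt_trans.
apply: ae_ge0_le_integral => //.
- by apply: measurableT_comp => //; exact/measurable_EFinP.
- by have /integrableP[mg _] := L1_norm lg; exact: measurableT_comp mg.
- apply: filterS fg => x fgx _ /=; rewrite normr_id lee_fin (le_trans fgx)//.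
  exact: ler_norm.
Qed.

Lemma L1_le g f : measurable_fun setT f -> L1 mu g ->
  (forall x, `|f x| <= g x) -> L1 mu f.
Proof. by move=> mf lg fg; apply: (L1_ae_le mf lg); exact: aeW. Qed.

Lemma ae_le_Rintegral f g : L1 mu f -> L1 mu g ->
  {ae mu, forall x, f x <= g x} -> \int[mu]_x f x <= \int[mu]_x g x.
Proof.
move=> lf lg fg; rewrite -subr_ge0 -RintegralB//.
have lfg := L1B lg lf.
rewrite [leRHS](_ : _ = \int[mu]_x `|g x - f x|); last first.
  rewrite /Rintegral; congr fine; apply: ae_eq_integral => //.
  - exact: (measurable_int _ lfg).
  - exact: (measurable_int _ (L1_norm lfg)).
  - by apply: filterS fg => x fgx _ /=; rewrite ger0_norm// subr_ge0.
exact: Rintegral_ge0.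
Qed.

Lemma Rintegral_ae_le g f : measurable_fun setT f -> L1 mu g ->
  {ae mu, forall x, `|f x| <= g x} ->
  `|\int[mu]_x f x| <= \int[mu]_x g x.
Proof.
move=> mf lg fg; have lf := L1_ae_le mf lg fg.
by apply: le_trans (le_normr_Rintegral _ lf) _ => //; apply: ae_le_Rintegral => //; exact: L1_norm.
Qed.

Lemma ae_eq_Rintegral f g : measurable_fun setT f -> measurable_fun setT g ->
  {ae mu, forall x, f x = g x} -> \int[mu]_x f x = \int[mu]_x g x.
Proof.
move=> mf mg fg; rewrite /Rintegral; congr fine; apply: ae_eq_integral => //.
- exact/measurable_EFinP.
- exact/measurable_EFinP.
- by apply: filterS fg => x fgx _ /=; rewrite fgx.
Qed.

Lemma Rintegral_sum (I : Type) (s : seq I) (P : pred I) (F : I -> T -> R) :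
  (forall i, P i -> L1 mu (F i)) ->
  \int[mu]_x (\sum_(i <- s | P i) F i x) = \sum_(i <- s | P i) \int[mu]_x F i x.
Proof.
move=> lF; elim: s => [|i s IH].
  rewrite big_nil; under eq_Rintegral do rewrite big_nil.
  by rewrite Rintegral_cst// mul0r.
rewrite big_cons; under eq_Rintegral do rewrite big_cons.
case Pi : (P i) => //; rewrite RintegralD ?IH//; first exact: lF.
exact: L1_sum.
Qed.

Lemma RintegralN f : L1 mu f -> \int[mu]_x (- f x) = - \int[mu]_x f x.
Proof.
move=> lf; under eq_Rintegral do rewrite -mulN1r.
by rewrite RintegralZl// mulN1r.
Qed.

Lemma L1_bounded_on (A : set T) (M : R) f : measurable A -> (mu A < +oo)%E ->
  measurable_fun setT f -> (forall x, `|f x| <= M) -> (forall x, ~ A x -> f x = 0) ->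
  L1 mu f /\ `|\int[mu]_x f x| <= M * fine (mu A).
Proof.
move=> mA Aoo mf fM fA.
have e : EFin \o f = (EFin \o f) \_ A.
  apply/funext => x /=; rewrite patchE; case: ifPn => //.
  by rewrite notin_setE => /fA /= ->.
have bf : [bounded f x | x in A].
  exists M; split; first exact: num_real.
  by move=> N MN x _; apply: le_trans (fM x) _; exact: ltW.
have lA : integrable mu A (EFin \o f).
  by apply: measurable_bounded_integrable => //; exact: measurable_funTS.
split; first by have := (integrable_mkcond (EFin \o f) mA).1 lA; rewrite -e.
rewrite (_ : \int[mu]_x f x = \int[mu]_(x in A) f x); last first.
  rewrite [RHS]Rintegral_mkcond; apply: eq_Rintegral => x _; rewrite patchE.
  by case: ifPn => //; rewrite notin_setE => /fA.
apply: le_trans (le_normr_Rintegral _ lA) _ => //.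
rewrite -Rintegral_cst//; apply: le_Rintegral => //.
- by apply: measurable_bounded_integrable => //; [exact: measurableT_comp (measurable_funTS mf)|
    case: bf => N [Nr H]; exists N; split=> // P NP x Ax /=; rewrite normr_id; exact: H].
- apply: measurable_bounded_integrable => //.
  by exists `|M|; split=> // N MN x _ /=; exact: ltW.
Qed.

End real_integrals.

(** * Fubini for real integrals *)

Section Rfubini.
Context d1 d2 (T1 : measurableType d1) (T2 : measurableType d2) (R : realType).
Variables (m1 : {sigma_finite_measure set T1 -> \bar R})
  (m2 : {sigma_finite_measure set T2 -> \bar R}).

Lemma Rfubini1 (f : T1 * T2 -> R) : L1 (m1 \x m2)%E f ->
  (forall x, L1 m2 (fun y => f (x, y))) ->
  \int[(m1 \x m2)%E]_z f z = \int[m1]_x \int[m2]_y f (x, y).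
Proof.
move=> lf l2; rewrite {1}/Rintegral -(integral12_prod_meas1 lf)/=.
rewrite /Rintegral; congr fine; apply: eq_integral => x _ /=.
by rewrite fineK//; apply: integrable_fin_num => //; exact: l2.
Qed.

Lemma Rfubini2 (f : T1 * T2 -> R) : L1 (m1 \x m2)%E f ->
  (forall y, L1 m1 (fun x => f (x, y))) ->
  \int[(m1 \x m2)%E]_z f z = \int[m2]_y \int[m1]_x f (x, y).
Proof.
move=> lf l1; rewrite {1}/Rintegral -(integral21_prod_meas1 lf)/=.
rewrite /Rintegral; congr fine; apply: eq_integral => x _ /=.
by rewrite fineK//; apply: integrable_fin_num => //; exact: l1.
Qed.

End Rfubini.

Lemma lipschitz_continuous (R : realType) (V W : normedModType R) (L : V -> W)
    (C : R) : (forall x y, `|L x - L y| <= C * `|x - y|) -> continuous L.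
Proof.
move=> LC x; apply/cvgrPdist_le => e e0.
have C0 : 0 < `|C| + 1 by rewrite ltr_wpDl.
near=> y; apply: le_trans (LC x y) _.
have : `|x - y| <= e / (`|C| + 1).
  by near: y; apply: cvgr_dist_le; [exact: cvg_id|rewrite divr_gt0].
rewrite ler_pdivlMr// => H; apply: le_trans H.
rewrite mulrC ler_wpM2l//.
by rewrite (le_trans (ler_norm C))// lerDl.
Unshelve. all: by end_near. Qed.

(** * Integration of continuous functions on R^n *)

Section integration_rV.
Context {R : realType}.
Local Notation leb := (@lebesgue_measure R).
Implicit Types n : nat.

Lemma measurable_cube n (c : 'rV[R]_n) (A : R) :
  measurable [set x : 'rV[R]_n | `|x - c| <= A].
Proof.
rewrite -[X in measurable X]setCK; apply: measurableC; apply: open_measurable_rV.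
apply: closed_openC.
apply: (@preimage_closed _ _ (fun x : 'rV[R]_n => `|x - c|) [set y | y <= A]).
  move=> x _; apply: (@lipschitz_continuous _ _ _ (fun x : 'rV[R]_n => `|x - c|) 1).
  move=> a b; rewrite mul1r.
  by rewrite (le_trans (ler_dist_dist _ _))// opprB addrA subrK.
exact: closed_le.
Qed.

Lemma cube_measure n (c : 'rV[R]_n) (A : R) : 0 <= A ->
  @lebesgue_rV R n [set x : 'rV[R]_n | `|x - c| <= A] = ((2 * A) ^+ n)%:E.
Proof.
move=> A0.
rewrite (_ : [set _ | _] =
    [set x : 'rV[R]_n | forall i, `[c 0 i - A, c 0 i + A]%classic (x 0 i)]).
  have H := @lebesgue_rV_box R n (fun i => `[c 0 i - A, c 0 i + A]%classic)
    (fun i => measurable_itv _).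
  rewrite [LHS]H.
  under eq_bigr => i _.
    rewrite itv_measure; last by rewrite lerD2l (le_trans _ A0)// oppr_le0.
    rewrite (_ : _ - _ = 2 * A); last by ring.
    over.
  by rewrite prodEFin prodr_const card_ord.
apply/seteqP; split=> [x /= /(rV_norm_le _ A0) H i|x /= H].
  by have := H i; rewrite !mxE in_itv/= ler_distl.
by apply/(rV_norm_le _ A0) => i; have := H i; rewrite !mxE in_itv/= ler_distl.
Qed.

Lemma L1_cube_supp n (f : 'rV[R]_n -> R) c (A M : R) : 0 <= A ->
  measurable_fun setT f -> (forall x, `|f x| <= M) ->
  (forall x, A < `|x - c| -> f x = 0) ->
  L1 (@lebesgue_rV R n) f /\
  `|\int[@lebesgue_rV R n]_x f x| <= M * (2 * A) ^+ n.
Proof.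
move=> A0 mf fM fA.
have -> : (2 * A) ^+ n = fine (@lebesgue_rV R n [set x : 'rV[R]_n | `|x - c| <= A]).
  by rewrite cube_measure.
apply: L1_bounded_on => //.
- exact: measurable_cube.
- by have H := cube_measure c A0; rewrite [X in (X < _)%E]H ltry.
- by move=> x /= /negP; rewrite -ltNge; exact: fA.
Qed.

Lemma bsupp_ge0 (V : normedModType R) (f : V -> R) : bsupp f ->
  exists2 A : R, 0 <= A & forall z, A < `|z| -> f z = 0.
Proof.
move=> [A fA]; exists (Num.max A 0); first by rewrite le_max lexx orbT.
by move=> z; rewrite gt_max => /andP[/fA].
Qed.

Lemma L1_bsupp n (f : 'rV[R]_n -> R) : continuous f -> bsupp f ->
  L1 (@lebesgue_rV R n) f.
Proof.
move=> cf bf; have [A A0 fA] := bsupp_ge0 bf.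
have [M M0 fM] := bsupp_bounded (@heine_borel_rV R n) cf bf.
have := @L1_cube_supp n f 0 A M A0 (continuous_measurable_rV cf) fM.
by case=> // x; rewrite subr0; exact: fA.
Qed.

Lemma rV_cons_lip n (p q : R * 'rV[R]_n) :
  `|@rV_cons R n p - rV_cons q| <= 1 * `|p - q|.
Proof.
rewrite mul1r; apply/rV_norm_le => // i; rewrite !mxE.
case: (unliftP ord0 i) => [j|] _ /=; rewrite prod_normE /= le_max.
  by apply/orP; right; have := le_rV_coord (p.2 - q.2) j; rewrite !mxE.
by rewrite lexx.
Qed.

Lemma rV_norm_cons n (p : R * 'rV[R]_n) : `|@rV_cons R n p| = `|p|.
Proof.
apply/eqP; rewrite eq_le; apply/andP; split.
  have := rV_cons_lip p 0; rewrite mul1r subr0 (_ : rV_cons 0 = 0) ?subr0//.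
  apply/rowP => i; rewrite !mxE.
  by case: (unliftP ord0 i) => [j|] _ /=; rewrite ?mxE.
rewrite prod_normE ge_max; apply/andP; split.
  by have := le_rV_coord (@rV_cons R n p) ord0; rewrite rV_cons0.
apply/rV_norm_le => // i.
by have := le_rV_coord (@rV_cons R n p) (lift ord0 i); rewrite rV_consS.
Qed.

Lemma Rintegral_cons n (f : 'rV[R]_n.+1 -> R) : measurable_fun setT f ->
  L1 (leb \x @lebesgue_rV R n)%E (fun p => f (rV_cons p)) ->
  L1 (@lebesgue_rV R n.+1) f /\
  \int[@lebesgue_rV R n.+1]_x f x =
  \int[(leb \x @lebesgue_rV R n)%E]_p f (rV_cons p).
Proof.
move=> mf lf; have mef : measurable_fun setT (EFin \o f) by exact/measurable_EFinP.
split; first exact: (integrable_pushforward (@measurable_rV_cons R n) mef lf).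
rewrite /Rintegral; congr fine.
exact: (integral_pushforward (@measurable_rV_cons R n) mef lf).
Qed.

Lemma L1_cons n (f : 'rV[R]_n.+1 -> R) : continuous f -> bsupp f ->
  L1 (leb \x @lebesgue_rV R n)%E (fun p => f (rV_cons p)).
Proof.
move=> cf bf; have [A A0 fA] := bsupp_ge0 bf.
have [M M0 fM] := bsupp_bounded (@heine_borel_rV R n.+1) cf bf.
pose Q := [set x : 'rV[R]_n | `|x - 0| <= A].
have mQ : measurable Q by exact: measurable_cube.
have mI : measurable `[- A, A]%classic by exact: measurable_itv.
have [] // := @L1_bounded_on _ _ R (leb \x @lebesgue_rV R n)%E
  (`[- A, A]%classic `*` Q) M (fun p => f (rV_cons p)).
- exact: measurableX.
- have AA : - A <= A by rewrite (le_trans _ A0)// oppr_le0.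
  have H := @product_measure1E _ _ _ _ _ leb (@lebesgue_rV R n) _ _ mI mQ.
  have HQ : @lebesgue_rV R n Q = ((2 * A) ^+ n)%:E by exact: cube_measure.
  have HI := itv_measure AA.
  rewrite [X in (X < _)%E]H [X in (X * _ < _)%E]HI [X in (_ * X < _)%E]HQ.
  by rewrite -EFinM ltry.
- apply: measurableT_comp; [exact: continuous_measurable_rV|exact: measurable_rV_cons].
- move=> [s x] /= H; apply: fA; rewrite rV_norm_cons prod_normE/= lt_max.
  rewrite !ltNge; apply/orP; case: (leP `|s| A) => sA; last by left.
  right; apply/negP => xA; apply: H; split; last by rewrite /Q/= subr0.
  by rewrite /= in_itv/= -ler_norml.
Qed.

Lemma continuous_slice n (s : R) : continuous (fun x : 'rV[R]_n => rV_cons (s, x)).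
Proof.
apply: (@lipschitz_continuous _ _ _ _ 1) => x y.
apply: le_trans (rV_cons_lip _ _) _.
by rewrite ler_wpM2l// prod_normE/= subrr normr0 ge_max normr_ge0 lexx.
Qed.

Lemma continuous_slice' n (x : 'rV[R]_n) : continuous (fun s : R => rV_cons (s, x)).
Proof.
apply: (@lipschitz_continuous _ R^o _ _ 1) => s t.
apply: le_trans (rV_cons_lip _ _) _.
by rewrite ler_wpM2l// prod_normE/= subrr normr0 ge_max normr_ge0 lexx.
Qed.

Lemma bsupp_slice n (f : 'rV[R]_n.+1 -> R) s : bsupp f ->
  bsupp (fun x : 'rV[R]_n => f (rV_cons (s, x))).
Proof.
move=> [A fA]; exists A => x Ax; apply: fA; rewrite rV_norm_cons.
by rewrite prod_normE lt_max Ax orbT.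
Qed.

Lemma bsupp_slice' n (f : 'rV[R]_n.+1 -> R) x : bsupp f ->
  bsupp (fun s : R => f (rV_cons (s, x))).
Proof.
move=> [A fA]; exists A => s As; apply: fA; rewrite rV_norm_cons.
by rewrite prod_normE lt_max As.
Qed.

Lemma L1_bsupp1 (f : R -> R) : continuous f -> bsupp f -> L1 leb f /\
  exists2 A, 0 < A & forall B, A <= B -> \int[leb]_x f x = \int[leb]_(x in `[- B, B]) f x.
Proof.
move=> cf bf; have [A A0 fA] := bsupp_ge0 bf.
have H B : A <= B -> forall x, ~ `[- B, B]%classic x -> f x = 0.
  move=> AB x; rewrite /= in_itv/= -ler_norml => /negP; rewrite -ltNge => Bx.
  by apply: fA; exact: le_lt_trans Bx.
have e B : A <= B -> EFin \o f = (EFin \o f) \_ `[- B, B]%classic.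
  move=> AB; apply/funext => x; rewrite patchE; case: ifPn => //=.
  by rewrite notin_setE => /(H B AB) ->.
split.
  have lI := continuous_itv_integrable (- A) A cf.
  by move: lI; rewrite integrable_mkcond// -e.
exists (A + 1) => [|B AB]; first by rewrite ltr_wpDl.
rewrite [RHS]Rintegral_mkcond; apply: eq_Rintegral => x _; rewrite patchE.
case: ifPn => //; rewrite notin_setE => /H -> //.
by apply: le_trans AB; rewrite lerDl.
Qed.

Lemma Rintegral_slices n (f : 'rV[R]_n.+1 -> R) : continuous f -> bsupp f ->
  \int[@lebesgue_rV R n.+1]_x f x =
    \int[leb]_s \int[@lebesgue_rV R n]_x f (rV_cons (s, x)) /\
  \int[@lebesgue_rV R n.+1]_x f x =
    \int[@lebesgue_rV R n]_x \int[leb]_s f (rV_cons (s, x)).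
Proof.
move=> cf bf; have lf := L1_cons cf bf.
have [_ ->] := Rintegral_cons (continuous_measurable_rV cf) lf.
split.
  apply: (Rfubini1 lf) => s; apply: L1_bsupp; last exact: bsupp_slice.
  by move=> x; apply: (@continuous_comp _ _ _ (fun x => rV_cons (s, x)) f);
    [exact: continuous_slice|exact: cf].
apply: (Rfubini2 lf) => x; apply: (L1_bsupp1 _ _).1; last exact: bsupp_slice'.
by move=> s; apply: (@continuous_comp _ _ _ (fun s => rV_cons (s, x)) f);
  [exact: continuous_slice'|exact: cf].
Qed.

Lemma rV_cons_affine n (s h : R) (y w : 'rV[R]_n) :
  rV_cons (s, h *: w + y) = h *: rV_cons (0, w) + rV_cons (s, y).
Proof.
apply/rowP => i; rewrite !mxE; case: (unliftP ord0 i) => [j|] _ /=.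
  by rewrite !mxE.
by rewrite mulr0 add0r.
Qed.

Lemma rV_cons_unit n (j : 'I_n) :
  rV_cons (0, unit_vec j) = unit_vec (lift ord0 j) :> 'rV[R]_n.+1.
Proof.
apply/rowP => i; rewrite !mxE; case: (unliftP ord0 i) => [k|] -> /=.
  by rewrite !mxE /= (inj_eq lift_inj).
by [].
Qed.

Lemma rV_cons_head n (s : R) (x : 'rV[R]_n) :
  rV_cons (s, x) = rV_cons (0, x) + s *: unit_vec ord0.
Proof.
apply/rowP => i; rewrite !mxE; case: (unliftP ord0 i) => [k|] -> /=.
  by rewrite mulr0 addr0.
by rewrite add0r mulr1.
Qed.

(** By induction on the dimension with Fubini, this reduces to the
    fundamental theorem of calculus on a line. *)
Lemma Rintegral_derive0 n (k : 'I_n) (f : 'rV[R]_n -> R) : smooth f -> bsupp f ->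
  \int[@lebesgue_rV R n]_x 'D_(unit_vec k) f x = 0.
Proof.
elim: n => [|n IH] in k f *; first by case: k.
move=> sf bf; case: (unliftP ord0 k) => [j|] ->.
  have [-> _] := Rintegral_slices
    (smooth_continuous (smooth_derive (unit_vec (lift ord0 j)) sf))
    (bsupp_derive (unit_vec (lift ord0 j)) bf).
  under eq_Rintegral => s _.
    have := IH j (fun x => f (rV_cons (s, x))).
    have -> : (fun x => 'D_(unit_vec j) (fun x0 => f (rV_cons (s, x0))) x) =
        fun x => 'D_(unit_vec (lift ord0 j)) f (rV_cons (s, x)).
      apply/funext => x.
      rewrite (@derive_comp_affine _ _ _ (fun x => rV_cons (s, x)) (fun x => rV_cons (0, x))).
        by rewrite rV_cons_unit.
      by move=> h y w; exact: rV_cons_affine.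
    move=> ->; last exact: bsupp_slice.
      over.
    apply: (smooth_comp_affine (L0 := fun x => rV_cons (0, x))) sf.
      by move=> h y w; exact: rV_cons_affine.
    exact: continuous_slice.
  by rewrite Rintegral_cst// mul0r.
have [_ ->] := Rintegral_slices
    (smooth_continuous (smooth_derive (unit_vec ord0) sf))
    (bsupp_derive (unit_vec ord0) bf).
under eq_Rintegral => x _.
  have DE : (fun s => 'D_(unit_vec ord0) f (rV_cons (s, x))) =
      (fun s => 'D_(unit_vec ord0) f (rV_cons (0, x) + s *: unit_vec ord0)).
    by apply/funext => s; rewrite rV_cons_head.
  have cD : continuous (fun s => 'D_(unit_vec ord0) f (rV_cons (s, x))).
    rewrite DE.
    exact: (@continuous_line _ _ (fun y => 'D_(unit_vec ord0) f y) (unit_vec ord0)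
      (rV_cons (0, x)) (smooth_continuous (smooth_derive (unit_vec ord0) sf))).
  have [_ [A A0 H]] := L1_bsupp1 cD (bsupp_slice' x (bsupp_derive (unit_vec ord0) bf)).
  have [B B0 fB] := bsupp_ge0 bf.
  pose C := Num.max A (B + 1).
  rewrite (H C); last by rewrite le_max lexx.
  have CB : B < C by rewrite lt_max ltrDl ltr01 orbT.
  have C0 : - C < C by rewrite gtrN// (le_lt_trans B0).
  rewrite DE.
  have := FTC_line (unit_vec ord0) (rV_cons (0, x)) C0 sf.
  rewrite /lineint => ->.
  rewrite -!rV_cons_head !fB ?subrr; first over.
    by rewrite rV_norm_cons prod_normE lt_max normrN ger0_norm ?CB// (le_trans B0)// ltW.
  by rewrite rV_norm_cons prod_normE lt_max ger0_norm ?CB// (le_trans B0)// ltW.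
by rewrite Rintegral_cst// mul0r.
Qed.

End integration_rV.

(** * Bounded fields depending continuously on time *)

Section time_pairing.
Context {R : realType} {d : nat}.
Local Notation E := 'rV[R]_d.
Local Notation mu := (@lebesgue_rV R d).
Local Notation leb := (@lebesgue_measure R).
Implicit Types (T : R) (f g : R -> E -> R) (phi psi : R * E -> R).

(** Scalar fields in [C^0 ([0, T[; L^oo)], with norms expressed by almost
    everywhere bounds. *)
Definition cbt T f :=
  (forall t, 0 <= t < T -> measurable_fun setT (f t) /\
     exists M : R, {ae mu, forall x, `|f t x| <= M}) /\
  (forall t, 0 <= t < T -> forall e : R, 0 < e -> exists2 r : R, 0 < r &
     forall s, 0 <= s < T -> `|s - t| < r ->
       {ae mu, forall x, `|f s x - f t x| <= e}).

(** Continuity on [0, T[ in the form in which pairings inherit it from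
    [cbt]. *)
Definition tcont T (m : R -> R) :=
  forall t, 0 <= t < T -> forall e : R, 0 < e -> exists2 r : R, 0 < r &
    forall s, 0 <= s < T -> `|s - t| < r -> `|m s - m t| <= e.

(** Only the future end of the slab is cut off: test functions need not
    vanish at the initial time. *)
Definition tcut T phi := exists2 t1 : R, t1 < T & forall z, t1 < z.1 -> phi z = 0.

Definition tL1 T (m : R -> R) := leb.-integrable `[0, T[ (EFin \o m).

Lemma locally_bounded_itv T t1 (P : R -> R -> Prop) : t1 < T ->
  (forall t M N, P t M -> M <= N -> P t N) ->
  (forall t, 0 <= t < T -> exists (M : R) (r : R), 0 < r /\
     forall s, 0 <= s < T -> `|s - t| < r -> P s M) ->
  exists2 M : R, 0 <= M & forall t, 0 <= t <= t1 -> P t M.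
Proof.
move=> t1T PM H.
have /compact_near_coveringP K := @segment_compact R 0 t1.
have : \forall M \near +oo, `[0, t1]%classic `<=` (fun t => 0 <= t < T -> P t M).
  apply: (K _ (+oo : set_system R) (fun M t => 0 <= t < T -> P t M)) => t.
  rewrite /= in_itv/= => /andP[t0 tt1].
  have tT : 0 <= t < T by rewrite t0 (le_lt_trans tt1).
  have [M [r [r0 HM]]] := H t tT.
  exists (ball t r, [set N | M <= N]).
    by split=> /=; [exact: nbhsx_ballx|apply: nbhs_pinfty_ge; exact: num_real].
  move=> [s N] /= [ts MN] sT; apply: PM MN; apply: HM => //.
  by move: ts; rewrite -ball_normE/= distrC.
move=> [M [_ /(_ (Num.max M 0 + 1))]] HM.
have M0 : 0 <= Num.max M 0 + 1 by rewrite addr_ge0// le_max lexx orbT.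
exists (Num.max M 0 + 1) => // t /andP[t0 tt1].
apply: HM => /=.
- by rewrite ltr_pwDr// le_max lexx.
- by rewrite in_itv/= t0.
- by rewrite t0 (le_lt_trans tt1).
Qed.

(** Compactness of [0, t1] turns the local bounds given by continuity into a
    uniform one. *)
Lemma cbt_bounded T f t1 : t1 < T -> cbt T f ->
  exists2 M : R, 0 <= M & forall t, 0 <= t <= t1 -> {ae mu, forall x, `|f t x| <= M}.
Proof.
move=> t1T [f1 f2]; apply: (@locally_bounded_itv T t1
  (fun t M => {ae mu, forall x, `|f t x| <= M})) => //.
  by move=> t M N H MN; apply: filterS H => x /le_trans; apply.
move=> t tT; have [_ [M fM]] := f1 t tT.
have [r r0 H] := f2 t tT 1 ltr01.
exists (M + 1), r; split=> // s sT st.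
apply: filterS2 fM (H s sT st) => x xM xs.
rewrite -[f s x](subrK (f t x)) (le_trans (ler_normD _ _))//.
by rewrite addrC lerD.
Qed.

Lemma tcont_tL1 T m : tcont T m ->
  (exists2 t1, t1 < T & forall t, t1 < t -> m t = 0) -> tL1 T m.
Proof.
move=> cm [t1 t1T m0].
have [M M0 mM] : exists2 M : R, 0 <= M & forall t, 0 <= t <= t1 -> `|m t| <= M.
  apply: (@locally_bounded_itv T t1 (fun t M => `|m t| <= M)) => //.
    by move=> t M N /le_trans; apply.
  move=> t tT; have [r r0 H] := cm t tT 1 ltr01.
  exists (`|m t| + 1), r; split=> // s sT st.
  rewrite -[m s](subrK (m t)) (le_trans (ler_normD _ _))//.
  by rewrite addrC lerD2l H.
have cm' : {within `[0, T[, continuous m}.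
  apply/subspace_continuousP => t; rewrite /= in_itv/= => tT.
  apply/cvgrPdist_le => e e0; have [r r0 H] := cm t tT e e0.
  rewrite near_withinE.
  apply: (filterS _ (nbhsx_ballx t r r0)) => s.
  rewrite -ball_normE/= in_itv/= => ts sT.
  by rewrite distrC; apply: H => //; rewrite distrC.
apply: measurable_bounded_integrable.
- exact: measurable_itv.
- rewrite [X in (X < _)%E](lebesgue_measure_itv `[0, T[)/= lte_fin.
  by case: ifP => // _; rewrite -EFinB ltry.
- by apply: subspace_continuous_measurable_fun => //; exact: measurable_itv.
- exists M; split; first exact: num_real.
  move=> N MN t; rewrite /= in_itv/= => /andP[t0 tT].
  apply: le_trans (ltW MN); have [tt1|/m0 ->] := leP t t1; last by rewrite normr0.
  by apply: mM; rewrite t0.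
Qed.

Lemma L1_pair (f : E -> R) (M : R) (z : E -> R) : measurable_fun setT f ->
  {ae mu, forall x, `|f x| <= M} -> L1 mu z ->
  L1 mu (fun x => f x * z x) /\
  `|\int[mu]_x (f x * z x)| <= M * \int[mu]_x `|z x|.
Proof.
move=> mf fM lz.
have mfz : measurable_fun setT (fun x => f x * z x).
  by apply: measurable_funM => //; exact: L1_measurable lz.
have lMz := L1Z M (L1_norm lz).
have fzM : {ae mu, forall x, `|f x * z x| <= M * `|z x|}.
  by apply: filterS fM => x xM; rewrite normrM ler_wpM2r.
split; first exact: (L1_ae_le mfz lMz fzM).
apply: le_trans (Rintegral_ae_le mfz lMz fzM) _.
by rewrite RintegralZl//; exact: L1_norm.
Qed.

Definition pair f phi (t : R) := \int[mu]_x (f t x * phi (t, x)).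

Lemma continuous_tslice phi (t : R) : continuous phi ->
  continuous (fun x : E => phi (t, x)).
Proof.
move=> cp x; apply: (@continuous_comp _ _ _ (fun x : E => (t, x)) phi); last exact: cp.
apply: (@lipschitz_continuous _ _ _ _ 1) => y z.
by rewrite mul1r prod_normE/= subrr normr0 ge_max normr_ge0 lexx.
Qed.

Lemma bsupp_tslice phi (t : R) : bsupp phi -> bsupp (fun x : E => phi (t, x)).
Proof.
by move=> [A pA]; exists A => x Ax; apply: pA; rewrite prod_normE lt_max Ax orbT.
Qed.

Lemma L1_tslice phi t : continuous phi -> bsupp phi -> L1 mu (fun x => phi (t, x)).
Proof.
by move=> cp bp; apply: L1_bsupp; [exact: continuous_tslice|exact: bsupp_tslice].
Qed.

Lemma L1_pair_t T f phi t : cbt T f -> continuous phi -> bsupp phi -> 0 <= t < T ->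
  L1 mu (fun x => f t x * phi (t, x)).
Proof.
move=> [f1 _] cp bp tT; have [mf [M fM]] := f1 t tT.
by have [] := L1_pair mf fM (L1_tslice t cp bp).
Qed.

(** The density varies continuously in [L^oo] and the test function
    uniformly, with supports in a fixed cube. *)
Lemma pair_tcont T f phi : cbt T f -> continuous phi -> bsupp phi ->
  tcont T (pair f phi).
Proof.
move=> cf cp bp t tT e e0.
have [A A0 pA] := bsupp_ge0 bp.
have [S S0 pS] := bsupp_bounded (@heine_borel_prod R d) cp bp.
have [M M0 fM] : exists2 M : R, 0 <= M & {ae mu, forall x, `|f t x| <= M}.
  have [_ [M fM]] := cf.1 t tT; exists `|M| => //.
  by apply: filterS fM => x /le_trans; apply; exact: ler_norm.
pose V := (2 * A) ^+ d.
have V0 : 0 <= V by rewrite exprn_ge0// mulr_ge0.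
have e2 : 0 < e / 2 by rewrite divr_gt0.
pose e3 := e / 2 / (S * V + 1); have e30 : 0 < e3.
  by rewrite divr_gt0// ltr_wpDl// mulr_ge0.
pose e4 := e / 2 / (M * V + 1); have e40 : 0 < e4.
  by rewrite divr_gt0// ltr_wpDl// mulr_ge0.
have [r1 r10 H1] := cf.2 t tT e3 e30.
have [r2 r20 H2] := bsupp_unif_continuous (@heine_borel_prod R d) cp bp e40.
exists (Num.min r1 r2); first by rewrite lt_min r10.
move=> s sT; rewrite lt_min => /andP[st1 st2].
have l1 := L1_pair_t cf cp bp sT; have l2 := L1_pair_t cf cp bp tT.
have lp u := L1_tslice u cp bp.
have [ms _] := cf.1 s sT; have [mt _] := cf.1 t tT.
have mfs : measurable_fun setT (fun x => f s x - f t x) by exact: measurable_funB.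
have bnd (h : E -> R) (N : R) : continuous h -> (forall x, `|h x| <= N) ->
    (forall x, A < `|x| -> h x = 0) -> \int[mu]_x `|h x| <= N * V.
  move=> ch hN hA.
  have [_] := @L1_cube_supp R d (fun x => `|h x|) 0 A N A0
    (continuous_measurable_rV (f := fun x => `|h x|) (fun x => cvg_norm (ch x)))
    (fun x => eq_ind_r (fun y => y <= N) (hN x) (normr_id (h x)))
    (fun x H => eq_ind_r (fun y => `|y| = 0) (normr0 _) (hA x (eq_ind _ (fun y => A < `|y|) H _ (subr0 x)))).
  by apply: le_trans; exact: ler_norm.
have [l3 b3] := L1_pair mfs (H1 s sT st1) (lp s).
have ld : L1 mu (fun x => phi (s, x) - phi (t, x)) by exact: L1B.
have [l4 b4] := L1_pair mt fM ld.
rewrite /pair -RintegralB//.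
rewrite (_ : \int[mu]_x _ = \int[mu]_x ((f s x - f t x) * phi (s, x)) +
    \int[mu]_x (f t x * (phi (s, x) - phi (t, x)))); last first.
  by rewrite -RintegralD//; apply: eq_Rintegral => x _; ring.
rewrite (le_trans (ler_normD _ _))// [leRHS]splitr lerD//.
  apply: le_trans b3 _.
  apply: (@le_trans _ _ (e3 * (S * V))).
    apply: ler_wpM2l; first exact: ltW.
    apply: bnd.
    - exact: continuous_tslice.
    - by move=> x; exact: pS.
    - by move=> x Ax; apply: pA; rewrite prod_normE lt_max Ax orbT.
  rewrite /e3 mulrAC ler_pdivrMr ?ltr_wpDl ?mulr_ge0//.
  by rewrite ler_pM2l// lerDl.
apply: le_trans b4 _.
apply: (@le_trans _ _ (M * (e4 * V))).
  apply: ler_wpM2l => //; apply: bnd.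
  - have cs := @continuous_tslice phi s cp; have ct := @continuous_tslice phi t cp.
    exact: (fun x : E => cvgB (cs x) (ct x)).
  - move=> x; apply: H2; rewrite prod_normE/= subrr normr0 ge_max ltW//=.
    exact: ltW.
  - by move=> x Ax; rewrite !pA ?subrr// prod_normE lt_max Ax orbT.
rewrite /e4 mulrCA mulrAC ler_pdivrMr ?ltr_wpDl ?mulr_ge0//.
by rewrite ler_pM2l// lerDl.
Qed.

Lemma pair_tL1 T f phi : cbt T f -> continuous phi -> bsupp phi -> tcut T phi ->
  tL1 T (pair f phi).
Proof.
move=> cf cp bp [t1 t1T p0]; apply: tcont_tL1; first exact: pair_tcont.
exists t1 => // t t1t; rewrite /pair; under eq_Rintegral do rewrite p0// mulr0.
by rewrite Rintegral_cst// mul0r.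
Qed.

End time_pairing.

(** * Regular distributions on the half-open time interval *)

Section regular_distributions.
Context {R : realType} {d : nat}.
Local Notation E := 'rV[R]_d.
Local Notation mu := (@lebesgue_rV R d).
Local Notation leb := (@lebesgue_measure R).
Implicit Types (T : R) (f g : R -> E -> R) (phi psi : R * E -> R).

Lemma cbt_ext T f g : (forall t x, f t x = g t x) -> cbt T f -> cbt T g.
Proof.
by move=> fg; rewrite (_ : g = f)//; apply/funext => t; apply/funext => x.
Qed.

Lemma cbtD T f g : cbt T f -> cbt T g -> cbt T (fun t x => f t x + g t x).
Proof.
move=> [f1 f2] [g1 g2]; split=> t tT.
  have [mf [M fM]] := f1 t tT; have [mg [N gN]] := g1 t tT; split.
    exact: measurable_funD.
  exists (M + N); apply: filterS2 fM gN => x xM xN.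
  by rewrite (le_trans (ler_normD _ _))// lerD.
move=> e e0; have e2 : 0 < e / 2 by rewrite divr_gt0.
have [r r0 Hf] := f2 t tT _ e2; have [q q0 Hg] := g2 t tT _ e2.
exists (Num.min r q); first by rewrite lt_min r0.
move=> s sT; rewrite lt_min => /andP[sr sq].
apply: filterS2 (Hf s sT sr) (Hg s sT sq) => x xf xg.
by rewrite opprD addrACA (le_trans (ler_normD _ _))// [leRHS]splitr lerD.
Qed.

Lemma cbtM T f g : cbt T f -> cbt T g -> cbt T (fun t x => f t x * g t x).
Proof.
move=> [f1 f2] [g1 g2]; split=> t tT.
  have [mf [M fM]] := f1 t tT; have [mg [N gN]] := g1 t tT; split.
    exact: measurable_funM.
  exists (M * N); apply: filterS2 fM gN => x xM xN.
  by rewrite normrM ler_pM.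
move=> e e0.
have [_ [M fM]] := f1 t tT; have [_ [N gN]] := g1 t tT.
pose K := `|M| + `|N| + 1; have K0 : 0 < K by rewrite ltr_wpDl ?addr_ge0.
pose e' := Num.min 1 (e / K); have e'0 : 0 < e' by rewrite lt_min ltr01 divr_gt0.
have [r r0 Hf] := f2 t tT _ e'0; have [q q0 Hg] := g2 t tT _ e'0.
exists (Num.min r q); first by rewrite lt_min r0.
move=> s sT; rewrite lt_min => /andP[sr sq].
have fM' : {ae mu, forall x, `|f t x| <= `|M|}.
  by apply: filterS fM => x /le_trans; apply; exact: ler_norm.
have gN' : {ae mu, forall x, `|g t x| <= `|N|}.
  by apply: filterS gN => x /le_trans; apply; exact: ler_norm.
apply: filterS2 (filterI fM' (Hf s sT sr)) (filterI gN' (Hg s sT sq)).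
move=> x [xM xf] [xN xg].
have e'1 : e' <= 1 by rewrite ge_min lexx.
have eK : e' * K <= e by rewrite -ler_pdivlMr// ge_min lexx orbT.
rewrite (_ : f s x * g s x - f t x * g t x = (f s x - f t x) * (g s x - g t x)
  + f t x * (g s x - g t x) + (f s x - f t x) * g t x); last by ring.
apply: le_trans (ler_normD _ _) _; apply: le_trans (lerD (ler_normD _ _) (lexx _)) _.
apply: le_trans eK; rewrite !normrM /K !mulrDr mulr1.
have p1 : `|f s x - f t x| * `|g s x - g t x| <= e'.
  rewrite -[leRHS]mulr1; apply: ler_pM => //; exact: le_trans e'1.
have p2 : `|f t x| * `|g s x - g t x| <= e' * `|M|.
  by rewrite mulrC; apply: ler_pM.
have p3 : `|f s x - f t x| * `|g t x| <= e' * `|N| by apply: ler_pM.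
by lra.
Qed.

Lemma cbt_cst T (c : R) : cbt T (fun (_ : R) (_ : E) => c).
Proof.
split=> t tT; first by split=> //; exists `|c|; exact: aeW.
by move=> e e0; exists 1 => // s _ _; apply: aeW => x; rewrite subrr normr0 ltW.
Qed.

Lemma cbtZ T (c : R) f : cbt T f -> cbt T (fun t x => c * f t x).
Proof. by move=> cf; apply: (@cbtM T (fun _ _ => c)) => //; exact: cbt_cst. Qed.

Lemma cbtB T f g : cbt T f -> cbt T g -> cbt T (fun t x => f t x - g t x).
Proof.
move=> cf cg; apply: (@cbt_ext T (fun t x => f t x + (-1) * g t x)).
  by move=> t x; rewrite mulN1r.
by apply: cbtD => //; exact: cbtZ.
Qed.

(** The class to which derivatives of test functions belong, large enough to
    define pairings. *)
Definition cpair T phi := [/\ continuous phi, bsupp phi & tcut T phi].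

(** Test functions smooth on all of R x R^d with bounded support, a normal
    form to which all others are reduced. *)
Definition ctest T phi := [/\ smooth phi, bsupp phi & tcut T phi].

Lemma ctest_cpair T phi : ctest T phi -> cpair T phi.
Proof. by move=> [sp bp cp]; split=> //; exact: smooth_continuous. Qed.

Lemma tcut_derive T phi v : tcut T phi -> tcut T (fun z => 'D_v phi z).
Proof.
move=> [t1 t1T p0]; exists t1 => // z zt1.
rewrite -(derive_cst (0 : R) z v); apply: near_eq_derive.
have : \forall y \near z, t1 < y.1.
  have r0 : 0 < z.1 - t1 by rewrite subr_gt0.
  apply: (filterS _ (nbhsx_ballx z _ r0)) => y [+ _].
  by rewrite -ball_normE/= ltr_norml => /andP[_]; lra.
by apply: filterS => y /p0.
Qed.

Lemma tcutD T phi psi : tcut T phi -> tcut T psi -> tcut T (fun z => phi z + psi z).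
Proof.
move=> [t t1 tp] [s s1 sp]; exists (Num.max t s); first by rewrite gt_max t1.
by move=> z; rewrite gt_max => /andP[/tp -> /sp ->]; rewrite addr0.
Qed.

Lemma tcutMr T phi psi : tcut T psi -> tcut T (fun z => phi z * psi z).
Proof. by move=> [t t1 tp]; exists t => // z /tp ->; rewrite mulr0. Qed.

Lemma ctest_derive T phi v : ctest T phi -> ctest T (fun z => 'D_v phi z).
Proof.
move=> [sp bp tp]; split; [exact: smooth_derive|exact: bsupp_derive|
  exact: tcut_derive].
Qed.

Lemma ctestD T phi psi : ctest T phi -> ctest T psi -> ctest T (fun z => phi z + psi z).
Proof.
move=> [sp bp tp] [sq bq tq]; split; [exact: smoothD|exact: bsuppD|exact: tcutD].
Qed.

Lemma ctestZ T (c : R) phi : ctest T phi -> ctest T (fun z => c * phi z).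
Proof.
move=> [sp bp tp]; split; [exact: smoothZ|exact: bsuppMr|exact: tcutMr].
Qed.

Lemma ctest0 T : ctest T (fun=> 0 : R).
Proof.
split; first exact: smooth_cst.
  by exists 0.
by exists (T - 1) => //; rewrite ltrBlDr ltrDl.
Qed.

Lemma ctest_sum T (I : Type) (s : seq I) (F : I -> R * E -> R) :
  (forall i, ctest T (F i)) -> ctest T (fun z => \sum_(i <- s) F i z).
Proof.
move=> tF; elim: s => [|i s IH].
  by under eq_fun do rewrite big_nil; exact: ctest0.
by under eq_fun do rewrite big_cons; exact: ctestD.
Qed.

Definition xshift (y : E) phi : R * E -> R := fun z => phi (z.1, z.2 + y).

Lemma xshift_affine (y : E) (h : R) (z w : R * E) :
  ((h *: w + z).1, (h *: w + z).2 + y) = h *: w + (z.1, z.2 + y).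
Proof. by rewrite -[(h *: w + z).2]/(h *: w.2 + z.2) -addrA. Qed.

Lemma continuous_xshift (y : E) : continuous (fun z : R * E => (z.1, z.2 + y)).
Proof.
apply: (@lipschitz_continuous _ _ _ _ 1) => [[t x] [s x']].
by rewrite mul1r !prod_normE/= opprD addrACA subrr addr0.
Qed.

Lemma smooth_xshift y phi : smooth phi -> smooth (xshift y phi).
Proof.
apply: (smooth_comp_affine (L0 := id)); last exact: continuous_xshift.
by move=> h z w; exact: xshift_affine.
Qed.

Lemma xshift_derive y phi v z :
  'D_v (xshift y phi) z = xshift y (fun z => 'D_v phi z) z.
Proof.
apply: (@derive_comp_affine _ _ _ (fun z : R * E => (z.1, z.2 + y)) id).
by move=> h w w'; exact: xshift_affine.
Qed.

Lemma ctest_xshift T y phi : ctest T phi -> ctest T (xshift y phi).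
Proof.
move=> [sp [A pA] [t1 t1T tp]]; split; first exact: smooth_xshift.
  exists (A + `|y|) => z Az; apply: pA.
  have : `|z| <= `|(z.1, z.2 + y)| + `|y|.
    rewrite {1}(_ : z = (z.1, z.2 + y) - (0, y)).
      rewrite (le_trans (ler_normB _ _))// lerD2l.
      by rewrite prod_normE/= normr0 ge_max normr_ge0 lexx.
    rewrite -[RHS]/(z.1 - 0, z.2 + y - y) subr0 addrK.
    by case: z {Az}.
  by lra.
by exists t1 => // z zt; apply: tp.
Qed.

Lemma rd_pair T f phi : regular_dist T f phi = \int[leb]_(t in `[0, T[) pair f phi t.
Proof. by []. Qed.

(** The initial time is negligible, so that an identity between derivatives
    is only needed at positive times. *)
Lemma tint_eq T (m m' : R -> R) : tL1 T m' ->
  (forall t, 0 < t < T -> m t = m' t) ->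
  \int[leb]_(t in `[0, T[) m t = \int[leb]_(t in `[0, T[) m' t.
Proof.
move=> lm' H; rewrite /Rintegral; congr fine.
have e t : `]0, T[%classic t -> (m t)%:E = (m' t)%:E.
  by rewrite /= in_itv/= => /H ->.
have mm' : measurable_fun `]0, T[%classic (EFin \o m').
  have := measurable_int _ lm'; apply: measurable_funS => //.
  by apply: subset_itvr; rewrite bnd_simp.
have mm : measurable_fun `]0, T[%classic (EFin \o m).
  by apply: eq_measurable_fun mm' => t; rewrite inE => /e /esym.
rewrite -(integral_itv_obnd_cbnd mm) -(integral_itv_obnd_cbnd mm').
by apply: eq_integral => t; rewrite inE => /e.
Qed.

Lemma tintD T (m m' : R -> R) : tL1 T m -> tL1 T m' ->
  \int[leb]_(t in `[0, T[) (m t + m' t) =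
  \int[leb]_(t in `[0, T[) m t + \int[leb]_(t in `[0, T[) m' t.
Proof. by move=> lm lm'; rewrite RintegralD. Qed.

Lemma rd_addf T f g phi : cbt T f -> cbt T g -> cpair T phi ->
  regular_dist T (fun t x => f t x + g t x) phi =
  regular_dist T f phi + regular_dist T g phi.
Proof.
move=> cf cg [cp bp tp]; rewrite !rd_pair -tintD; try exact: pair_tL1.
apply: eq_Rintegral => t; rewrite inE/= in_itv/= => tT.
rewrite /pair -RintegralD//; try exact: L1_pair_t tT.
by apply: eq_Rintegral => x _; rewrite mulrDl.
Qed.

Lemma rd_scalef T (c : R) f phi : cbt T f -> cpair T phi ->
  regular_dist T (fun t x => c * f t x) phi = c * regular_dist T f phi.
Proof.
move=> cf [cp bp tp]; rewrite !rd_pair -RintegralZl//; last exact: pair_tL1.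
apply: eq_Rintegral => t; rewrite inE/= in_itv/= => tT.
rewrite /pair -RintegralZl//; last exact: L1_pair_t tT.
by apply: eq_Rintegral => x _; rewrite mulrA.
Qed.

Lemma rd_addphi T f phi psi : cbt T f -> cpair T phi -> cpair T psi ->
  regular_dist T f (fun z => phi z + psi z) =
  regular_dist T f phi + regular_dist T f psi.
Proof.
move=> cf [cp bp tp] [cq bq tq]; rewrite !rd_pair -tintD; try exact: pair_tL1.
apply: eq_Rintegral => t; rewrite inE/= in_itv/= => tT.
rewrite /pair -RintegralD//; try exact: L1_pair_t tT.
by apply: eq_Rintegral => x _; rewrite mulrDr.
Qed.

Lemma rd_scalephi T (c : R) f phi : cbt T f -> cpair T phi ->
  regular_dist T f (fun z => c * phi z) = c * regular_dist T f phi.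
Proof.
move=> cf [cp bp tp]; rewrite !rd_pair -RintegralZl//; last exact: pair_tL1.
apply: eq_Rintegral => t; rewrite inE/= in_itv/= => tT.
rewrite /pair -RintegralZl//; last exact: L1_pair_t tT.
by apply: eq_Rintegral => x _; rewrite mulrCA.
Qed.

Lemma tint_bound T (m : R -> R) (C : R) : 0 <= T -> tL1 T m ->
  (forall t, 0 <= t < T -> `|m t| <= C) ->
  `|\int[leb]_(t in `[0, T[) m t| <= C * T.
Proof.
move=> T0 lm mC; have mI : measurable `[0, T[%classic by exact: measurable_itv.
have I : leb `[0, T[%classic = T%:E.
  rewrite lebesgue_measure_itv/= lte_fin; case: ltP => [_|T0'].
    by rewrite oppr0 adde0.
  by congr EFin; apply/eqP; rewrite eq_le T0 T0'.
apply: le_trans; first exact: le_normr_Rintegral.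
have <- : \int[leb]_(t in `[0, T[) C = C * T.
  by rewrite Rintegral_cst//; congr (_ * _); rewrite -[RHS]/(fine T%:E); congr fine.
apply: le_Rintegral => //.
- exact: (integrable_abse lm).
- apply: measurable_bounded_integrable => //.
    by rewrite [X in (X < _)%E]I ltry.
  by exists `|C|; split; [exact: num_real|move=> M CM t _ /=; exact: ltW].
Qed.

(** The constant does not depend on the centre of the cube, hence is the
    same for all spatial translates of a test function. *)
Lemma rd_bound T f (t1 A : R) : 0 <= T -> t1 < T -> 0 <= A -> cbt T f ->
  exists2 C : R, 0 <= C & forall phi (c : E) (S : R), continuous phi -> bsupp phi ->
    (forall z, t1 < z.1 -> phi z = 0) -> (forall z, A < `|z.2 - c| -> phi z = 0) ->
    (forall z, `|phi z| <= S) -> `|regular_dist T f phi| <= C * S.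
Proof.
move=> T0 t1T A0 cf; have [M M0 fM] := cbt_bounded t1T cf.
exists (M * (2 * A) ^+ d * T).
  by rewrite mulr_ge0// mulr_ge0// exprn_ge0// mulr_ge0.
move=> phi c S cp bp pt pA pS.
have S0 : 0 <= S by apply: le_trans (normr_ge0 (phi 0)) (pS _).
rewrite mulrAC -[M * _ * S]mulrA; apply: tint_bound => //.
  by apply: pair_tL1 => //; exists t1.
move=> t /andP[t0 tT].
have [tt1|t1t] := leP t t1; last first.
  rewrite /pair; under eq_Rintegral do rewrite pt// mulr0.
  rewrite Rintegral_cst// mul0r normr0.
  by rewrite mulr_ge0// mulr_ge0// exprn_ge0// mulr_ge0.
have [mf _] := cf.1 t (introT andP (conj t0 tT)).
have tt1' : 0 <= t <= t1 by rewrite t0.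
have [_] := L1_pair mf (fM t tt1') (L1_tslice t cp bp).
move=> /le_trans; apply; rewrite ler_wpM2l//.
have cs : continuous (fun x : E => `|phi (t, x)|).
  have ct := @continuous_tslice _ _ phi t cp.
  exact: (fun x : E => cvg_norm (ct x)).
have [_] := @L1_cube_supp R d (fun x => `|phi (t, x)|) c A S A0
    (continuous_measurable_rV cs)
    (fun x => eq_ind_r (fun y => y <= S) (pS (t, x)) (normr_id (phi (t, x))))
    (fun x H => eq_ind_r (fun y => `|y| = 0) (normr0 _) (pA (t, x) H)).
by rewrite mulrC; apply: le_trans; exact: ler_norm.
Qed.

End regular_distributions.

(** * Algebra of continuous functions *)

Section continuity_algebra.
Context {R : realType} {V : normedModType R}.
Implicit Types f g : V -> R.

Lemma contC (c : R) : continuous (fun _ : V => c).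
Proof. exact: cst_continuous. Qed.

Lemma contD f g : continuous f -> continuous g -> continuous (fun x => f x + g x).
Proof. by move=> cf cg x; exact: cvgD (cf x) (cg x). Qed.

Lemma contB f g : continuous f -> continuous g -> continuous (fun x => f x - g x).
Proof. by move=> cf cg x; exact: cvgB (cf x) (cg x). Qed.

Lemma contM f g : continuous f -> continuous g -> continuous (fun x => f x * g x).
Proof. by move=> cf cg x; exact: cvgM (cf x) (cg x). Qed.

End continuity_algebra.

Lemma continuous_sumR (R : realType) (V : normedModType R) (I : Type) (s : seq I)
    (F : I -> V -> R) : (forall i, continuous (F i)) ->
  continuous (fun x => \sum_(i <- s) F i x).
Proof.
move=> cF; elim: s => [|i s IH].
  by under eq_fun do rewrite big_nil; exact: cst_continuous.
by under eq_fun do rewrite big_cons; exact: (fun x => cvgD (cF i x) (IH x)).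
Qed.

(** * The Liouville theorem for bounded harmonic functions *)

Section liouville.
Context {R : realType}.

(** If the second derivative were positive at a maximum, the first one would
    be positive just after it. *)
Lemma second_derivative_test (F F1 : R -> R) (F2 r : R) : 0 < r ->
  (forall s : R, is_derive s 1 F (F1 s)) -> is_derive (0 : R) 1 F1 F2 ->
  (forall s : R, `|s| < r -> F s <= F 0) -> F2 <= 0.
Proof.
move=> r0 dF dF1 Fmax; rewrite leNgt; apply/negP => F20.
have F10 : F1 0 = 0.
  have r0' : (0 : R) \in `](- r), r[ by rewrite in_itv/= r0 oppr_lt0 r0.
  have := @derive1_at_max R F (- r) r 0 _ _ r0' _.
  case.
  - by rewrite (@le_trans _ _ 0)// ?oppr_le0 ltW.
  - by move=> t _; have [] := dF t.
  - by move=> t; rewrite in_itv/= => /andP[t1 t2]; apply: Fmax; rewrite ltr_norml t1.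
  - by move=> _ H; have [_ <-] := dF 0.
have [dd ed] := dF1.
have := dd; rewrite /derivable => /cvg_ex [/= l Hl].
have el : l = F2.
  by rewrite -ed; apply/esym; apply: cvg_lim => //; exact: Hl.
rewrite el in Hl.
have F22 : 0 < F2 / 2 by rewrite divr_gt0.
have /cvgrPdist_lt/(_ _ F22) := Hl.
rewrite near_withinE => /nbhs_ballP[q /= q0 Hq].
pose s := Num.min q r / 2.
have m0 : 0 < Num.min q r by rewrite lt_min q0.
have s0 : 0 < s by rewrite divr_gt0.
have sm : s < Num.min q r by rewrite /s; move: m0; clear; lra.
have cF : {within `[0, s], continuous F}.
  by apply: derivable_within_continuous => t _; have [] := dF t.
have [c] := MVT s0 (fun t _ => dF t) cF.
rewrite in_itv/= => /andP[c0 cs] e.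
have cq : ball 0 q c.
  rewrite -ball_normE/= sub0r normrN gtr0_norm//.
  by rewrite (lt_trans cs)// (lt_le_trans sm)// ge_min lexx.
have := Hq c cq (lt0r_neq0 c0).
rewrite /= addr0 F10 subr0 scaler1 => H.
have F1c : 0 < F1 c.
  have : 0 < c^-1 *: F1 c.
    by move: H; rewrite ltr_norml => /andP[_]; move: F20; move: (_ *: _) => x; lra.
  by rewrite pmulr_rgt0// invr_gt0.
have : F s <= F 0.
  apply: Fmax; rewrite gtr0_norm// (lt_le_trans sm)//.
  by rewrite ge_min lexx orbT.
rewrite -subr_le0 e leNgt => /negP; apply.
by rewrite subr0 mulr_gt0.
Qed.

Context {d : nat}.
Local Notation E := 'rV[R]_d.

Lemma dot_line (y : E) k (s : R) :
  dot (y + s *: unit_vec k) (y + s *: unit_vec k) = dot y y + (2 * y 0 k * s + s * s).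
Proof.
rewrite /dot (bigD1 k)//= [in RHS](bigD1 k)//= !mxE !eqxx /= mulr1.
rewrite (eq_bigr (fun i => y 0 i * y 0 i)); first by ring.
by move=> i ik; rewrite !mxE/= (negbTE ik) mulr0 addr0.
Qed.

Lemma dot_ge0 (y : E) : 0 <= dot y y.
Proof. by apply: sumr_ge0 => i _; rewrite -expr2 sqr_ge0. Qed.

Lemma coord_le_dot (y : E) i : y 0 i * y 0 i <= dot y y.
Proof.
by rewrite /dot (bigD1 i)//= lerDl; apply: sumr_ge0 => k _; rewrite -expr2 sqr_ge0.
Qed.

Lemma continuous_rV_coord i : continuous (fun y : E => y 0 i).
Proof.
apply: (@lipschitz_continuous _ _ R^o _ 1) => x y; rewrite mul1r.
by have := le_rV_coord (x - y) i; rewrite !mxE.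
Qed.

Lemma continuous_dot : continuous (fun y : E => dot y y).
Proof.
have H i : continuous (fun y : E => y 0 i * y 0 i).
  by have c := @continuous_rV_coord i; exact: (fun y => cvgM (c y) (c y)).
exact: continuous_sumR.
Qed.

Lemma compact_dot_ball (r : R) : compact [set y : E | dot y y <= r].
Proof.
apply: bounded_closed_compact.
  exists (`|r| + 1); split; first exact: num_real.
  move=> M rM y /= yr; have M0 : 0 <= M by rewrite (le_trans _ (ltW rM))// addr_ge0.
  apply/rV_norm_le => // i.
  rewrite -(@ler_sqr _ `|y 0 i|) ?nnegrE// real_normK ?num_real// expr2.
  apply: le_trans (coord_le_dot y i) _; apply: le_trans yr _.
  apply: le_trans (ler_norm r) _.
  have M1 : `|r| + 1 <= M by exact: ltW.
  have := normr_ge0 r; nra.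
apply: (@preimage_closed _ _ (fun y : E => dot y y) [set x | x <= r]).
  by move=> x _; exact: continuous_dot.
exact: closed_le.
Qed.

Lemma is_derive_along (h : E -> R) (h1 : E -> R) (y e : E) (s : R) :
  (forall y, is_derive y e h (h1 y)) ->
  is_derive s 1 (fun s : R => h (y + s *: e)) (h1 (y + s *: e)).
Proof.
move=> dh; have [_ <-] := dh (y + s *: e).
by apply: is_derive_line; have [] := dh (y + s *: e).
Qed.

Lemma is_derive1D (f g : R -> R) (s a b : R) : is_derive s 1 f a ->
  is_derive s 1 g b -> is_derive s 1 (fun x => f x + g x) (a + b).
Proof. by move=> df dg; exact: is_deriveD. Qed.

Lemma is_derive1M (f g : R -> R) (s a b : R) : is_derive s 1 f a ->
  is_derive s 1 g b -> is_derive s 1 (fun x => f x * g x) (f s * b + g s * a).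
Proof. by move=> df dg; exact: is_deriveM. Qed.

Lemma is_derive1Z (c : R) (f : R -> R) (s a : R) : is_derive s 1 f a ->
  is_derive s 1 (fun x => c * f x) (c * a).
Proof. by move=> df; exact: (is_deriveZ c df). Qed.

Lemma is_derive1_cst (c s : R) : is_derive s 1 (fun _ : R => c) 0.
Proof. exact: is_derive_cst. Qed.

Lemma is_derive1_id (s : R) : is_derive s 1 (fun x : R => x) 1.
Proof. exact: is_derive_id. Qed.

Lemma is_derive1_eq (f : R -> R) (s a b : R) :
  is_derive s 1 f a -> a = b -> is_derive s 1 f b.
Proof. by move=> df <-. Qed.

Lemma is_derive1N (f : R -> R) (s a : R) : is_derive s 1 f a ->
  is_derive s 1 (fun x => - f x) (- a).
Proof. by move=> df; exact: is_deriveN. Qed.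

Lemma is_derive_quad (c a s : R) :
  is_derive s 1 (fun s : R => c + (2 * a * s + s * s)) (2 * a + 2 * s).
Proof.
apply: (is_derive1_eq (is_derive1D (is_derive1_cst c s)
  (is_derive1D (is_derive1Z (2 * a) (is_derive1_id s))
    (is_derive1M (is_derive1_id s) (is_derive1_id s))))).
ring.
Qed.

Lemma is_derive_weight (C A eps s q' G' H' : R) (q G H : R -> R) :
  is_derive s 1 q q' -> is_derive s 1 G G' -> is_derive s 1 H H' ->
  is_derive s 1
    (fun s => (1 - C * q s) * (1 - C * q s) * (G s * G s) + A * (H s * H s) + eps * q s)
    (2 * ((1 - C * q s) * - (C * q')) * (G s * G s)
     + 2 * ((1 - C * q s) * (1 - C * q s)) * (G s * G') + 2 * A * (H s * H') + eps * q').
Proof.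
move=> dq dG dH.
have dE := is_derive1D (is_derive1_cst 1 s) (is_derive1N (is_derive1Z C dq)).
apply: (is_derive1_eq (is_derive1D (is_derive1D
  (is_derive1M (is_derive1M dE dE) (is_derive1M dG dG))
  (is_derive1Z A (is_derive1M dH dH))) (is_derive1Z eps dq))).
move: (q s) (G s) (H s) => x y z; ring.
Qed.

Lemma is_derive_weight2 (C A eps a G' H' G2 H2 : R) (q G H G1 H1 : R -> R) :
  is_derive (0 : R) 1 q (2 * a + 2 * 0) ->
  is_derive (0 : R) 1 G G' -> is_derive (0 : R) 1 H H' ->
  is_derive (0 : R) 1 G1 G2 -> is_derive (0 : R) 1 H1 H2 ->
  is_derive (0 : R) 1
    (fun s => 2 * ((1 - C * q s) * - (C * (2 * a + 2 * s))) * (G s * G s)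
     + 2 * ((1 - C * q s) * (1 - C * q s)) * (G s * G1 s) + 2 * A * (H s * H1 s)
     + eps * (2 * a + 2 * s))
    (2 * (- (C * (2 * a + 2 * 0)) * G 0) ^+ 2 - 4 * C * (1 - C * q 0) * G 0 ^+ 2
     + 4 * (- (C * (2 * a + 2 * 0)) * G 0) * ((1 - C * q 0) * G')
     + 4 * (- (C * (2 * a + 2 * 0)) * G1 0) * ((1 - C * q 0) * G 0)
     + 2 * ((1 - C * q 0) * G') * ((1 - C * q 0) * G1 0)
     + 2 * (1 - C * q 0) ^+ 2 * G 0 * G2
     + 2 * A * (H' * H1 0 + H 0 * H2) + 2 * eps).
Proof.
move=> dq dG dH dG1 dH1.
have dE := is_derive1D (is_derive1_cst 1 0) (is_derive1N (is_derive1Z C dq)).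
have dq' := is_derive1D (is_derive1_cst (2 * a) 0) (is_derive1Z 2 (is_derive1_id 0)).
have dE' := is_derive1N (is_derive1Z C dq').
apply: (is_derive1_eq (is_derive1D (is_derive1D (is_derive1D
  (is_derive1M (is_derive1Z 2 (is_derive1M dE dE')) (is_derive1M dG dG))
  (is_derive1M (is_derive1Z 2 (is_derive1M dE dE)) (is_derive1M dG dG1)))
  (is_derive1Z (2 * A) (is_derive1M dH dH1))) (is_derive1Z eps dq'))).
move: (q 0) (G 0) (H 0) (G1 0) (H1 0) => x y z t u; ring.
Qed.

Section bernstein.
Variables (h : E -> R) (h1 h2 g1 g2 : 'I_d -> E -> R) (j : 'I_d) (M : R).
Hypotheses (hM : forall y, `|h y| <= M) (ch : continuous h) (cg : continuous (h1 j)).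
Hypotheses (dh : forall k y, is_derive y (unit_vec k) h (h1 k y))
  (dh1 : forall k y, is_derive y (unit_vec k) (h1 k) (h2 k y))
  (dg : forall k y, is_derive y (unit_vec k) (h1 j) (g1 k y))
  (dg1 : forall k y, is_derive y (unit_vec k) (g1 k) (g2 k y)).
Hypotheses (Lh : forall y, \sum_k h2 k y = 0) (Lg : forall y, \sum_k g2 k y = 0).

Let g := h1 j.

Lemma bernstein_line (y : E) k (C A eps : R) (s : R) :
  let q (s : R) := dot y y + (2 * y 0 k * s + s * s) in
  let L (p : E -> R) (s : R) := p (y + s *: unit_vec k) in
  let eta s := 1 - C * q s in
  let eta' s := - (C * (2 * y 0 k + 2 * s)) in
  is_derive s 1
    (fun s => (eta s * eta s) * (L g s * L g s) + A * (L h s * L h s) + eps * q s)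
    (2 * (eta s * eta' s) * (L g s * L g s) + 2 * (eta s * eta s) * (L g s * L (g1 k) s)
     + 2 * A * (L h s * L (h1 k) s) + eps * (2 * y 0 k + 2 * s)).
Proof.
move=> q L eta eta'.
have dq : is_derive s 1 q (2 * y 0 k + 2 * s) by exact: is_derive_quad.
have dG : is_derive s 1 (L g) (L (g1 k) s) by exact: is_derive_along.
have dH : is_derive s 1 (L h) (L (h1 k) s) by exact: is_derive_along.
exact: (is_derive_weight C A eps dq dG dH).
Qed.

(** Leibniz, at the foot of a coordinate line; in the sum over [k] the
    second derivatives of [g] and [h] cancel by harmonicity. *)
Lemma bernstein_line2 (y : E) k (C A eps : R) :
  let q (s : R) := dot y y + (2 * y 0 k * s + s * s) in
  let L (p : E -> R) (s : R) := p (y + s *: unit_vec k) in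
  let eta s := 1 - C * q s in
  let eta' s := - (C * (2 * y 0 k + 2 * s)) in
  is_derive (0 : R) 1
    (fun s => 2 * (eta s * eta' s) * (L g s * L g s) +
       2 * (eta s * eta s) * (L g s * L (g1 k) s)
     + 2 * A * (L h s * L (h1 k) s) + eps * (2 * y 0 k + 2 * s))
    (2 * (eta' 0 * g y) ^+ 2 - 4 * C * eta 0 * g y ^+ 2
     + 4 * (eta' 0 * g y) * (eta 0 * g1 k y) + 4 * (eta' 0 * g1 k y) * (eta 0 * g y)
     + 2 * (eta 0 * g1 k y) * (eta 0 * g1 k y)
     + 2 * eta 0 ^+ 2 * g y * g2 k y
     + 2 * A * (h1 k y * h1 k y + h y * h2 k y) + 2 * eps).
Proof.
move=> q L eta eta'.
have L0 p : L p 0 = p y by rewrite /L scale0r addr0.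
have dq : is_derive (0 : R) 1 q (2 * y 0 k + 2 * 0) by exact: is_derive_quad.
have dG : is_derive (0 : R) 1 (L g) (g1 k y).
  by rewrite -(L0 (g1 k)); exact: is_derive_along.
have dH : is_derive (0 : R) 1 (L h) (h1 k y).
  by rewrite -(L0 (h1 k)); exact: is_derive_along.
have dG1 : is_derive (0 : R) 1 (L (g1 k)) (g2 k y).
  by rewrite -(L0 (g2 k)); exact: is_derive_along.
have dH1 : is_derive (0 : R) 1 (L (h1 k)) (h2 k y).
  by rewrite -(L0 (h2 k)); exact: is_derive_along.
have := is_derive_weight2 C A eps dq dG dH dG1 dH1.
by rewrite !L0.
Qed.

(** Bernstein: the auxiliary function is [eta^2 g^2 + A h^2 + eps |y|^2]
    with [eta = 1 - |y|^2 / r^2].  For [A = (2 d + 12) / r^2] it is strictly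
    subharmonic, so that its maximum over the ball is reached on the sphere,
    where [eta] vanishes. *)
Lemma bernstein_bound (r eps : R) : 0 < r -> 0 < eps ->
  g 0 ^+ 2 <= (2 * d%:R + 12) / r ^+ 2 * M ^+ 2 + eps * r ^+ 2.
Proof.
move=> r0 eps0.
have r20 : 0 < r ^+ 2 by rewrite exprn_gt0.
pose C := (r ^+ 2)^-1; have C0 : 0 < C by rewrite invr_gt0.
pose A := (2 * d%:R + 12) * C.
have A0 : 0 <= A by rewrite mulr_ge0 ?(ltW C0)// addr_ge0// mulr_ge0.
pose eta (y : E) := 1 - C * dot y y.
pose w (y : E) := (eta y * eta y) * (g y * g y) + A * (h y * h y) + eps * dot y y.
have ceta : continuous eta.
  exact: contB (@contC _ _ _) (contM (@contC _ _ _) continuous_dot).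
have cw : continuous w.
  exact: contD (contD (contM (contM ceta ceta) (contM cg cg))
    (contM (@contC _ _ _) (contM ch ch))) (contM (@contC _ _ _) continuous_dot).
have K0 : [set y : E | dot y y <= r ^+ 2] !=set0.
  exists 0; rewrite /= /dot big1; first exact: ltW.
  by move=> i _; rewrite mxE mul0r.
have [y yK ymax] := EVT_max_rV K0 (@compact_dot_ball (r ^+ 2)) (continuous_subspaceT cw).
rewrite inE/= in yK.
have hM2 x : h x * h x <= M ^+ 2.
  rewrite -expr2 -(@real_normK _ (h x)) ?num_real// lerXn2r// nnegrE.
  exact: le_trans (hM x).
have w0 : g 0 ^+ 2 <= w 0.
  rewrite /w /eta (_ : dot 0 0 = 0); last by rewrite /dot big1// => i _; rewrite mxE mul0r.
  rewrite !mulr0 subr0 !mul1r addr0 expr2 lerDl mulr_ge0// -expr2 sqr_ge0//.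
apply: (le_trans w0).
have wy : w 0 <= w y.
  apply: ymax; rewrite inE/= /dot big1; first exact: ltW.
  by move=> i _; rewrite mxE mul0r.
apply: (le_trans wy).
have [yr|yr] := eqVneq (dot y y) (r ^+ 2).
  rewrite /w /eta yr /C mulVf ?gt_eqF// subrr !mul0r add0r lerD2r.
  by rewrite ler_wpM2l.
exfalso.
have {}yr : dot y y < r ^+ 2 by rewrite lt_neqAle yr.
pose del := r ^+ 2 - dot y y; have del0 : 0 < del by rewrite subr_gt0.
have H k : 2 * ((- (C * (2 * y 0 k))) * g y) ^+ 2 - 4 * C * eta y * g y ^+ 2
     + 4 * ((- (C * (2 * y 0 k))) * g y) * (eta y * g1 k y)
     + 4 * ((- (C * (2 * y 0 k))) * g1 k y) * (eta y * g y)
     + 2 * (eta y * g1 k y) * (eta y * g1 k y)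
     + 2 * eta y ^+ 2 * g y * g2 k y
     + 2 * A * (h1 k y * h1 k y + h y * h2 k y) + 2 * eps <= 0.
  have B0 : 0 < 2 * `|y 0 k| + 1 by rewrite ltr_wpDl// mulr_ge0.
  pose rr := Num.min 1 (del / (2 * `|y 0 k| + 1)).
  have rr0 : 0 < rr by rewrite lt_min ltr01 divr_gt0.
  have D1 := bernstein_line y k C A eps; cbv zeta in D1.
  have D2 := bernstein_line2 y k C A eps; cbv zeta in D2.
  have := second_derivative_test rr0 D1 D2.
  rewrite !mulr0 !addr0 -/(eta y); apply.
  move=> s srr; cbv beta.
  have e x : (1 - C * (dot y y + (2 * y 0 k * x + x * x))) *
      (1 - C * (dot y y + (2 * y 0 k * x + x * x))) *
      (g (y + x *: unit_vec k) * g (y + x *: unit_vec k)) +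
      A * (h (y + x *: unit_vec k) * h (y + x *: unit_vec k)) +
      eps * (dot y y + (2 * y 0 k * x + x * x)) = w (y + x *: unit_vec k).
    by rewrite /w /eta dot_line.
  rewrite !e scale0r addr0; apply: ymax; rewrite inE/= dot_line.
  have : 2 * y 0 k * s + s * s <= del.
    have s1 : `|s| <= 1 by rewrite (le_trans (ltW srr))// ge_min lexx.
    apply: (@le_trans _ _ (`|s| * (2 * `|y 0 k| + 1))).
      rewrite (le_trans (ler_norm _))// (le_trans (ler_normD _ _))// !normrM.
      rewrite mulrDr mulr1 ger0_norm// [X in X + _ <= _]mulrC lerD2l.
      by rewrite ler_piMr.
    by rewrite -ler_pdivlMr// (le_trans (ltW srr))// ge_min lexx orbT.
  by rewrite /del; lra.
have eta01 : 0 <= eta y <= 1.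
  rewrite /eta; apply/andP; split.
    by rewrite subr_ge0 /C mulrC ler_pdivrMr// mul1r.
  by rewrite lerBlDr lerDl mulr_ge0// ?dot_ge0// ltW.
have S : \sum_k (- 24 * C ^+ 2 * (y 0 k * y 0 k) * g y ^+ 2 - 4 * C * g y ^+ 2
     + 2 * eta y ^+ 2 * g y * g2 k y
     + 2 * A * (h1 k y ^+ 2 + h y * h2 k y) + 2 * eps) <= 0.
  apply: sumr_le0 => k _; apply: le_trans (H k).
  rewrite !lerD2r.
  have := eta01 => /andP[e0 e1].
  have := sqr_ge0 (eta y * g1 k y + 2 * ((- (C * (2 * y 0 k))) * g y)).
  have : C * eta y * g y ^+ 2 <= C * g y ^+ 2.
    by rewrite ler_wpM2r ?sqr_ge0// ler_piMr// ltW.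
  move: (eta y) (g1 k y) (g y) (y 0 k) => ee b gy yk.
  by rewrite !expr2 => *; lra.
move: S; rewrite !big_split/= -!mulr_sumr -!mulr_suml -!mulr_sumr.
rewrite big_split/= -!mulr_sumr Lg Lh !mulr0 !addr0.
rewrite !sumr_const !card_ord -/(dot y y) => S.
have h1j : g y ^+ 2 <= \sum_k h1 k y ^+ 2.
  rewrite (bigD1 j)//= lerDl; apply: sumr_ge0 => k _; exact: sqr_ge0.
have d0 : 0 < d%:R :> R by rewrite ltr0n; exact: leq_trans (ltn_ord j).
have Cy : C * dot y y <= 1 by rewrite /C mulrC ler_pdivrMr// mul1r.
have X0 := sqr_ge0 (g y).
have X1 : C ^+ 2 * dot y y * g y ^+ 2 <= C * g y ^+ 2.
  by rewrite ler_wpM2r// expr2 -mulrA ler_piMr// ltW.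
have X2 : A * g y ^+ 2 <= A * \sum_k h1 k y ^+ 2 by rewrite ler_wpM2l.
have X3 : 0 < 2 * (eps * d%:R) by rewrite mulr_gt0// mulr_gt0.
have X4 : A * g y ^+ 2 = 2 * (C * g y ^+ 2 * d%:R) + 12 * (C * g y ^+ 2) by rewrite /A; ring.
move: S; rewrite -[(- (4 * C * g y ^+ 2)) *+ d]mulr_natr -[eps *+ d]mulr_natr => S.
lra.
Qed.

(** Letting the radius tend to infinity in the gradient estimate. *)
Lemma bernstein_liouville : g 0 = 0.
Proof.
apply/eqP; rewrite -sqrf_eq0 eq_le sqr_ge0 andbT.
apply/ler_addgt0Pl => e e0; rewrite addr0.
pose K := (2 * d%:R + 12) * M ^+ 2.
have K0 : 0 <= K by rewrite mulr_ge0 ?sqr_ge0// addr_ge0// mulr_ge0.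
pose r := Num.max 1 (K / (e / 2)).
have r1 : 1 <= r by rewrite le_max lexx.
have r0 : 0 < r by exact: lt_le_trans r1.
have r20 : 0 < r ^+ 2 by rewrite exprn_gt0.
have e2 : 0 < e / 2 by rewrite divr_gt0.
have := @bernstein_bound r (e / 2 / r ^+ 2) r0 (divr_gt0 e2 r20).
move=> /le_trans; apply.
rewrite divfK ?gt_eqF// [leRHS]splitr lerD2r.
rewrite mulrAC -/K ler_pdivrMr//.
rewrite mulrC -ler_pdivrMr//.
rewrite (@le_trans _ _ r)//; first by rewrite le_max lexx orbT.
by rewrite expr2 ler_peMr// ltW.
Qed.

End bernstein.

End liouville.

HB.lock Definition rdD {R : realType} {d : nat} (T : R) (f : R -> 'rV[R]_d -> R)
    (v : R * 'rV[R]_d) (phi : R * 'rV[R]_d -> R) : R :=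
  regular_dist T f (fun z => 'D_v phi z).

HB.lock Definition pair0 {R : realType} {d : nat} (f0 : 'rV[R]_d -> R)
    (phi : R * 'rV[R]_d -> R) : R :=
  \int[@lebesgue_rV R d]_x (f0 x * phi (0, x)).

(** * Tested scalar conservation laws *)

Section functional.
Context {R : realType} {d : nat}.
Local Notation E := 'rV[R]_d.
Local Notation mu := (@lebesgue_rV R d).
Local Notation leb := (@lebesgue_measure R).
Implicit Types (phi psi : R * E -> R).

Lemma derive_near0 (V : normedModType R) (phi : V -> R) v z :
  (\forall y \near z, phi y = 0) -> 'D_v phi z = 0.
Proof.
move=> H; rewrite -(derive_cst (0 : R) z v); apply: near_eq_derive.
by apply: filterS H => y ->.
Qed.

Lemma derive_vanish_time (t1 : R) phi v :
  (forall z, t1 < z.1 -> phi z = 0) -> forall z, t1 < z.1 -> 'D_v phi z = 0.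
Proof.
move=> p0 z zt; apply: derive_near0.
have r0 : 0 < z.1 - t1 by rewrite subr_gt0.
apply: (filterS _ (nbhsx_ballx z _ r0)) => y [+ _].
by rewrite -ball_normE/= ltr_norml => /andP[_ ?]; apply: p0; lra.
Qed.

Lemma derive_vanish_space (A : R) (c : E) phi v :
  (forall z, A < `|z.2 - c| -> phi z = 0) -> forall z, A < `|z.2 - c| -> 'D_v phi z = 0.
Proof.
move=> p0 z zt; apply: derive_near0.
have r0 : 0 < `|z.2 - c| - A by rewrite subr_gt0.
apply: (filterS _ (nbhsx_ballx z _ r0)) => y [_].
rewrite -ball_normE/= => H; apply: p0.
have := ler_normD (z.2 - y.2) (y.2 - c); rewrite addrA subrK; lra.
Qed.

Lemma deriveDf (V : normedModType R) (phi psi : V -> R) v : smooth phi -> smooth psi ->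
  (fun z => 'D_v (fun z => phi z + psi z) z) = (fun z => 'D_v phi z + 'D_v psi z).
Proof.
move=> sp sq; apply/funext => z.
by have := deriveD (smooth_derivable (x := z) (v := v) sp) (smooth_derivable sq); apply.
Qed.

Lemma deriveZf (V : normedModType R) (c : R) (phi : V -> R) v : smooth phi ->
  (fun z => 'D_v (fun z => c * phi z) z) = (fun z => c * 'D_v phi z).
Proof.
move=> sp; apply/funext => z.
by have := deriveZ c (smooth_derivable (x := z) (v := v) sp); apply.
Qed.

Lemma deriveMf (V : normedModType R) (phi psi : V -> R) v : smooth phi -> smooth psi ->
  (fun z => 'D_v (fun z => phi z * psi z) z) =
  (fun z => phi z * 'D_v psi z + psi z * 'D_v phi z).
Proof.
move=> sp sq; apply/funext => z.
by have := deriveM (smooth_derivable (x := z) (v := v) sp) (smooth_derivable sq); apply.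
Qed.

(** The left-hand side minus the right-hand side of a scalar conservation
    law with density [f], flux [g] and initial datum [f0]. *)
Definition Qf (T : R) (f : R -> E -> R) (g : 'I_d -> R -> E -> R) (f0 : E -> R) phi : R :=
  - rdD T f (@dir_t R d) phi - \sum_k rdD T (g k) (dir_x k) phi - pair0 f0 phi.

Variables (T : R) (f : R -> E -> R) (g : 'I_d -> R -> E -> R) (f0 : E -> R).
Hypotheses (T0 : 0 < T) (cf : cbt T f) (cg : forall k, cbt T (g k)).
Hypotheses (mf0 : measurable_fun setT f0)
  (bf0 : exists M : R, {ae mu, forall x, `|f0 x| <= M}).

Local Notation Q := (Qf T f g f0).

Let L1_f0 phi : continuous phi -> bsupp phi -> L1 mu (fun x => f0 x * phi (0, x)).
Proof.
move=> cp bp; have [M fM] := bf0.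
by have [] := L1_pair mf0 fM (L1_tslice 0 cp bp).
Qed.

Lemma rdD_add F v phi psi : cbt T F -> ctest T phi -> ctest T psi ->
  rdD T F v (fun z => phi z + psi z) = rdD T F v phi + rdD T F v psi.
Proof.
move=> cF tp tq; have [sp _ _] := tp; have [sq _ _] := tq.
rewrite rdD.unlock (deriveDf v sp sq).
exact: (rd_addphi cF (ctest_cpair (ctest_derive _ tp))
  (ctest_cpair (ctest_derive _ tq))).
Qed.

Lemma rdD_scale F v (c : R) phi : cbt T F -> ctest T phi ->
  rdD T F v (fun z => c * phi z) = c * rdD T F v phi.
Proof.
move=> cF tp; have [sp _ _] := tp.
rewrite rdD.unlock (deriveZf c v sp).
exact: (rd_scalephi c cF (ctest_cpair (ctest_derive _ tp))).
Qed.

Lemma pair0_add phi psi : ctest T phi -> ctest T psi ->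
  pair0 f0 (fun z => phi z + psi z) = pair0 f0 phi + pair0 f0 psi.
Proof.
move=> [sp bp _] [sq bq _]; rewrite pair0.unlock.
under eq_Rintegral do rewrite mulrDr.
by rewrite RintegralD//; apply: L1_f0 => //; exact: smooth_continuous.
Qed.

Lemma pair0_scale (c : R) phi : ctest T phi ->
  pair0 f0 (fun z => c * phi z) = c * pair0 f0 phi.
Proof.
move=> [sp bp _]; rewrite pair0.unlock.
under eq_Rintegral do rewrite mulrCA.
by rewrite RintegralZl//; apply: L1_f0 => //; exact: smooth_continuous.
Qed.

Lemma QfD phi psi : ctest T phi -> ctest T psi ->
  Q (fun z => phi z + psi z) = Q phi + Q psi.
Proof.
move=> tp tq; rewrite /Qf (rdD_add _ cf tp tq) (pair0_add tp tq).
have -> : \sum_k rdD T (g k) (dir_x k) (fun z => phi z + psi z) =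
    \sum_k rdD T (g k) (dir_x k) phi + \sum_k rdD T (g k) (dir_x k) psi.
  by rewrite -big_split; apply: eq_bigr => k _; exact: rdD_add.
ring.
Qed.

Lemma QfZ (c : R) phi : ctest T phi -> Q (fun z => c * phi z) = c * Q phi.
Proof.
move=> tp; rewrite /Qf (rdD_scale _ c cf tp) (pair0_scale c tp).
have -> : \sum_k rdD T (g k) (dir_x k) (fun z => c * phi z) =
    c * \sum_k rdD T (g k) (dir_x k) phi.
  by rewrite mulr_sumr; apply: eq_bigr => k _; exact: rdD_scale.
ring.
Qed.

Lemma QfB phi psi : ctest T phi -> ctest T psi ->
  Q (fun z => phi z - psi z) = Q phi - Q psi.
Proof.
move=> tp tq; rewrite (_ : (fun z => _) = fun z => phi z + (-1) * psi z).
  by rewrite QfD// ?QfZ ?mulN1r//; exact: ctestZ.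
by apply/funext => z; rewrite mulN1r.
Qed.

Lemma Qf_sum (I : Type) (s : seq I) (F : I -> R * E -> R) :
  (forall i, ctest T (F i)) -> Q (fun z => \sum_(i <- s) F i z) = \sum_(i <- s) Q (F i).
Proof.
move=> tF; elim: s => [|i s IH].
  rewrite big_nil (_ : (fun z => _) = fun z => 0 * (fun=> 0) z).
    by rewrite QfZ ?mul0r//; exact: ctest0.
  by apply/funext => z; rewrite big_nil mul0r.
rewrite big_cons -IH -QfD//; last exact: ctest_sum.
by congr (Q _); apply/funext => z; rewrite big_cons.
Qed.

(** The functional has order one, with a constant uniform over spatial
    translates. *)
Lemma Qf_bound (t1 A : R) : t1 < T -> 0 <= A ->
  exists2 C : R, 0 <= C & forall phi (c : E) (S : R), ctest T phi ->
    (forall z, t1 < z.1 -> phi z = 0) -> (forall z, A < `|z.2 - c| -> phi z = 0) ->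
    (forall z, `|phi z| <= S) -> (forall z, `|'D_(@dir_t R d) phi z| <= S) ->
    (forall k z, `|'D_(dir_x k) phi z| <= S) -> `|Q phi| <= C * S.
Proof.
move=> t1T A0.
have [C1 C10 H1] := rd_bound (ltW T0) t1T A0 cf.
have H2 k := rd_bound (ltW T0) t1T A0 (cg k).
pose C2 k := xget 0 [set C : R | 0 <= C /\ forall phi (c : E) (S : R),
   continuous phi -> bsupp phi ->
    (forall z, t1 < z.1 -> phi z = 0) -> (forall z, A < `|z.2 - c| -> phi z = 0) ->
    (forall z, `|phi z| <= S) -> `|regular_dist T (g k) phi| <= C * S].
have HC2 k : 0 <= C2 k /\ forall phi (c : E) (S : R),
   continuous phi -> bsupp phi ->
    (forall z, t1 < z.1 -> phi z = 0) -> (forall z, A < `|z.2 - c| -> phi z = 0) ->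
    (forall z, `|phi z| <= S) -> `|regular_dist T (g k) phi| <= C2 k * S.
  rewrite /C2; case: xgetP => [C _ []//|H].
  by have [C C0 HC] := H2 k; exfalso; apply: (H C).
have [M fM] := bf0.
exists (C1 + \sum_k C2 k + `|M| * (2 * A) ^+ d).
  rewrite addr_ge0// ?addr_ge0//; last by rewrite mulr_ge0// exprn_ge0// mulr_ge0.
  by apply: sumr_ge0 => k _; have [] := HC2 k.
move=> phi c S tp pt pA pS pSt pSk; have [sp bp _] := tp.
have cD v := smooth_continuous (smooth_derive v sp).
have bD v := bsupp_derive v bp.
rewrite /Qf (le_trans (ler_normB _ _))// mulrDl lerD//.
  rewrite (le_trans (ler_normB _ _))// normrN mulrDl lerD//.
    rewrite rdD.unlock.
    exact: (H1 _ c S (cD _) (bD _) (derive_vanish_time dir_t pt)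
      (derive_vanish_space dir_t pA) pSt).
  rewrite mulr_suml; apply: le_trans (ler_norm_sum _ _ _) _; apply: ler_sum => k _.
  rewrite rdD.unlock.
  exact: ((HC2 k).2 _ c S (cD _) (bD _) (derive_vanish_time (dir_x k) pt)
    (derive_vanish_space (dir_x k) pA) (pSk k)).
rewrite pair0.unlock.
have [_] := L1_pair mf0 fM (L1_tslice 0 (smooth_continuous sp) bp).
move=> /le_trans; apply.
have cs : continuous (fun x : E => `|phi (0, x)|).
  have ct := @continuous_tslice _ _ phi 0 (smooth_continuous sp).
  exact: (fun x : E => cvg_norm (ct x)).
have [_] := @L1_cube_supp R d (fun x => `|phi (0, x)|) c A S A0
    (continuous_measurable_rV cs)
    (fun x => eq_ind_r (fun y => y <= S) (pS (0, x)) (normr_id (phi (0, x))))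
    (fun x H => eq_ind_r (fun y => `|y| = 0) (normr0 _) (pA (0, x) H)).
rewrite ger0_norm; last by apply: Rintegral_ge0 => x _.
move=> H; apply: (@le_trans _ _ (`|M| * \int[mu]_x `|phi (0, x)|)).
  by rewrite ler_wpM2r ?ler_norm//; apply: Rintegral_ge0 => x _.
by rewrite -mulrA ler_wpM2l// mulrC.
Qed.

Lemma shift_affine (a : R * E) (h : R) (y w : R * E) :
  (h *: w + y) + a = h *: w + (y + a).
Proof. by rewrite addrA. Qed.

Lemma derive_shift_arg (a v : R * E) phi z :
  'D_v (fun z => phi (z + a)) z = 'D_v phi (z + a).
Proof.
apply: (@derive_comp_affine _ _ _ (fun z : R * E => z + a) id) => h y w.
exact: shift_affine.
Qed.

Lemma smooth_shift_arg (a : R * E) phi : smooth phi -> smooth (fun z => phi (z + a)).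
Proof.
apply: (smooth_comp_affine (L0 := id)); first by move=> h y w; exact: shift_affine.
apply: (@lipschitz_continuous _ _ _ _ 1) => x y.
by rewrite mul1r opprD addrACA subrr addr0.
Qed.

Lemma norm_dir_x (k : 'I_d) : `|dir_x k : R * E| <= 1.
Proof.
rewrite prod_normE/= normr0 ge_max ler01/=; apply/rV_norm_le => // i.
by rewrite !mxE eqxx/=; case: (_ == _); rewrite ?normr1 ?normr0.
Qed.

Lemma fst_shift_x (z : R * E) (s : R) (k : 'I_d) : (z + s *: dir_x k).1 = z.1.
Proof. by rewrite -[LHS]/(z.1 + s * 0) mulr0 addr0. Qed.

Lemma ctest_shift_arg (k : 'I_d) (s : R) phi : ctest T phi ->
  ctest T (fun z => phi (z + s *: dir_x k)).
Proof.
move=> [sp [A pA] [t1 t1T tp]]; split; first exact: smooth_shift_arg.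
  exists (A + `|s|) => z zA; apply: pA.
  have := ler_normB (z + s *: dir_x k) (s *: dir_x k); rewrite addrK normrZ.
  have := norm_dir_x k; have := normr_ge0 s; nra.
by exists t1 => // z zt; apply: tp; rewrite fst_shift_x.
Qed.

(** The mean value theorem and uniform continuity of the derivative. *)
Lemma quotient_uniform phi (k : 'I_d) (e : R) : smooth phi -> bsupp phi -> 0 < e ->
  \forall s \near (0 : R)^', forall z,
    `|s^-1 * (phi (z + s *: dir_x k) - phi z) - 'D_(dir_x k) phi z| <= e.
Proof.
move=> sp bp e0.
have cD := smooth_continuous (smooth_derive (dir_x k) sp).
have [r r0 H] := bsupp_unif_continuous (@heine_borel_prod R d) cD
  (bsupp_derive (dir_x k) bp) e0.
near=> s => z.
have s0 : s != 0 by near: s; exact: nbhs_dnbhs_neq.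
have sr : `|s| < r by near: s; exact: dnbhs0_lt.
have [c cs E1] := @MVT_line _ _ phi z (dir_x k) s (fun y => smooth_derivable sp).
rewrite E1 mulKf//; apply: H.
rewrite addrC addKr normrZ.
apply: (@le_trans _ _ (`|c| * 1)); first by rewrite ler_wpM2l// norm_dir_x.
by rewrite mulr1 (le_trans cs)// ltW.
Unshelve. all: by end_near. Qed.

Lemma deriveBf (V : normedModType R) (u w : V -> R) v z : smooth u -> smooth w ->
  'D_v (fun z => u z - w z) z = 'D_v u z - 'D_v w z.
Proof. by move=> su sw; apply: deriveB; exact: smooth_derivable. Qed.

Lemma derive_quotient phi (a v w z : R * E) (s : R) : smooth phi ->
  'D_v (fun z => s * (phi (z + a) - phi z) - 'D_w phi z) z =
  s * ('D_v phi (z + a) - 'D_v phi z) - 'D_w (fun z => 'D_v phi z) z.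
Proof.
move=> sp; have ssh := smooth_shift_arg a sp.
have e1 := deriveBf v z ssh sp; rewrite derive_shift_arg in e1.
have e2 := congr1 (fun F => F z) (deriveZf s v (smoothB ssh sp)).
have e3 := congr1 (fun F => F z) (derive_comm v w sp).
have e4 := deriveBf v z (smoothZ s (smoothB ssh sp)) (smooth_derive w sp).
apply: (eq_trans e4).
exact: (f_equal2 (fun x y => x - y) (eq_trans e2 (congr1 (fun x => s * x) e1)) e3).
Qed.

(** Difference quotients of a test function converge to its derivative with
    one more derivative, uniformly and with a common support, so that
    continuity of order one applies. *)
Lemma Qf_quotient phi (k : 'I_d) : ctest T phi ->
  s^-1 * (Q (fun z => phi (z + s *: dir_x k)) - Q phi) @[s --> (0 : R)^'] -->
    Q (fun z => 'D_(dir_x k) phi z).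
Proof.
move=> tp; have [sp bp [t1 t1T pt]] := tp; have [A A0 pA] := bsupp_ge0 bp.
have [C C0 HC] := @Qf_bound t1 (A + 1) t1T (addr_ge0 A0 ler01).
apply/cvgrPdist_le => e e0.
pose e' := e / (C + 1).
have C1 : 0 < C + 1 by rewrite ltr_wpDl.
have e'0 : 0 < e' by rewrite divr_gt0.
have n1 := @quotient_uniform phi k e' sp bp e'0.
have nD v := @quotient_uniform (fun z => 'D_v phi z) k e' (smooth_derive v sp)
  (bsupp_derive v bp) e'0.
have n2 := nD (@dir_t R d).
have n3 : \forall s \near (0 : R)^', forall l z,
    `|s^-1 * ('D_(dir_x l) phi (z + s *: dir_x k) - 'D_(dir_x l) phi z) -
      'D_(dir_x k) (fun z => 'D_(dir_x l) phi z) z| <= e'.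
  by apply: filter_forall => l; exact: nD.
near=> s.
have s0 : s != 0 by near: s; exact: nbhs_dnbhs_neq.
have s1 : `|s| < 1 by near: s; exact: dnbhs0_lt.
have N1 : forall z, `|s^-1 * (phi (z + s *: dir_x k) - phi z) -
    'D_(dir_x k) phi z| <= e' by near: s; exact: n1.
have N2 : forall z, `|s^-1 * ('D_(@dir_t R d) phi (z + s *: dir_x k) -
    'D_(@dir_t R d) phi z) - 'D_(dir_x k) (fun z => 'D_(@dir_t R d) phi z) z| <= e'.
  by near: s; exact: n2.
have N3 : forall l z, `|s^-1 * ('D_(dir_x l) phi (z + s *: dir_x k) -
    'D_(dir_x l) phi z) - 'D_(dir_x k) (fun z => 'D_(dir_x l) phi z) z| <= e'.
  by near: s; exact: n3.
pose psi (z : R * E) := s^-1 * (phi (z + s *: dir_x k) - phi z).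
have tsh := @ctest_shift_arg k s phi tp.
have tdiff : ctest T (fun z => phi (z + s *: dir_x k) - phi z).
  rewrite (_ : (fun z => _) = fun z => phi (z + s *: dir_x k) + (-1) * phi z).
    by apply: ctestD => //; exact: ctestZ.
  by apply/funext => z; rewrite mulN1r.
have tpsi : ctest T psi by exact: ctestZ.
have tDk := ctest_derive (dir_x k) tp.
pose chi z := psi z - 'D_(dir_x k) phi z.
have tchi : ctest T chi.
  rewrite (_ : chi = fun z => psi z + (-1) * 'D_(dir_x k) phi z).
    by apply: ctestD => //; exact: ctestZ.
  by apply/funext => z; rewrite mulN1r.
have Dchi v z : 'D_v chi z =
    s^-1 * ('D_v phi (z + s *: dir_x k) - 'D_v phi z) -
      'D_(dir_x k) (fun z => 'D_v phi z) z by exact: derive_quotient.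
rewrite distrC -QfB// -QfZ// -QfB// -/psi.
rewrite -[X in Q X]/chi.
apply: (@le_trans _ _ (C * e')); last first.
  by rewrite /e' mulrCA ler_piMr ?(ltW e0)// ler_pdivrMr// mul1r lerDl.
apply: (HC chi 0) => //.
- move=> z zt; rewrite /chi /psi !pt//; last by rewrite fst_shift_x.
  by rewrite (derive_vanish_time (dir_x k) pt zt) subr0 subrr mulr0.
- move=> z; rewrite subr0 => zA.
  have zA' : A < `|z.2 - 0| by rewrite subr0; lra.
  have pA' w : A < `|w.2 - 0| -> phi w = 0.
    by rewrite subr0 => wA; apply: pA; rewrite prod_normE lt_max wA orbT.
  have pz : phi (z + s *: dir_x k) = 0.
    apply: pA'; rewrite subr0 -[X in `|X|]/(z.2 + s *: unit_vec k).
    have := ler_normB (z.2 + s *: unit_vec k) (s *: unit_vec k); rewrite addrK normrZ.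
    have : `|unit_vec k : E| <= 1.
      by have := norm_dir_x k; rewrite prod_normE/= ge_max => /andP[].
    have := normr_ge0 s; nra.
  by rewrite /chi /psi (derive_vanish_space (dir_x k) pA' zA') (pA' z zA') pz
    subrr mulr0 subrr.
- by move=> z; rewrite Dchi; exact: N2.
- by move=> l z; rewrite Dchi; exact: N3.
Unshelve. all: by end_near. Qed.

End functional.

Lemma finite_radius (R : realType) (I : finType) (P : I -> R -> Prop) :
  (forall i r s, P i r -> s <= r -> P i s) ->
  (forall i, exists2 r, 0 < r & P i r) -> exists2 r, 0 < r & forall i, P i r.
Proof.
move=> Pm H; have : \forall r \near (0 : R)^'+, forall i, P i r.
  apply: filter_forall => i; have [r r0 Pr] := H i.
  near=> s; apply: Pm Pr _; near: s; exact: nbhs_right_le.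
move=> K; near (0 : R)^'+ => r; exists r; first by [].
exact: (near K r).
Unshelve. all: by end_near. Qed.

Lemma continuous_near_le (R : realType) (V : normedModType R) (f : V -> R) :
  (forall (x : V) (e : R), 0 < e -> \forall y \near x, `|f x - f y| <= e) ->
  continuous f.
Proof. by move=> H x; apply/cvgrPdist_le => e e0; exact: H. Qed.

(** * Liouville for conservation laws *)

Section functional_liouville.
Context {R : realType} {d : nat}.
Local Notation E := 'rV[R]_d.
Local Notation mu := (@lebesgue_rV R d).
Implicit Types (phi psi : R * E -> R).
Variables (T : R) (f : R -> E -> R) (g : 'I_d -> R -> E -> R) (f0 : E -> R).
Hypotheses (T0 : 0 < T) (cf : cbt T f) (cg : forall k, cbt T (g k)).
Hypotheses (mf0 : measurable_fun setT f0)
  (bf0 : exists M : R, {ae mu, forall x, `|f0 x| <= M}).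

Local Notation Q := (Qf T f g f0).
Let h phi (y : E) := Q (xshift y phi).

Lemma xshift_support phi (A : R) (y : E) : (forall z, A < `|z| -> phi z = 0) ->
  forall z : R * E, A < `|z.2 - (- y)| -> xshift y phi z = 0.
Proof.
move=> pA z; rewrite opprK => zA; apply: pA.
by rewrite prod_normE/= lt_max zA orbT.
Qed.

Lemma bounded_derivatives phi : smooth phi -> bsupp phi -> exists S : R,
  [/\ forall z, `|phi z| <= S, forall z, `|'D_(@dir_t R d) phi z| <= S &
    forall k z, `|'D_(dir_x k) phi z| <= S].
Proof.
move=> sp bp; have hb := @heine_borel_prod R d.
have [S0 S00 H0] := bsupp_bounded hb (smooth_continuous sp) bp.
have H v := bsupp_bounded hb (smooth_continuous (smooth_derive v sp)) (bsupp_derive v bp).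
have [S1 S10 H1] := H dir_t.
have H2 k : exists S : R, 0 <= S /\ forall z, `|'D_(dir_x k) phi z| <= S.
  by have [S SS HS] := H (dir_x k); exists S.
have [S2 H3] := choice H2.
have S20 : 0 <= \sum_k S2 k by apply: sumr_ge0 => k _; have [] := H3 k.
exists (S0 + S1 + \sum_k S2 k); split=> [z|z|k z].
- by have := H0 z; lra.
- by have := H1 z; lra.
- have [_ /(_ z)] := H3 k.
  have : S2 k <= \sum_k S2 k.
    by rewrite (bigD1 k)//= lerDl; apply: sumr_ge0 => l _; have [] := H3 l.
  lra.
Qed.

Lemma Qf_xshift_bounded phi : ctest T phi -> exists M : R, forall y, `|h phi y| <= M.
Proof.
move=> tp; have [sp bp [t1 t1T pt]] := tp; have [A A0 pA] := bsupp_ge0 bp.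
have [C C0 HC] := Qf_bound T0 cf cg mf0 bf0 t1T A0.
have [S [H0 H1 H2]] := bounded_derivatives sp bp.
exists (C * S) => y; apply: (HC _ (- y)).
- exact: ctest_xshift.
- by move=> z zt; apply: pt.
- exact: xshift_support.
- by move=> z; exact: H0.
- by move=> z; rewrite xshift_derive; exact: H1.
- by move=> k z; rewrite xshift_derive; exact: H2.
Qed.

Lemma shift_norm (y y' : E) (z : R * E) :
  `|((z.1, z.2 + y') : R * E) - (z.1, z.2 + y)| = `|y - y'|.
Proof.
rewrite prod_normE/= subrr normr0 opprD addrACA subrr add0r.
by rewrite distrC; apply/eqP; rewrite eq_le le_max lexx orbT ge_max normr_ge0 lexx.
Qed.

Lemma Qf_xshift_continuous phi : ctest T phi -> continuous (h phi).
Proof.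
move=> tp; have [sp bp [t1 t1T pt]] := tp; have [A A0 pA] := bsupp_ge0 bp.
have [C C0 HC] := Qf_bound T0 cf cg mf0 bf0 t1T (addr_ge0 A0 ler01).
have hb := @heine_borel_prod R d.
have uc v (e : R) (e0 : 0 < e) := bsupp_unif_continuous hb
  (smooth_continuous (smooth_derive v sp)) (bsupp_derive v bp) e0.
apply: continuous_near_le => y e e0.
have C1 : 0 < C + 1 by rewrite ltr_wpDl.
pose e' := e / (C + 1); have e'0 : 0 < e' by rewrite divr_gt0.
have [r1 r10 H1] := bsupp_unif_continuous hb (smooth_continuous sp) bp e'0.
have [r2 r20 H2] := uc (@dir_t R d) e' e'0.
have [r3 r30 H3] : exists2 r : R, 0 < r & forall (k : 'I_d) (x w : R * E),
    `|x - w| <= r -> `|'D_(dir_x k) phi x - 'D_(dir_x k) phi w| <= e'.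
  apply: (finite_radius (P := fun k r => forall (x w : R * E),
    `|x - w| <= r -> `|'D_(dir_x k) phi x - 'D_(dir_x k) phi w| <= e')).
    by move=> k r s H sr x w /le_trans/(_ sr); exact: H.
  by move=> k; exact: uc (dir_x k) e' e'0.
pose r := Num.min (Num.min 1 r1) (Num.min r2 r3).
have r0 : 0 < r by rewrite !lt_min ltr01 r10 r20.
apply: (filterS _ (nbhsx_ballx y r r0)) => y'.
rewrite -ball_normE/= !lt_min => /andP[/andP[yy' yr1] /andP[yr2 yr3]].
have N1 : forall z, `|xshift y' phi z - xshift y phi z| <= e'.
  by move=> z; apply: H1; rewrite shift_norm ltW.
have N2 : forall z, `|xshift y' (fun z => 'D_(@dir_t R d) phi z) z -
    xshift y (fun z => 'D_(@dir_t R d) phi z) z| <= e'.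
  by move=> z; apply: H2; rewrite shift_norm ltW.
have N3 : forall k z, `|xshift y' (fun z => 'D_(dir_x k) phi z) z -
    xshift y (fun z => 'D_(dir_x k) phi z) z| <= e'.
  by move=> k z; apply: H3; rewrite shift_norm ltW.
have ty := ctest_xshift y tp; have ty' := ctest_xshift y' tp.
have [sy _ _] := ty; have [sy' _ _] := ty'.
rewrite distrC -(QfB cf cg mf0 bf0 ty' ty).
have tD : ctest T (fun z => xshift y' phi z - xshift y phi z).
  rewrite (_ : (fun z => _) = fun z => xshift y' phi z + (-1) * xshift y phi z).
    by apply: ctestD => //; exact: ctestZ.
  by apply/funext => z; rewrite mulN1r.
have DE v z := deriveBf v z sy' sy.
apply: (@le_trans _ _ (C * e')); last first.
  by rewrite /e' mulrCA ler_piMr ?(ltW e0)// ler_pdivrMr// mul1r lerDl.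
apply: (HC _ (- y)) tD _ _ N1 _ _.
- by move=> z zt; rewrite /xshift !pt// subrr.
- move=> z zA.
  rewrite (xshift_support pA (y := y)) ?(xshift_support pA (y := y')) ?subrr//.
    rewrite opprK in zA *.
    have := ler_normD (z.2 + y') (y - y'); rewrite addrACA subrr addr0 opprK.
    lra.
  by apply: le_lt_trans zA; rewrite lerDl.
- by move=> z; rewrite DE !xshift_derive; exact: N2.
- by move=> k z; rewrite DE !xshift_derive; exact: N3.
Qed.

Lemma xshift_shift phi (y : E) (s : R) (k : 'I_d) :
  xshift (s *: unit_vec k + y) phi = fun z => xshift y phi (z + s *: dir_x k).
Proof.
apply/funext => z; rewrite /xshift fst_shift_x.
by rewrite -[X in (_, X + y)]/(z.2 + s *: unit_vec k) addrA.
Qed.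

Lemma Qf_xshift_is_derive phi (k : 'I_d) (y : E) : ctest T phi ->
  is_derive y (unit_vec k) (h phi) (h (fun z => 'D_(dir_x k) phi z) y).
Proof.
move=> tp; have H := @Qf_quotient _ _ T f g f0 T0 cf cg mf0 bf0 _ k (ctest_xshift y tp).
have e : (fun z => 'D_(dir_x k) (xshift y phi) z) =
    xshift y (fun z => 'D_(dir_x k) phi z).
  by apply/funext => z; exact: xshift_derive.
rewrite e in H.
have H' : s^-1 *: (h phi (s *: unit_vec k + y) - h phi y) @[s --> (0 : R)^'] -->
    h (fun z => 'D_(dir_x k) phi z) y.
  by under eq_fun do rewrite {1}/h xshift_shift; exact: H.
by apply: DeriveDef; [apply: cvgP H'|exact: cvg_lim H'].
Qed.

Hypothesis harmonic : forall phi, ctest T phi ->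
  Q (fun z => \sum_k 'D_(dir_x k) (fun z => 'D_(dir_x k) phi z) z) = 0.

Lemma Qf_xshift_harmonic phi (y : E) : ctest T phi ->
  \sum_k h (fun z => 'D_(dir_x k) (fun z => 'D_(dir_x k) phi z) z) y = 0.
Proof.
move=> tp; rewrite /h -(Qf_sum cf cg mf0 bf0); last first.
  by move=> k; apply: ctest_xshift; do 2 apply: ctest_derive.
have := harmonic (ctest_xshift y tp).
have DE v psi : (fun z => 'D_v (xshift y psi) z) = xshift y (fun z => 'D_v psi z).
  by apply/funext => z; exact: xshift_derive.
have eF k : (fun z => 'D_(dir_x k) (fun z => 'D_(dir_x k) (xshift y phi) z) z) =
    xshift y (fun z => 'D_(dir_x k) (fun z => 'D_(dir_x k) phi z) z).
  by rewrite (DE (dir_x k) phi); exact: DE.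
have e := congr1 (fun F : 'I_d -> R * E -> R => Q (fun z => \sum_k F k z))
  (funext eF).
exact: eq_trans (esym e).
Qed.

(** A functional of order one with bounded coefficients that annihilates
    Laplacians annihilates derivatives, since its translates form a bounded
    harmonic function. *)
Theorem Qf_liouville phi (j : 'I_d) : ctest T phi -> Q (fun z => 'D_(dir_x j) phi z) = 0.
Proof.
move=> tp; have tj := ctest_derive (dir_x j) tp.
have tD v w := ctest_derive v (ctest_derive w tp).
have [M hM] := Qf_xshift_bounded tp.
have := @bernstein_liouville R d (h phi) (fun k => h (fun z => 'D_(dir_x k) phi z))
  (fun k => h (fun z => 'D_(dir_x k) (fun z => 'D_(dir_x k) phi z) z))
  (fun k => h (fun z => 'D_(dir_x k) (fun z => 'D_(dir_x j) phi z) z))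
  (fun k => h (fun z => 'D_(dir_x k) (fun z => 'D_(dir_x k)
     (fun z => 'D_(dir_x j) phi z) z) z)) j M hM
  (Qf_xshift_continuous tp) (Qf_xshift_continuous tj)
  (fun k y => Qf_xshift_is_derive k y tp)
  (fun k y => Qf_xshift_is_derive k y (ctest_derive (dir_x k) tp))
  (fun k y => Qf_xshift_is_derive k y tj)
  (fun k y => Qf_xshift_is_derive k y (tD (dir_x k) (dir_x j)))
  (fun y => Qf_xshift_harmonic y tp) (fun y => Qf_xshift_harmonic y tj).
rewrite /h; have -> // : xshift 0 (fun z => 'D_(dir_x j) phi z) = (fun z => 'D_(dir_x j) phi z).
by apply/funext => -[t x]; rewrite /xshift /= addr0.
Qed.

End functional_liouville.

(** * Radial cutoffs *)

Section cutoffs.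
Context {R : realType} {d : nat}.
Local Notation E := 'rV[R]_d.
Variables (chi : E -> R) (j0 : 'I_d).
Hypothesis Hchi : cutoff chi.

Lemma enorm_line (s : R) : enorm (s *: unit_vec j0 : E) = `|s|.
Proof.
rewrite /enorm /dot (bigD1 j0)//= big1 ?addr0.
  by rewrite !mxE !eqxx /= mulr1 -expr2 sqrtr_sqr.
by move=> i ij; rewrite !mxE /= (negbTE ij) mulr0 mul0r.
Qed.

Lemma enorm0 : enorm (0 : E) = 0.
Proof. by rewrite -(scale0r (unit_vec j0)) enorm_line normr0. Qed.

Lemma enorm_ge0 (x : E) : 0 <= enorm x.
Proof. exact: sqrtr_ge0. Qed.

Lemma cutoff0 xi : 2 <= enorm xi -> chi xi = 0.
Proof.
move=> H; apply/eqP/negPn/negP => /eqP nz.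
have := cutoff_supp Hchi; move=> /(_ xi) /=.
by move=> /(_ (@subset_closure _ _ xi (introN eqP nz))); rewrite ltNge H.
Qed.

Lemma cutoff_ge0 xi : 0 <= chi xi.
Proof.
pose s := Num.max 2 (enorm xi).
rewrite -(@cutoff0 (s *: unit_vec j0)).
  apply: (cutoff_nincr Hchi); rewrite enorm_line ger0_norm ?le_max ?lexx ?orbT//.
  by rewrite ler0n.
by rewrite enorm_line ger0_norm ?le_max ?lexx// ler0n.
Qed.

Lemma cutoff_le1 xi : chi xi <= 1.
Proof.
rewrite -(cutoff_one Hchi (xi := 0)); last by rewrite enorm0.
by apply: (cutoff_nincr Hchi); rewrite enorm0 enorm_ge0.
Qed.

Definition cut1 (s : R) : R := chi (s *: unit_vec j0).

Lemma smooth_cut1 : smooth cut1.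
Proof.
apply: (smooth_comp_affine (V := R) (L0 := fun s => s *: unit_vec j0)) (cutoff_smooth Hchi).
  by move=> h s t; rewrite scalerDl -scalerA.
apply: (@lipschitz_continuous _ R^o _ _ `|unit_vec j0 : E|) => x y.
by rewrite -scalerBl normrZ mulrC.
Qed.

Lemma cut1_ge0 s : 0 <= cut1 s. Proof. exact: cutoff_ge0. Qed.
Lemma cut1_le1 s : cut1 s <= 1. Proof. exact: cutoff_le1. Qed.

Lemma cut1_one s : `|s| <= 1 -> cut1 s = 1.
Proof. by move=> s1; apply: (cutoff_one Hchi); rewrite enorm_line. Qed.

Lemma cut1_zero s : 2 <= `|s| -> cut1 s = 0.
Proof. by move=> s2; apply: cutoff0; rewrite enorm_line. Qed.

Lemma coord_le_enorm (x : E) i : `|x 0 i| <= enorm x.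
Proof.
rewrite /enorm -sqrtr_sqr ler_sqrt ?expr2 ?coord_le_dot//; exact: dot_ge0.
Qed.

Lemma norm_le_enorm (x : E) : `|x| <= enorm x.
Proof. by apply/rV_norm_le; [exact: enorm_ge0|move=> i; exact: coord_le_enorm]. Qed.

Lemma enorm_le (x : E) : enorm x <= d%:R * `|x|.
Proof.
have d1 : 1 <= d%:R :> R by rewrite ler1n; exact: leq_trans (ltn_ord j0).
rewrite -(@ger0_norm _ (d%:R * `|x|)) ?mulr_ge0// -sqrtr_sqr ler_sqrt ?sqr_ge0//.
apply: (@le_trans _ _ (\sum_(i < d) `|x| ^+ 2)).
  apply: ler_sum => i _; rewrite -expr2 -(@real_normK _ (x 0 i)) ?num_real//.
  by rewrite lerXn2r ?nnegrE// le_rV_coord.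
rewrite sumr_const card_ord exprMn -[leLHS]mulr_natl ler_wpM2r ?sqr_ge0//.
by rewrite expr2 ler_peMr.
Qed.

Lemma enormZ (s : R) (x : E) : enorm (s *: x) = `|s| * enorm x.
Proof.
rewrite /enorm -sqrtr_sqr -sqrtrM ?sqr_ge0//; congr Num.sqrt.
by rewrite /dot mulr_sumr; apply: eq_bigr => i _; rewrite !mxE; ring.
Qed.

Lemma smooth_chiZ (s : R) : smooth (fun x : E => chi (s *: x)).
Proof.
apply: (smooth_comp_affine (L0 := fun x => s *: x)) (cutoff_smooth Hchi).
  by move=> h y w; rewrite scalerDr !scalerA mulrC.
apply: (@lipschitz_continuous _ _ _ _ `|s|) => x y.
by rewrite -scalerBr normrZ.
Qed.

Lemma chiZ_supp (s : R) x : 0 < s -> 2 / s < `|x| -> chi (s *: x) = 0.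
Proof.
move=> s0 sx; apply: cutoff0; rewrite enormZ gtr0_norm//.
rewrite mulrC -ler_pdivrMr// (le_trans (ltW sx))//; exact: norm_le_enorm.
Qed.

Lemma chiZ_one (s : R) x : 0 < s -> s * (d%:R * `|x|) <= 1 -> chi (s *: x) = 1.
Proof.
move=> s0 sx; apply: (cutoff_one Hchi); rewrite enormZ gtr0_norm//.
by apply: le_trans sx; rewrite ler_pM2l// enorm_le.
Qed.

End cutoffs.

(** * Open boxes determine measures *)

Section box_uniqueness.
Context {R : realType} {n : nat}.
Local Notation E := 'rV[R]_n.
Local Notation leb := (@lebesgue_measure R).

Definition obox (a b : 'I_n -> R) : set E := [set x | forall i, a i < x 0 i < b i].

Lemma measurable_obox a b : measurable (obox a b).
Proof.
rewrite (_ : obox a b = \bigcap_(i in [set: 'I_n])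
    (@rV_coord R n i @^-1` `]a i, b i[%classic)); last first.
  apply/seteqP; split => x /= Ax i.
    by move=> _ /=; rewrite in_itv/=; exact: Ax.
  by have := Ax i Logic.I; rewrite /= in_itv.
apply: fin_bigcap_measurable => // i _.
by rewrite -[X in measurable X]setTI; exact: measurable_rV_coord.
Qed.

Lemma obox_cover : \bigcup_k (obox (fun=> - k%:R) (fun=> k%:R)) = [set: E].
Proof.
rewrite -subTset => x _; exists (Num.trunc `|x|).+1 => // i.
by rewrite -ltr_norml (le_lt_trans (le_rV_coord x i))// truncnS_gt.
Qed.

Lemma oboxI a b a' b' : obox a b `&` obox a' b' =
  obox (fun i => Num.max (a i) (a' i)) (fun i => Num.min (b i) (b' i)).
Proof.
apply/seteqP; split => [x [H H'] i|x H].
  by have /andP[? ?] := H i; have /andP[? ?] := H' i; rewrite gt_max lt_min; apply/andP; split; apply/andP.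
by split=> i; have := H i; rewrite gt_max lt_min => /andP[/andP[? ?] /andP[? ?]]; apply/andP.
Qed.

Let G := [set A | exists a b, A = obox a b].

Lemma measurable_rV_oboxes : @measurable _ E = <<s G >>.
Proof.
apply/seteqP; split; last first.
  apply: smallest_sub; first exact: sigma_algebra_measurable.
  by move=> _ [a [b ->]]; exact: measurable_obox.
apply: smallest_sub; first exact: smallest_sigma_algebra.
move=> A; rewrite -bigcup_seq => -[i _ [B mB <-]].
have cov (u v : R) : <<s G >> (@rV_coord R n i @^-1` `]u, v[%classic).
  rewrite (_ : _ @^-1` _ = \bigcup_k
     (obox (fun j => if j == i then u else - k%:R) (fun j => if j == i then v else k%:R))).
    have [_ _ H] := smallest_sigma_algebra setT G; apply: H => k.
    by apply: sub_sigma_algebra; eexists; eexists.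
  apply/seteqP; split=> x /=.
    rewrite in_itv/= /rV_coord => xuv; have : [set: E] x by [].
    rewrite -obox_cover => -[k _ kx]; exists k => // j.
    by case: eqP => [->|_]//; exact: kx.
  by move=> [k _ /(_ i)]; rewrite eqxx in_itv.
have : @measurable_fun _ _ (g_sigma_algebraType G) R setT (@rV_coord R n i).
  apply: (measurability _ (measurable_realfun.RGenOpens.measurableE R)).
  by move=> _ [_ [u [v ->] <-]]; rewrite setTI; exact: cov.
by move=> /(_ measurableT _ mB).
Qed.

(** Open boxes are stable under intersection, generate the sigma-algebra and
    exhaust the space. *)
Lemma rV_measure_unique (m1 m2 : {measure set E -> \bar R}) :
  (forall a b, m1 (obox a b) = m2 (obox a b)) ->
  (forall a b, (m1 (obox a b) < +oo)%E) ->
  forall A, measurable A -> m1 A = m2 A.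
Proof.
move=> m12 moo; apply: (@measure_unique _ _ _ G
  (fun k => obox (fun=> - k%:R) (fun=> k%:R))) => //.
- exact: measurable_rV_oboxes.
- by move=> _ _ [a [b ->]] [a' [b' ->]]; rewrite oboxI; eexists; eexists.
- by move=> k; eexists; eexists.
- exact: obox_cover.
- by move=> _ [a [b ->]].
Qed.

Lemma itvoo_measure (a b : R) : leb `]a, b[%classic = (Num.max 0 (b - a))%:E.
Proof.
rewrite lebesgue_measure_itv/= lte_fin; case: ltP => ab.
  by rewrite max_r ?subr_ge0 ?(ltW ab)// EFinB.
by rewrite max_l// subr_le0.
Qed.

Lemma obox_measure a b :
  @lebesgue_rV R n (obox a b) = (\prod_(i < n) Num.max 0 (b i - a i))%:E.
Proof.
have H := @lebesgue_rV_box R n (fun i => `]a i, b i[%classic) (fun i => measurable_itv _).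
rewrite (_ : obox a b = [set x : E | forall i, `]a i, b i[%classic (x 0 i)]); last first.
  by apply/seteqP; split=> x /= Ax i; have := Ax i; rewrite /= in_itv.
rewrite [LHS]H -prodEFin; apply: eq_bigr => i _; exact: itvoo_measure.
Qed.

Lemma obox_affine a b (s : R) (y : E) : s != 0 ->
  (fun x : E => s *: x + y) @^-1` obox a b =
  obox (fun i => if 0 < s then s^-1 * (a i - y 0 i) else s^-1 * (b i - y 0 i))
       (fun i => if 0 < s then s^-1 * (b i - y 0 i) else s^-1 * (a i - y 0 i)).
Proof.
move=> s0.
have E1 (x : E) i : (a i < (s *: x + y) 0 i < b i) =
    ((if 0 < s then s^-1 * (a i - y 0 i) else s^-1 * (b i - y 0 i)) < x 0 i <
     (if 0 < s then s^-1 * (b i - y 0 i) else s^-1 * (a i - y 0 i))).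
  rewrite !mxE -[a i < _]ltrBlDr -[_ < b i]ltrBrDr ![s^-1 * _]mulrC ![s * _]mulrC.
  case: (ltP 0 s) => s1; first by rewrite ltr_pdivrMr// ltr_pdivlMr.
  have {}s1 : s < 0 by rewrite lt_neqAle s0.
  by rewrite ltr_ndivrMr// ltr_ndivlMr// andbC.
by apply/seteqP; split=> x /= H i; have := H i; rewrite E1.
Qed.

End box_uniqueness.

(** * Affine changes of variables *)

Section change_of_variables.
Context {R : realType} {n : nat}.
Local Notation E := 'rV[R]_n.
Local Notation mu := (@lebesgue_rV R n).
Variables (s : R) (y : E).
Hypothesis s0 : s != 0.

Let A (x : E) : E := s *: x + y.

Lemma measurable_affine : measurable_fun setT A.
Proof.
apply: measurable_fun_rVP => i.
apply: (@continuous_measurable_rV R n (fun x => A x 0 i)).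
rewrite (_ : (fun x => A x 0 i) = (fun x : E => s * x 0 i + y 0 i)); last first.
  by apply/funext => x; rewrite !mxE.
have c2 := @contM _ _ (fun=> s) _ (@contC _ _ s) (@continuous_rV_coord R n i).
exact: (@contD _ _ _ _ c2 (@contC _ _ (y 0 i))).
Qed.

Let nu : {measure set E -> \bar R} :=
  measure_function_pushforward__canonical__measure_function_Measure mu measurable_affine.

Let k : {nonneg R} := NngNum (exprn_ge0 n (normr_ge0 s)).

(** Both measures agree on boxes. *)
Lemma lebesgue_affine B : measurable B -> mu B = mscale k nu B.
Proof.
have H a b := @obox_measure R n a b.
apply: rV_measure_unique => a b; last by rewrite [X in (X < _)%E]H ltry.
transitivity (k%:num%:E * mu (A @^-1` obox a b))%E; last by [].
rewrite /A obox_affine//; rewrite [LHS]H [X in (_ * X)%E]H -EFinM; congr EFin.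
rewrite /= -[n in _ ^+ n]card_ord -prodr_const -big_split/=; apply: eq_bigr => i _.
rewrite maxr_pMr// mulr0; congr Num.max.
have si : s * s^-1 = 1 by rewrite divff.
case: (ltP 0 s) => s1; rewrite -mulrBr mulrA ?(gtr0_norm s1) ?(ler0_norm s1) ?mulNr si; lra.
Qed.

Lemma Rintegral_affine (f : E -> R) : measurable_fun setT f ->
  L1 mu (fun x => f (A x)) ->
  L1 mu f /\ \int[mu]_x f x = `|s| ^+ n * \int[mu]_x f (A x).
Proof.
move=> mf lf; have mef : measurable_fun setT (EFin \o f) by exact/measurable_EFinP.
have inu : nu.-integrable setT (EFin \o f).
  exact: (integrable_pushforward measurable_affine mef lf).
have e : (forall B, measurable B -> B `<=` setT -> mscale k nu B = mu B).
  by move=> B mB _; symmetry; exact: lebesgue_affine.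
have i2 : (mscale k nu).-integrable setT (EFin \o f).
  apply/integrableP; split=> //; rewrite ge0_integral_mscale//; last first.
    exact: measurableT_comp.
  by rewrite lte_mul_pinfty//; have /integrableP[] := inu.
split.
  apply/integrableP; split => //.
  have -> : (\int[mu]_x `|(EFin \o f) x| = \int[mscale k nu]_x `|(EFin \o f) x|)%E.
    by apply: eq_measure_integral => B mB sB; symmetry; exact: e.
  by have /integrableP[] := i2.
rewrite /Rintegral.
have -> : (\int[mu]_x (f x)%:E = \int[mscale k nu]_x (f x)%:E)%E.
  by apply: eq_measure_integral => B mB sB; symmetry; exact: e.
have ->: (\int[mscale k nu]_x (f x)%:E = k%:num%:E * \int[nu]_x (f x)%:E)%E.
  have [fp fn] := (integrable_pos_fin_num measurableT inu, integrable_neg_fin_num measurableT inu).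
  rewrite integralE ge0_integral_mscale//; last exact: measurable_funepos.
  rewrite ge0_integral_mscale//; last exact: measurable_funeneg.
  rewrite -muleBr//; first by rewrite -integralE.
  by rewrite fin_num_adde_defr// fin_numN.
rewrite fineM//; last exact: integrable_fin_num.
congr (_ * fine _); exact: (integral_pushforward measurable_affine mef lf).
Qed.

End change_of_variables.
(** * Integrability of partial integrals *)

Section Rfubini_integrable.
Context d1 d2 (T1 : measurableType d1) (T2 : measurableType d2) (R : realType).
Variables (m1 : {sigma_finite_measure set T1 -> \bar R})
  (m2 : {sigma_finite_measure set T2 -> \bar R}).

Lemma L1_fubini1 (f : T1 * T2 -> R) : L1 (m1 \x m2)%E f ->
  (forall x, L1 m2 (fun y => f (x, y))) -> L1 m1 (fun x => \int[m2]_y f (x, y)).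
Proof.
move=> lf l2; have := integrable_fubini_F lf; congr (integrable _ _ _).
apply/funext => x /=; rewrite /fubini_F /Rintegral fineK//.
exact: integrable_fin_num (l2 x).
Qed.

Lemma L1_fubini2 (f : T1 * T2 -> R) : L1 (m1 \x m2)%E f ->
  (forall y, L1 m1 (fun x => f (x, y))) -> L1 m2 (fun y => \int[m1]_x f (x, y)).
Proof.
move=> lf l1; have /integrableP[mf _] := lf.
have lf' : (m2 \x m1)%E.-integrable setT (fun z => (f (z.2, z.1))%:E).
  apply/integrable21ltyP; first exact: (measurableT_comp mf (@measurable_swap _ _ _ _)).
  by have /(integrable12ltyP _ _ mf) := lf.
have := integrable_fubini_F lf'; congr (integrable _ _ _).
apply/funext => x /=; rewrite /fubini_F /Rintegral fineK//.
exact: integrable_fin_num (l1 x).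
Qed.

End Rfubini_integrable.

(** * Convolutions *)

Section convolution.
Context {R : realType} {n : nat}.
Local Notation E := 'rV[R]_n.
Local Notation mu := (@lebesgue_rV R n).
Implicit Types (p w g : E -> R).

Lemma L1_affine (f : E -> R) (s : R) (y : E) : s != 0 -> L1 mu f ->
  L1 mu (fun x => f (s *: x + y)) /\
  \int[mu]_x f x = `|s| ^+ n * \int[mu]_x f (s *: x + y).
Proof.
move=> s0 lf; have mf := L1_measurable lf.
have mfA : measurable_fun setT (fun x : E => f (s *: x + y)).
  by apply: (measurableT_comp mf); exact: measurable_affine.
have e (x : E) : s *: (s^-1 *: x + (- s^-1) *: y) + y = x.
  by rewrite scalerDr !scalerA mulrN divff// scale1r scaleN1r subrK.
have l : L1 mu (fun x => f (s *: x + y)).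
  have [] := @Rintegral_affine R n s^-1 ((- s^-1) *: y) (invr_neq0 s0) _ mfA => //.
  by under [X in L1 mu X]eq_fun do rewrite e.
by split => //; have [] := @Rintegral_affine R n s y s0 f mf l.
Qed.

Lemma L1_reflect w (y : E) : L1 mu w ->
  L1 mu (fun x => w (y - x)) /\ \int[mu]_x w (y - x) = \int[mu]_x w x.
Proof.
move=> lw; have n0 : -1 != 0 :> R by rewrite oppr_eq0 oner_eq0.
have [] := @L1_affine w (-1) y n0 lw; rewrite normrN1 expr1n mul1r => l ->.
have e (x : E) : -1 *: x + y = y - x by rewrite scaleN1r addrC.
by split; [under [X in L1 mu X]eq_fun do rewrite -e|under eq_Rintegral do rewrite -e].
Qed.

Lemma L1_translate w (y : E) : L1 mu w ->
  L1 mu (fun x => w (x + y)) /\ \int[mu]_x w (x + y) = \int[mu]_x w x.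
Proof.
move=> lw; have [] := @L1_affine w 1 y (oner_neq0 _) lw.
rewrite normr1 expr1n mul1r.
by rewrite (_ : (fun x : E => w (1 *: x + y)) = (fun x => w (x + y))) => [l ->//|];
  apply/funext => x; rewrite scale1r.
Qed.

Lemma measurable_sub_prod w : measurable_fun setT w ->
  measurable_fun setT (fun z : E * E => w (z.2 - z.1)).
Proof.
move=> mw; apply: (measurableT_comp mw); apply: measurable_fun_rVP => i.
rewrite (_ : (fun x => _) = (fun z : E * E => rV_coord i z.2 - rV_coord i z.1)); last first.
  by apply/funext => x; rewrite !mxE.
by apply: measurable_funB; apply: (measurableT_comp (measurable_rV_coord i)).
Qed.

Variables (p w : E -> R) (B : R).
Hypotheses (lp : L1 mu p) (lw : L1 mu w) (wB : forall x, `|w x| <= B).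

Let f (z : E * E) := p z.2 * w (z.2 - z.1).

Lemma L1_conv_slice1 x : L1 mu (fun y => f (x, y)).
Proof.
apply: (L1_le (g := fun y => B * `|p y|)).
- apply: measurable_funM; first exact: L1_measurable lp.
  have [l _] := @L1_translate w (- x) lw; exact: L1_measurable l.
- exact: L1Z (L1_norm lp).
- by move=> y; rewrite /f/= normrM mulrC ler_wpM2r.
Qed.

Lemma L1_conv_slice2 y : L1 mu (fun x => f (x, y)).
Proof. have [l _] := L1_reflect y lw; exact: (L1Z (p y) l). Qed.

Lemma L1_conv_prod : L1 (mu \x mu)%E f.
Proof.
have mf : measurable_fun setT f.
  apply: measurable_funM; last exact: measurable_sub_prod (L1_measurable lw).
  exact: (measurableT_comp (L1_measurable lp)).
apply/integrable21ltyP; first exact/measurable_EFinP.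
under eq_integral => y _.
  rewrite (_ : (\int[mu]_x _)%E = (`|p y| * \int[mu]_x `|w x|)%:E).
    over.
  rewrite -(L1_reflect y (L1_norm lw)).2 -RintegralZl//; last first.
    exact: (L1_reflect y (L1_norm lw)).1.
  rewrite /Rintegral fineK; last first.
    apply: integrable_fin_num => //; apply: L1Z; exact: (L1_reflect y (L1_norm lw)).1.
  by apply: eq_integral => x _; rewrite /f/= normrM.
have : L1 mu (fun y => `|p y| * \int[mu]_x `|w x|).
  by under [X in L1 mu X]eq_fun do rewrite mulrC; exact: L1Z (L1_norm lp).
move=> /integrableP[_]; apply: le_lt_trans; apply: ge0_le_integral => //.
- by move=> y _; rewrite lee_fin mulr_ge0// Rintegral_ge0.
- apply/measurable_EFinP; apply: measurable_funM => //.
  exact: (L1_measurable (L1_norm lp)).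
- apply: measurableT_comp => //; apply/measurable_EFinP; apply: measurable_funM => //.
  exact: (L1_measurable (L1_norm lp)).
- by move=> x _; rewrite lee_fin ler_norm.
Qed.

Lemma L1_conv : L1 mu (fun x => \int[mu]_y (p y * w (y - x))).
Proof. exact: L1_fubini1 L1_conv_prod L1_conv_slice1. Qed.

Variables (g : E -> R) (M : R).
Hypotheses (mg : measurable_fun setT g) (gM : {ae mu, forall x, `|g x| <= M}).

(* Truncating [g] makes every slice integrable, not only almost every one. *)
Let g' x := if `|g x| <= M then g x else 0.

Let mg' : measurable_fun setT g'.
Proof.
apply: measurable_fun_ifT => //.
by apply: measurable_fun_ler => //; exact: measurableT_comp.
Qed.

Let g'M x : `|g' x| <= `|M|.
Proof. by rewrite /g'; case: ifP => [/le_trans|_]; [apply; exact: ler_norm|rewrite normr0]. Qed.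

Let gg' : {ae mu, forall x, g x = g' x}.
Proof. by apply: filterS gM => x; rewrite /g' => ->. Qed.

(** An essential bound on [g] suffices, because the double integral of [p y
    * w (y - x)] converges absolutely. *)
Lemma conv_fubini :
  L1 mu (fun y => p y * \int[mu]_x (g x * w (y - x))) /\
  \int[mu]_x (g x * \int[mu]_y (p y * w (y - x))) =
  \int[mu]_y (p y * \int[mu]_x (g x * w (y - x))).
Proof.
pose F (z : E * E) := g' z.1 * f z.
have mF : measurable_fun setT F.
  apply: measurable_funM; first exact: (measurableT_comp mg').
  exact: L1_measurable L1_conv_prod.
have FM z : `|F z| <= `|M| * `|f z| by rewrite normrM ler_wpM2r.
have lF : L1 (mu \x mu)%E F.
  by apply: (L1_le mF) FM; exact: L1Z (L1_norm L1_conv_prod).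
have F1 x : L1 mu (fun y => F (x, y)) by exact: (L1Z (g' x) (L1_conv_slice1 x)).
have mFs y : measurable_fun setT (fun x => F (x, y)).
  by apply: measurable_funM => //; exact: L1_measurable (L1_conv_slice2 y).
have F2 y : L1 mu (fun x => F (x, y)).
  by apply: (L1_le (mFs y)) => [|x]; [exact: (L1Z `|M| (L1_norm (L1_conv_slice2 y)))|exact: FM].
have e1 : \int[mu]_x (g x * \int[mu]_y (p y * w (y - x))) = \int[mu]_x \int[mu]_y F (x, y).
  transitivity (\int[mu]_x (g' x * \int[mu]_y (p y * w (y - x)))).
    apply: ae_eq_Rintegral.
    - by apply: measurable_funM => //; exact: L1_measurable L1_conv.
    - by apply: measurable_funM => //; exact: L1_measurable L1_conv.
    - by apply: filterS gg' => x ->.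
  apply: eq_Rintegral => x _; rewrite -RintegralZl//; exact: L1_conv_slice1.
have mw (y : E) : measurable_fun setT (fun x : E => w (y - x)).
  by have [l _] := L1_reflect y lw; exact: L1_measurable l.
have e2 (y : E) : p y * \int[mu]_x (g x * w (y - x)) = \int[mu]_x F (x, y).
  have -> : \int[mu]_x (g x * w (y - x)) = \int[mu]_x (g' x * w (y - x)).
    apply: ae_eq_Rintegral; [exact: measurable_funM|exact: measurable_funM|].
    by apply: filterS gg' => x ->.
  rewrite -RintegralZl//; first by apply: eq_Rintegral => x _; rewrite /F /f/= mulrCA.
  apply: (L1_le (g := fun x : E => `|M| * `|w (y - x)|)); first exact: measurable_funM.
  - by apply: L1Z; apply: L1_norm; have [] := L1_reflect y lw.
  - by move=> x; rewrite normrM ler_wpM2r.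
split; first by under [X in L1 mu X]eq_fun do rewrite e2; exact: L1_fubini2 lF F2.
by rewrite e1 -(Rfubini1 lF F1) (Rfubini2 lF F2); apply: eq_Rintegral => y _; rewrite e2.
Qed.

(** After the exchange of integrals the inner one is a pairing of [g] with a
    translate of [w]. *)
Lemma conv_bound (e : R) : (forall y, `|\int[mu]_x (g x * w (y - x))| <= e) ->
  `|\int[mu]_x (g x * \int[mu]_y (p y * w (y - x)))| <= e * \int[mu]_y `|p y|.
Proof.
move=> He; have [l ->] := conv_fubini.
rewrite -RintegralZl//; last exact: L1_norm.
apply: Rintegral_ae_le; [exact: L1_measurable l|exact: L1Z (L1_norm lp)|].
by apply: aeW => y; rewrite normrM mulrC ler_wpM2r.
Qed.

End convolution.
Lemma Rdominated d (T : measurableType d) (R : realType)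
    (mu : {measure set T -> \bar R}) (D : set T) (F : nat -> T -> R) (f g : T -> R) :
  measurable D -> (forall n, measurable_fun D (F n)) -> measurable_fun D f ->
  (forall x, D x -> F ^~ x @ \oo --> f x) ->
  mu.-integrable D (EFin \o g) -> (forall n x, D x -> `|F n x| <= g x) ->
  \int[mu]_(x in D) F n x @[n --> \oo] --> \int[mu]_(x in D) f x.
Proof.
move=> mD mF mf Ff ig Fg.
have H := @dominated_convergence _ _ _ mu D mD (fun n x => (F n x)%:E) (fun x => (f x)%:E)
  (EFin \o g).
have [|||||intf _ cv] := H.
- by move=> n; exact/measurable_EFinP.
- exact/measurable_EFinP.
- by apply: aeW => x Dx; apply/fine_cvgP; split; [exact: nearW|exact: Ff].
- exact: ig.
- by apply: aeW => x n Dx; rewrite lee_fin; exact: Fg.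
rewrite /Rintegral; apply: fine_cvg.
by rewrite fineK; [exact: cv|exact: integrable_fin_num].
Qed.

(** * Measures with a density *)

Section density.
Context d (T : measurableType d) (R : realType).
Variables (mu : {measure set T -> \bar R}) (G : T -> R).
Hypotheses (mG : measurable_fun setT G) (G0 : forall x, 0 <= G x).

(** Used to compare integrals over boxes through uniqueness of measures. *)
Definition density A := (\int[mu]_(x in A) (G x)%:E)%E.

Let density0 : density set0 = 0%E.
Proof. exact: integral_set0. Qed.

Let density_ge0 A : (0 <= density A)%E.
Proof. by apply: integral_ge0 => x _; rewrite lee_fin. Qed.

Let density_sigma_additive : semi_sigma_additive density.
Proof.
by apply: semi_sigma_additive_nng_induced => [|x]; [exact/measurable_EFinP|rewrite lee_fin].
Qed.

Definition density_measure : {measure set T -> \bar R} :=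
  HB.pack density (isMeasure.Build _ _ _ density density0 density_ge0 density_sigma_additive).

End density.

(** * Functions with zero integrals on boxes *)

Section null_functions.
Context {R : realType} {n : nat}.
Local Notation E := 'rV[R]_n.
Local Notation mu := (@lebesgue_rV R n).
Implicit Types g : E -> R.

Lemma obox_finite (a b : 'I_n -> R) : (mu (obox a b) < +oo)%E.
Proof. by have H := @obox_measure R n a b; rewrite [X in (X < _)%E]H ltry. Qed.

Lemma integrable_obox g (M : R) (a b : 'I_n -> R) : measurable_fun setT g ->
  (forall x, `|g x| <= M) -> mu.-integrable (obox a b) (EFin \o g).
Proof.
move=> mg gM; apply: measurable_bounded_integrable.
- exact: measurable_obox.
- exact: obox_finite.
- exact: measurable_funTS.
- exists M; split; first exact: num_real.
  by move=> x Mx y _; exact: le_trans (gM y) (ltW Mx).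
Qed.

(** The measures of densities [g + M] and [M] agree on boxes, hence
    everywhere. *)
Lemma zero_on_boxes g (M : R) : measurable_fun setT g -> (forall x, `|g x| <= M) ->
  (forall a b, \int[mu]_(x in obox a b) g x = 0) -> {ae mu, forall x, g x = 0}.
Proof.
move=> mg gM g0.
have M0 : 0 <= M by apply: le_trans (gM 0).
pose G x := g x + M.
have mG : measurable_fun setT G by exact: measurable_funD.
have G0 x : 0 <= G x by rewrite /G -lerBlDr sub0r; have := gM x; rewrite ler_norml => /andP[].
pose m1 := density_measure mu mG G0.
pose m2 := density_measure mu (measurable_cst M) (fun=> M0).
have MM (x : E) : `|M| <= M by rewrite ger0_norm.
have iM a b := @integrable_obox (fun=> M) M a b (measurable_cst M) MM.
have ig a b := @integrable_obox g M a b mg gM.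
have e A : measurable A -> m1 A = m2 A.
  apply: rV_measure_unique => a b.
    rewrite -[LHS]/(\int[mu]_(x in obox a b) (G x)%:E)%E.
    rewrite -[RHS]/(\int[mu]_(x in obox a b) M%:E)%E.
    have mo := @measurable_obox R n a b.
    rewrite /G; under eq_integral do rewrite EFinD.
    rewrite (integralD mo (ig a b) (iM a b)).
    have gi : (\int[mu]_(x in obox a b) (g x)%:E = 0)%E.
      by rewrite -[LHS]fineK; [congr EFin; exact: g0|exact: integrable_fin_num (ig a b)].
    by rewrite [X in (X + _)%E]gi add0e.
  rewrite -[X in (X < _)%E]/(\int[mu]_(x in obox a b) (G x)%:E)%E.
  apply: integrable_lty; first exact: measurable_obox.
  apply: (@integrable_obox G (M + M)) => // x.
  by rewrite (le_trans (ler_normD _ _))// lerD// ger0_norm.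
have ae k : {ae mu, forall x, obox (fun=> - k%:R) (fun=> k%:R) x -> g x = 0}.
  have mo := @measurable_obox R n (fun=> - k%:R) (fun=> k%:R).
  have : ae_eq mu (obox (fun=> - k%:R) (fun=> k%:R)) (EFin \o G) (EFin \o (fun=> M)).
    apply: integral_ae_eq => //.
    - apply: (@integrable_obox G (M + M)) => // x.
      by rewrite (le_trans (ler_normD _ _))// lerD// ger0_norm.
    - by apply/measurable_EFinP; exact: measurable_cst.
    - by move=> A _ mA; exact: e.
  by apply: filterS => x H /H [] /eqP; rewrite /G -subr_eq0 addrK => /eqP.
have := ae_foralln ae; apply: filterS => x H.
have : [set: E] x by [].
by rewrite -obox_cover => -[k _]; exact: H.
Qed.

End null_functions.
(** * Smooth approximation of boxes *)

Section weak_constancy.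
Context {R : realType} {d : nat}.
Local Notation E := 'rV[R]_d.
Local Notation mu := (@lebesgue_rV R d).
Variables (chi : E -> R) (j0 : 'I_d).
Hypothesis Hchi : cutoff chi.

(** Half of the profile of the one-dimensional cutoff, reversed. *)
Definition sstep (s : R) : R := if s < 2 then cut1 chi j0 (2 - s) else 1.

Lemma sstep0 s : s <= 0 -> sstep s = 0.
Proof.
move=> s0; rewrite /sstep (le_lt_trans s0)// cut1_zero//.
by rewrite ger0_norm; rewrite ?lerDl ?oppr_ge0// subr_ge0 (le_trans s0).
Qed.

Lemma sstep1 s : 1 <= s -> sstep s = 1.
Proof.
move=> s1; rewrite /sstep; case: ifPn => // s2; apply: cut1_one => //.
by rewrite ger0_norm ?subr_ge0 ?(ltW s2)//; lra.
Qed.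

Lemma sstep_01 s : 0 <= sstep s <= 1.
Proof.
rewrite /sstep; case: ifP => _; last by rewrite ler01 lexx.
by rewrite cut1_ge0// cut1_le1.
Qed.

Lemma smooth_sstep : smooth sstep.
Proof.
apply: smooth_near => s; have [s2|s2] := ltP s 2.
  exists (fun r => cut1 chi j0 (2 - r)).
    apply: (smooth_comp_affine (V := R) (W := R) (L := fun r => 2 - r) (L0 := fun r => - r))
      (smooth_cut1 j0 Hchi).
      by move=> h y w; rewrite /GRing.scale/=; ring.
    exact: (@contB _ _ (fun=> 2) id (@contC _ _ 2) (fun x => cvg_id)).
  near=> r; rewrite /sstep ifT//.
  by near: r; exact: lt_nbhsl.
exists (fun=> 1); first exact: smooth_cst.
near=> r; apply: sstep1; apply: ltW; near: r; apply: lt_nbhsr.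
by apply: lt_le_trans s2; rewrite ltr1n.
Unshelve. all: by end_near. Qed.

Definition boxstep (k : nat) (a b : 'I_d -> R) (x : E) : R :=
  \prod_(i < d) (sstep (k%:R * (x 0 i - a i)) * sstep (k%:R * (b i - x 0 i))).

Lemma smooth_boxstep k a b : smooth (boxstep k a b).
Proof.
have ci i := @continuous_rV_coord R d i.
have S1 i : smooth (fun x : E => sstep (k%:R * (x 0 i - a i))).
  apply: (smooth_comp_affine (W := R) (L := fun x : E => k%:R * (x 0 i - a i))
    (L0 := fun x : E => k%:R * x 0 i)) smooth_sstep.
    by move=> h y w; rewrite !mxE /GRing.scale/=; ring.
  exact: (@contM _ _ _ _ (@contC _ _ k%:R) (@contB _ _ _ _ (ci i) (@contC _ _ (a i)))).
have S2 i : smooth (fun x : E => sstep (k%:R * (b i - x 0 i))).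
  apply: (smooth_comp_affine (W := R) (L := fun x : E => k%:R * (b i - x 0 i))
    (L0 := fun x : E => - (k%:R * x 0 i))) smooth_sstep.
    by move=> h y w; rewrite !mxE /GRing.scale/=; ring.
  exact: (@contM _ _ _ _ (@contC _ _ k%:R) (@contB _ _ _ _ (@contC _ _ (b i)) (ci i))).
exact: (@smooth_prod _ _ _ _ _ (fun i (x : E) =>
  sstep (k%:R * (x 0 i - a i)) * sstep (k%:R * (b i - x 0 i)))
  (fun i => smoothM (S1 i) (S2 i))).
Qed.

Lemma boxstep_01 k a b x : 0 <= boxstep k a b x <= 1.
Proof.
apply: (big_ind (fun r : R => 0 <= r <= 1)); first by rewrite ler01 lexx.
  by move=> u v /andP[u0 u1] /andP[v0 v1]; rewrite mulr_ge0//= mulr_ile1.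
move=> i _; have /andP[u0 u1] := sstep_01 (k%:R * (x 0 i - a i)).
have /andP[v0 v1] := sstep_01 (k%:R * (b i - x 0 i)).
by rewrite mulr_ge0//= mulr_ile1.
Qed.

Lemma boxstep_out k a b x : ~ obox a b x -> boxstep k a b x = 0.
Proof.
move=> H; have [i Hi] : exists i, ~~ (a i < x 0 i < b i).
  by move: H => /existsNP[i /negP Hi]; exists i.
rewrite negb_and -!leNgt in Hi; rewrite /boxstep (bigD1 i)//=.
have k0 : 0 <= k%:R :> R by [].
case/orP: Hi => Hi; last first.
  by rewrite [X in _ * X * _]sstep0 ?mulr0 ?mul0r// mulr_ge0_le0// subr_le0.
by rewrite [X in X * _ * _]sstep0 ?mul0r// mulr_ge0_le0// subr_le0.
Qed.

Lemma bsupp_boxstep k a b : bsupp (boxstep k a b).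
Proof.
pose A := \sum_i (`|a i| + `|b i|).
exists A => x Ax; apply: boxstep_out => H.
have A0 : 0 <= A by apply: sumr_ge0 => i _; rewrite addr_ge0.
have : `|x| <= A.
  apply/rV_norm_le => // i; rewrite /A (bigD1 i)//=.
  apply: (@le_trans _ _ (`|a i| + `|b i|)); last first.
    by rewrite lerDl sumr_ge0// => k' _; rewrite addr_ge0.
  have /andP[H1 H2] := H i; rewrite ler_norml.
  have := ler_norm (b i); have := ler_norm (- a i); rewrite normrN.
  have := normr_ge0 (a i); have := normr_ge0 (b i) => *; apply/andP; split; lra.
by rewrite leNgt Ax.
Qed.

Lemma boxstep_cvg a b x : boxstep k a b x @[k --> \oo] --> (\1_(obox a b) x : R).
Proof.
have [H|H] := asboolP (obox a b x); last first.
  rewrite indicE memNset//=; apply: cvg_near_cst; apply: nearW => k.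
  exact: boxstep_out.
rewrite indicE mem_set//=; apply: cvg_near_cst.
pose S := \sum_i ((x 0 i - a i)^-1 + (b i - x 0 i)^-1).
have pos i : 0 < x 0 i - a i /\ 0 < b i - x 0 i.
  by have /andP[? ?] := H i; rewrite !subr_gt0.
near=> k; rewrite /boxstep big1// => i _.
have kS : S <= k%:R by near: k; exact: nbhs_infty_ger.
have [p1 p2] := pos i.
have : (x 0 i - a i)^-1 + (b i - x 0 i)^-1 <= k%:R.
  apply: le_trans kS; rewrite /S (bigD1 i)//= lerDl sumr_ge0// => j _.
  by have [q1 q2] := pos j; rewrite addr_ge0// invr_ge0 ltW.
have i1 : 0 < (x 0 i - a i)^-1 by rewrite invr_gt0.
have i2 : 0 < (b i - x 0 i)^-1 by rewrite invr_gt0.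
move=> Hk; rewrite !sstep1 ?mulr1//.
  by rewrite -ler_pdivrMr// div1r; lra.
by rewrite -ler_pdivrMr// div1r; lra.
Unshelve. all: by end_near. Qed.

(** Indicators of boxes are limits of smooth functions, and boxes are enough
    by uniqueness of measures. *)
Lemma weak_zero (g : E -> R) (M : R) : measurable_fun setT g ->
  {ae mu, forall x, `|g x| <= M} ->
  (forall z : E -> R, smooth z -> bsupp z -> \int[mu]_x (g x * z x) = 0) ->
  {ae mu, forall x, g x = 0}.
Proof.
move=> mg gM g0.
pose g' x := if `|g x| <= M then g x else 0.
have gg' : {ae mu, forall x, g x = g' x} by apply: filterS gM => x; rewrite /g' => ->.
have mg' : measurable_fun setT g'.
  apply: measurable_fun_ifT => //.
  by apply: measurable_fun_ler => //; exact: measurableT_comp.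
have g'M x : `|g' x| <= `|M|.
  by rewrite /g'; case: ifP => [/le_trans|_]; [apply; exact: ler_norm|rewrite normr0].
suff : {ae mu, forall x, g' x = 0} by apply: filterS2 gg' => x ->.
apply: (zero_on_boxes mg' g'M) => a b.
have mo := @measurable_obox R d a b.
have MM (x : E) : `|(`|M|)| <= `|M| by rewrite normr_id.
have cv : \int[mu]_(x in obox a b) (g' x * boxstep k a b x) @[k --> \oo] -->
    \int[mu]_(x in obox a b) (g' x * \1_(obox a b) x).
  apply: (@Rdominated _ _ _ mu (obox a b) _ _ (fun=> `|M|)) => //.
  - move=> k; apply: measurable_funTS; apply: measurable_funM => //.
    by apply: continuous_measurable_rV; apply: smooth_continuous; exact: smooth_boxstep.
  - by apply: measurable_funTS; apply: measurable_funM.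
  - by move=> x _; apply: cvgM; [exact: cvg_cst|exact: boxstep_cvg].
  - exact: (@integrable_obox R d (fun=> `|M|) `|M| a b (measurable_cst _)
      MM).
  - move=> k x _; have /andP[h0 h1] := boxstep_01 k a b x.
    by rewrite normrM (ger0_norm h0) -[leRHS]mulr1 ler_pM.
have e : \int[mu]_(x in obox a b) g' x = \int[mu]_(x in obox a b) (g' x * \1_(obox a b) x).
  by apply: eq_Rintegral => x xo; rewrite indicE xo mulr1.
rewrite e; apply: (cvg_unique _ cv) => //.
apply: cvg_near_cst; apply: nearW => k.
rewrite Rintegral_mkcond.
have sz := smooth_boxstep k a b.
rewrite -(g0 _ sz (bsupp_boxstep k a b)).
have mb : measurable_fun setT (boxstep k a b).
  by apply: continuous_measurable_rV; exact: smooth_continuous.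
transitivity (\int[mu]_x (g' x * boxstep k a b x)).
  apply: eq_Rintegral => x _; rewrite patchE; case: ifPn => // /negP xo.
  by rewrite boxstep_out ?mulr0// => H; apply: xo; rewrite inE.
apply: ae_eq_Rintegral; [exact: measurable_funM|exact: measurable_funM|].
by apply: filterS gg' => x ->.
Qed.

End weak_constancy.
(** * Derivatives and translations *)

Section shift_invariance.
Context {R : realType} {V : normedModType R}.
Implicit Types (phi : V -> R) (e : V).

Lemma bsupp_lineint phi e (b : R) : 0 <= b -> bsupp phi -> bsupp (lineint phi e 0 b).
Proof.
move=> b0 [A pA]; exists (A + b * `|e|) => z Az.
rewrite /lineint (_ : \int[_]_(r in _) _ = \int[lebesgue_measure]_(r in `[0, b]) 0).
  by rewrite Rintegral_cst// mul0r.
apply: eq_Rintegral => r; rewrite inE/= in_itv/= => /andP[r0 rb]; apply: pA.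
have : `|z| <= `|z + r *: e| + b * `|e|.
  rewrite -{1}(addrK (r *: e) z) (le_trans (ler_normB _ _))// lerD2l normrZ.
  by rewrite ler_wpM2r// ger0_norm.
lra.
Qed.

(** The fundamental theorem along [e]: a difference of translates is a
    derivative. *)
Lemma derive_lineint_shift phi e (b : R) z : 0 < b -> smooth phi ->
  'D_e (lineint phi e 0 b) z = phi (z + b *: e) - phi z.
Proof.
move=> b0 sp; have b0' := ltW b0.
apply: (eq_trans (lineint_derive e z e b0' sp)).
apply: (eq_trans (FTC_line e z b0 sp)).
by rewrite scale0r addr0.
Qed.

Variables (I : finType) (e : I -> V) (C : (V -> R) -> Prop) (A : (V -> R) -> R).
Hypothesis Cshift : forall phi i b, C phi -> C (fun z => phi (z + b *: e i)).
Hypothesis Apos : forall phi i b, 0 < b -> C phi -> A (fun z => phi (z + b *: e i)) = A phi.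

(** Negative shifts are inverse to positive ones, and a combination is
    reached one direction at a time. *)
Lemma shift_invariant phi (y : I -> R) : C phi ->
  C (fun z => phi (z + \sum_i y i *: e i)) /\
  A (fun z => phi (z + \sum_i y i *: e i)) = A phi.
Proof.
have A1 psi i b : C psi -> A (fun z => psi (z + b *: e i)) = A psi.
  move=> Cpsi; have [b0|b0|<-] := ltgtP 0 b; first exact: Apos.
    have nb : 0 < - b by rewrite oppr_gt0.
    rewrite -(Apos i nb (Cshift i b Cpsi)); congr A; apply/funext => z.
    by rewrite -addrA scaleNr addNr addr0.
  by congr A; apply/funext => z; rewrite scale0r addr0.
elim: (index_enum I) phi => [|i s IH] phi Cp.
  have -> : (fun z => phi (z + \sum_(i <- [::]) y i *: e i)) = phi.
    by apply/funext => z; rewrite big_nil addr0.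
  by [].
have e1 : (fun z => phi (z + \sum_(j <- i :: s) y j *: e j)) =
          (fun z => (fun z => phi (z + y i *: e i)) (z + \sum_(j <- s) y j *: e j)).
  by apply/funext => z; rewrite big_cons/= -addrA [X in _ + X]addrC.
have [C1 E1] := IH (fun z => phi (z + y i *: e i)) (Cshift i (y i) Cp).
by rewrite e1; split => //; rewrite E1 A1.
Qed.

End shift_invariance.

Lemma Rintegral_mul_const d (T : measurableType d) (R : realType)
    (mu : {measure set T -> \bar R}) (f h : T -> R) (c : R) :
  L1 mu f -> (forall y, h y = c) -> \int[mu]_y (f y * h y) = \int[mu]_y f y * c.
Proof. by move=> lf hc; rewrite -RintegralZr//; apply: eq_Rintegral => y _; rewrite hc. Qed.

(** * Bounded functions with zero gradient *)

Section weak_constant.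
Context {R : realType} {d : nat}.
Local Notation E := 'rV[R]_d.
Local Notation mu := (@lebesgue_rV R d).
Variables (chi : E -> R) (j0 : 'I_d).
Hypothesis Hchi : cutoff chi.

Lemma Rintegral_ge_cube (f : E -> R) (r m : R) : 0 <= r -> L1 mu f ->
  (forall x, 0 <= f x) -> (forall x, `|x| <= r -> m <= f x) ->
  m * (2 * r) ^+ d <= \int[mu]_x f x.
Proof.
move=> r0 lf f0 f1; pose Q := [set x : E | `|x - 0| <= r].
have mQ : measurable Q by exact: measurable_cube.
have HQ : mu Q = ((2 * r) ^+ d)%:E by exact: cube_measure.
have HQ' : (mu Q < +oo)%E by rewrite [X in (X < _)%E]HQ ltry.
have iQ : mu.-integrable Q (EFin \o f) by exact: integrableS lf.
apply: (@le_trans _ _ (\int[mu]_(x in Q) f x)).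
  have <- : \int[mu]_(x in Q) m = m * (2 * r) ^+ d.
    by rewrite Rintegral_cst//; congr (_ * _); rewrite -[RHS]/(fine ((2 * r) ^+ d)%:E) -HQ.
  apply: le_Rintegral => //.
    apply: measurable_bounded_integrable => //.
    exists `|m|; split; first exact: num_real.
    by move=> x mx y _; exact: ltW.
  by move=> x; rewrite /Q/= subr0; exact: f1.
rewrite /Rintegral fine_le//.
- exact: integrable_fin_num.
- exact: integrable_fin_num.
- apply: ge0_subset_integral => //; first by have /integrableP[] := lf.
  by move=> x _; rewrite lee_fin.
Qed.

Lemma bsupp_chi : bsupp chi.
Proof.
exists 2 => x x2; apply: (cutoff0 Hchi); apply: (le_trans (ltW x2)).
exact: norm_le_enorm.
Qed.

Lemma L1_smooth_bsupp (z : E -> R) : smooth z -> bsupp z -> L1 mu z.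
Proof. by move=> sz bz; apply: L1_bsupp => //; exact: smooth_continuous. Qed.

Lemma chi_even x : chi (- x) = chi x.
Proof. by apply: (cutoff_radial Hchi); rewrite -scaleN1r enormZ normrN1 mul1r. Qed.

Lemma Rintegral_chi_gt0 : 0 < \int[mu]_x chi x.
Proof.
have d0 : 0 < d%:R :> R by rewrite ltr0n; exact: leq_trans (ltn_ord j0).
have di : 0 <= d%:R^-1 :> R by rewrite invr_ge0.
have lc := L1_smooth_bsupp (cutoff_smooth Hchi) bsupp_chi.
have := @Rintegral_ge_cube chi d%:R^-1 1 di lc (cutoff_ge0 j0 Hchi) => H.
apply: lt_le_trans (H _); first by rewrite mul1r exprn_gt0// mulr_gt0// invr_gt0.
- move=> x xr; rewrite -(scale1r x) (chiZ_one j0 Hchi)// mul1r.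
  by rewrite -ler_pdivlMl// mulr1.
Qed.

(** The difference of two translates of [z] along an axis is a derivative of
    a test function. *)
Lemma weak_translation (g : E -> R) (M : R) : measurable_fun setT g ->
  {ae mu, forall x, `|g x| <= M} ->
  (forall (z : E -> R) j, smooth z -> bsupp z ->
     \int[mu]_x (g x * 'D_(unit_vec j) z x) = 0) ->
  forall z : E -> R, smooth z -> bsupp z -> forall y : E,
    \int[mu]_x (g x * z (x + y)) = \int[mu]_x (g x * z x).
Proof.
move=> mg gM g0 z sz bz y.
pose C (z : E -> R) := smooth z /\ bsupp z.
pose A (z : E -> R) := \int[mu]_x (g x * z x).
have Cs (phi : E -> R) (j : 'I_d) (b : R) : C phi -> C (fun x => phi (x + b *: unit_vec j)).
  move=> [sp [B pB]]; split.
    apply: (smooth_comp_affine (L := fun x => x + b *: unit_vec j) (L0 := id)) sp.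
      by move=> h u w; rewrite addrA.
    by apply: (@lipschitz_continuous _ _ _ _ 1) => u w; rewrite mul1r opprD addrACA subrr addr0.
  exists (B + `|b *: (unit_vec j : E)|) => x xB; apply: pB.
  have : `|x| <= `|x + b *: unit_vec j| + `|b *: (unit_vec j : E)|.
    by rewrite -{1}(addrK (b *: unit_vec j) x) ler_normB.
  lra.
have Ap (phi : E -> R) (j : 'I_d) (b : R) : 0 < b -> C phi ->
    A (fun x => phi (x + b *: unit_vec j)) = A phi.
  move=> b0 Cp; have [sp bp] := Cp; have [ss bs] := Cs phi j b Cp.
  have sl := smooth_lineint (unit_vec j) (ltW b0) sp.
  have bl := bsupp_lineint (unit_vec j) (ltW b0) bp.
  have [l1 _] := L1_pair mg gM (L1_smooth_bsupp ss bs).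
  have [l2 _] := L1_pair mg gM (L1_smooth_bsupp sp bp).
  apply/eqP; rewrite -subr_eq0 /A -RintegralB//; apply/eqP.
  rewrite -(g0 _ j sl bl); apply: eq_Rintegral => x _.
  by rewrite -mulrBr; apply: (congr1 (fun r => g x * r));
    exact: (esym (derive_lineint_shift (unit_vec j) x b0 sp)).
have [_ ] := @shift_invariant R _ _ (fun j : 'I_d => unit_vec j : E) C A Cs Ap z (fun j => y 0 j)
  (conj sz bz).
by rewrite /A => <-; apply: eq_Rintegral => x _; rewrite -row_sum_delta.
Qed.

(** By translation invariance, averaging the translates of a test function
    [z] against [chi] shows that the integral of [g z] is a constant
    multiple of that of [z]. *)
Lemma weak_constant (g : E -> R) (M : R) : measurable_fun setT g ->
  {ae mu, forall x, `|g x| <= M} ->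
  (forall (z : E -> R) j, smooth z -> bsupp z ->
     \int[mu]_x (g x * 'D_(unit_vec j) z x) = 0) ->
  exists c : R, {ae mu, forall x, g x = c}.
Proof.
move=> mg gM g0.
have inv := weak_translation mg gM g0.
have lchi := L1_smooth_bsupp (cutoff_smooth Hchi) bsupp_chi.
have chi1 x : `|chi x| <= 1.
  by rewrite ger0_norm ?(cutoff_le1 j0 Hchi)// (cutoff_ge0 j0 Hchi).
have I0 := Rintegral_chi_gt0.
pose c := \int[mu]_x (g x * chi x) / \int[mu]_x chi x; exists c.
have key z : smooth z -> bsupp z ->
    (\int[mu]_x (g x * z x)) * (\int[mu]_x chi x) =
    (\int[mu]_x z x) * (\int[mu]_x (g x * chi x)).
  move=> sz bz; have lz := L1_smooth_bsupp sz bz.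
  have [B B0 zB] := bsupp_bounded (@heine_borel_rV R d) (smooth_continuous sz) bz.
  have [_ e1] := conv_fubini lz lchi chi1 mg gM.
  have [lz' _] := L1_reflect 0 lz.
  have {}lz' : L1 mu (fun x => z (- x)) by under [X in L1 mu X]eq_fun do rewrite -sub0r.
  have [_ e2] := conv_fubini lchi lz' (fun x => zB (- x)) mg gM.
  have e3 (x : E) : \int[mu]_y (z y * chi (y - x)) = \int[mu]_y (chi y * z (- (y - x))).
    have lzc : L1 mu (fun y => z y * chi (y - x)) by exact: (L1_conv_slice1 lz lchi chi1 x).
    rewrite -(L1_reflect x lzc).2; apply: eq_Rintegral => y _.
    by rewrite opprB mulrC addrAC subrr add0r chi_even.
  have {}e1 : \int[mu]_x (g x * \int[mu]_y (chi y * z (- (y - x)))) =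
      (\int[mu]_x z x) * (\int[mu]_x (g x * chi x)).
    transitivity (\int[mu]_x (g x * \int[mu]_y (z y * chi (y - x)))).
      by apply: eq_Rintegral => x _; rewrite e3.
    have i1 (y : E) : \int[mu]_x (g x * chi (y - x)) = \int[mu]_x (g x * chi x).
      rewrite -(inv chi (cutoff_smooth Hchi) bsupp_chi (- y)).
      by apply: eq_Rintegral => x _; rewrite -chi_even opprB.
    exact: (eq_trans e1 (Rintegral_mul_const lz i1)).
  have i2 (y : E) : \int[mu]_x (g x * z (- (y - x))) = \int[mu]_x (g x * z x).
    rewrite -(inv z sz bz (- y)).
    by apply: eq_Rintegral => x _; rewrite opprB.
  by rewrite -e1 mulrC; exact: esym (eq_trans e2 (Rintegral_mul_const lchi i2)).
have gcM : {ae mu, forall x, `|g x - c| <= M + `|c|}.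
  by apply: filterS gM => x gx; rewrite (le_trans (ler_normB _ _))// lerD2r.
suff : {ae mu, forall x, g x - c = 0} by apply: filterS => x /eqP; rewrite subr_eq0 => /eqP.
apply: (weak_zero j0 Hchi (M := M + `|c|)) => //; first exact: measurable_funB.
move=> z sz bz; have lz := L1_smooth_bsupp sz bz.
have [l1 _] := L1_pair mg gM lz.
under eq_Rintegral do rewrite mulrBl.
rewrite RintegralB//; last exact: L1Z.
rewrite RintegralZl//; apply/eqP; rewrite subr_eq0 /c mulrAC.
apply/eqP; have n0 : \int[mu]_x chi x != 0 by rewrite gt_eqF.
by apply: (mulIf n0); rewrite (key z sz bz) divfK// mulrC.
Qed.

End weak_constant.

(** * The scalar product *)

Section dot_product.
Context {R : realType} {d : nat}.
Local Notation E := 'rV[R]_d.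

Lemma dotDr (x y z : E) : dot x (y + z) = dot x y + dot x z.
Proof. by rewrite /dot -big_split/=; apply: eq_bigr => i _; rewrite mxE mulrDr. Qed.

Lemma dotC (x y : E) : dot x y = dot y x.
Proof. by apply: eq_bigr => i _; rewrite mulrC. Qed.

Lemma dotZr (x y : E) (s : R) : dot x (s *: y) = s * dot x y.
Proof. by rewrite /dot mulr_sumr; apply: eq_bigr => i _; rewrite mxE mulrCA. Qed.

Lemma dotNr (x y : E) : dot x (- y) = - dot x y.
Proof. by rewrite -scaleN1r dotZr mulN1r. Qed.

Lemma dotBr (x y z : E) : dot x (y - z) = dot x y - dot x z.
Proof. by rewrite dotDr dotNr. Qed.

Lemma dot_unit (x : E) j : dot x (unit_vec j) = x 0 j.
Proof.
rewrite /dot (bigD1 j)//= big1 ?addr0.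
  by rewrite !mxE !eqxx mulr1.
by move=> i ij; rewrite !mxE /= (negbTE ij) mulr0.
Qed.

Lemma continuous_dotr (x : E) : continuous (fun y => dot x y).
Proof.
apply: continuous_sumR => i.
exact: (@contM _ _ _ _ (@contC _ _ (x 0 i)) (@continuous_rV_coord R d i)).
Qed.

Lemma dot_le (x y : E) : `|dot x y| <= `|x| * \sum_i `|y 0 i|.
Proof.
rewrite mulr_sumr; apply: le_trans (ler_norm_sum _ _ _) _; apply: ler_sum => i _.
by rewrite normrM ler_wpM2r// le_rV_coord.
Qed.

End dot_product.

(** * Phase-shifted cosines *)

Section trigonometric.
Context {R : realType}.

(** A phase [th] treats sines and cosines together: a shift by [pi / 2]
    corresponds to a derivative. *)
Definition cosp (th s : R) : R := cos (s + th).

Lemma is_derive_dir (f : R -> R) (s v a : R) : is_derive s (1 : R) f a ->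
  is_derive s v f (v * a).
Proof.
move=> [df <-]; have fd : differentiable f s by exact/derivable1_diffP.
apply: DeriveDef; first exact: diff_derivable.
rewrite !deriveE// -[v in LHS]mulr1 -[v * 1]/(v *: (1 : R)) linearZ.
by [].
Qed.

Lemma is_derive_cosp th s : is_derive s (1 : R) (cosp th) (cosp (th + pi / 2) s).
Proof.
apply: DeriveDef.
  apply: (@derivable_comp_affine _ _ _ (fun s => s + th) id cos s 1); last exact: derivable_cos.
  by move=> h y w; rewrite addrA.
rewrite /cosp (@derive_comp_affine _ _ _ (fun s => s + th) id); last first.
  by move=> h y w; rewrite addrA.
by rewrite derive_val addrA cosDpihalf.
Qed.

Lemma smooth_cosp th : smooth (cosp th).
Proof.
apply: (@smooth_coind _ _ (fun f => exists c th, f = fun s => c * cosp th s));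
  last by exists 1, th; apply/funext => s; rewrite mul1r.
- move=> _ [c [t ->]].
  have cc : continuous (cosp t).
    move=> s; apply: (@continuous_comp _ _ _ (fun s : R => s + t) cos); last exact: continuous_cos.
    by apply: cvgD; [exact: cvg_id|exact: cvg_cst].
  exact: (@contM _ _ _ _ (@contC _ _ c) cc).
- move=> _ v [c [t ->]].
  have D s : is_derive s v (fun s => c * cosp t s) (v * c * cosp (t + pi / 2) s).
    rewrite -mulrA; apply: is_derive_dir.
    exact: is_derive1Z (is_derive_cosp t s).
  split; first by move=> s; have [] := D s.
  exists (v * c), (t + pi / 2); apply/funext => s; by have [_] := D s.
Qed.

End trigonometric.
(** * Trigonometric integrals and their decay *)

Section trigonometric_integrals.
Context {R : realType} {d : nat}.
Local Notation E := 'rV[R]_d.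
Local Notation mu := (@lebesgue_rV R d).
Implicit Types (a : E -> R) (th : R) (x v : E).

(** The cosine transform with phase [th]; real and imaginary parts of a
    Fourier transform are obtained for [th = 0] and [th = pi / 2] up to
    sign. *)
Definition trig a th x : R := \int[mu]_xi (cosp th (dot x xi) * a xi).

Lemma cosp_le1 th (s : R) : `|cosp th s| <= 1.
Proof. exact: cos_max. Qed.

Lemma continuous_cosp_dot th x : continuous (fun xi : E => cosp th (dot x xi)).
Proof.
move=> xi; apply: (@continuous_comp _ _ _ (fun xi : E => dot x xi) (cosp th)).
  exact: continuous_dotr.
exact: (smooth_continuous (smooth_cosp th)).
Qed.

Lemma L1_trig a th x : L1 mu a -> L1 mu (fun xi => cosp th (dot x xi) * a xi).
Proof.
move=> la; apply: (L1_le _ (L1_norm la)) => [|xi].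
  apply: measurable_funM; last exact: L1_measurable la.
  exact: continuous_measurable_rV (@continuous_cosp_dot th x).
by rewrite normrM ler_piMl// cosp_le1.
Qed.

Lemma trig_bound a th x : L1 mu a -> `|trig a th x| <= \int[mu]_xi `|a xi|.
Proof.
move=> la; apply: Rintegral_ae_le.
- exact: L1_measurable (L1_trig th x la).
- exact: L1_norm.
- by apply: aeW => xi; rewrite normrM ler_piMl// cosp_le1.
Qed.

(** Continuous functions of bounded support, the frequency densities for
    which all integrals converge. *)
Definition cbs a := continuous a /\ bsupp a.

Lemma cbs_L1 a : cbs a -> L1 mu a.
Proof. by move=> [ca ba]; exact: L1_bsupp. Qed.

Lemma cbs_mul (b a : E -> R) : continuous b -> cbs a -> cbs (fun xi => b xi * a xi).
Proof. by move=> cb [ca ba]; split; [exact: (@contM _ _ _ _ cb ca)|exact: bsuppMr]. Qed.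

Lemma cosp_lip th (s r : R) : `|cosp th s - cosp th r| <= `|s - r|.
Proof.
have sc := smooth_cosp th.
have [c _ e] := @MVT_line R R (cosp th) r 1 (s - r) (fun y => smooth_derivable sc).
have -> : cosp th s = cosp th (r + (s - r) *: 1).
  by rewrite /GRing.scale/= mulr1 addrC subrK.
rewrite e normrM ler_piMr//; have [_ ->] := is_derive_cosp th (r + c *: 1).
exact: cosp_le1.
Qed.

Lemma cbs_sum_norm a : cbs a -> L1 mu (fun xi : E => (\sum_i `|xi 0 i|) * a xi).
Proof.
move=> ca; apply: cbs_L1; apply: cbs_mul => //; apply: continuous_sumR => i x.
have c := @continuous_rV_coord R d i x; exact: (cvg_norm c).
Qed.

Lemma trig_continuous a th : cbs a -> continuous (trig a th).
Proof.
move=> ca; have la := cbs_L1 ca.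
have l2 := L1_norm (cbs_sum_norm ca).
apply: (@lipschitz_continuous _ _ R^o _ (\int[mu]_xi `|(\sum_i `|xi 0 i|) * a xi|)) => x y.
rewrite /trig -RintegralB//; [|exact: L1_trig|exact: L1_trig].
rewrite mulrC -RintegralZl//; apply: Rintegral_ae_le.
- by apply: L1_measurable; apply: L1B; exact: L1_trig.
- exact: (L1Z `|x - y| l2).
- apply: aeW => xi; rewrite -mulrBl normrM [`|_ * a xi|]normrM mulrA ler_wpM2r//.
  apply: le_trans (cosp_lip _ _ _) _; rewrite !(dotC _ xi) -dotBr dotC.
  apply: le_trans (dot_le _ _) _; rewrite ler_wpM2l// ler_norm.
  by [].
Qed.

Lemma trig_is_derive a th x v : cbs a ->
  is_derive x v (trig a th) (trig (fun xi => dot v xi * a xi) (th + pi / 2) x).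
Proof.
move=> ca; have la := cbs_L1 ca.
have cd := cbs_mul (@continuous_dotr R d v) ca.
pose f (s : R) (xi : E) := cosp th (dot (x + s *: v) xi) * a xi.
have df s xi : is_derive s (1 : R) (f ^~ xi)
    (cosp (th + pi / 2) (dot (x + s *: v) xi) * (dot v xi * a xi)).
  have D : is_derive s (1 : R) (fun s => cosp th (dot x xi + s * dot v xi))
      (dot v xi * cosp (th + pi / 2) (dot x xi + s * dot v xi)).
    have [D1 E1] := is_derive_cosp th (dot x xi + s * dot v xi).
    have L h (y w : R) : dot x xi + (h *: w + y) * dot v xi =
        h *: (w * dot v xi) + (dot x xi + y * dot v xi).
      by rewrite /GRing.scale/=; ring.
    have [D2 E2] := is_derive_dir (dot v xi) (is_derive_cosp th (dot x xi + s * dot v xi)).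
    apply: DeriveDef.
      by apply: (derivable_comp_affine L); rewrite mul1r.
    by rewrite (derive_comp_affine _ _ _ L) mul1r.
  have -> : (f ^~ xi) = (fun s => a xi * cosp th (dot x xi + s * dot v xi)).
    apply/funext => r; rewrite /f mulrC dotC dotDr dotZr.
    by rewrite ![dot xi _]dotC.
  rewrite (_ : _ * (_ * _) = a xi * (dot v xi * cosp (th + pi / 2) (dot x xi + s * dot v xi))).
    exact: is_derive1Z D.
  rewrite [dot (x + _) xi]dotC dotDr dotZr ![dot xi _]dotC; ring.
have I0 : `](-1 : R), 1[%classic (0 : R) by rewrite /= in_itv/= ltrN10 ltr01.
have lf s : L1 mu (f s) by exact: L1_trig.
have D1E s xi : derive1 (f ^~ xi) s = cosp (th + pi / 2) (dot (x + s *: v) xi) * (dot v xi * a xi).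
  by rewrite derive1E; have [_ ->] := df s xi.
have H := @cvg_differentiation_under_integral R _ E mu f setT measurableT 0 (-1) 1 I0
  (fun s _ => lf s) (fun s xi _ _ => @ex_derive _ _ _ _ _ _ _ (df s xi))
  (fun xi => `|dot v xi * a xi|) (fun xi => normr_ge0 _) (L1_norm (cbs_L1 cd)).
have Hb (s : R) (xi : E) : `](-1 : R), 1[%classic s -> setT xi ->
    `|derive1 (f ^~ xi) s| <= `|dot v xi * a xi|.
  by move=> _ _; rewrite D1E normrM ler_piMl// cosp_le1.
have {H Hb}H := H Hb.
have e : \int[mu]_(y in setT) derive1 (f ^~ y) 0 =
    trig (fun xi => dot v xi * a xi) (th + pi / 2) x.
  by apply: eq_Rintegral => xi _; rewrite D1E scale0r addr0.
have e2 : (fun h : R => h^-1 *: (\int[mu]_(y in setT) f (h + 0) y - \int[mu]_(y in setT) f 0 y)) =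
    (fun h : R => h^-1 *: (trig a th (h *: v + x) - trig a th x)).
  apply/funext => h; apply: (congr1 (fun r => h^-1 *: r)); apply: f_equal2.
    by rewrite addr0 /f addrC.
  by rewrite /f scale0r addr0.
have cv : (fun h : R => h^-1 *: (trig a th (h *: v + x) - trig a th x)) @ 0^' -->
    trig (fun xi => dot v xi * a xi) (th + pi / 2) x.
  by rewrite -e -e2; exact: H.
apply: DeriveDef.
  by apply/cvg_ex; exists (trig (fun xi => dot v xi * a xi) (th + pi / 2) x).
exact: cvg_lim cv.
Qed.

Lemma smooth_trig a th : cbs a -> smooth (trig a th).
Proof.
move=> ca; apply: (@smooth_coind _ _ (fun f => exists a th, cbs a /\ f = trig a th));
  last by exists a, th.
  by move=> _ [b [t [cb ->]]]; exact: trig_continuous.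
move=> _ v [b [t [cb ->]]]; split; first by move=> x; have [] := trig_is_derive t x v cb.
exists (fun xi => dot v xi * b xi), (t + pi / 2); split.
  exact: (cbs_mul (@continuous_dotr R d v) cb).
by apply/funext => x; have [_] := trig_is_derive t x v cb.
Qed.

Lemma trig_derive a th x v : cbs a ->
  'D_v (trig a th) x = trig (fun xi => dot v xi * a xi) (th + pi / 2) x.
Proof. by move=> ca; have [_] := trig_is_derive th x v ca. Qed.

Lemma smooth_cosp_dot th x : smooth (fun xi : E => cosp th (dot x xi)).
Proof.
apply: (smooth_comp_affine (W := R) (L := fun xi => dot x xi) (L0 := fun xi => dot x xi))
  (smooth_cosp th); first by move=> h y w; rewrite dotDr dotZr.
exact: continuous_dotr.
Qed.

Lemma derive_cosp_dot th x (xi : E) j :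
  'D_(unit_vec j) (fun xi : E => cosp th (dot x xi)) xi =
  x 0 j * cosp (th + pi / 2) (dot x xi).
Proof.
have L h (y w : E) : dot x (h *: w + y) = h *: dot x w + dot x y by rewrite dotDr dotZr.
apply: (eq_trans (derive_comp_affine (cosp th) xi (unit_vec j) L)).
rewrite dot_unit; by have [_] := is_derive_dir (x 0 j) (is_derive_cosp th (dot x xi)).
Qed.

Lemma trig_ibp a th x j : smooth a -> bsupp a ->
  x 0 j * trig a (th + pi / 2) x = - trig (fun xi => 'D_(unit_vec j) a xi) th x.
Proof.
move=> sa ba; have ca := smooth_continuous sa.
have la := L1_bsupp ca ba; have sc := smooth_cosp_dot th x.
have lda : L1 mu (fun xi => 'D_(unit_vec j) a xi).
  apply: L1_bsupp; [exact: smooth_continuous (smooth_derive _ sa)|exact: bsupp_derive].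
have H := Rintegral_derive0 j (smoothM sc sa) (bsuppMr _ ba).
have e (xi : E) : 'D_(unit_vec j) (fun xi => cosp th (dot x xi) * a xi) xi =
    cosp th (dot x xi) * 'D_(unit_vec j) a xi +
    x 0 j * (cosp (th + pi / 2) (dot x xi) * a xi).
  apply: (eq_trans (congr1 (fun F => F xi) (deriveMf (unit_vec j) sc sa))).
  apply: (f_equal2 (fun r s : R => r + s)); first by [].
  apply: (eq_trans (congr1 (fun r => a xi * r) (derive_cosp_dot th x xi j))); ring.
have {H} : \int[mu]_xi (cosp th (dot x xi) * 'D_(unit_vec j) a xi +
    x 0 j * (cosp (th + pi / 2) (dot x xi) * a xi)) = 0.
  by apply: (eq_trans _ H); apply: eq_Rintegral => xi _; exact: esym (e xi).
have l1 := L1_trig th x lda; have l2 := L1_trig (th + pi / 2) x la.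
rewrite RintegralD//; last exact: (L1Z (x 0 j) l2).
rewrite RintegralZl// => /eqP; rewrite addrC addr_eq0 => /eqP; exact.
Qed.

Lemma trig_antiperiodic a th x : L1 mu a -> trig a (th - pi / 2 - pi / 2) x = - trig a th x.
Proof.
move=> la; rewrite -RintegralN; last exact: L1_trig.
apply: eq_Rintegral => xi _; rewrite /cosp -[RHS]mulNr; congr (_ * _).
rewrite (_ : _ + (_ - _ - _) = dot x xi + th - pi); last by lra.
by rewrite cosB cospi sinpi mulr0 addr0 mulrN1.
Qed.

Lemma trig_ibp2 a th x j : smooth a -> bsupp a ->
  (1 + x 0 j ^+ 2) * trig a th x =
  trig (fun xi => a xi - 'D_(unit_vec j) (fun xi => 'D_(unit_vec j) a xi) xi) th x.
Proof.
move=> sa ba; have sd := smooth_derive (unit_vec j) sa.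
have bd := bsupp_derive (unit_vec j) ba.
have sdd := smooth_derive (unit_vec j) sd; have bdd := bsupp_derive (unit_vec j) bd.
have e1 := trig_ibp (th - pi / 2) x j sa ba.
have e2 := trig_ibp (th - pi / 2 - pi / 2) x j sd bd.
rewrite !subrK in e1 e2.
have e3 : trig (fun xi => 'D_(unit_vec j) (fun xi => 'D_(unit_vec j) a xi) xi)
    (th - pi / 2 - pi / 2) x =
    - trig (fun xi => 'D_(unit_vec j) (fun xi => 'D_(unit_vec j) a xi) xi) th x.
  by apply: trig_antiperiodic; apply: L1_bsupp => //; exact: smooth_continuous.
have -> : trig (fun xi => a xi - 'D_(unit_vec j) (fun xi => 'D_(unit_vec j) a xi) xi) th x =
    trig a th x - trig (fun xi => 'D_(unit_vec j) (fun xi => 'D_(unit_vec j) a xi) xi) th x.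
  rewrite /trig -RintegralB//; last 2 first.
  - by apply: L1_trig; apply: L1_bsupp => //; exact: smooth_continuous.
  - by apply: L1_trig; apply: L1_bsupp => //; exact: smooth_continuous.
  by apply: eq_Rintegral => xi _; rewrite mulrBr.
rewrite mulrDl mul1r expr2 -mulrA e1 mulrN e2 e3 opprK.
by [].
Qed.

(** Each factor [1 + x_j^2] is absorbed by two integrations by parts in the
    frequency variable [j]. *)
Lemma trig_decay (s : seq 'I_d) a th : smooth a -> bsupp a -> exists2 C : R, 0 <= C &
  forall x, (\prod_(j <- s) (1 + x 0 j ^+ 2)) * `|trig a th x| <= C.
Proof.
elim: s a => [|j s IH] a sa ba.
  exists (\int[mu]_xi `|a xi|); first exact: Rintegral_ge0.
  move=> x; rewrite big_nil mul1r; apply: trig_bound; apply: L1_bsupp => //.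
  exact: smooth_continuous.
pose b xi := a xi - 'D_(unit_vec j) (fun xi => 'D_(unit_vec j) a xi) xi.
have sb : smooth b.
  exact: (smoothB sa (smooth_derive (unit_vec j) (smooth_derive (unit_vec j) sa))).
have bb : bsupp b.
  have [A pA] := ba; have [B pB] := bsupp_derive (unit_vec j) (bsupp_derive (unit_vec j) ba).
  exists (Num.max A B) => z; rewrite gt_max => /andP[Az Bz].
  by rewrite /b pA// (pB z Bz) subrr.
have [C C0 H] := IH b sb bb.
exists C => // x; rewrite big_cons.
apply: le_trans (H x); rewrite -mulrA mulrCA ler_wpM2l//.
  by apply: prodr_ge0 => k _; rewrite addr_ge0// sqr_ge0.
rewrite -(trig_ibp2 th x j sa ba) normrM ger0_norm//.
by rewrite addr_ge0// sqr_ge0.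
Qed.

End trigonometric_integrals.
(** * An integrable polynomial weight *)

Section weight.
Context {R : realType}.
Local Notation leb := (@lebesgue_measure R).

Lemma L1_prod d1 d2 (T1 : measurableType d1) (T2 : measurableType d2)
    (m1 : {sigma_finite_measure set T1 -> \bar R})
    (m2 : {sigma_finite_measure set T2 -> \bar R}) (f : T1 -> R) (g : T2 -> R) :
  L1 m1 f -> L1 m2 g -> L1 (m1 \x m2)%E (fun z => f z.1 * g z.2).
Proof.
move=> lf lg.
have mfg : measurable_fun setT (fun z : T1 * T2 => f z.1 * g z.2).
  apply: measurable_funM; first exact: (measurableT_comp (L1_measurable lf)).
  exact: (measurableT_comp (L1_measurable lg)).
apply/integrable12ltyP; first exact/measurable_EFinP.
have I0 : 0 <= \int[m2]_y `|g y| by exact: Rintegral_ge0.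
have H := L1Z (\int[m2]_y `|g y|) (L1_norm lf).
under eq_integral => x _.
  rewrite (_ : (\int[m2]_y _)%E = ((\int[m2]_y `|g y|) * `|f x|)%:E).
    over.
  rewrite mulrC -RintegralZl//; last exact: L1_norm.
  rewrite /Rintegral fineK; last first.
    by apply: integrable_fin_num => //; exact: (L1Z `|f x| (L1_norm lg)).
  by apply: eq_integral => y _; rewrite /= normrM.
have := H => /integrableP[_]; apply: le_lt_trans; apply: ge0_le_integral => //.
- by move=> x _; rewrite lee_fin mulr_ge0.
- by apply/measurable_EFinP; exact: L1_measurable H.
- by apply: measurableT_comp => //; apply/measurable_EFinP; exact: L1_measurable H.
- by move=> x _; rewrite lee_fin ler_norm.
Qed.

Lemma L1_oneDsqr : L1 leb (fun s : R => (1 + s ^+ 2)^-1).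
Proof.
have m : measurable_fun setT (fun s : R => (1 + s ^+ 2)^-1).
  by apply: measurable_realfun.continuous_measurable_fun => s; exact: continuous_oneDsqrV.
apply/integrableP; split; first exact/measurable_EFinP.
have n0 (s : R) : 0 <= (1 + s ^+ 2)^-1 by rewrite invr_ge0 addr_ge0// sqr_ge0.
under eq_integral do rewrite /= ger0_norm//.
rewrite ge0_symfun_integralT//; first last.
- by move=> s /=; rewrite sqrrN.
- by move=> s; exact: continuous_oneDsqrV.
rewrite (_ : [set x | _] = `[0, +oo[%classic); last first.
  by apply/seteqP; split => x/=; rewrite in_itv/= andbT.
by rewrite integral0y_oneDsqr -EFinM ltry.
Qed.

(** A polynomial weight whose inverse is integrable, variable by variable. *)
Definition poly_weight n (x : 'rV[R]_n) : R := \prod_i (1 + x 0 i ^+ 2).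

Lemma poly_weight_ge1 n (s : seq 'I_n) (x : 'rV[R]_n) (P : pred 'I_n) :
  1 <= \prod_(i <- s | P i) (1 + x 0 i ^+ 2).
Proof.
elim/big_ind : _ => // [a b a1 b1|i _]; last by rewrite lerDl sqr_ge0.
by rewrite (le_trans a1)// ler_peMr// (le_trans ler01).
Qed.

Lemma norm_le_poly_weight n (x : 'rV[R]_n) : `|x| <= poly_weight x.
Proof.
have w1 := poly_weight_ge1 (index_enum 'I_n) x predT.
apply/rV_norm_le; first exact: le_trans w1.
move=> i; rewrite /poly_weight (bigD1 i)//=.
apply: (@le_trans _ _ (1 + x 0 i ^+ 2)).
  rewrite -(@real_normK _ (x 0 i)) ?num_real//; have := normr_ge0 (x 0 i); nra.
by rewrite ler_peMr ?poly_weight_ge1// addr_ge0// sqr_ge0.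
Qed.

Lemma continuous_poly_weightV n : continuous (fun x : 'rV[R]_n => (poly_weight x)^-1).
Proof.
have c : continuous (@poly_weight n).
  rewrite /poly_weight; elim: (index_enum 'I_n) => [|i s IH].
    by under eq_fun do rewrite big_nil; exact: contC.
  under eq_fun do rewrite big_cons.
  have ci := @continuous_rV_coord R n i.
  apply: (@contM _ _ _ _ _ IH); apply: (@contD _ _ _ _ (@contC _ _ 1)).
  exact: (@contM _ _ _ _ ci ci).
move=> x; have n0 : poly_weight x != 0.
  by rewrite gt_eqF// (lt_le_trans ltr01)// poly_weight_ge1.
exact: (@continuousV _ _ _ _ n0 (c x)).
Qed.

Lemma L1_poly_weightV n : L1 (@lebesgue_rV R n) (fun x => (poly_weight x)^-1).
Proof.
elim: n => [|n IH].
  have m := continuous_measurable_rV (@continuous_poly_weightV 0).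
  have [] // := @L1_bounded_on _ _ R (@lebesgue_rV R 0) setT 1 _ measurableT _ m.
  - by rewrite /= diracT ltry.
  - by move=> x; rewrite /poly_weight big_ord0 invr1 normr1.
  - by move=> x /(_ I).
have m := continuous_measurable_rV (@continuous_poly_weightV n.+1).
apply: (@Rintegral_cons R n _ m _).1.
have := L1_prod L1_oneDsqr IH.
apply: eq_integrable => // p _ /=; congr EFin.
rewrite /poly_weight big_ord_recl rV_cons0 invfM; congr (_ * _).
by congr (_^-1); apply: eq_bigr => i _; rewrite rV_consS.
Qed.

End weight.
(** * Integrable trigonometric integrals *)

Section oscillatory.
Context {R : realType} {d : nat}.
Local Notation E := 'rV[R]_d.
Local Notation mu := (@lebesgue_rV R d).
Implicit Types (a p : E -> R) (th l : R) (x y z xi : E).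

(** Applied twice per variable, the decay leaves one weight for the factor
    [|x|] and one for integrability. *)
Lemma trig_L1 a th : smooth a -> bsupp a ->
  L1 mu (trig a th) /\ L1 mu (fun x => `|x| * trig a th x).
Proof.
move=> sa ba; have ca : cbs a by split => //; exact: smooth_continuous.
have ct : continuous (trig a th) by exact: trig_continuous.
have [C C0 H] := trig_decay (index_enum 'I_d ++ index_enum 'I_d) th sa ba.
have lw := L1Z C (@L1_poly_weightV R d).
have {}H x : poly_weight x * (poly_weight x * `|trig a th x|) <= C.
  by have := H x; rewrite big_cat/= mulrA.
have w1 x : 1 <= poly_weight x by exact: poly_weight_ge1.
have w0 x : 0 < poly_weight x by exact: lt_le_trans ltr01 (w1 x).
have mt : measurable_fun setT (trig a th) by exact: continuous_measurable_rV.
have mn : measurable_fun setT (fun x : E => `|x|).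
  by apply: continuous_measurable_rV; exact: norm_continuous.
split; apply: (L1_le _ lw) => //.
- move=> x; rewrite ler_pdivlMr//; apply: le_trans (H x).
  by rewrite mulrC ler_wpM2l ?(ltW (w0 x))// ler_peMl.
- exact: measurable_funM.
- move=> x; rewrite ler_pdivlMr//; apply: le_trans (H x).
  rewrite mulrC ler_wpM2l ?(ltW (w0 x))// normrM normr_id ler_wpM2r//.
  exact: norm_le_poly_weight.
Qed.

(** Dilating the density dilates its transform in the inverse way. *)
Lemma trig_scale a th l z : 0 < l -> L1 mu a ->
  trig (fun xi => a (l *: xi)) th z = (l ^+ d)^-1 * trig a th (l^-1 *: z).
Proof.
move=> l0 la; have l1 := lt0r_neq0 l0.
have [_ ] := L1_affine 0 l1 (L1_trig th (l^-1 *: z) la).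
rewrite -/(trig a th (l^-1 *: z)) => ->.
rewrite gtr0_norm// mulrA mulVf ?mul1r; last by rewrite expf_neq0.
apply: eq_Rintegral => xi _; rewrite addr0; congr (cosp th _ * _).
by rewrite dotZr [dot (_ *: z) xi]dotC dotZr mulrA mulfV// mul1r dotC.
Qed.

Lemma trig_scale_norm a th l : 0 < l -> smooth a -> bsupp a ->
  \int[mu]_x `|trig (fun xi => a (l *: xi)) th x| = \int[mu]_x `|trig a th x|.
Proof.
move=> l0 sa ba; have [lt _] := trig_L1 th sa ba; have li : l^-1 != 0 by rewrite invr_eq0 gt_eqF.
have la := L1_bsupp (smooth_continuous sa) ba.
have [l2 ->] := L1_affine 0 li (L1_norm lt).
rewrite -RintegralZl//; apply: eq_Rintegral => x _.
rewrite addr0 trig_scale// normrM normfV [`|l ^+ d|]ger0_norm ?exprn_ge0 ?(ltW l0)//.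
by rewrite normfV (gtr0_norm l0) exprVn.
Qed.

Lemma trig_scale_int a th l : 0 < l -> smooth a -> bsupp a ->
  \int[mu]_x trig (fun xi => a (l *: xi)) th x = \int[mu]_x trig a th x.
Proof.
move=> l0 sa ba; have [lt _] := trig_L1 th sa ba; have li : l^-1 != 0 by rewrite invr_eq0 gt_eqF.
have la := L1_bsupp (smooth_continuous sa) ba.
have [l2 ->] := L1_affine 0 li lt.
rewrite -RintegralZl//; apply: eq_Rintegral => x _.
by rewrite addr0 trig_scale// normfV (gtr0_norm l0) exprVn.
Qed.

Lemma measurable_dot_prod x :
  measurable_fun setT (fun z : E * E => dot (z.2 - x) z.1).
Proof.
rewrite /dot; apply: measurable_sum => i; apply: measurable_funM.
  rewrite (_ : (fun u => _) = (fun u : E * E => rV_coord i u.2 - x 0 i)); last first.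
    by apply/funext => u; rewrite !mxE.
  apply: measurable_funB => //.
  exact: (measurableT_comp (measurable_rV_coord i) measurable_snd).
exact: (measurableT_comp (measurable_rV_coord i) measurable_fst).
Qed.

Lemma trig_fubini_L1 a p th x : L1 mu a -> L1 mu p ->
  L1 mu (fun xi => a xi * \int[mu]_y (p y * cosp th (dot (y - x) xi))) /\
  \int[mu]_xi (a xi * \int[mu]_y (p y * cosp th (dot (y - x) xi))) =
  \int[mu]_y (p y * trig a th (y - x)).
Proof.
move=> la lp.
have mc : measurable_fun setT (cosp th : R -> R).
  by apply: measurable_realfun.continuous_measurable_fun; exact: (smooth_continuous (smooth_cosp th)).
pose F (z : E * E) := (a z.1 * p z.2) * cosp th (dot (z.2 - x) z.1).
have lap := L1_prod la lp.
have mF : measurable_fun setT F.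
  apply: measurable_funM; first exact: L1_measurable lap.
  exact: (measurableT_comp mc (measurable_dot_prod x)).
have FM (z : E * E) : `|F z| <= `|a z.1 * p z.2|.
  by rewrite normrM ler_piMr// cosp_le1.
have lF : L1 (mu \x mu)%E F := L1_le mF (L1_norm lap) FM.
have l1 xi : L1 mu (fun y => p y * cosp th (dot (y - x) xi)).
  apply: (L1_le _ (L1_norm lp)) => [|y]; last by rewrite normrM ler_piMr// cosp_le1.
  apply: measurable_funM; first exact: L1_measurable lp.
  apply: (measurableT_comp mc); apply: continuous_measurable_rV.
  rewrite (_ : (fun y => _) = (fun y => dot xi y - dot xi x)); last first.
    by apply/funext => y; rewrite dotC dotBr.
  exact: (@contB _ _ _ _ (@continuous_dotr R d xi) (@contC _ _ (dot xi x))).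
have F1 xi : L1 mu (fun y => F (xi, y)).
  have := L1Z (a xi) (l1 xi); apply: eq_integrable => // y _ /=.
  by rewrite /F/= mulrA.
have F2 y : L1 mu (fun xi => F (xi, y)).
  have := L1Z (p y) (L1_trig th (y - x) la); apply: eq_integrable => // xi _ /=.
  by rewrite /F/=; congr EFin; ring.
have e xi : a xi * \int[mu]_y (p y * cosp th (dot (y - x) xi)) = \int[mu]_y F (xi, y).
  by rewrite -RintegralZl//; apply: eq_Rintegral => y _; rewrite /F/= mulrA.
split.
  have := L1_fubini1 lF F1; apply: eq_integrable => // xi _ /=.
  exact: (congr1 EFin (esym (e xi))).
transitivity (\int[mu]_xi \int[mu]_y F (xi, y)); first by apply: eq_Rintegral => xi _.
rewrite -(Rfubini1 lF F1) (Rfubini2 lF F2); apply: eq_Rintegral => y _.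
rewrite /trig -RintegralZl//; last exact: L1_trig.
by apply: eq_Rintegral => xi _; rewrite /F/=; ring.
Qed.

Lemma trig_fubini a p th x : L1 mu a -> L1 mu p ->
  \int[mu]_xi (a xi * \int[mu]_y (p y * cosp th (dot (y - x) xi))) =
  \int[mu]_y (p y * trig a th (y - x)).
Proof. by move=> la lp; have [] := trig_fubini_L1 th x la lp. Qed.

Lemma trig_even a x : L1 mu a -> (forall xi, a (- xi) = a xi) -> trig a (pi / 2) x = 0.
Proof.
move=> la ae; have lt := L1_trig (pi / 2) x la.
have [_ E1] := L1_reflect 0 lt.
have E2 : \int[mu]_xi (cosp (pi / 2) (dot x (0 - xi)) * a (0 - xi)) = - trig a (pi / 2) x.
  rewrite /trig -RintegralN//; apply: eq_Rintegral => xi _.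
  by rewrite sub0r ae dotNr /cosp !cosDpihalf sinN mulNr.
move: E1; rewrite E2 -/(trig a (pi / 2) x) => /eqP.
by rewrite -subr_eq0 -opprD oppr_eq0 -mulr2n mulrn_eq0 => /eqP.
Qed.

End oscillatory.

(** * The mass of the low-frequency kernel *)

Section kernel.
Context {R : realType} {d : nat}.
Local Notation E := 'rV[R]_d.
Local Notation mu := (@lebesgue_rV R d).
Variables (chi : E -> R) (j0 : 'I_d).
Hypothesis Hchi : cutoff chi.
Implicit Types (l : R) (x y z xi : E).

Let chis := cutoff_smooth Hchi.
Let chib := bsupp_chi Hchi.
Let chil l xi := chi (l *: xi).

Lemma bsupp_chil l : 0 < l -> bsupp (chil l).
Proof. by move=> l0; exists (2 / l) => x; exact: chiZ_supp. Qed.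

(** Lipschitz, so that small translations change it little, and even, so that its transform is real. *)
Let tent x : R := Num.max 0 (1 - `|x|).

Let tent_lip x y : `|tent x - tent y| <= `|x - y|.
Proof.
apply: le_trans (ler_dist_dist x y); rewrite /tent.
have := ler_norm (`|x| - `|y|); have := ler_norm (`|y| - `|x|); rewrite (distrC (`|y|)).
rewrite ler_norml; have := normr_ge0 (`|x| - `|y|).
case: (ltP 0 (1 - `|x|)) => ?; case: (ltP 0 (1 - `|y|)) => ? *; apply/andP; split; lra.
Qed.

Let tent_cbs : cbs tent.
Proof.
split.
  apply: (@lipschitz_continuous _ _ R^o _ 1) => x y; rewrite mul1r.
  exact: tent_lip.
exists 1 => x x1; rewrite /tent max_l// subr_le0 ltW//.
Qed.

Let H := trig tent 0.

Let tent_fourier x xi : \int[mu]_y (tent y * cosp 0 (dot (y - x) xi)) = cosp 0 (dot x xi) * H xi.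
Proof.
have lt := cbs_L1 tent_cbs.
have e0 : trig tent (pi / 2) xi = 0.
  by apply: trig_even => // y; rewrite /tent normrN.
have -> : cosp 0 (dot x xi) * H xi =
    cosp 0 (dot x xi) * H xi - sin (dot x xi) * trig tent (pi / 2) xi.
  by rewrite e0 mulr0 subr0.
rewrite /H /trig -!RintegralZl//; [|exact: L1_trig|exact: L1_trig].
rewrite -RintegralB//; [|by apply: L1Z; exact: L1_trig|by apply: L1Z; exact: L1_trig].
apply: eq_Rintegral => y _.
rewrite (dotC _ xi) dotBr (dotC x xi) /cosp !addr0 cosB cosDpihalf; ring.
Qed.

(** The quadratic form of the kernel on the tent, read on the frequency side. *)
Let energy l : 0 < l ->
  \int[mu]_x (tent x * \int[mu]_y (tent y * trig (chil l) 0 (y - x))) =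
  \int[mu]_xi (chil l xi * (H xi * H xi)).
Proof.
move=> l0; have lt := cbs_L1 tent_cbs.
have sc := smooth_chiZ Hchi l; have bc := bsupp_chil l0.
have lc := L1_bsupp (smooth_continuous sc) bc.
have lcH : L1 mu (fun xi => H xi * chil l xi).
  apply: cbs_L1; apply: cbs_mul; first exact: trig_continuous.
  by split => //; exact: smooth_continuous.
transitivity (\int[mu]_x (tent x * trig (fun xi => H xi * chil l xi) 0 (x - 0))).
  apply: eq_Rintegral => x _; congr (_ * _); rewrite -trig_fubini// subr0.
  by apply: eq_Rintegral => xi _; rewrite tent_fourier; ring.
rewrite -trig_fubini//; apply: eq_Rintegral => xi _.
have := tent_fourier 0 xi => ->.
have -> : dot (0 : E) xi = 0 by rewrite /dot big1// => i _; rewrite mxE mul0r.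
by rewrite /cosp addr0 cos0; ring.
Qed.

(** For [l <= 1] the cutoff at scale [l] is 1 on a fixed neighbourhood of 0, where the transform of the tent is bounded below. *)
Let energy_gt0 : exists2 m : R, 0 < m & forall l, 0 < l <= 1 ->
  m <= \int[mu]_xi (chil l xi * (H xi * H xi)).
Proof.
have cH : continuous H by exact: trig_continuous.
have d0 : 0 < d%:R :> R by rewrite ltr0n; exact: leq_trans (ltn_ord j0).
have HH : 0 < H 0.
  have lt := cbs_L1 tent_cbs.
  have -> : H 0 = \int[mu]_x tent x.
    apply: eq_Rintegral => x _; rewrite /cosp addr0.
    have -> : dot (0 : E) x = 0 by rewrite /dot big1// => i _; rewrite mxE mul0r.
    by rewrite cos0 mul1r.
  have h2 : 0 <= (2^-1 : R) by rewrite invr_ge0.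
  have t0 x : 0 <= tent x by rewrite /tent le_max lexx.
  have t1 x : `|x| <= 2^-1 -> 2^-1 <= tent x.
    by move=> xh; rewrite /tent le_max; apply/orP; right; lra.
  apply: lt_le_trans (Rintegral_ge_cube h2 lt t0 t1).
  by rewrite mulr_gt0 ?invr_gt0// exprn_gt0// mulr_gt0// invr_gt0.
have H2 : 0 < H 0 / 2 by rewrite divr_gt0.
have [r r0 Hr] : exists2 r : R, 0 < r & forall x, `|x| <= r -> H 0 / 2 <= H x.
  have N : nbhs (0 : E) [set x | ball (H 0) (H 0 / 2) (H x)].
    exact: (cH 0 _ (nbhsx_ballx (H 0) _ H2)).
  have /nbhs_ballP[r /= r0 Hr] := N.
  exists (r / 2); first by rewrite divr_gt0.
  move=> x xr; have : ball (0 : E) r x.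
    rewrite -ball_normE/= sub0r normrN; apply: le_lt_trans xr _.
    by rewrite ltr_pdivrMr// ltr_pMr// ltr1n.
  move=> /Hr; rewrite /= -ball_normE/= ltr_norml => /andP[*]; lra.
pose r' := Num.min r d%:R^-1.
have r'0 : 0 < r' by rewrite /r' lt_min r0 invr_gt0.
exists (H 0 / 2 * (H 0 / 2) * (2 * r') ^+ d).
  by rewrite !mulr_gt0// exprn_gt0// mulr_gt0.
move=> l /andP[l0 l1].
apply: Rintegral_ge_cube; first exact: ltW.
- have -> : (fun xi => chil l xi * (H xi * H xi)) = (fun xi => (H xi * H xi) * chil l xi).
    by apply/funext => xi; rewrite mulrC.
  apply: cbs_L1; apply: cbs_mul; first exact: (@contM _ _ _ _ cH cH).
  by split; [exact: smooth_continuous (smooth_chiZ Hchi l)|exact: bsupp_chil].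
- by move=> xi; rewrite mulr_ge0 ?(cutoff_ge0 j0 Hchi)// -expr2 sqr_ge0.
- move=> x; rewrite /r' le_min => /andP[xr xd].
  have -> : chil l x = 1.
    apply: (chiZ_one j0 Hchi) => //.
    have : d%:R * `|x| <= 1 by rewrite -ler_pdivlMl// mulr1.
    have : 0 <= d%:R * `|x| by rewrite mulr_ge0.
    by nra.
  by rewrite mul1r; apply: ler_pM; rewrite ?(ltW H2)//; exact: Hr.
Qed.

(** If the mass were zero, the kernel would annihilate constants, and its
    dilation by a small factor [l] would send the Lipschitz tent to a
    function of size [O(l)]; but the pairing of that function with the tent
    is the integral of [chi (l xi) H(xi)^2], which is bounded below. *)
Lemma kernel_mass : \int[mu]_x trig chi 0 x != 0.
Proof.
apply/negP => /eqP I0; have [m m0 Hm] := energy_gt0.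
have lt := cbs_L1 tent_cbs; have lc := L1_bsupp (smooth_continuous chis) chib.
have [lk lxk] := trig_L1 0 chis chib.
pose C := (\int[mu]_x tent x) * \int[mu]_z `| `|z| * trig chi 0 z|.
have t0 x : 0 <= tent x by rewrite /tent le_max lexx.
have I1 : 0 <= \int[mu]_z `| `|z| * trig chi 0 z| by exact: Rintegral_ge0.
have C0 : 0 <= C by rewrite mulr_ge0// Rintegral_ge0.
have tl x z l : 0 <= l -> `|tent (x + l *: z) - tent x| <= l * `|z|.
  move=> l0; apply: le_trans (tent_lip _ _) _.
  by rewrite addrAC subrr add0r normrZ (ger0_norm l0).
have inner l x : 0 < l ->
    `|\int[mu]_y (tent y * trig (chil l) 0 (y - x))| <= l * \int[mu]_z `| `|z| * trig chi 0 z|.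
  move=> l0; have ln := lt0r_neq0 l0.
  have [lk' _] := L1_translate (- x) lk.
  have lf : L1 mu (fun y => tent y * trig chi 0 (l^-1 *: (y - x))).
    apply: (L1_le _ (L1Z (\int[mu]_xi `|chi xi|) (L1_norm lt))).
      apply: measurable_funM; first exact: L1_measurable lt.
      rewrite (_ : (fun y => _) = (fun y : E => trig chi 0 (l^-1 *: y + - (l^-1 *: x)))).
        exact: (measurableT_comp (L1_measurable lk) (measurable_affine _ _)).
      by apply/funext => y; rewrite scalerBr.
    by move=> y; rewrite normrM mulrC ler_wpM2r// trig_bound.
  have [lf' e] := L1_affine x ln lf.
  have -> : \int[mu]_y (tent y * trig (chil l) 0 (y - x)) =
     \int[mu]_z (tent (x + l *: z) * trig chi 0 z).
    have -> : \int[mu]_y (tent y * trig (chil l) 0 (y - x)) =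
       (l ^+ d)^-1 * \int[mu]_y (tent y * trig chi 0 (l^-1 *: (y - x))).
      by rewrite -RintegralZl//; apply: eq_Rintegral => y _; rewrite trig_scale//; ring.
    have cancel (r : R) : (l ^+ d)^-1 * (`|l| ^+ d * r) = r.
      by rewrite gtr0_norm// mulrA mulVf ?mul1r// expf_neq0.
    apply: (eq_trans (congr1 (fun r => (l ^+ d)^-1 * r) e)); apply: (eq_trans (cancel _)).
    by apply: eq_Rintegral => z _; rewrite addrK scalerA mulVf// scale1r addrC.
  have l3 : L1 mu (fun z => tent (x + l *: z) * trig chi 0 z).
    move: lf'; apply: eq_integrable => // z _ /=.
    by rewrite addrK scalerA mulVf// scale1r addrC.
  have l4 := L1Z (tent x) lk.
  have -> : \int[mu]_z (tent (x + l *: z) * trig chi 0 z) =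
      \int[mu]_z (tent (x + l *: z) * trig chi 0 z - tent x * trig chi 0 z).
    by rewrite RintegralB// RintegralZl// I0 mulr0 subr0.
  have l5 := L1_norm lxk.
  rewrite -RintegralZl//; apply: Rintegral_ae_le.
  - exact: L1_measurable (L1B l3 l4).
  - exact: (L1Z l l5).
  - apply: aeW => z; rewrite -mulrBl normrM [`|_ * trig _ _ _|]normrM normr_id mulrA.
    by rewrite ler_wpM2r// tl// ltW.
have bound l : 0 < l <= 1 -> m <= l * C.
  move=> l01; have /andP[l0 _] := l01; apply: le_trans (Hm l l01) _.
  rewrite -energy//; apply: le_trans (ler_norm _) _.
  have [ll _] := @trig_L1 R d (chil l) 0 (smooth_chiZ Hchi l) (bsupp_chil l0).
  have lcl := L1_bsupp (smooth_continuous (smooth_chiZ Hchi l)) (bsupp_chil l0).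
  have lconv := L1_conv lt ll (fun x => trig_bound 0 x lcl).
  rewrite /C mulrCA -RintegralZr//; apply: Rintegral_ae_le.
  - by apply: measurable_funM; [exact: L1_measurable lt|exact: L1_measurable lconv].
  - by have := L1Z (l * \int[mu]_z `| `|z| * trig chi 0 z|) lt; apply: eq_integrable => // x _ /=;
      rewrite mulrC.
  - by apply: aeW => x; rewrite normrM ger0_norm// ler_wpM2l// inner.
pose l := Num.min 1 (m / (2 * (C + 1))).
have l0 : 0 < l by rewrite lt_min ltr01 divr_gt0// mulr_gt0// ltr_wpDl.
have := bound l; rewrite l0 ge_min lexx => /(_ isT).
have : l <= m / (2 * (C + 1)) by rewrite /l ge_min lexx orbT.
rewrite ler_pdivlMr; last by rewrite mulr_gt0// ltr_wpDl.
by nra.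
Qed.

End kernel.

(** * Smoothness of linear forms *)

Section smooth_linear.
Context {R : realType} {d : nat}.
Local Notation E := 'rV[R]_d.

Lemma smooth_dotr (x : E) : smooth (fun y => dot x y).
Proof.
have D (x' v y : E) (c : R) : is_derive y v (fun y => dot x' y + c) (dot x' v).
  have L h (z w : E) : dot x' (h *: w + z) = h *: dot x' w + dot x' z by rewrite dotDr dotZr.
  have [D1 E1] := is_derive_dir (dot x' v)
    (is_derive1D (is_derive1_id (dot x' y)) (is_derive1_cst c (dot x' y))).
  apply: DeriveDef; first exact: (derivable_comp_affine L D1).
  by apply: (eq_trans (derive_comp_affine (fun s => s + c) y v L)); rewrite E1 addr0 mulr1.
apply: (@smooth_coind _ _ (fun f => exists x c, f = fun y => dot x y + c)).
- move=> _ [x' [c ->]].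
  exact: (@contD _ _ _ _ (@continuous_dotr R d x') (@contC _ _ c)).
- move=> _ v [x' [c ->]]; split; first by move=> y; have [] := D x' v y c.
  exists 0, (dot x' v); apply/funext => y; have [_ ->] := D x' v y c.
  by rewrite /dot [X in X + _]big1 ?add0r// => i _; rewrite mxE mul0r.
- by exists x, 0; apply/funext => y; rewrite addr0.
Qed.

End smooth_linear.

(** * The multiplier as a convolution *)

Section convolution_kernel.
Context {R : realType} {d : nat}.
Local Notation E := 'rV[R]_d.
Local Notation mu := (@lebesgue_rV R d).
Local Notation C := R[i].
Variables (chi : E -> R) (j0 : 'I_d).
Hypothesis Hchi : cutoff chi.
Implicit Types (l : R) (x y z xi v : E) (p q g : E -> R).

Let chis := cutoff_smooth Hchi.
Let chib := bsupp_chi Hchi.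
Let chil l xi := chi (l *: xi).

Let c0 : R := ((2 * pi) ^+ d)^-1.

Let c0_gt0 : 0 < c0.
Proof. by rewrite invr_gt0 exprn_gt0// mulr_gt0// pi_gt0. Qed.

(** The convolution kernel of the multiplier [chi (l D)]. *)
Definition kernel l z : R := c0 * trig (chil l) 0 z.

Let chil_smooth l : smooth (chil l). Proof. exact: smooth_chiZ. Qed.
Let chil_bsupp l : 0 < l -> bsupp (chil l). Proof. exact: bsupp_chil. Qed.
Let chil_cbs l : 0 < l -> cbs (chil l).
Proof. by move=> l0; split; [exact: smooth_continuous|exact: chil_bsupp]. Qed.

Lemma kernel_smooth l : 0 < l -> smooth (kernel l).
Proof. by move=> l0; apply: smoothZ; apply: smooth_trig; exact: chil_cbs. Qed.

Lemma kernel_L1 l : 0 < l -> L1 mu (kernel l).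
Proof.
move=> l0; have [h _] := trig_L1 0 (chil_smooth l) (chil_bsupp l0); exact: (L1Z c0 h).
Qed.

Lemma kernel_bounded l : 0 < l -> exists B : R, forall z, `|kernel l z| <= B.
Proof.
move=> l0; exists (c0 * \int[mu]_xi `|chil l xi|) => z.
by rewrite normrM gtr0_norm// ler_pM2l// trig_bound//; apply: cbs_L1; exact: chil_cbs.
Qed.

Definition kernel_norm : R := c0 * \int[mu]_x `|trig chi 0 x|.

Lemma kernel_normE l : 0 < l -> \int[mu]_z `|kernel l z| = kernel_norm.
Proof.
move=> l0; rewrite /kernel_norm -(trig_scale_norm 0 l0 chis chib) -RintegralZl//; last first.
  by apply: L1_norm; have [] := trig_L1 0 (chil_smooth l) (chil_bsupp l0).
by apply: eq_Rintegral => z _; rewrite normrM gtr0_norm.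
Qed.

Definition kernel_int : R := c0 * \int[mu]_x trig chi 0 x.

Lemma kernel_intE l : 0 < l -> \int[mu]_z kernel l z = kernel_int.
Proof.
move=> l0; rewrite /kernel_int -(trig_scale_int 0 l0 chis chib) -RintegralZl//.
by have [] := trig_L1 0 (chil_smooth l) (chil_bsupp l0).
Qed.

Lemma kernel_int_neq0 : kernel_int != 0.
Proof. by rewrite mulf_neq0 ?(kernel_mass j0 Hchi)// gt_eqF. Qed.

(** The [L^1] norm of the derivative of the kernel along [v] at scale 1. *)
Definition kernel_dnorm v : R := c0 * \int[mu]_x `|trig (fun xi => dot v xi * chi xi) (pi / 2) x|.

(** A derivative multiplies the density by a coordinate, which by scaling
    contributes a factor [1 / l]. *)
Lemma kernel_derive l v : 0 < l ->
  L1 mu (fun z => 'D_v (kernel l) z) /\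
  \int[mu]_z `|'D_v (kernel l) z| = l^-1 * kernel_dnorm v.
Proof.
move=> l0; have ln := lt0r_neq0 l0.
pose a xi := dot v xi * chi xi.
have sa : smooth a by exact: smoothM (smooth_dotr v) chis.
have ba : bsupp a by exact: bsuppMr.
have sal : smooth (fun xi => a (l *: xi)).
  apply: (smooth_comp_affine (L0 := fun x => l *: x)) sa.
    by move=> h y w; rewrite scalerDr !scalerA mulrC.
  by apply: (@lipschitz_continuous _ _ _ _ `|l|) => x y; rewrite -scalerBr normrZ.
have bal : bsupp (fun xi => a (l *: xi)).
  by apply: bsuppMr; exact: chil_bsupp.
have [h _] := trig_L1 (pi / 2) sal bal.
have D z : 'D_v (kernel l) z = c0 * l^-1 * trig (fun xi => a (l *: xi)) (pi / 2) z.
  have st := smooth_trig 0 (chil_cbs l0).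
  apply: (eq_trans (congr1 (fun F => F z) (deriveZf c0 v st))).
  rewrite -mulrA; apply: (congr1 (fun r => c0 * r)).
  apply: (eq_trans (trig_derive 0 z v (chil_cbs l0))).
  rewrite add0r /trig -RintegralZl//; last first.
    by apply: L1_trig; apply: L1_bsupp => //; exact: smooth_continuous.
  apply: eq_Rintegral => xi _; rewrite /a dotZr /chil.
  by rewrite -[LHS]mul1r -(mulVf ln); ring.
split.
  have := L1Z (c0 * l^-1) h; apply: eq_integrable => // z _ /=.
  by apply: (congr1 EFin); exact: esym (D z).
rewrite /kernel_dnorm -(trig_scale_norm (pi / 2) l0 sa ba) mulrCA mulrA.
rewrite -RintegralZl//; last exact: L1_norm.
apply: eq_Rintegral => z _; apply: (eq_trans (congr1 (fun r => `|r|) (D z))).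
by rewrite normrM (ger0_norm (mulr_ge0 (ltW c0_gt0) _))// invr_ge0 ltW.
Qed.

Lemma kernel_derive_bounded l v : 0 < l -> exists B : R, forall z, `|'D_v (kernel l) z| <= B.
Proof.
move=> l0; have st := smooth_trig 0 (chil_cbs l0).
have cd := cbs_mul (@continuous_dotr R d v) (chil_cbs l0).
exists (c0 * \int[mu]_xi `|dot v xi * chil l xi|) => z.
have D : 'D_v (kernel l) z = c0 * trig (fun xi => dot v xi * chil l xi) (0 + pi / 2) z.
  apply: (eq_trans (congr1 (fun F => F z) (deriveZf c0 v st))).
  exact: (congr1 (fun r => c0 * r) (trig_derive 0 z v (chil_cbs l0))).
apply: (le_trans (y := `|c0 * trig (fun xi => dot v xi * chil l xi) (0 + pi / 2) z|)).
  by rewrite le_eqVlt; apply/orP; left; apply/eqP; exact: (congr1 (fun r => `|r|) D).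
by rewrite normrM gtr0_norm// ler_pM2l// trig_bound//; exact: cbs_L1.
Qed.

Lemma kernel_even l z : kernel l (- z) = kernel l z.
Proof.
congr (_ * _); apply: eq_Rintegral => xi _; rewrite /cosp !addr0.
by rewrite dotC dotNr cosN dotC.
Qed.

Section multiplier_formula.
Variables (l : R) (p q A B : E -> R) (x : E).
Hypotheses (l0 : 0 < l) (lp : L1 mu p) (lq : L1 mu q).
Hypothesis HA : forall xi, A xi = \int[mu]_y (cos (dot xi y) * p y - sin (dot xi y) * q y).
Hypothesis HB : forall xi, B xi = \int[mu]_y (cos (dot xi y) * q y + sin (dot xi y) * p y).

Let lcos (r : E -> R) xi : L1 mu r -> L1 mu (fun y => cos (dot xi y) * r y).
Proof.
move=> lr; have := L1_trig 0 xi lr; apply: eq_integrable => // y _ /=.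
by rewrite /cosp addr0.
Qed.

Let lsin (r : E -> R) xi : L1 mu r -> L1 mu (fun y => sin (dot xi y) * r y).
Proof.
move=> lr; have := L1N (L1_trig (pi / 2) xi lr); apply: eq_integrable => // y _ /=.
by rewrite /cosp cosDpihalf mulNr opprK.
Qed.

(** Fubini on the frequency side, with [A] and [B] the real and imaginary
    parts of the Fourier integral of [p + i q]; the terms in [q] cancel
    since the density is even. *)
Lemma multiplier_component :
  \int[mu]_xi (c0 * (chil l xi * (cos (dot xi x) * A xi + sin (dot xi x) * B xi))) =
  \int[mu]_y (p y * kernel l (y - x)).
Proof.
have lc := cbs_L1 (chil_cbs l0).
have lph th (r : E -> R) xi : L1 mu r -> L1 mu (fun y => r y * cosp th (dot (y - x) xi)).
  move=> lr; apply: (L1_le _ (L1_norm lr)) => [|y]; last by rewrite normrM ler_piMr// cosp_le1.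
  apply: measurable_funM; first exact: L1_measurable lr.
  apply: continuous_measurable_rV.
  have -> : (fun y => cosp th (dot (y - x) xi)) = (fun y => cosp (th - dot xi x) (dot xi y)).
    by apply/funext => y; rewrite /cosp dotC dotBr; congr cos; ring.
  exact: continuous_cosp_dot.
have e xi : cos (dot xi x) * A xi + sin (dot xi x) * B xi =
    (\int[mu]_y (p y * cosp 0 (dot (y - x) xi))) +
    (\int[mu]_y (q y * cosp (pi / 2) (dot (y - x) xi))).
  have la := L1B (lcos xi lp) (lsin xi lq); have lb := L1D (lcos xi lq) (lsin xi lp).
  have la' := L1Z (cos (dot xi x)) la; have lb' := L1Z (sin (dot xi x)) lb.
  have pp := lph 0 p xi lp; have qq := lph (pi / 2) q xi lq.
  rewrite HA HB -!RintegralZl// -!RintegralD//.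
  apply: eq_Rintegral => y _; rewrite /cosp addr0 cosDpihalf.
  by rewrite (dotC (y - x)) dotBr cosB sinB; ring.
have l1 th (r : E -> R) : L1 mu r -> L1 mu (fun y => r y * trig (chil l) th (y - x)).
  move=> lr; apply: (L1_le _ (L1Z (\int[mu]_xi `|chil l xi|) (L1_norm lr))).
    apply: measurable_funM; first exact: L1_measurable lr.
    have mt : measurable_fun setT (trig (chil l) th).
      apply: continuous_measurable_rV; apply: smooth_continuous; apply: smooth_trig.
      exact: chil_cbs.
    have := measurableT_comp mt (measurable_affine 1 (- x)).
    by under [X in measurable_fun setT X -> _]eq_fun do rewrite /= scale1r.
  by move=> y; rewrite normrM mulrC ler_wpM2r// trig_bound.
have z0 y : trig (chil l) (pi / 2) y = 0.
  by apply: trig_even => // xi; rewrite /chil scalerN chi_even.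
have lpa th (r : E -> R) : L1 mu r ->
    L1 mu (fun xi => chil l xi * \int[mu]_y (r y * cosp th (dot (y - x) xi))).
  by move=> lr; have [] := trig_fubini_L1 th x lc lr.
have i1 := lpa 0 p lp; have i2 := lpa (pi / 2) q lq.
transitivity (\int[mu]_xi (c0 * (chil l xi * (\int[mu]_y (p y * cosp 0 (dot (y - x) xi))) +
    chil l xi * (\int[mu]_y (q y * cosp (pi / 2) (dot (y - x) xi)))))).
  by apply: eq_Rintegral => xi _; rewrite e mulrDr.
rewrite RintegralZl//; last exact: L1D i1 i2.
rewrite RintegralD// !trig_fubini//.
have -> : \int[mu]_y (q y * trig (chil l) (pi / 2) (y - x)) = 0.
  transitivity (\int[mu]_y ((fun=> 0) y : R)); last by rewrite Rintegral_cst// mul0r.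
  by apply: eq_Rintegral => y _; rewrite z0 mulr0.
rewrite addr0 -RintegralZl//; last exact: l1.
by apply: eq_Rintegral => y _; rewrite /kernel mulrCA.
Qed.

End multiplier_formula.

(** The Schwartz seminorm of order [2 d] controls the polynomial weight. *)
Lemma schwartz_L1 p (M : R) : smooth p -> weighted_le (2 * d) M p ->
  [/\ L1 mu p, \int[mu]_x `|p x| <= M * \int[mu]_x (poly_weight x)^-1 &
      forall x, `|p x| <= M].
Proof.
move=> sp wp; have mp := continuous_measurable_rV (smooth_continuous sp).
have w1 x : 1 <= poly_weight x by exact: poly_weight_ge1.
have w0 x : 0 < poly_weight x by exact: lt_le_trans ltr01 (w1 x).
have pw x : poly_weight x * `|p x| <= M.
  apply: le_trans (wp [::] isT x); rewrite ler_wpM2r//.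
  rewrite /poly_weight exprM -[X in _ ^+ X]card_ord -prodr_const.
  apply: ler_prod => i _; have h0 := enorm_ge0 x; have := coord_le_enorm x i => h1.
  have : x 0 i ^+ 2 = `|x 0 i| ^+ 2 by rewrite real_normK ?num_real.
  have := normr_ge0 (x 0 i) => ? ->; apply/andP; split; nra.
have bp x : `|p x| <= M * (poly_weight x)^-1 by rewrite ler_pdivlMr// mulrC.
have lw := @L1_poly_weightV R d.
have lp : L1 mu p := L1_le mp (L1Z M lw) bp.
split=> //; last by move=> x; apply: le_trans (pw x); rewrite ler_peMl.
rewrite -RintegralZl//; apply: ae_le_Rintegral; [exact: L1_norm|exact: (L1Z M lw)|].
exact: aeW.
Qed.

Lemma normc_le (z : C) : Normc.normc z <= `|complex.Re z| + `|complex.Im z|.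
Proof.
case: z => a b /=; rewrite -[leRHS]ger0_norm ?addr_ge0// -sqrtr_sqr ler_sqrt ?sqr_ge0//.
rewrite -[a ^+ 2]real_normK ?num_real// -[b ^+ 2]real_normK ?num_real//.
have := normr_ge0 a; have := normr_ge0 b; nra.
Qed.

Lemma Re_le_normc (z : C) : `|complex.Re z| <= Normc.normc z.
Proof. by case: z => a b /=; rewrite -sqrtr_sqr ler_sqrt ?addr_ge0 ?sqr_ge0// lerDl sqr_ge0. Qed.

Lemma schwartz_parts (phi : E -> C) : schwartz phi ->
  [/\ L1 mu (Re_fun phi), L1 mu (Im_fun phi),
      exists B, forall x, `|Re_fun phi x| <= B & exists B, forall x, `|Im_fun phi x| <= B].
Proof.
move=> [sr si /(_ (2 * d)%N)[M [wr wi]]].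
have [lr _ br] := schwartz_L1 sr wr; have [li _ bi] := schwartz_L1 si wi.
by split=> //; exists M.
Qed.

Lemma tempered_ofE g (phi : E -> C) : tempered_of g phi =
  ((\int[mu]_x (g x * Re_fun phi x)) +i* (\int[mu]_x (g x * Im_fun phi x)))%C.
Proof.
rewrite /tempered_of /integralC; apply: (f_equal2 (fun a b : R => (a +i* b)%C)).
- apply: eq_Rintegral => x _; rewrite /Re_fun; case: (phi x) => u v /=.
  by rewrite mul0r subr0.
- apply: eq_Rintegral => x _; rewrite /Im_fun; case: (phi x) => u v /=.
  by rewrite mul0r addr0.
Qed.

(** Bounded functions pair with Schwartz functions through the [L^1] norm of
    the latter. *)
Lemma tempered_bounded g (M : R) : measurable_fun setT g ->
  {ae mu, forall x, `|g x| <= M} -> tempered (tempered_of g).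
Proof.
move=> mg gM; split.
  move=> [a1 a2] phi psi sphi spsi.
  have [lr li _ _] := schwartz_parts sphi; have [lr' li' _ _] := schwartz_parts spsi.
  have [gr _] := L1_pair mg gM lr; have [gi _] := L1_pair mg gM li.
  have [gr' _] := L1_pair mg gM lr'; have [gi' _] := L1_pair mg gM li'.
  rewrite !tempered_ofE.
  have -> : \int[mu]_x (g x * Re_fun (fun x => (a1 +i* a2)%C * phi x + psi x) x) =
      a1 * (\int[mu]_x (g x * Re_fun phi x)) - a2 * (\int[mu]_x (g x * Im_fun phi x)) +
      \int[mu]_x (g x * Re_fun psi x).
    have h1 := L1Z a1 gr; have h2 := L1Z a2 gi; have h3 := L1B h1 h2.
    rewrite -!RintegralZl// -RintegralB// -RintegralD//; apply: eq_Rintegral => x _.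
    by rewrite /Re_fun /Im_fun; case: (phi x) => ? ?; case: (psi x) => ? ? /=; ring.
  have -> : \int[mu]_x (g x * Im_fun (fun x => (a1 +i* a2)%C * phi x + psi x) x) =
      a1 * (\int[mu]_x (g x * Im_fun phi x)) + a2 * (\int[mu]_x (g x * Re_fun phi x)) +
      \int[mu]_x (g x * Im_fun psi x).
    have h1 := L1Z a1 gi; have h2 := L1Z a2 gr; have h3 := L1D h1 h2.
    rewrite -!RintegralZl// -!RintegralD//; apply: eq_Rintegral => x _.
    by rewrite /Re_fun /Im_fun; case: (phi x) => ? ?; case: (psi x) => ? ? /=; ring.
  by [].
exists (2 * d)%N, (2 * (`|M| * \int[mu]_x (poly_weight x)^-1)).
move=> phi N [sr si _] wr wi.
have [lr nr _] := schwartz_L1 sr wr; have [li ni _] := schwartz_L1 si wi.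
have gM' : {ae mu, forall x, `|g x| <= `|M|}.
  by apply: filterS gM => x /le_trans; apply; exact: ler_norm.
have [_ b1] := L1_pair mg gM' lr; have [_ b2] := L1_pair mg gM' li.
rewrite tempered_ofE; apply: le_trans (normc_le _) _ => /=.
have {}b1 := le_trans b1 (ler_wpM2l (normr_ge0 M) nr).
have {}b2 := le_trans b2 (ler_wpM2l (normr_ge0 M) ni).
by apply: le_trans (lerD b1 b2) _; rewrite le_eqVlt; apply/orP; left; apply/eqP; ring.
Qed.

(** Duality moves the Fourier multiplier to the test function, where it is a
    convolution with the kernel. *)
Lemma multiplier_kernel g (phi : E -> C) l : 0 < l ->
  L1 mu (Re_fun phi) -> L1 mu (Im_fun phi) ->
  fourier_multiplier (fun xi => chi (l *: xi)) (tempered_of g) phi =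
  ((\int[mu]_x (g x * \int[mu]_y (Re_fun phi y * kernel l (y - x)))) +i*
   (\int[mu]_x (g x * \int[mu]_y (Im_fun phi y * kernel l (y - x)))))%C.
Proof.
move=> l0 lp lq.
pose A xi := \int[mu]_y (cos (dot xi y) * Re_fun phi y - sin (dot xi y) * Im_fun phi y).
pose B xi := \int[mu]_y (cos (dot xi y) * Im_fun phi y + sin (dot xi y) * Re_fun phi y).
have inv xi : fourier_inv phi xi = (c0 * A xi +i* (c0 * B xi))%C.
  rewrite /fourier_inv /integralC.
  have -> : \int[mu]_y complex.Re (expi (dot xi y) * phi y) = A xi.
    by apply: eq_Rintegral => y _; rewrite /Re_fun /Im_fun /expi; case: (phi y) => u v /=.
  have -> : \int[mu]_y complex.Im (expi (dot xi y) * phi y) = B xi.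
    by apply: eq_Rintegral => y _; rewrite /Re_fun /Im_fun /expi; case: (phi y) => u v /=.
  by rewrite -/c0; apply: (f_equal2 (fun a b : R => (a +i* b)%C)); rewrite mul0r ?subr0 ?addr0.
rewrite -[LHS]/(tempered_of g (fourier (fun xi => (chi (l *: xi))%:C%C * fourier_inv phi xi))).
rewrite tempered_ofE; apply: (f_equal2 (fun a b : R => (a +i* b)%C));
  apply: eq_Rintegral => x _; apply: (congr1 (fun r => g x * r)).
- rewrite -(@multiplier_component l _ _ A B x l0 lp lq)//.
  apply: eq_Rintegral => xi _; rewrite inv /expi cosN sinN /chil /=; ring.
- have nq : L1 mu (fun y => - Re_fun phi y) := L1N lp.
  rewrite -(@multiplier_component l _ _ B (fun xi => - A xi) x l0 lq nq).
  + apply: eq_Rintegral => xi _; rewrite inv /expi cosN sinN /chil /=; ring.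
  + by move=> xi; apply: eq_Rintegral => y _; rewrite mulrN opprK.
  + move=> xi; have lA : L1 mu (fun y => cos (dot xi y) * Re_fun phi y - sin (dot xi y) * Im_fun phi y).
      have h1 := L1_trig 0 xi lp; have h2 := L1_trig (pi / 2) xi lq.
      have := L1D h1 h2; apply: eq_integrable => // y _ /=.
      by rewrite /cosp addr0 cosDpihalf mulNr.
    by rewrite -RintegralN//; apply: eq_Rintegral => y _; rewrite opprB mulrN addrC.
Qed.

End convolution_kernel.

(** * Measurability in space-time *)

Section spacetime_measurability.
Context {R : realType} {d : nat}.
Local Notation E := 'rV[R]_d.

(** Space-time is identified with R^(d+1), where continuous functions are
    measurable. *)
Lemma continuous_measurable_prod (psi : R * E -> R) : continuous psi ->
  measurable_fun setT (psi : measurableTypeR R * E -> R).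
Proof.
move=> cp; pose u (x : 'rV[R]_d.+1) : R * E := (x 0 ord0, \row_(i < d) x 0 (lift ord0 i)).
have cu : continuous u.
  apply: (@lipschitz_continuous _ _ _ _ 1) => x y; rewrite mul1r prod_normE/= ge_max.
  apply/andP; split; first by have := le_rV_coord (x - y) ord0; rewrite !mxE.
  apply/rV_norm_le => // i; rewrite !mxE.
  by have := le_rV_coord (x - y) (lift ord0 i); rewrite !mxE.
have cpu : continuous (psi \o u) by move=> x; exact: continuous_comp (cu x) (cp (u x)).
have := measurableT_comp (continuous_measurable_rV cpu) (@measurable_rV_cons R d).
apply: eq_measurable_fun => p _ /=; congr psi.
exact: (@rV_consK R d p).
Qed.

End spacetime_measurability.

(** * Averages over spatial translates *)

Section averaging.
Context {R : realType} {d : nat}.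
Local Notation E := 'rV[R]_d.
Local Notation mu := (@lebesgue_rV R d).
Local Notation leb := (@lebesgue_measure R).

(** Fubini and evenness of [w]: averaging the translates of [z] is
    convolving [z] with [w]. *)
Lemma average_translates (g w z : E -> R) (M B B' : R) : measurable_fun setT g ->
  {ae mu, forall x, `|g x| <= M} -> L1 mu w -> (forall x, `|w x| <= B) ->
  (forall x, w (- x) = w x) -> L1 mu z -> (forall x, `|z x| <= B') ->
  \int[mu]_y (w y * \int[mu]_x (g x * z (x + y))) =
  \int[mu]_x (g x * \int[mu]_y (z y * w (y - x))).
Proof.
move=> mg gM lw wB we lz zB.
have lz' : L1 mu (fun x => z (- x)).
  by have [l _] := L1_reflect 0 lz; under [X in L1 mu X]eq_fun do rewrite -sub0r.
have [l1 e1] := conv_fubini lw lz' (fun x => zB (- x)) mg gM.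
have e2 (x : E) : \int[mu]_y (w y * z (- (y - x))) = \int[mu]_y (z y * w (y - x)).
  have lzw : L1 mu (fun y => z y * w (y - x)) by exact: (L1_conv_slice1 lz lw wB x).
  rewrite -(L1_reflect x lzw).2; apply: eq_Rintegral => y _.
  by rewrite opprB mulrC addrAC subrr add0r we.
have -> : \int[mu]_x (g x * \int[mu]_y (z y * w (y - x))) =
   \int[mu]_y (w y * \int[mu]_x (g x * z (- (y - x)))).
  by rewrite -e1; apply: eq_Rintegral => x _; rewrite e2.
rewrite -(L1_reflect 0 l1).2; apply: eq_Rintegral => y _.
rewrite sub0r we; apply: (congr1 (fun r => w y * r)).
by apply: eq_Rintegral => x _; rewrite opprB opprK.
Qed.

Lemma max_lip (a b c : R) : `|Num.max a c - Num.max b c| <= `|a - b|.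
Proof.
have := ler_norm (a - b); have := ler_norm (b - a); rewrite (distrC b a).
rewrite ler_norml; have := normr_ge0 (a - b).
by case: (ltP a c) => ?; case: (ltP b c) => ? *; apply/andP; split; lra.
Qed.

Lemma min_lip (a b c : R) : `|Num.min a c - Num.min b c| <= `|a - b|.
Proof.
have := ler_norm (a - b); have := ler_norm (b - a); rewrite (distrC b a).
rewrite ler_norml; have := normr_ge0 (a - b).
by case: (ltP a c) => ?; case: (ltP b c) => ? *; apply/andP; split; lra.
Qed.

Lemma clamp_lip (t1 s t : R) :
  `|Num.min (Num.max s 0) t1 - Num.min (Num.max t 0) t1| <= `|s - t|.
Proof.
by apply: le_trans (min_lip _ _ _) _; exact: max_lip.
Qed.

Lemma clamp_itv (t1 t : R) : 0 <= t1 -> 0 <= Num.min (Num.max t 0) t1 <= t1.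
Proof.
move=> t10; rewrite le_min t10 le_max lexx orbT/=.
by rewrite ge_min lexx orbT.
Qed.

(** Time is clamped to [0, t1] to obtain a function continuous on the whole
    space-time, hence measurable there. *)
Lemma pair_joint_continuous T f (phi : R * E -> R) t1 : 0 <= t1 -> t1 < T -> cbt T f ->
  continuous phi -> bsupp phi ->
  continuous (fun p : R * E => pair f (xshift p.2 phi) (Num.min (Num.max p.1 0) t1)).
Proof.
move=> t10 t1T cf cp bp.
have [M M0 fM] := cbt_bounded t1T cf.
have [A A0 pA] := bsupp_ge0 bp.
have [S S0 pS] := bsupp_bounded (@heine_borel_prod R d) cp bp.
apply: continuous_near_le => -[t y] e e0 /=.
set s := Num.min (Num.max t 0) t1.
have sI : 0 <= s <= t1 by exact: clamp_itv.
have sT : 0 <= s < T by case/andP: sI => -> /le_lt_trans ->.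
pose C := (M + S) * (2 * (A + 1)) ^+ d.
have A1 : 0 <= A + 1 by rewrite addr_ge0.
have C0 : 0 <= C by rewrite mulr_ge0 ?addr_ge0// exprn_ge0// mulr_ge0.
pose e' := e / (C + 1).
have e'0 : 0 < e' by rewrite divr_gt0// ltr_wpDl.
have [r1 r10 H1] := bsupp_unif_continuous (@heine_borel_prod R d) cp bp e'0.
have [r2 r20 H2] := cf.2 s sT e' e'0.
pose r := Num.min 1 (Num.min r1 r2).
have r0 : 0 < r by rewrite !lt_min ltr01 r10.
apply: (filterS _ (nbhsx_ballx (t, y) r r0)) => -[t' y'] [/=].
rewrite -!ball_normE/= => tt' yy'.
set s' := Num.min (Num.max t' 0) t1.
have s'I : 0 <= s' <= t1 by exact: clamp_itv.
have s'T : 0 <= s' < T by case/andP: s'I => -> /le_lt_trans ->.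
have ss' : `|s' - s| < r by apply: le_lt_trans (clamp_lip t1 t' t) _; rewrite distrC.
have [rr1 rr2 rr3] : [/\ r <= 1, r <= r1 & r <= r2].
  by split; rewrite /r !ge_min lexx ?orbT.
have cz (q : R) (v : E) : continuous (fun x : E => phi (q, x + v)).
  have := @continuous_tslice _ _ (xshift v phi) q; apply.
  by move=> z; apply: (@continuous_comp _ _ _ (fun z : R * E => (z.1, z.2 + v)) phi);
    [exact: continuous_xshift|exact: cp].
have bz (q : R) (v : E) x : A < `|x - (- v)| -> phi (q, x + v) = 0.
  by rewrite opprK => xA; apply: pA; rewrite prod_normE lt_max xA orbT.
have lz (q : R) (v : E) : L1 mu (fun x : E => phi (q, x + v)).
  by have [] := L1_cube_supp A0 (continuous_measurable_rV (cz q v)) (fun x => pS _) (bz q v).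
have [mf' _] := cf.1 s' s'T; have [mf _] := cf.1 s sT.
have lD := L1B (lz s y) (lz s' y').
have [l1 b1] := L1_pair mf' (fM s' s'I) lD.
have [l2 _] := L1_pair mf' (fM s' s'I) (lz s' y').
have [l3 _] := L1_pair mf (fM s sI) (lz s y).
have ff' : {ae mu, forall x, `|f s x - f s' x| <= e'}.
  apply: filterS (H2 s' s'T _) => [x|]; first by rewrite distrC.
  exact: lt_le_trans rr3.
have [l4 b4] := L1_pair (measurable_funB mf mf') ff' (lz s y).
have e5 : pair f (xshift y phi) s - pair f (xshift y' phi) s' =
    \int[mu]_x ((f s x - f s' x) * phi (s, x + y)) +
    \int[mu]_x (f s' x * (phi (s, x + y) - phi (s', x + y'))).
  rewrite /pair/xshift/= -RintegralB// -RintegralD//.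
  by apply: eq_Rintegral => x _; ring.
have i1 : \int[mu]_x `|phi (s, x + y) - phi (s', x + y')| <= e' * (2 * (A + 1)) ^+ d.
  have cD : continuous (fun x : E => phi (s, x + y) - phi (s', x + y')).
    exact: (@contB _ _ _ _ (cz s y) (cz s' y')).
  have mD := continuous_measurable_rV cD.
  have mN : measurable_fun setT (fun x : E => `|phi (s, x + y) - phi (s', x + y')|).
    exact: measurableT_comp.
  have [|x xA|_] := @L1_cube_supp R d (fun x => `|phi (s, x + y) - phi (s', x + y')|) (- y)
    (A + 1) e' A1 mN.
  - move=> x; rewrite normr_id; apply: H1.
    rewrite -[_ - _]/(s - s', x + y - (x + y')) opprD addrACA subrr add0r.
    rewrite prod_normE/= ge_max; apply/andP; split; apply: ltW.
      by rewrite distrC; exact: lt_le_trans rr2.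
    exact: lt_le_trans rr2.
  - rewrite bz; last by apply: lt_trans xA; rewrite ltrDl.
    rewrite bz ?subrr ?normr0//.
    move: xA; rewrite !opprK => xA.
    have exy : x + y = (x + y') + (y - y') by rewrite -addrA [y' + _]addrC subrK.
    have := ler_normD (x + y') (y - y'); rewrite -exy; lra.
  - by apply: le_trans; exact: ler_norm.
have i2 : \int[mu]_x `|phi (s, x + y)| <= S * (2 * (A + 1)) ^+ d.
  have mN : measurable_fun setT (fun x : E => `|phi (s, x + y)|).
    by apply: measurableT_comp => //; exact: continuous_measurable_rV (cz s y).
  have [|x xA|_] := @L1_cube_supp R d (fun x => `|phi (s, x + y)|) (- y) (A + 1) S A1 mN.
  - by move=> x; rewrite normr_id.
  - by rewrite bz ?normr0//; apply: lt_trans xA; rewrite ltrDl.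
  - by apply: le_trans; exact: ler_norm.
rewrite e5; apply: le_trans (ler_normD _ _) _.
apply: (@le_trans _ _ (e' * C)); last first.
  by rewrite /e' mulrAC ler_pdivrMr ?ltr_wpDl// ler_pM2l// lerDl.
have h1 := le_trans b1 (ler_wpM2l M0 i1); have h2 := le_trans b4 (ler_wpM2l (ltW e'0) i2).
apply: le_trans (lerD h2 h1) _; rewrite /C le_eqVlt; apply/orP; left; apply/eqP; ring.
Qed.

(** Averaging over spatial translates commutes with the time integral, by
    Fubini for a bounded continuous integrand. *)
Lemma rd_average T f (phi : R * E -> R) (w : E -> R) : 0 < T -> cbt T f -> cpair T phi ->
  L1 mu w ->
  [/\ L1 mu (fun y => w y * regular_dist T f (xshift y phi)),
      tL1 T (fun t => \int[mu]_y (w y * pair f (xshift y phi) t)) &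
      \int[mu]_y (w y * regular_dist T f (xshift y phi)) =
      \int[leb]_(t in `[0, T[) \int[mu]_y (w y * pair f (xshift y phi) t)].
Proof.
move=> T0 cf [cp bp [t0 t0T pt]] lw.
pose t1 := Num.max t0 0.
have t10 : 0 <= t1 by rewrite le_max lexx orbT.
have t1T : t1 < T by rewrite gt_max t0T.
have [M M0 fM] := cbt_bounded t1T cf.
have [A A0 pA] := bsupp_ge0 bp.
have [S S0 pS] := bsupp_bounded (@heine_borel_prod R d) cp bp.
pose m (p : R * E) := pair f (xshift p.2 phi) (Num.min (Num.max p.1 0) t1).
have cm : continuous m by exact: (@pair_joint_continuous T f phi t1 t10 t1T cf cp bp).
have mm := continuous_measurable_prod cm.
pose I (t : R) : R := \1_(`[0, t1]%classic) t.
have mI : measurable `[0, t1]%classic by exact: measurable_itv.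
have lI : L1 leb I.
  have Ioo : (leb `[0%R, t1]%classic < +oo)%E.
    by rewrite [X in (X < _)%E](itv_measure t10) ltry.
  have [|t|t H|//] := @L1_bounded_on _ _ R leb `[0, t1]%classic 1 I mI Ioo.
  - exact: measurable_indic.
  - by rewrite /I indicE normr_nat lern1 leq_b1.
  - by rewrite /I indicE memNset.
have pE t y : 0 <= t < T -> pair f (xshift y phi) t = I t * m (t, y).
  move=> /andP[t_0 tT]; rewrite /I /m/= indicE.
  have [tt1|tt1] := leP t t1.
    by rewrite mem_set/= ?in_itv/= ?t_0// mul1r max_l// min_l.
  rewrite memNset/= ?mul0r; last by rewrite in_itv/= t_0/= leNgt tt1.
  rewrite /pair /xshift/=; under eq_Rintegral do rewrite pt ?mulr0 ?(le_lt_trans _ tt1) ?le_max ?lexx//.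
  by rewrite Rintegral_cst// mul0r.
have cz (s : R) (y : E) : continuous (fun x : E => phi (s, x + y)).
  have := @continuous_tslice _ _ (xshift y phi) s; apply.
  by move=> z; apply: (@continuous_comp _ _ _ (fun z : R * E => (z.1, z.2 + y)) phi);
    [exact: continuous_xshift|exact: cp].
have mB p : `|m p| <= M * (S * (2 * A) ^+ d).
  rewrite /m; set s := Num.min _ _; have sI : 0 <= s <= t1 by exact: clamp_itv.
  have sT : 0 <= s < T by case/andP: sI => -> /le_lt_trans ->.
  have bz x : A < `|x - (- p.2)| -> phi (s, x + p.2) = 0.
    by rewrite opprK => xA; apply: pA; rewrite prod_normE lt_max xA orbT.
  have [lz _] := L1_cube_supp A0 (continuous_measurable_rV (cz s p.2)) (fun x => pS _) bz.
  have [_] := L1_pair (cf.1 s sT).1 (fM s sI) lz.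
  move=> /le_trans; apply; rewrite ler_wpM2l//.
  have mN : measurable_fun setT (fun x : E => `|phi (s, x + p.2)|).
    by apply: measurableT_comp => //; exact: continuous_measurable_rV (cz s p.2).
  have [|x xA|_] := @L1_cube_supp R d (fun x => `|phi (s, x + p.2)|) (- p.2) A S A0 mN.
  - by move=> x; rewrite normr_id.
  - by rewrite bz ?normr0.
  - by apply: le_trans; exact: ler_norm.
pose F (p : measurableTypeR R * E) := (I p.1 * w p.2) * m p.
have lIw := L1_prod lI lw.
have mF : measurable_fun setT F.
  by apply: measurable_funM => //; exact: L1_measurable lIw.
have FB (p : measurableTypeR R * E) : `|F p| <= (M * (S * (2 * A) ^+ d)) * `|I p.1 * w p.2|.
  by rewrite normrM mulrC ler_wpM2r.
have lF : L1 (leb \x mu)%E F := L1_le mF (L1Z _ (L1_norm lIw)) FB.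
have F1 (t : measurableTypeR R) : L1 mu (fun y => F (t, y)).
  have mFt : measurable_fun setT (fun y => F (t, y)).
    exact: (measurable_funM (L1_measurable (L1Z (I t) lw))
      (continuous_measurable_rV (@continuous_tslice _ _ m t cm))).
  exact: (L1_le mFt (L1Z _ (L1_norm (L1Z (I t) lw))) (fun y => FB (t, y))).
have F2 (y : E) : L1 leb (fun t => F (t, y)).
  have mFy : measurable_fun setT (fun t : measurableTypeR R => F (t, y)).
    apply: (measurableT_comp mF); exact: measurable_pair2.
  have lIy : L1 leb (fun t => I t * w y).
    by have := L1Z (w y) lI; apply: eq_integrable => // t _ /=; rewrite mulrC.
  exact: (L1_le mFy (L1Z _ (L1_norm lIy)) (fun t => FB (t, y))).
have i1 (t : R) : ~ (0 <= t < T) -> forall y, F (t, y) = 0.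
  move=> tT y; rewrite /F /I/= indicE memNset ?mul0r//= in_itv/= => /andP[t_0 tt1].
  by apply: tT; rewrite t_0 (le_lt_trans tt1).
have eI (G : R -> R) : (forall t, ~ (0 <= t < T) -> G t = 0) ->
    \int[leb]_(t in `[0, T[) G t = \int[leb]_t G t.
  move=> G0; rewrite Rintegral_mkcond; apply: eq_Rintegral => t _; rewrite patchE.
  by case: ifPn => // /negP; rewrite inE/= in_itv/= => /G0.
have e1 (y : E) : w y * regular_dist T f (xshift y phi) = \int[leb]_t F (t, y).
  rewrite -eI => [|t tT]; last exact: i1.
  rewrite /regular_dist -/(pair f (xshift y phi)).
  transitivity (\int[leb]_(t in `[0, T[) (w y * pair f (xshift y phi) t)).
    rewrite -RintegralZl//; apply: pair_tL1 => //.
    - by move=> z; apply: (@continuous_comp _ _ _ (fun z : R * E => (z.1, z.2 + y)) phi);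
        [exact: continuous_xshift|exact: cp].
    - exists (A + `|y|) => z Az; apply: pA.
      have : `|z| <= `|(z.1, z.2 + y)| + `|y|.
        rewrite {1}(_ : z = (z.1, z.2 + y) - (0, y)).
          rewrite (le_trans (ler_normB _ _))// lerD2l.
          by rewrite prod_normE/= normr0 ge_max normr_ge0 lexx.
        by rewrite -[RHS]/(z.1 - 0, z.2 + y - y) subr0 addrK; case: z {Az}.
      by lra.
    - by exists t0 => // z zt; exact: pt.
  apply: eq_Rintegral => t; rewrite inE/= in_itv/= => tT.
  by rewrite pE// /F/=; ring.
have e2 (t : R) : 0 <= t < T ->
    \int[mu]_y (w y * pair f (xshift y phi) t) = \int[mu]_y F (t, y).
  by move=> tT; apply: eq_Rintegral => y _; rewrite pE// /F/=; ring.
split.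
- have := L1_fubini2 lF F2; apply: eq_integrable => // y _ /=; exact: (congr1 EFin (esym (e1 y))).
- have LL : tL1 T (fun t => \int[mu]_y F (t, y)).
    by apply: integrableS (L1_fubini1 lF F1) => //; exact: measurable_itv.
  move: LL; apply: eq_integrable => [|t]; first exact: measurable_itv.
  rewrite inE/= in_itv/= => tT; exact: (congr1 EFin (esym (e2 t tT))).
- transitivity (\int[mu]_y \int[leb]_t F (t, y)); first by apply: eq_Rintegral => y _; exact: e1.
  rewrite -(Rfubini2 lF F2) (Rfubini1 lF F1) -eI; last first.
    by move=> t /i1 H; under eq_Rintegral do rewrite H; rewrite Rintegral_cst// mul0r.
  by apply: eq_Rintegral => t; rewrite inE/= in_itv/= => tT; rewrite e2.
Qed.

End averaging.
(** * Fields constant in time *)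

Section constant_in_time.
Context {R : realType} {d : nat}.
Local Notation E := 'rV[R]_d.
Local Notation mu := (@lebesgue_rV R d).
Local Notation leb := (@lebesgue_measure R).

(** Exchanging the integrals, the fundamental theorem in time leaves the
    boundary term at time 0. *)
Lemma rd_constant_in_time T (c : E -> R) (M : R) (phi : R * E -> R) : 0 < T ->
  measurable_fun setT c -> {ae mu, forall x, `|c x| <= M} -> ctest T phi ->
  regular_dist T (fun=> c) (fun z => 'D_(@dir_t R d) phi z) =
  - \int[mu]_x (c x * phi (0, x)).
Proof.
move=> T0 mc cM tp; have [sp bp [t1 t1T pt]] := tp.
pose psi z := 'D_(@dir_t R d) phi z.
have spsi : smooth psi by exact: smooth_derive.
have cpsi := smooth_continuous spsi.
have bpsi : bsupp psi by exact: bsupp_derive.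
have [A A0 pA] := bsupp_ge0 bpsi.
have [S S0 pS] := bsupp_bounded (@heine_borel_prod R d) cpsi bpsi.
have mpsi := continuous_measurable_prod cpsi.
pose I (t : R) : R := \1_(`[0, T[%classic) t.
have mI : measurable `[0, T[%classic by exact: measurable_itv.
have lI : L1 leb I.
  have Ioo : (leb `[0%R, T[%classic < +oo)%E.
    by rewrite lebesgue_measure_itv/= lte_fin T0 -EFinB ltry.
  have [|t|t H|//] := @L1_bounded_on _ _ R leb `[0, T[%classic 1 I mI Ioo.
  - exact: measurable_indic.
  - by rewrite /I indicE normr_nat lern1 leq_b1.
  - by rewrite /I indicE memNset.
pose k (x : E) : R := \1_[set x : E | `|x - 0| <= A] x.
have mQ : measurable [set x : E | `|x - 0| <= A] by exact: measurable_cube.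
have lk : L1 mu k.
  have [|x|x xA|//] := @L1_cube_supp R d k 0 A 1 A0.
  - exact: measurable_indic.
  - by rewrite /k indicE normr_nat lern1 leq_b1.
  - by rewrite /k indicE memNset//= leNgt xA.
have [lck _] := L1_pair mc cM lk.
have lIck := L1_prod lI lck.
pose F (p : measurableTypeR R * E) := (I p.1 * (c p.2 * k p.2)) * psi p.
have mF : measurable_fun setT F by apply: measurable_funM => //; exact: L1_measurable lIck.
have FB (p : measurableTypeR R * E) : `|F p| <= S * `|I p.1 * (c p.2 * k p.2)|.
  by rewrite normrM mulrC ler_wpM2r.
have lF : L1 (leb \x mu)%E F := L1_le mF (L1Z S (L1_norm lIck)) FB.
have F1 (t : measurableTypeR R) : L1 mu (fun x => F (t, x)).
  have m1 : measurable_fun setT (fun x => F (t, x)).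
    exact: (measurable_funM (L1_measurable (L1Z (I t) lck))
      (continuous_measurable_rV (@continuous_tslice _ _ psi t cpsi))).
  exact: (L1_le m1 (L1Z S (L1_norm (L1Z (I t) lck))) (fun x => FB (t, x))).
have F2 (x : E) : L1 leb (fun t => F (t, x)).
  have m2 : measurable_fun setT (fun t : measurableTypeR R => F (t, x)).
    by apply: (measurableT_comp mF); exact: measurable_pair2.
  have lIx : L1 leb (fun t => I t * (c x * k x)).
    by have := L1Z (c x * k x) lI; apply: eq_integrable => // t _ /=; rewrite mulrC.
  exact: (L1_le m2 (L1Z S (L1_norm lIx)) (fun t => FB (t, x))).
have kpsi t x : k x * psi (t, x) = psi (t, x).
  rewrite /k indicE; have [xA|xA] := leP `|x - 0| A; first by rewrite mem_set// mul1r.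
  by rewrite memNset/= ?leNgt ?xA// mul0r pA// prod_normE lt_max -{2}(subr0 x) xA orbT.
have eI (G H : R -> R) : (forall t, H t = I t * G t) ->
    \int[leb]_(t in `[0, T[) G t = \int[leb]_t H t.
  move=> GH; rewrite Rintegral_mkcond; apply: eq_Rintegral => t _; rewrite patchE GH /I indicE.
  by case: ifPn => _; rewrite ?mul1r ?mul0r.
rewrite /regular_dist -/psi.
rewrite (eI _ (fun t => \int[mu]_x F (t, x))); last first.
  move=> t; have lt : L1 mu (fun x => c x * psi (t, x)).
    by have [] := L1_pair mc cM (L1_tslice t cpsi bpsi).
  rewrite -RintegralZl//; apply: eq_Rintegral => x _.
  by rewrite /F/= -!mulrA kpsi.
rewrite -(Rfubini1 lF F1) (Rfubini2 lF F2).
have ft (x : E) : \int[leb]_t F (t, x) = - (c x * phi (0, x)).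
  have lpx : leb.-integrable `[0, T] (EFin \o (fun t : R => psi (t, x))).
    apply: continuous_itv_integrable => t.
    apply: (@continuous_comp _ _ _ (fun t : R => (t, x)) psi); last exact: cpsi.
    apply: (@lipschitz_continuous _ R^o _ (fun t : R => (t, x)) 1) => a b.
    by rewrite mul1r prod_normE/= subrr normr0 ge_max normr_ge0 lexx.
  have lpx' : leb.-integrable `[0, T[ (EFin \o (fun t : R => psi (t, x))).
    apply: integrableS lpx => //.
    by apply: subset_itvl; rewrite bnd_simp.
  rewrite -(eI (fun t => c x * psi (t, x)) (fun t => F (t, x))); last first.
    by move=> t; rewrite /F/= -!mulrA kpsi.
  rewrite RintegralZl//.
  have := FTC_line (@dir_t R d) (0, x) T0 sp.
  have lin (r : R) : ((0, x) : R * E) + r *: dir_t = (r, x).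
    by rewrite /dir_t -[LHS]/(0 + r *: 1, x + r *: 0) scaler0 addr0 add0r /GRing.scale/= mulr1.
  rewrite !lin pt// sub0r /lineint => H.
  have -> : \int[leb]_(t in `[0, T[) psi (t, x) = - phi (0, x); last by rewrite mulrN.
  rewrite -H; transitivity (\int[leb]_(t in `[0, T]) psi (t, x)).
    apply: Rintegral_itv_bndo_bndc.
    exact: lpx'.
  by apply: eq_Rintegral => r _; rewrite lin.
rewrite -RintegralN; last by have [] := L1_pair mc cM (L1_tslice 0 (smooth_continuous sp) bp).
by apply: eq_Rintegral => x _.
Qed.

End constant_in_time.

(** * Test functions with separated variables *)

Section tensors.
Context {R : realType} {d : nat}.
Local Notation E := 'rV[R]_d.
Local Notation mu := (@lebesgue_rV R d).
Local Notation leb := (@lebesgue_measure R).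
Implicit Types (Th : R -> R) (z : E -> R).

(** Separated variables allow time and space to be localized independently. *)
Definition tens Th z : R * E -> R := fun p => Th p.1 * z p.2.

Lemma smooth_fst Th : smooth Th -> smooth (fun p : R * E => Th p.1).
Proof.
move=> sT; apply: (smooth_comp_affine (V := (R * E)%type) (W := R) (L := fst) (L0 := fst)) sT => //.
apply: (@lipschitz_continuous _ _ R^o fst 1) => x y.
by rewrite mul1r prod_normE/= le_max lexx.
Qed.

Lemma smooth_snd z : smooth z -> smooth (fun p : R * E => z p.2).
Proof.
move=> sz; apply: (smooth_comp_affine (V := (R * E)%type) (L := snd) (L0 := snd)) sz => //.
apply: (@lipschitz_continuous _ _ _ snd 1) => x y.
by rewrite mul1r prod_normE/= le_max lexx orbT.
Qed.

Lemma smooth_tens Th z : smooth Th -> smooth z -> smooth (tens Th z).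
Proof. by move=> sT sz; exact: smoothM (smooth_fst sT) (smooth_snd sz). Qed.

Lemma bsupp_tens Th z : bsupp Th -> bsupp z -> bsupp (tens Th z).
Proof.
move=> [A pA] [B pB]; exists (Num.max A B) => -[t x]; rewrite gt_max prod_normE/= !lt_max.
rewrite /tens/=; have [At _|tA] := ltP A `|t|; first by rewrite pA ?mul0r.
have [Bx _|xB] := ltP B `|x|; first by rewrite pB ?mulr0.
by move=> /andP[/= xA tB]; move: xA tB; rewrite ?orbF ?orFb => xA tB; lra.
Qed.

Lemma tens_derive_t Th z p : smooth Th -> smooth z ->
  'D_(@dir_t R d) (tens Th z) p = tens (fun s => 'D_(1 : R) Th s) z p.
Proof.
move=> sT sz.
apply: (eq_trans (congr1 (fun F => F p) (deriveMf (@dir_t R d) (smooth_fst sT) (smooth_snd sz)))).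
have e1 : 'D_(@dir_t R d) (fun p : R * E => Th p.1) p = 'D_(1 : R) Th p.1.
  exact: (@derive_comp_affine R _ _ (fst : R * E -> R) fst).
have e2 : 'D_(@dir_t R d) (fun p : R * E => z p.2) p = 0.
  apply: (eq_trans (@derive_comp_affine R _ _ (snd : R * E -> E) snd z p dir_t _)) => //.
  exact: derive0.
apply: (eq_trans (f_equal2 (fun a b => Th p.1 * a + z p.2 * b) e2 e1)).
by rewrite mulr0 add0r mulrC.
Qed.

Lemma tens_derive_x Th z k p : smooth Th -> smooth z ->
  'D_(dir_x k) (tens Th z) p = tens Th (fun x => 'D_(unit_vec k) z x) p.
Proof.
move=> sT sz.
apply: (eq_trans (congr1 (fun F => F p) (deriveMf (dir_x k) (smooth_fst sT) (smooth_snd sz)))).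
have e1 : 'D_(dir_x k) (fun p : R * E => z p.2) p = 'D_(unit_vec k) z p.2.
  exact: (@derive_comp_affine R _ _ (snd : R * E -> E) snd).
have e2 : 'D_(dir_x k) (fun p : R * E => Th p.1) p = 0.
  apply: (eq_trans (@derive_comp_affine R _ _ (fst : R * E -> R) fst Th p (dir_x k) _)) => //.
  exact: derive0.
apply: (eq_trans (f_equal2 (fun a b => Th p.1 * a + z p.2 * b) e1 e2)).
by rewrite mulr0 addr0.
Qed.

Lemma pair_tens (f : R -> E -> R) Th z t (M : R) : measurable_fun setT (f t) ->
  {ae mu, forall x, `|f t x| <= M} -> L1 mu z ->
  pair f (tens Th z) t = Th t * \int[mu]_x (f t x * z x).
Proof.
move=> mf fM lz; have [l _] := L1_pair mf fM lz; rewrite -RintegralZl//.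
by apply: eq_Rintegral => x _; rewrite /tens/= mulrCA.
Qed.

End tensors.

(** * Localization in time *)

Section time_steps.
Context {R : realType} {d : nat}.
Local Notation E := 'rV[R]_d.
Local Notation mu := (@lebesgue_rV R d).
Local Notation leb := (@lebesgue_measure R).
Variables (chi : E -> R) (j0 : 'I_d).
Hypothesis Hchi : cutoff chi.
Local Notation sstep := (sstep chi j0).

Definition tstep (t e s : R) : R := sstep (e^-1 * (s - t)).
(** An approximation of a Dirac mass just after time [t]. *)
Definition dtstep (t e s : R) : R := 'D_(1 : R) (tstep t e) s.

Lemma smooth_tstep t e : smooth (tstep t e).
Proof.
apply: (smooth_comp_affine (V := R) (W := R) (L := fun s => e^-1 * (s - t)) (L0 := fun s => e^-1 * s))
  (smooth_sstep j0 Hchi).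
  by move=> h y w; rewrite /GRing.scale/=; ring.
have ci : continuous (fun s : R => s) by move=> x; exact: cvg_id.
exact: (@contM _ _ _ _ (@contC _ _ e^-1) (@contB _ _ _ _ ci (@contC _ _ t))).
Qed.

Lemma tstep0 t e s : 0 < e -> s <= t -> tstep t e s = 0.
Proof. by move=> e0 st; rewrite /tstep (sstep0 j0 Hchi)// pmulr_rle0 ?invr_gt0// subr_le0. Qed.

Lemma tstep1 t e s : 0 < e -> t + e <= s -> tstep t e s = 1.
Proof.
move=> e0 st; rewrite /tstep (sstep1 j0 Hchi)// -(mulVf (lt0r_neq0 e0)) ler_pM2l ?invr_gt0//.
by lra.
Qed.

Lemma tstep_01 t e s : 0 <= tstep t e s <= 1.
Proof. exact: sstep_01. Qed.

Lemma continuous_dtstep t e : continuous (dtstep t e).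
Proof.
have c := smooth_continuous (smooth_derive (1 : R) (smooth_tstep t e)); exact: c.
Qed.

Lemma dtstep0 t e s : 0 < e -> s < t \/ t + e < s -> dtstep t e s = 0.
Proof.
move=> e0 [st|st]; rewrite /dtstep.
  apply: derive_near0; near=> r; apply: tstep0 => //; apply: ltW.
  by near: r; exact: lt_nbhsl.
rewrite -(derive_cst (1 : R) s 1); apply: near_eq_derive.
near=> r; apply: tstep1 => //; apply: ltW; near: r; exact: lt_nbhsr.
Unshelve. all: by end_near. Qed.

Lemma dtstep_bound : exists2 C : R, 0 <= C & forall t e s, 0 < e -> `|dtstep t e s| <= C / e.
Proof.
have ss := smooth_sstep j0 Hchi.
have cd := smooth_continuous (smooth_derive (1 : R) ss).
have bd : bsupp (fun s : R => 'D_(1 : R) sstep s).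
  exists 1 => s s1; have [s0|s0] := ltP s 0.
    apply: derive_near0; near=> r; apply: (sstep0 j0 Hchi); apply: ltW.
    by near: r; exact: lt_nbhsl.
  rewrite ger0_norm// in s1; rewrite -(derive_cst (1 : R) s 1); apply: near_eq_derive.
  near=> r; apply: (sstep1 j0 Hchi); apply: ltW; near: r; exact: lt_nbhsr.
have hb : @heine_borel R R.
  move=> A; rewrite (_ : [set _ | _] = `[- A, A]%classic); first exact: segment_compact.
  by apply/seteqP; split=> x /=; rewrite in_itv/= ler_norml.
have [C C0 HC] := bsupp_bounded hb cd bd; exists C => // t e s e0.
have L h (y w : R) : e^-1 * (h *: w + y - t) = h *: (e^-1 * w) + e^-1 * (y - t).
  by rewrite /GRing.scale/=; ring.
have [D1 E1] := is_derive_dir e^-1 (DeriveDef (smooth_derivable ss) (erefl ('D_(1 : R) sstep (e^-1 * (s - t))))).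
have -> : dtstep t e s = e^-1 * 'D_(1 : R) sstep (e^-1 * (s - t)).
  rewrite /dtstep /tstep.
  apply: (eq_trans (@derive_comp_affine R R R (fun s => e^-1 * (s - t)) (fun s => e^-1 * s) sstep s 1 L)).
  by rewrite mulr1.
by rewrite normrM gtr0_norm ?invr_gt0// mulrC ler_pM2r ?invr_gt0.
Unshelve. all: by end_near. Qed.

Lemma dtstep_int t e : 0 < e -> \int[leb]_(s in `[t, (t + e)]) dtstep t e s = 1.
Proof.
move=> e0; have te : t < t + e by rewrite ltrDl.
have := FTC_line (1 : R) 0 te (smooth_tstep t e).
have E0 (r : R) : 0 + r *: (1 : R) = r by rewrite add0r /GRing.scale/= mulr1.
rewrite !E0 (tstep0 e0 (lexx t)) (tstep1 e0 (lexx (t + e))) subr0 => <-.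
by apply: eq_Rintegral => r _; rewrite E0.
Qed.

(** Testing against the derivative of a steep step evaluates a continuous
    function of time. *)
Lemma dtstep_eval T (m : R -> R) t (eps : R) : tcont T m -> 0 <= t < T -> 0 < eps ->
  exists2 r : R, 0 < r & forall e, 0 < e < r -> t + e < T /\
    (tL1 T (fun s => dtstep t e s * m s) ->
     `|\int[leb]_(s in `[0, T[) (dtstep t e s * m s) - m t| <= eps).
Proof.
move=> cm tT eps0; have [C C0 HC] := dtstep_bound.
have e'0 : 0 < eps / (C + 1) by rewrite divr_gt0// ltr_wpDl.
have [r0 r00 Hr] := cm t tT _ e'0; have /andP[t0 tT'] := tT.
exists (Num.min r0 (T - t)); first by rewrite lt_min r00 subr_gt0.
move=> e /andP[e0]; rewrite lt_min => /andP[er eT].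
have teT : t + e < T by lra.
split=> // lm; have te : t <= t + e by rewrite lerDl ltW.
have mI : measurable `[t, (t + e)]%classic by exact: measurable_itv.
have sub : `[t, (t + e)]%classic `<=` `[0, T[%classic.
  by move=> s; rewrite /= !in_itv/= => /andP[ts st]; apply/andP; split; lra.
have -> : \int[leb]_(s in `[0, T[) (dtstep t e s * m s) =
    \int[leb]_(s in `[t, (t + e)]) (dtstep t e s * m s).
  rewrite Rintegral_mkcond [RHS]Rintegral_mkcond; apply: eq_Rintegral => s _.
  rewrite !patchE; have [st|st] := boolP (s \in `[t, (t + e)]%classic).
    by rewrite ifT// inE; apply: sub; move: st; rewrite inE.
  case: ifP => // _; rewrite dtstep0 ?mul0r//; move/negP: st; rewrite inE/= in_itv/= => st.
  by case: (ltP s t) => [|ts]; [left|right; rewrite ltNge; apply/negP => H; apply: st; rewrite ts].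
have ld := continuous_itv_integrable t (t + e) (@continuous_dtstep t e).
have lme : leb.-integrable `[t, (t + e)] (EFin \o (fun s => dtstep t e s * m s)).
  by apply: integrableS lm => //; exact: measurable_itv.
have ldm : leb.-integrable `[t, (t + e)] (EFin \o (fun s => dtstep t e s * m t)).
  apply: (continuous_itv_integrable (g := fun s => dtstep t e s * m t)).
  exact: (@contM _ _ _ _ (@continuous_dtstep t e) (@contC _ _ (m t))).
have -> : m t = \int[leb]_(s in `[t, (t + e)]) (dtstep t e s * m t).
  by rewrite RintegralZr// dtstep_int// mul1r.
have lB : leb.-integrable `[t, (t + e)] (EFin \o (fun s => dtstep t e s * m s - dtstep t e s * m t)).
  by apply: (integrableB _ lme ldm).
rewrite -RintegralB//; apply: le_trans; first exact: le_normr_Rintegral.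
have tint : \int[leb]_(s in `[t, (t + e)]) (C / e * (eps / (C + 1))) = C * (eps / (C + 1)).
  rewrite Rintegral_cst//.
  have -> : fine (leb `[t, (t + e)]%classic) = e.
    have I := itv_measure te; rewrite [X in fine X]I /=; lra.
  by rewrite mulrAC divfK// gt_eqF.
apply: (@le_trans _ _ (C * (eps / (C + 1)))).
  rewrite -tint; apply: le_Rintegral => //.
  - exact: (integrable_abse lB).
  - exact: (continuous_itv_integrable (g := fun=> C / e * (eps / (C + 1))) t (t + e) (fun x => cvg_cst _)).
  - move=> s; rewrite /= in_itv/= => /andP[ts st].
    rewrite -mulrBr normrM; apply: ler_pM => //; first exact: HC.
    by apply: Hr; [apply/andP; split; lra|rewrite ger0_norm; lra].
rewrite mulrCA ger_pMr// ler_pdivrMr ?ltr_wpDl// mul1r lerDl.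
by [].
Qed.

(** The hypothesis is the weak form of [m' = N] with initial value [c0],
    tested with steep steps ending just after [t]. *)
Lemma time_localization T (m N : R -> R) (c0 MN t t1 : R) : 0 <= t -> t < t1 -> t1 < T ->
  tcont T m -> 0 <= MN ->
  (forall e, 0 < e -> t + e < t1 -> tL1 T (fun s => dtstep t e s * m s)) ->
  (forall e, 0 < e -> t + e < t1 -> tL1 T (fun s => (1 - tstep t e s) * N s)) ->
  (forall s, 0 <= s <= t1 -> `|N s| <= MN) ->
  (forall e, 0 < e -> t + e < t1 ->
     \int[leb]_(s in `[0, T[) (dtstep t e s * m s) -
     \int[leb]_(s in `[0, T[) ((1 - tstep t e s) * N s) - c0 = 0) ->
  `|m t - c0| <= t * MN.
Proof.
move=> t0 tt1 t1T cm MN0 lm lN NM id.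
have tT : 0 <= t < T by rewrite t0 (lt_trans tt1).
have T0 : 0 < T by case/andP: tT => *; lra.
apply/ler_addgt0Pr => eps eps0.
have eps2 : 0 < eps / 2 by rewrite divr_gt0.
have [r r0 Hr] := dtstep_eval cm tT eps2.
have M1 : 0 < MN + 1 by rewrite ltr_wpDl.
pose e := Num.min (r / 2) (Num.min ((t1 - t) / 2) (eps / 2 / (MN + 1))).
have e0 : 0 < e by rewrite !lt_min !divr_gt0// subr_gt0.
have [er et eM] : [/\ e <= r / 2, e <= (t1 - t) / 2 & e <= eps / 2 / (MN + 1)].
  by split; rewrite /e !ge_min lexx ?orbT.
have er' : 0 < e < r by rewrite e0/=; lra.
have tet : t + e < t1 by lra.
have [teT] := Hr e er'; move=> /(_ (lm e e0 tet)) H1.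
have H2 := id e e0 tet; have lNe := lN e e0 tet.
have te : t <= t + e by lra.
have mI : measurable `[0, T[%classic by exact: measurable_itv.
have H3 : `|\int[leb]_(s in `[0, T[) ((1 - tstep t e s) * N s)| <= (t + e) * MN.
  have te0 : 0 <= t + e by lra.
  have -> : \int[leb]_(s in `[0, T[) ((1 - tstep t e s) * N s) =
      \int[leb]_(s in `[0, (t + e)]) ((1 - tstep t e s) * N s).
    rewrite Rintegral_mkcond [RHS]Rintegral_mkcond; apply: eq_Rintegral => s _.
    rewrite !patchE; have [st|st] := boolP (s \in `[0, (t + e)]%classic).
      rewrite ifT// inE/= in_itv/=; move: st; rewrite inE/= in_itv/= => /andP[-> st].
      by rewrite (le_lt_trans st).
    case: ifP => //; rewrite inE/= in_itv/= => /andP[s0 sT].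
    rewrite tstep1 ?subrr ?mul0r//; apply: ltW; rewrite ltNge; apply/negP => H.
    by move/negP: st; apply; rewrite inE/= in_itv/= s0.
  have mJ : measurable `[0, (t + e)]%classic by exact: measurable_itv.
  have lJ : leb.-integrable `[0, (t + e)] (EFin \o (fun s => (1 - tstep t e s) * N s)).
    apply: integrableS lNe => //.
    by move=> s; rewrite /= !in_itv/= => /andP[-> st]; rewrite (le_lt_trans st).
  have <- : \int[leb]_(s in `[0, (t + e)]) MN = (t + e) * MN.
    rewrite Rintegral_cst//.
    have -> : fine (leb `[0, (t + e)]%classic) = t + e.
      have -> : leb `[0%R, (t + e)]%classic = (t + e - 0)%:E by exact: itv_measure.
      by rewrite /= subr0.
    by rewrite mulrC.
  apply: le_trans; first exact: le_normr_Rintegral.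
  apply: le_Rintegral => //.
  - exact: (integrable_abse lJ).
  - exact: (continuous_itv_integrable (g := fun=> MN) 0 (t + e) (fun x => cvg_cst _)).
  - move=> s; rewrite /= in_itv/= => /andP[s0 st]; have /andP[h0 h1] := tstep_01 t e s.
    rewrite normrM -[leRHS]mul1r; apply: ler_pM => //.
      by rewrite ger0_norm; lra.
    by apply: NM; rewrite s0; lra.
set X := \int[leb]_(s in _) (dtstep t e s * m s) in H1 H2.
set Y := \int[leb]_(s in _) _ in H2 H3.
have e1 : m t - c0 = - (X - m t) + Y by lra.
rewrite e1; apply: le_trans (ler_normD _ _) _; rewrite normrN.
have eM' : e * (MN + 1) <= eps / 2 by rewrite -ler_pdivlMr.
by nra.
Qed.

(** A continuous function orthogonal to all steep step derivatives located
    at positive times vanishes; time 0 is reached by continuity. *)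
Lemma time_vanishing T (m : R -> R) : tcont T m ->
  (forall t e, 0 < t -> 0 < e -> t + e < T -> tL1 T (fun s => dtstep t e s * m s) /\
     \int[leb]_(s in `[0, T[) (dtstep t e s * m s) = 0) ->
  forall t, 0 <= t < T -> m t = 0.
Proof.
move=> cm H.
have pos t : 0 < t < T -> m t = 0.
  move=> /andP[t0 tT]; apply/eqP; rewrite -normr_eq0 eq_le normr_ge0 andbT.
  apply/ler_addgt0Pr => eps eps0; rewrite add0r.
  have tT' : 0 <= t < T by rewrite ltW.
  have [r r0 Hr] := dtstep_eval cm tT' eps0.
  have r2 : 0 < r / 2 < r by apply/andP; split; lra.
  have [teT Hm] := Hr _ r2; have [r20 _] := andP r2.
  by have [l e0] := H t (r / 2) t0 r20 teT; have := Hm l; rewrite e0 sub0r normrN.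
move=> t /andP[]; rewrite le_eqVlt => /predU1P[<- T0|t0 tT]; last by apply: pos; rewrite t0.
apply/eqP; rewrite -normr_eq0 eq_le normr_ge0 andbT.
apply/ler_addgt0Pr => eps eps0; rewrite add0r.
have T0' : 0 <= (0 : R) < T by rewrite lexx.
have [r r0 Hr] := cm 0 T0' eps eps0.
pose s := Num.min (r / 2) (T / 2).
have s0 : 0 < s by rewrite lt_min !divr_gt0.
have [s1 s2] : s <= r / 2 /\ s <= T / 2 by rewrite /s !ge_min !lexx orbT.
have sT : 0 <= s < T by apply/andP; split; lra.
have := Hr s sT; rewrite subr0 ger0_norm ?(ltW s0)//.
rewrite (pos s) ?sub0r ?normrN; last by apply/andP; split; lra.
by apply; lra.
Qed.

End time_steps.

(** * Conservation laws invariant under translations *)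

Section conserved_functional.
Context {R : realType} {d : nat}.
Local Notation E := 'rV[R]_d.
Local Notation mu := (@lebesgue_rV R d).
Local Notation leb := (@lebesgue_measure R).
Variables (chi : E -> R) (j0 : 'I_d).
Hypothesis Hchi : cutoff chi.
Implicit Types (phi psi : R * E -> R) (z : E -> R).

Lemma tcont_slice T f z : cbt T f -> L1 mu z -> tcont T (fun t => \int[mu]_x (f t x * z x)).
Proof.
move=> cf lz t tT e e0.
pose I := \int[mu]_x `|z x|.
have I0 : 0 <= I by exact: Rintegral_ge0.
have e'0 : 0 < e / (I + 1) by rewrite divr_gt0// ltr_wpDl.
have [r r0 Hr] := cf.2 t tT _ e'0; exists r => // s sT st.
have [ms [Ms fMs]] := cf.1 s sT; have [mt [Mt fMt]] := cf.1 t tT.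
have [ls _] := L1_pair ms fMs lz; have [lt _] := L1_pair mt fMt lz.
have [_ b] := L1_pair (measurable_funB ms mt) (Hr s sT st) lz.
rewrite -RintegralB//; under eq_Rintegral do rewrite -mulrBl.
apply: le_trans b _; rewrite mulrAC ler_pdivrMr ?ltr_wpDl//.
by rewrite ler_pM2l// lerDl.
Qed.

Lemma tint_sum T (s : seq 'I_d) (h : 'I_d -> R -> R) : (forall k, tL1 T (h k)) ->
  tL1 T (fun t => \sum_(k <- s) h k t) /\
  \int[leb]_(t in `[0, T[) (\sum_(k <- s) h k t) = \sum_(k <- s) \int[leb]_(t in `[0, T[) h k t.
Proof.
move=> lh; elim: s => [|k s [IH1 IH2]].
  have -> : (fun t => \sum_(k <- [::]) h k t) = (fun=> 0) by apply/funext => t; rewrite big_nil.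
  split; first exact: integrable0.
  by rewrite big_nil Rintegral_cst ?mul0r//; exact: measurable_itv.
have -> : (fun t => \sum_(k <- k :: s) h k t) = (fun t => h k t + \sum_(k <- s) h k t).
  by apply/funext => t; rewrite big_cons.
split; last by rewrite big_cons -IH2; exact: tintD.
rewrite /tL1 in lh IH1 *; exact: (integrableD _ (lh k) IH1).
Qed.

Lemma ctest_tens T (Th : R -> R) z : smooth Th -> bsupp Th ->
  (exists2 t2, t2 < T & forall s, t2 < s -> Th s = 0) -> smooth z -> bsupp z ->
  ctest T (tens Th z).
Proof.
move=> sTh bTh [t2 t2T H] sz bz; split; [exact: smooth_tens|exact: bsupp_tens|].
by exists t2 => // p pt; rewrite /tens H// mul0r.
Qed.

Section fixed.
Variables (T : R) (f : R -> E -> R) (g : 'I_d -> R -> E -> R) (f0 : E -> R).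
Hypotheses (T0 : 0 < T) (cf : cbt T f) (cg : forall k, cbt T (g k)).
Hypotheses (mf0 : measurable_fun setT f0)
  (bf0 : exists M : R, {ae mu, forall x, `|f0 x| <= M}).
Local Notation Q := (Qf T f g f0).

Lemma sum_dir_x (y : E) : \sum_j y 0 j *: (dir_x j : R * E) = (0, y).
Proof.
transitivity ((0 : R), \sum_j y 0 j *: (unit_vec j : E)); last by rewrite -row_sum_delta.
elim: (index_enum 'I_d) => [|j s IH]; first by rewrite !big_nil.
rewrite !big_cons IH -[LHS]/(y 0 j *: 0 + 0, y 0 j *: unit_vec j + _).
by rewrite scaler0 addr0.
Qed.

(** The difference of two translates along an axis is a derivative of a test
    function, on which the functional vanishes. *)
Lemma Qf_translate phi (y : E) : (forall psi j, ctest T psi -> Q (fun p => 'D_(dir_x j) psi p) = 0) ->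
  ctest T phi -> Q (xshift y phi) = Q phi.
Proof.
move=> H tp.
have Cs psi (j : 'I_d) (b : R) := @ctest_shift_arg R d T j b psi.
have Ap psi (j : 'I_d) (b : R) : 0 < b -> ctest T psi -> Q (fun p => psi (p + b *: dir_x j)) = Q psi.
  move=> b0 tpsi; have [sp bp [t1 t1T pt]] := tpsi.
  have tl : ctest T (lineint psi (dir_x j) 0 b).
    split; [exact: smooth_lineint (ltW b0) sp|exact: bsupp_lineint (ltW b0) bp|].
    exists t1 => // p zt; rewrite /lineint.
    transitivity (\int[leb]_(r in `[0, b]) (fun=> 0 : R) r); last by rewrite Rintegral_cst// mul0r.
    by apply: eq_Rintegral => r _; apply: pt; rewrite fst_shift_x.
  have := H _ j tl.
  have -> : (fun p => 'D_(dir_x j) (lineint psi (dir_x j) 0 b) p) =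
      (fun p => psi (p + b *: dir_x j) - psi p).
    by apply/funext => p; exact: (derive_lineint_shift (dir_x j) p b0 sp).
  rewrite (QfB cf cg mf0 bf0 (Cs psi j b tpsi) tpsi) => /eqP.
  by rewrite subr_eq0 => /eqP.
have [_ ] := @shift_invariant R _ _ (fun j : 'I_d => dir_x j : R * E) (ctest T) Q Cs Ap phi
  (fun j => y 0 j) tp.
move=> <-; congr (Q _); apply/funext => -[t x].
by rewrite sum_dir_x /xshift -[X in _ = phi X]/(t + 0, x + y) addr0.
Qed.

(** Testing with a steep time step times [z] compares the pairings at times
    [t] and 0; the flux contributes a time integral over [0, t]. *)
Lemma Qf_speed z t t1 (M : R) : 0 <= t -> t < t1 -> t1 < T -> smooth z -> bsupp z ->
  (forall Th, smooth Th -> bsupp Th -> (exists2 t2, t2 < T & forall s, t2 < s -> Th s = 0) ->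
     Q (tens Th z) = 0) -> 0 <= M ->
  (forall s, 0 <= s <= t1 -> forall k, {ae mu, forall x, `|g k s x| <= M}) ->
  `|\int[mu]_x (f t x * z x) - \int[mu]_x (f0 x * z x)| <=
    t * (M * \sum_k \int[mu]_x `|'D_(unit_vec k) z x|).
Proof.
move=> t0 tt1 t1T sz bz HQ M0 gM.
have lz := L1_smooth_bsupp sz bz.
have ldz k : L1 mu (fun x => 'D_(unit_vec k) z x).
  exact: (L1_smooth_bsupp (smooth_derive (unit_vec k) sz) (bsupp_derive (unit_vec k) bz)).
pose m s := \int[mu]_x (f s x * z x).
pose N s := \sum_k \int[mu]_x (g k s x * 'D_(unit_vec k) z x).
(* The first factor bounds the support at negative times without changing times [s >= -1]. *)
pose Th e s := sstep chi j0 (s + 2) * (1 - tstep chi j0 t e s).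
have sTh e : smooth (Th e).
  apply: smoothM; last by apply: smoothB; [exact: smooth_cst|exact: smooth_tstep].
  apply: (smooth_comp_affine (V := R) (W := R) (L := fun s => s + 2) (L0 := fun s => s))
    (smooth_sstep j0 Hchi); first by move=> h y w; rewrite /GRing.scale/=; ring.
  have ci : continuous (fun s : R => s) by move=> x; exact: cvg_id.
  exact: (@contD _ _ _ _ ci (@contC _ _ 2)).
have Th1 e s : -1 <= s -> Th e s = 1 - tstep chi j0 t e s.
  by move=> s1; rewrite /Th (sstep1 j0 Hchi) ?mul1r//; lra.
have dTh e s : 0 <= s -> 'D_(1 : R) (Th e) s = - dtstep chi j0 t e s.
  move=> s0; have s1 : -1 < s by lra.
  transitivity ('D_(1 : R) (fun s => 1 - tstep chi j0 t e s) s).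
    apply: near_eq_derive; near=> r; apply: Th1; apply: ltW; near: r; exact: lt_nbhsr.
  have st := smooth_tstep j0 Hchi t e.
  have [D1 E1] := is_derive1D (is_derive1_cst 1 s) (is_derive1N (DeriveDef
    (smooth_derivable (x := s) (v := 1) st) (erefl ('D_(1 : R) (tstep chi j0 t e) s)))).
  by apply: (eq_trans E1); rewrite add0r.
have bTh e : 0 < e -> bsupp (Th e).
  move=> e0; exists (2 + t + e) => s Hs; have [s0|s0] := leP 0 s.
    by move: Hs; rewrite (ger0_norm s0) => Hs; rewrite /Th tstep1 ?subrr ?mulr0//; lra.
  by move: Hs; rewrite (ltr0_norm s0) => Hs; rewrite /Th (sstep0 j0 Hchi) ?mul0r//; lra.
have vTh e : 0 < e -> t + e < t1 -> exists2 t2, t2 < T & forall s, t2 < s -> Th e s = 0.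
  move=> e0 te; exists (t + e); first exact: lt_trans t1T.
  by move=> s st; rewrite /Th tstep1 ?subrr ?mulr0// ltW.
have cTh e : 0 < e -> t + e < t1 -> ctest T (tens (Th e) z).
  by move=> e0 te; apply: ctest_tens (bTh e e0) (vTh e e0 te) sz bz.
have pt (h : R -> E -> R) (ch : cbt T h) Ph (w : E -> R) s : L1 mu w -> 0 <= s < T ->
    pair h (tens Ph w) s = Ph s * \int[mu]_x (h s x * w x).
  by move=> lw sT; have [mh [Mh hM]] := ch.1 s sT; exact: pair_tens mh hM lw.
have eqL1 (h h' : R -> R) : (forall s, 0 <= s < T -> h s = h' s) -> tL1 T h -> tL1 T h'.
  move=> hh; apply: eq_integrable => [|s]; first exact: measurable_itv.
  by rewrite inE/= in_itv/= => /hh ->.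
have lm e : 0 < e -> t + e < t1 -> tL1 T (fun s => dtstep chi j0 t e s * m s).
  move=> e0 te; have ct := cTh e e0 te.
  have [cc bc tc] := ctest_cpair (ctest_derive (@dir_t R d) ct).
  have L := pair_tL1 cf cc bc tc.
  have L2 : tL1 T (fun s => - pair f (fun p => 'D_(@dir_t R d) (tens (Th e) z) p) s).
    exact: (integrableN L).
  apply: eqL1 L2 => s sT; have /andP[s0 _] := sT.
  have -> : pair f (fun p => 'D_(@dir_t R d) (tens (Th e) z) p) s =
      pair f (tens (fun s => 'D_(1 : R) (Th e) s) z) s.
    by apply: eq_Rintegral => x _; apply: (congr1 (fun r => f s x * r)); exact: tens_derive_t.
  by rewrite (pt f cf _ z s lz sT) dTh// mulNr opprK.
have gk k e s : 0 <= s < T -> pair (g k) (fun p => 'D_(dir_x k) (tens (Th e) z) p) s =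
    Th e s * \int[mu]_x (g k s x * 'D_(unit_vec k) z x).
  move=> sT; rewrite -(pt (g k) (cg k) _ _ s (ldz k) sT).
  by apply: eq_Rintegral => x _; apply: (congr1 (fun r => g k s x * r)); exact: tens_derive_x.
have lNk k e : 0 < e -> t + e < t1 ->
    tL1 T (fun s => (1 - tstep chi j0 t e s) * \int[mu]_x (g k s x * 'D_(unit_vec k) z x)).
  move=> e0 te; have ct := cTh e e0 te.
  have [cc bc tc] := ctest_cpair (ctest_derive (dir_x k) ct).
  apply: eqL1 (pair_tL1 (cg k) cc bc tc) => s sT; have /andP[s0 _] := sT.
  by rewrite gk// Th1//; lra.
have lN e : 0 < e -> t + e < t1 -> tL1 T (fun s => (1 - tstep chi j0 t e s) * N s).
  move=> e0 te; have [L _] := tint_sum (index_enum 'I_d) (fun k => lNk k e e0 te).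
  by apply: eqL1 L => s sT; rewrite /N mulr_sumr.
rewrite -/(m t); apply: (@time_localization R d chi j0 Hchi T m N _ _ t t1) => //.
- exact: tcont_slice.
- by rewrite mulr_ge0// sumr_ge0// => k _; exact: Rintegral_ge0.
- move=> s sI; have sT : 0 <= s < T by case/andP: sI => -> /le_lt_trans ->.
  rewrite /N mulr_sumr; apply: le_trans (ler_norm_sum _ _ _) _; apply: ler_sum => k _.
  by have [] := L1_pair ((cg k).1 s sT).1 (gM s sI k) (ldz k).
- move=> e e0 te; have ct := cTh e e0 te.
  have := HQ (Th e) (sTh e) (bTh e e0) (vTh e e0 te); rewrite /Qf rdD.unlock pair0.unlock.
  have -> : regular_dist T f (fun p => 'D_(@dir_t R d) (tens (Th e) z) p) =
      - \int[leb]_(s in `[0, T[) (dtstep chi j0 t e s * m s).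
    rewrite -mulN1r -RintegralZl//; last exact: lm.
    apply: eq_Rintegral => s; rewrite inE/= in_itv/= => sT; have /andP[s0 _] := sT.
    have -> : -1 * (dtstep chi j0 t e s * m s) = pair f (tens (fun r => 'D_(1 : R) (Th e) r) z) s.
      by rewrite (pt f cf _ z s lz sT) dTh// mulN1r mulNr.
    by apply: eq_Rintegral => x _; apply: (congr1 (fun r => f s x * r)); exact: tens_derive_t.
  have -> : \sum_k regular_dist T (g k) (fun p => 'D_(dir_x k) (tens (Th e) z) p) =
      \int[leb]_(s in `[0, T[) ((1 - tstep chi j0 t e s) * N s).
    transitivity (\sum_k \int[leb]_(s in `[0, T[)
       ((1 - tstep chi j0 t e s) * \int[mu]_x (g k s x * 'D_(unit_vec k) z x))).
      apply: eq_bigr => k _; apply: eq_Rintegral => s; rewrite inE/= in_itv/= => sT.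
      have /andP[s0 _] := sT; have := gk k e s sT; rewrite /pair => ->; rewrite Th1//; lra.
    have [_ <-] := tint_sum (index_enum 'I_d) (fun k => lNk k e e0 te).
    by apply: eq_Rintegral => s _; rewrite /N mulr_sumr.
  have -> : \int[mu]_x (f0 x * tens (Th e) z (0, x)) = \int[mu]_x (f0 x * z x).
    apply: eq_Rintegral => x _; rewrite /tens/= Th1 ?tstep0 ?subr0 ?mul1r//; lra.
  by rewrite opprK.
Unshelve. all: by end_near. Qed.

Let smooth_cut (P : E -> R) n : smooth P -> smooth (fun x => P x * chi (n.+1%:R^-1 *: x)) /\
  bsupp (fun x => P x * chi (n.+1%:R^-1 *: x)).
Proof.
move=> sP; split; first exact: smoothM sP (smooth_chiZ Hchi _).
by apply: bsuppMr; exact: bsupp_chil.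
Qed.

(** The cutoffs [P chi (x / n)] converge to [P], and their gradients differ
    from those of [P] by [O(1 / n)]. *)
Lemma Qf_speed_L1 (P : E -> R) t t1 (M : R) : 0 <= t -> t < t1 -> t1 < T ->
  smooth P -> L1 mu P -> (forall k, L1 mu (fun x => 'D_(unit_vec k) P x)) ->
  (forall phi, ctest T phi -> Q phi = 0) -> 0 <= M ->
  (forall s, 0 <= s <= t1 -> forall k, {ae mu, forall x, `|g k s x| <= M}) ->
  `|\int[mu]_x ((f t x - f0 x) * P x)| <=
    t * (M * \sum_k \int[mu]_x `|'D_(unit_vec k) P x|).
Proof.
move=> t0 tt1 t1T sP lP ldP HQ M0 gM.
have tT : 0 <= t < T by rewrite t0 (lt_trans tt1).
have [mf [Mf fM]] := cf.1 t tT; have [Mf0 f0M] := bf0.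
have [l1 _] := L1_pair mf fM lP; have [l2 _] := L1_pair mf0 f0M lP.
have lG : L1 mu (fun x => (f t x - f0 x) * P x).
  by have := L1B l1 l2; apply: eq_integrable => // x _ /=; rewrite mulrBl.
pose c n (x : E) := chi (n.+1%:R^-1 *: x).
have n1 n : 0 < n.+1%:R^-1 :> R by rewrite invr_gt0.
have c0 n x : 0 <= c n x by exact: (cutoff_ge0 j0 Hchi).
have c1 n x : c n x <= 1 by exact: (cutoff_le1 j0 Hchi).
have scn n : smooth (c n) by exact: smooth_chiZ.
have mc n : measurable_fun setT (c n) := continuous_measurable_rV (smooth_continuous (scn n)).
have cv x : c n x @[n --> \oo] --> (1 : R).
  apply: cvg_near_cst; near=> n; apply: (chiZ_one j0 Hchi) => //.
  rewrite mulrC ler_pdivrMr// mul1r; have : d%:R * `|x| <= n%:R.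
    by near: n; exact: nbhs_infty_ger.
  by move=> /le_trans; apply; rewrite ler_nat.
have cvG : \int[mu]_x ((f t x - f0 x) * P x * c n x) @[n --> \oo] -->
    \int[mu]_x ((f t x - f0 x) * P x).
  apply: (@Rdominated _ _ _ mu setT _ _ (fun x => `|(f t x - f0 x) * P x|)) => //.
  - by move=> n; apply: measurable_funM => //; exact: L1_measurable lG.
  - exact: L1_measurable lG.
  - move=> x _; rewrite -[X in _ --> X]mulr1; apply: cvgM; first exact: cvg_cst.
    exact: cv.
  - exact: L1_norm.
  - by move=> n x _; rewrite normrM ler_piMr// ger0_norm.
have [S S0 HS] : exists2 S : R, 0 <= S & forall k x, `|'D_(unit_vec k) chi x| <= S.
  have H k : exists S : R, 0 <= S /\ forall x, `|'D_(unit_vec k) chi x| <= S.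
    have [S S0 HS] := bsupp_bounded (@heine_borel_rV R d)
      (smooth_continuous (smooth_derive (unit_vec k) (cutoff_smooth Hchi)))
      (bsupp_derive (unit_vec k) (bsupp_chi Hchi)).
    by exists S.
  have [S HS] := choice H; exists (\sum_k S k).
    by apply: sumr_ge0 => k _; have [] := HS k.
  move=> k x; apply: le_trans ((HS k).2 x) _.
  by rewrite (bigD1 k)//= lerDl sumr_ge0// => i _; have [] := HS i.
have dc n k x : `|'D_(unit_vec k) (c n) x| <= n.+1%:R^-1 * S.
  have L h (y w : E) : n.+1%:R^-1 *: (h *: w + y) = h *: (n.+1%:R^-1 *: w) + n.+1%:R^-1 *: y.
    by rewrite scalerDr !scalerA mulrC.
  have e1 : 'D_(unit_vec k) (c n) x = 'D_(n.+1%:R^-1 *: unit_vec k) chi (n.+1%:R^-1 *: x).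
    exact: (derive_comp_affine chi x (unit_vec k) L).
  have e2 : 'D_(n.+1%:R^-1 *: unit_vec k) chi (n.+1%:R^-1 *: x) =
      n.+1%:R^-1 * 'D_(unit_vec k) chi (n.+1%:R^-1 *: x).
    have LL h (y w : R) : n.+1%:R^-1 *: x + (h *: w + y) *: unit_vec k =
       h *: (w *: unit_vec k) + (n.+1%:R^-1 *: x + y *: unit_vec k).
      by rewrite scalerDl -scalerA addrCA.
    have dd := is_derive_line (smooth_derivable (v := unit_vec k) (x := n.+1%:R^-1 *: x + 0 *: unit_vec k) (cutoff_smooth Hchi)).
    have [_ E2] := is_derive_dir n.+1%:R^-1 dd.
    have e3 := derive_comp_affine chi (0 : R) n.+1%:R^-1 LL.
    have := eq_trans (esym e3) E2; rewrite scale0r addr0; apply.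
  apply: (le_trans (y := `|n.+1%:R^-1 * 'D_(unit_vec k) chi (n.+1%:R^-1 *: x)|)).
    by rewrite le_eqVlt; apply/orP; left; apply/eqP; exact: (congr1 (fun r => `|r|) (eq_trans e1 e2)).
  by rewrite normrM (ger0_norm (ltW (n1 n))) ler_pM2l//.
pose D := \sum_k \int[mu]_x `|'D_(unit_vec k) P x|.
pose I := \int[mu]_x `|P x|.
have I0 : 0 <= I by exact: Rintegral_ge0.
have bound n : `|\int[mu]_x ((f t x - f0 x) * P x * c n x)| <=
    t * (M * D) + n.+1%:R^-1 * (t * (M * (d%:R * (S * I)))).
  have [sPc bPc] := smooth_cut n sP.
  have lPc := L1_smooth_bsupp sPc bPc.
  have [l3 _] := L1_pair mf fM lPc; have [l4 _] := L1_pair mf0 f0M lPc.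
  have := Qf_speed t0 tt1 t1T sPc bPc (fun Th sTh bTh vTh =>
    HQ _ (ctest_tens sTh bTh vTh sPc bPc)) M0 gM.
  have -> : \int[mu]_x (f t x * (P x * chi (n.+1%:R^-1 *: x))) -
      \int[mu]_x (f0 x * (P x * chi (n.+1%:R^-1 *: x))) =
      \int[mu]_x ((f t x - f0 x) * P x * c n x).
    by rewrite -RintegralB//; apply: eq_Rintegral => x _; rewrite /c; ring.
  move=> /le_trans; apply.
  have -> : t * (M * D) + n.+1%:R^-1 * (t * (M * (d%:R * (S * I)))) =
      t * (M * (D + d%:R * (n.+1%:R^-1 * (S * I)))) by ring.
  rewrite ler_wpM2l// ler_wpM2l// /D.
  have -> : d%:R * (n.+1%:R^-1 * (S * I)) = \sum_(k < d) (n.+1%:R^-1 * (S * I)).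
    by rewrite sumr_const card_ord mulr_natl.
  rewrite -big_split/=; apply: ler_sum => k _.
  have lS : L1 mu (fun x => n.+1%:R^-1 * S * `|P x|) := L1Z _ (L1_norm lP).
  have -> : n.+1%:R^-1 * (S * I) = \int[mu]_x (n.+1%:R^-1 * S * `|P x|).
    by rewrite RintegralZl ?mulrA//; exact: L1_norm.
  rewrite -RintegralD//; last exact: L1_norm.
  apply: ae_le_Rintegral.
  - apply: L1_norm; exact: (L1_smooth_bsupp (smooth_derive _ sPc) (bsupp_derive _ bPc)).
  - exact: L1D (L1_norm (ldP k)) lS.
  - apply: aeW => x.
    have e := congr1 (fun F => F x) (deriveMf (unit_vec k) sP (scn n)).
    apply: (le_trans (y := `|P x * 'D_(unit_vec k) (c n) x + c n x * 'D_(unit_vec k) P x|)).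
      by rewrite le_eqVlt; apply/orP; left; apply/eqP; exact: (congr1 (fun r => `|r|) e).
    apply: le_trans (ler_normD _ _) _; rewrite addrC; apply: lerD; rewrite normrM.
      by rewrite ler_piMl// ger0_norm.
    by rewrite mulrC ler_wpM2r.
have K0 : 0 <= t * (M * (d%:R * (S * I))) by rewrite !mulr_ge0.
apply/ler_addgt0Pr => e e0; have e2 : 0 < e / 2 by rewrite divr_gt0.
have [n [H1 H2]] : exists n, `|\int[mu]_x ((f t x - f0 x) * P x) -
    \int[mu]_x ((f t x - f0 x) * P x * c n x)| <= e / 2 /\
    n.+1%:R^-1 * (t * (M * (d%:R * (S * I)))) <= e / 2.
  near \oo => n; exists n; split.
    by near: n; move/cvgrPdist_le : cvG => /(_ _ e2).
  rewrite mulrC ler_pdivrMr//; have : (t * (M * (d%:R * (S * I)))) / (e / 2) <= n%:R.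
    by near: n; exact: nbhs_infty_ger.
  rewrite (ler_pdivrMr _ _ e2) => /le_trans; apply; rewrite mulrC ler_pM2l// ler_nat//.
have := bound n; set A := \int[mu]_x _ in H1 *; set B := \int[mu]_x _ in H1 * => H3.
have := ler_normD (A - B) B; rewrite subrK => H4; change (`|A| <= t * (M * D) + e).
apply: (le_trans H4); apply: (le_trans (lerD H1 H3)).
by rewrite addrCA lerD2l [leRHS](splitr e) lerD2l.
Unshelve. all: by end_near. Qed.
(** The speed estimate at time 0 for the test function [D_j z], on which the
    functional vanishes. *)
Lemma Qf_initial : (forall psi j, ctest T psi -> Q (fun p => 'D_(dir_x j) psi p) = 0) ->
  forall z j, smooth z -> bsupp z ->
  \int[mu]_x (f 0 x * 'D_(unit_vec j) z x) = \int[mu]_x (f0 x * 'D_(unit_vec j) z x).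
Proof.
move=> H z j sz bz.
have t1T : T / 2 < T by rewrite ltr_pdivrMr// ltr_pMr// ltr1n.
have /choice[M HM] : forall k, exists M : R, 0 <= M /\
    forall s, 0 <= s <= T / 2 -> {ae mu, forall x, `|g k s x| <= M}.
  by move=> k; have [M M0 HM] := cbt_bounded t1T (cg k); exists M.
have M0 : 0 <= \sum_k M k by apply: sumr_ge0 => k _; have [] := HM k.
have := Qf_speed (lexx 0) (divr_gt0 T0 (ltr0n _ 2)) t1T (smooth_derive (unit_vec j) sz)
  (bsupp_derive (unit_vec j) bz) (M := \sum_k M k).
rewrite mul0r normr_le0 subr_eq0 => HH; apply/eqP; apply: HH => //.
  move=> Th sTh bTh vTh; rewrite -[RHS](H (tens Th z) j (ctest_tens sTh bTh vTh sz bz)).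
  by congr (Q _); apply/funext => p; exact: (esym (tens_derive_x j p sTh sz)).
move=> s sI k; apply: filterS ((HM k).2 s sI) => x /le_trans; apply.
by rewrite (bigD1 k)//= lerDl sumr_ge0// => i _; have [] := HM i.
Qed.

End fixed.

Lemma smooth_tslice phi t : smooth phi -> smooth (fun x : E => phi (t, x)).
Proof.
move=> sp; apply: (smooth_comp_affine (L := fun x : E => (t, x)) (L0 := fun x : E => (0, x))) sp.
  by move=> h y w; rewrite -[RHS]/(h * 0 + t, h *: w + y) mulr0 add0r.
apply: (@lipschitz_continuous _ _ _ _ 1) => y w.
by rewrite mul1r prod_normE/= subrr normr0 ge_max normr_ge0 lexx.
Qed.

Lemma derive_tslice phi t k x : 'D_(unit_vec k) (fun x : E => phi (t, x)) x = 'D_(dir_x k) phi (t, x).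
Proof.
apply: (derive_comp_affine (L := fun x : E => (t, x)) (L0 := fun x : E => (0, x))).
by move=> h y w; rewrite -[RHS]/(h * 0 + t, h *: w + y) mulr0 add0r.
Qed.

Lemma cbt_const T (c : E -> R) (M : R) : measurable_fun setT c ->
  {ae mu, forall x, `|c x| <= M} -> cbt T (fun=> c).
Proof.
move=> mc cM; split=> t tT; first by split=> //; exists M.
move=> e e0; exists 1 => // s _ _; apply: aeW => x.
by rewrite subrr normr0 ltW.
Qed.

Lemma conv_kernel_bound (g p w : E -> R) (M B : R) : measurable_fun setT g ->
  {ae mu, forall x, `|g x| <= M} -> L1 mu p -> L1 mu w -> (forall x, `|w x| <= B) ->
  `|\int[mu]_x (g x * \int[mu]_y (p y * w (y - x)))| <=
    M * (\int[mu]_x `|w x|) * \int[mu]_y `|p y|.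
Proof.
move=> mg gM lp lw wB; apply: (conv_bound lp lw wB mg gM) => y.
have [lr _] := L1_reflect y lw.
have [_ b] := L1_pair mg gM lr; apply: (le_trans b).
by have [_ ->] := L1_reflect y (L1_norm lw).
Qed.

Let l1 n : 0 < n.+1%:R :> R. Proof. by rewrite ltr0n. Qed.

(** Dominated convergence in time; the dominating function is a multiple of
    the [L^1] norm of [phi] at time [t]. *)
Lemma average_vanish T F phi : 0 < T -> cbt T F -> cpair T phi ->
  (forall t, 0 <= t < T ->
    (fun n => \int[mu]_x (F t x * \int[mu]_y (phi (t, y) * kernel chi n.+1%:R (y - x)))) @ \oo
      --> (0 : R)) ->
  (fun n => \int[mu]_y (kernel chi n.+1%:R y * regular_dist T F (xshift y phi))) @ \oo --> (0 : R).
Proof.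
move=> T0 cF [cp bp [t1 t1T vt]] H.
pose w n := kernel chi n.+1%:R : E -> R.
have lw n : L1 mu (w n) := kernel_L1 Hchi (l1 n).
pose a n t := \int[mu]_y (w n y * pair F (xshift y phi) t).
have R3 n := rd_average T0 cF (And3 cp bp (ex_intro2 _ _ t1 t1T vt)) (lw n).
have la n : tL1 T (a n) by have [] := R3 n.
have -> : (fun n => \int[mu]_y (kernel chi n.+1%:R y * regular_dist T F (xshift y phi))) =
    (fun n => \int[leb]_(t in `[0, T[) a n t).
  by apply/funext => n; have [_ _] := R3 n.
have lp t : L1 mu (fun x => phi (t, x)) by exact: L1_tslice.
have [S S0 pS] := bsupp_bounded (@heine_borel_prod R d) cp bp.
have aE n t : 0 <= t < T -> a n t =
    \int[mu]_x (F t x * \int[mu]_y (phi (t, y) * w n (y - x))).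
  move=> tT; have [mF [M FM]] := cF.1 t tT; have [B HB] := kernel_bounded Hchi (l1 n).
  exact: (average_translates mF FM (lw n) HB (kernel_even _ _) (lp t) (fun x => pS (t, x))).
have [MF MF0 HMF] := cbt_bounded t1T cF.
pose I t := pair (fun _ _ => 1 : R) (fun p => `|phi p|) t.
have IE t : I t = \int[mu]_y `|phi (t, y)| by apply: eq_Rintegral => y _; rewrite mul1r.
have cabs : continuous (fun p => `|phi p|).
  by move=> p; apply: (continuous_comp (cp p)); exact: norm_continuous.
have babs : bsupp (fun p => `|phi p|).
  by have [A HA] := bp; exists A => p /HA ->; rewrite normr0.
have lI : tL1 T I.
  apply: (pair_tL1 (cbt_cst T 1) cabs babs); exists t1 => // p /vt ->; exact: normr0.
have lG : tL1 T (fun t => kernel_norm chi * MF * I t) by exact: (integrableZl _ _ lI).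
suff : (fun n => \int[leb]_(t in `[0, T[) a n t) @ \oo --> \int[leb]_(t in `[0, T[) (fun=> 0 : R) t.
  by rewrite Rintegral_cst ?mul0r//; exact: measurable_itv.
apply: (@Rdominated _ _ R leb `[0, T[%classic a (fun=> 0) (fun t => kernel_norm chi * MF * I t)).
- exact: measurable_itv.
- by move=> n; have /measurable_int/measurable_EFinP := la n.
- exact: measurable_cst.
- move=> t; rewrite /= in_itv/= => tT.
  by under eq_fun do rewrite (aE _ _ tT); exact: H.
- exact: lG.
- move=> n t; rewrite /= in_itv/= => tT; rewrite aE// IE.
  have [mF [M FM]] := cF.1 t tT; have [B HB] := kernel_bounded Hchi (l1 n).
  have [tt1|tt1] := leP t t1.
    have tI : 0 <= t <= t1 by case/andP: tT => -> _.
    have := conv_kernel_bound mF (HMF t tI) (lp t) (lw n) HB.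
    by rewrite (kernel_normE Hchi (l1 n)) [kernel_norm chi * MF]mulrC.
  have p0 : \int[mu]_y `|phi (t, y)| = 0.
    under eq_Rintegral do rewrite (vt (t, _) tt1) normr0.
    by rewrite Rintegral_cst// mul0r.
  have := conv_kernel_bound mF FM (lp t) (lw n) HB.
  by rewrite p0 !mulr0.
Qed.

Lemma kernel_by_parts (p : E -> R) k l x : 0 < l -> smooth p -> bsupp p ->
  \int[mu]_y ('D_(unit_vec k) p y * kernel chi l (y - x)) =
  - \int[mu]_y (p y * 'D_(unit_vec k) (kernel chi l) (y - x)).
Proof.
move=> l0 sp bp; have sw := kernel_smooth Hchi l0.
have sws : smooth (fun y => kernel chi l (y - x)).
  apply: (smooth_comp_affine (L := fun y : E => y - x) (L0 := fun y : E => y)) sw.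
    by move=> h y w; rewrite addrA.
  apply: (@lipschitz_continuous _ _ _ _ 1) => y w.
  by rewrite mul1r opprB addrA subrK.
have dw y : 'D_(unit_vec k) (fun y => kernel chi l (y - x)) y =
    'D_(unit_vec k) (kernel chi l) (y - x).
  apply: (derive_comp_affine (L := fun y : E => y - x) (L0 := fun y : E => y)).
  by move=> h u w; rewrite addrA.
have bpw : bsupp (fun y => p y * kernel chi l (y - x)) := bsuppMl _ bp.
have := Rintegral_derive0 k (smoothM sp sws) bpw.
have e := deriveMf (unit_vec k) sp sws.
have lA : L1 mu (fun y => p y * 'D_(unit_vec k) (kernel chi l) (y - x)).
  have -> : (fun y => p y * 'D_(unit_vec k) (kernel chi l) (y - x)) =
    (fun y => p y * 'D_(unit_vec k) (fun y => kernel chi l (y - x)) y).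
    by apply/funext => y; apply: (congr1 (fun r => p y * r)); exact: esym (dw y).
  apply: L1_smooth_bsupp; first exact: smoothM sp (smooth_derive _ sws).
  exact: bsuppMl.
have lB : L1 mu (fun y => 'D_(unit_vec k) p y * kernel chi l (y - x)).
  apply: L1_smooth_bsupp; first exact: smoothM (smooth_derive _ sp) sws.
  exact: bsuppMl _ (bsupp_derive _ bp).
have -> : \int[mu]_y 'D_(unit_vec k) (fun y => p y * kernel chi l (y - x)) y =
   \int[mu]_y (p y * 'D_(unit_vec k) (kernel chi l) (y - x) +
     'D_(unit_vec k) p y * kernel chi l (y - x)).
  apply: eq_Rintegral => y _; apply: (eq_trans (congr1 (fun F => F y) e)).
  by apply: f_equal2; [apply: (congr1 (fun r => p y * r)); exact: dw|rewrite mulrC].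
rewrite RintegralD// => /eqP; rewrite addrC addr_eq0 => /eqP; exact.
Qed.

Lemma cvg_sum0 (B : 'I_d -> R^nat) (s : seq 'I_d) : (forall k, B k @ \oo --> (0 : R)) ->
  (fun n => \sum_(k <- s) B k n) @ \oo --> (0 : R).
Proof.
move=> H; elim: s => [|k s IH].
  by under eq_fun do rewrite big_nil; exact: cvg_cst.
under eq_fun do rewrite big_cons.
by have HH := cvgD (H k) IH; rewrite addr0 in HH; exact: HH.
Qed.

(** By translation invariance, averaging against the kernel multiplies the
    functional by the nonzero mass of the kernel.  The flux terms of the
    average tend to 0 because a derivative can be moved to the kernel, and
    the density term does so by hypothesis, once [f 0] has been subtracted
    from [f]. *)
Lemma Qf_zero T f (g : 'I_d -> R -> E -> R) (f0 : E -> R) : 0 < T -> cbt T f ->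
  (forall k, cbt T (g k)) -> (forall x, f0 x = f 0 x) ->
  (forall psi j, ctest T psi -> Qf T f g f0 (fun p => 'D_(dir_x j) psi p) = 0) ->
  (forall t p, 0 <= t < T -> smooth p -> bsupp p ->
    (fun n => \int[mu]_x ((f t x - f 0 x) *
        \int[mu]_y (p y * kernel chi n.+1%:R (y - x)))) @ \oo --> (0 : R)) ->
  forall phi, ctest T phi -> Qf T f g f0 phi = 0.
Proof.
move=> T0 cf cg /funext -> H L phi tp.
have zT : (0 : R) <= 0 < T by rewrite lexx.
have [mc [M cM]] := cf.1 0 zT.
have cc := cbt_const T mc cM.
pose F t x := f t x - f 0 x.
have cF : cbt T F := cbtB cf cc.
have QE psi : ctest T psi -> Qf T f g (f 0) psi =
    - regular_dist T F (fun p => 'D_(@dir_t R d) psi p)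
    - \sum_k regular_dist T (g k) (fun p => 'D_(dir_x k) psi p).
  move=> tpsi; rewrite /Qf rdD.unlock pair0.unlock.
  have -> : regular_dist T f (fun p => 'D_(@dir_t R d) psi p) =
      regular_dist T F (fun p => 'D_(@dir_t R d) psi p) - \int[mu]_x (f 0 x * psi (0, x)).
    rewrite -(rd_constant_in_time T0 mc cM tpsi).
    rewrite -(rd_addf cF cc (ctest_cpair (ctest_derive (@dir_t R d) tpsi))).
    apply: (congr1 (fun h => regular_dist T h _)); apply/funext => t; apply/funext => x.
    by rewrite /F subrK.
  by ring.
have mb : exists M' : R, {ae mu, forall x, `|f 0 x| <= M'} by exists M.
pose A n := \int[mu]_y (kernel chi n.+1%:R y *
  regular_dist T F (xshift y (fun p => 'D_(@dir_t R d) phi p))).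
pose B k n := \int[mu]_y (kernel chi n.+1%:R y *
  regular_dist T (g k) (xshift y (fun p => 'D_(dir_x k) phi p))).
have lw n : L1 mu (kernel chi n.+1%:R) := kernel_L1 Hchi (l1 n).
have ct v := ctest_cpair (ctest_derive v tp).
have E1 n : kernel_int chi * Qf T f g (f 0) phi = - A n - \sum_k B k n.
  rewrite -(kernel_intE Hchi (l1 n)).
  rewrite -(Rintegral_mul_const (lw n)
     (fun y => @Qf_translate T f g (f 0) cf cg mc mb phi y H tp)).
  have [LA _ _] := rd_average T0 cF (ct (@dir_t R d)) (lw n).
  have LB k := rd_average T0 (cg k) (ct (dir_x k)) (lw n).
  have LS : L1 mu (fun y => \sum_k (kernel chi n.+1%:R y *
      regular_dist T (g k) (xshift y (fun p => 'D_(dir_x k) phi p)))).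
    by apply: L1_sum => k _; have [] := LB k.
  transitivity (\int[mu]_y ((- (kernel chi n.+1%:R y *
      regular_dist T F (xshift y (fun p => 'D_(@dir_t R d) phi p)))) -
     \sum_k (kernel chi n.+1%:R y *
      regular_dist T (g k) (xshift y (fun p => 'D_(dir_x k) phi p))))).
    apply: eq_Rintegral => y _; rewrite QE; last exact: ctest_xshift.
    have xd v (G : R -> E -> R) : regular_dist T G (fun p => 'D_v (xshift y phi) p) =
        regular_dist T G (xshift y (fun p => 'D_v phi p)).
      by apply: (congr1 (regular_dist T G)); apply/funext => p; exact: xshift_derive.
    have alg (K a : R) (r : 'I_d -> R) : K * (- a - \sum_k r k) = - (K * a) - \sum_k (K * r k).
      by rewrite mulrBr mulrN mulr_sumr.
    apply: eq_trans (alg _ _ _); apply: (congr1 (fun r => kernel chi n.+1%:R y * r)).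
    apply: (f_equal2 (fun a b : R => - a - b)); first exact: xd.
    by apply: eq_bigr => k _; exact: xd.
  rewrite RintegralB//; last exact: L1N.
  congr (_ - _).
    by rewrite /A -mulN1r -RintegralZl//; apply: eq_Rintegral => y _; rewrite mulN1r.
  by apply: Rintegral_sum => k _; have [] := LB k.
have cA : A @ \oo --> (0 : R).
  apply: (average_vanish T0 cF (ct (@dir_t R d))) => t tT.
  have [sp bp _] := ctest_derive (@dir_t R d) tp.
  exact: L t _ tT (smooth_tslice t sp) (bsupp_tslice t bp).
have cB k : B k @ \oo --> (0 : R).
  apply: (average_vanish T0 (cg k) (ct (dir_x k))) => t tT.
  have [sp bp _] := tp; have [mg [Mg gMg]] := (cg k).1 t tT.
  have sps := smooth_tslice t sp; have bps := bsupp_tslice t bp.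
  pose C := Mg * kernel_dnorm chi (unit_vec k) * \int[mu]_y `|phi (t, y)|.
  apply: norm_cvg0.
  apply: (@squeeze_cvgr _ _ _ _ (fun=> 0) (fun n => n.+1%:R^-1 * C)); last first.
  - rewrite -[X in _ --> X](mul0r C); apply: cvgMl; exact: cvg_harmonic.
  - exact: cvg_cst.
  - apply: nearW => n; rewrite normr_ge0/=.
    have [ld dn] := kernel_derive Hchi (unit_vec k) (l1 n).
    have [Bd HBd] := kernel_derive_bounded Hchi (unit_vec k) (l1 n).
    have := conv_kernel_bound mg gMg (L1_smooth_bsupp sps bps) ld HBd.
    rewrite dn => b; apply: (le_trans (y := `|\int[mu]_x (g k t x * \int[mu]_y
      (phi (t, y) * 'D_(unit_vec k) (kernel chi n.+1%:R) (y - x)))|)); last first.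
      by apply: (le_trans b); rewrite /C le_eqVlt; apply/orP; left; apply/eqP; ring.
    rewrite -normrN -mulN1r -RintegralZl//; last first.
      have [Bk HBk] := kernel_bounded Hchi (l1 n).
      have [cd bd _] := ct (dir_x k).
      by have [] := L1_pair mg gMg (L1_conv (L1_tslice t cd bd) (lw n) HBk).
    rewrite le_eqVlt; apply/orP; left; apply/eqP; apply: (congr1 (fun r : R => `|r|)).
    apply: eq_Rintegral => x _; rewrite mulN1r -mulrN; congr (_ * _).
    rewrite -[RHS]opprK; apply: (congr1 (fun r : R => - r)).
    apply: eq_trans (kernel_by_parts k x (l1 n) sps bps).
    apply: eq_Rintegral => y _; apply: (congr1 (fun r => r * _)).
    exact: esym (derive_tslice phi t k y).
have : (fun n => - A n - \sum_k B k n) @ \oo --> (- 0 - 0 : R).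
  by apply: cvgB; [exact: cvgN|exact: cvg_sum0].
have -> : (fun n => - A n - \sum_k B k n) = (fun=> kernel_int chi * Qf T f g (f 0) phi).
  by apply/funext => n; exact: esym (E1 n).
move=> c0; have c1 : (fun _ : nat => kernel_int chi * Qf T f g (f 0) phi) @ \oo -->
    (kernel_int chi * Qf T f g (f 0) phi) by exact: cvg_cst.
have e0 : kernel_int chi * Qf T f g (f 0) phi = - 0 - 0.
  by rewrite -(cvg_lim (@norm_hausdorff _ R) c1) (cvg_lim (@norm_hausdorff _ R) c0).
have : kernel_int chi * Qf T f g (f 0) phi = 0 by rewrite e0 oppr0 addr0.
move/eqP.
by rewrite mulf_eq0 (negbTE (kernel_int_neq0 j0 Hchi)) => /eqP.
Qed.
(** The finite speed estimate applied to translates of the kernel, whose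
    gradient has an [L^1] norm of order [1 / l]. *)
Lemma Qf_zero_conv T f (g : 'I_d -> R -> E -> R) (f0 : E -> R) t : cbt T f ->
  (forall k, cbt T (g k)) -> (forall x, f0 x = f 0 x) -> 0 <= t < T ->
  (forall phi, ctest T phi -> Qf T f g f0 phi = 0) ->
  exists2 C : R, 0 <= C & forall l p, 0 < l -> L1 mu p ->
    `|\int[mu]_x ((f t x - f 0 x) * \int[mu]_y (p y * kernel chi l (y - x)))| <=
      C / l * \int[mu]_x `|p x|.
Proof.
move=> cf cg /funext -> tT HQ; have /andP[t0 tT'] := tT.
have T0 : 0 < T by exact: le_lt_trans tT'.
have zT : (0 : R) <= 0 < T by rewrite lexx.
have [mc [M0 cM0]] := cf.1 0 zT; have [mt [Mt ftM]] := cf.1 t tT.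
have mb : exists M' : R, {ae mu, forall x, `|f 0 x| <= M'} by exists M0.
pose t1 := (t + T) / 2.
have tt1 : t < t1 by rewrite /t1; lra.
have t1T : t1 < T by rewrite /t1; lra.
have /choice[M HM] : forall k, exists M : R, 0 <= M /\
    forall s, 0 <= s <= t1 -> {ae mu, forall x, `|g k s x| <= M}.
  by move=> k; have [M M0' HM] := cbt_bounded t1T (cg k); exists M.
have SM0 : 0 <= \sum_k M k by apply: sumr_ge0 => k _; have [] := HM k.
have gM s : 0 <= s <= t1 -> forall k, {ae mu, forall x, `|g k s x| <= \sum_k M k}.
  move=> sI k; apply: filterS ((HM k).2 s sI) => x /le_trans; apply.
  by rewrite (bigD1 k)//= lerDl sumr_ge0// => i _; have [] := HM i.
have [ld1 dn1] := kernel_derive Hchi (0 : E) (ltr01 : 0 < (1 : R)).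
have dn0 k : 0 <= kernel_dnorm chi (unit_vec k).
  have [_ e] := kernel_derive Hchi (unit_vec k) (ltr01 : 0 < (1 : R)).
  by rewrite invr1 mul1r in e; rewrite -e; exact: Rintegral_ge0.
exists (t * ((\sum_k M k) * (\sum_k kernel_dnorm chi (unit_vec k)))).
  by apply: mulr_ge0 => //; apply: mulr_ge0 => //; exact: sumr_ge0.
move=> l p l0 lp.
have [B HB] := kernel_bounded Hchi l0.
have lw := kernel_L1 Hchi l0.
have mF : measurable_fun setT (fun x => f t x - f 0 x) := measurable_funB mt mc.
have FM : {ae mu, forall x, `|f t x - f 0 x| <= Mt + M0}.
  by near=> x; apply: (le_trans (ler_normB _ _)); apply: lerD; near: x.
apply: (conv_bound lp lw HB mF FM) => y.
pose P x := kernel chi l (x - y).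
have L h (u w : E) : h *: w + u - y = h *: w + (u - y) by rewrite addrA.
have sP : smooth P.
  apply: (smooth_comp_affine (L := fun x : E => x - y) (L0 := fun x : E => x)) (kernel_smooth Hchi l0) => //.
  apply: (@lipschitz_continuous _ _ _ _ 1) => u w.
  by rewrite mul1r opprB addrA subrK.
have dP k : (fun x => 'D_(unit_vec k) P x) = (fun x => 'D_(unit_vec k) (kernel chi l) (x - y)).
  apply/funext => x.
  exact: (derive_comp_affine (L := fun x : E => x - y) (L0 := fun x : E => x)).
have [lP _] := L1_translate (- y) lw.
have ldP k : L1 mu (fun x => 'D_(unit_vec k) P x).
  rewrite dP; have [ld _] := kernel_derive Hchi (unit_vec k) l0.
  by have [] := L1_translate (- y) ld.
have := Qf_speed_L1 cf cg mc mb t0 tt1 t1T sP lP ldP HQ SM0 gM.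
have -> : \int[mu]_x ((f t x - f 0 x) * P x) = \int[mu]_x ((f t x - f 0 x) * kernel chi l (y - x)).
  by apply: eq_Rintegral => x _; rewrite /P -kernel_even opprB.
move=> /le_trans; apply.
have -> : \sum_k \int[mu]_x `|'D_(unit_vec k) P x| = \sum_k (l^-1 * kernel_dnorm chi (unit_vec k)).
  apply: eq_bigr => k _; have [ld dn] := kernel_derive Hchi (unit_vec k) l0.
  have [_ e1] := L1_translate (- y) (L1_norm ld).
  apply: eq_trans dn; apply: eq_trans e1.
  by apply: eq_Rintegral => x _; exact: (congr1 (fun F => `|F x|) (dP k)).
rewrite -mulr_sumr le_eqVlt; apply/orP; left; apply/eqP; ring.
Unshelve. all: by end_near. Qed.

Lemma tcont_sum T (m : 'I_d -> R -> R) (s : seq 'I_d) : (forall k, tcont T (m k)) ->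
  tcont T (fun t => \sum_(k <- s) m k t).
Proof.
move=> cm; elim: s => [|k s IH] t tT e e0.
  by exists 1 => // r _ _; rewrite !big_nil subrr normr0 ltW.
have e2 : 0 < e / 2 by rewrite divr_gt0.
have [r1 r10 H1] := cm k t tT _ e2; have [r2 r20 H2] := IH t tT _ e2.
exists (Num.min r1 r2); first by rewrite lt_min r10.
move=> u uT; rewrite lt_min => /andP[u1 u2]; rewrite !big_cons opprD addrACA.
by rewrite [leRHS](splitr e); apply: (le_trans (ler_normD _ _)); apply: lerD; [exact: H1|exact: H2].
Qed.

(** The constraint is tested with functions concentrated just after a given
    time; time 0 is reached by continuity. *)
Lemma fixed_time_divergence T (v : 'I_d -> R -> E -> R) : (forall k, cbt T (v k)) ->
  (forall phi, ctest T phi -> (exists2 t0, 0 < t0 & forall p, p.1 < t0 -> phi p = 0) ->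
     \sum_k regular_dist T (v k) (fun p => 'D_(dir_x k) phi p) = 0) ->
  forall t z, 0 <= t < T -> smooth z -> bsupp z ->
  \sum_k \int[mu]_x (v k t x * 'D_(unit_vec k) z x) = 0.
Proof.
move=> cv H t z tT sz bz; move: t tT.
have ldz k : L1 mu (fun x => 'D_(unit_vec k) z x).
  exact: (L1_smooth_bsupp (smooth_derive (unit_vec k) sz) (bsupp_derive (unit_vec k) bz)).
apply: (time_vanishing Hchi (chi := chi) (j0 := j0)).
  by apply: tcont_sum => k; exact: tcont_slice.
move=> t e t0 e0 te.
pose Th := dtstep chi j0 t e.
have sTh : smooth Th := smooth_derive (1 : R) (smooth_tstep j0 Hchi t e).
have bTh : bsupp Th.
  exists (t + e) => s Hs; have [s0|s0] := leP 0 s; apply: (dtstep0 j0 Hchi) => //.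
    by move: Hs; rewrite (ger0_norm s0); right.
  by left; exact: lt_trans t0.
have vTh : exists2 t2, t2 < T & forall s, t2 < s -> Th s = 0.
  by exists (t + e) => // s st; apply: (dtstep0 j0 Hchi) => //; right.
have ct := ctest_tens sTh bTh vTh sz bz.
have gk k s : 0 <= s < T -> pair (v k) (fun p => 'D_(dir_x k) (tens Th z) p) s =
    Th s * \int[mu]_x (v k s x * 'D_(unit_vec k) z x).
  move=> sT; have [mv [Mv vM]] := (cv k).1 s sT.
  rewrite -(pair_tens Th mv vM (ldz k)).
  by apply: eq_Rintegral => x _; apply: (congr1 (fun r => v k s x * r)); exact: tens_derive_x.
have lk k : tL1 T (fun s => Th s * \int[mu]_x (v k s x * 'D_(unit_vec k) z x)).
  have [cc bc tc] := ctest_cpair (ctest_derive (dir_x k) ct).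
  have := pair_tL1 (cv k) cc bc tc; apply: eq_integrable => [|s]; first exact: measurable_itv.
  by rewrite inE/= in_itv/= => sT; rewrite gk.
have [L E1] := tint_sum (index_enum 'I_d) lk.
have eS : (fun s => Th s * \sum_k \int[mu]_x (v k s x * 'D_(unit_vec k) z x)) =
    (fun s => \sum_k (Th s * \int[mu]_x (v k s x * 'D_(unit_vec k) z x))).
  by apply/funext => s; rewrite mulr_sumr.
rewrite -/Th eS; split; first exact: L.
rewrite E1; transitivity (\sum_k regular_dist T (v k) (fun p => 'D_(dir_x k) (tens Th z) p)).
  apply: eq_bigr => k _; rewrite rd_pair; apply: eq_Rintegral => s.
  by rewrite inE/= in_itv/= => sT; rewrite gk.
apply: H => //; exists t => // p pt.
by rewrite /tens /Th (dtstep0 j0 Hchi) ?mul0r//; left.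
Qed.

End conserved_functional.

(** * Bounded vector fields *)

Section bounded_fields.
Context {R : realType} {d : nat}.
Local Notation E := 'rV[R]_d.
Local Notation mu := (@lebesgue_rV R d).
Local Notation leb := (@lebesgue_measure R).
Variable j0 : 'I_d.
Implicit Types (f : E -> E) (v : R -> E -> E).

Lemma mu_gt0 : (0 < mu [set: E])%E.
Proof.
apply: (@lt_le_trans _ _ (mu (obox (fun=> 0) (fun=> 1)))).
  by rewrite obox_measure lte_fin; apply: prodr_gt0 => i _; rewrite subr0 lt_max ltr01 orbT.
by apply: le_measure; rewrite ?inE//; exact: measurable_obox.
Qed.

Lemma Linfty_normP f (M : R) :
  (Linfty_norm f <= M%:E)%E <-> {ae mu, forall x, enorm (f x) <= M}.
Proof.
rewrite /Linfty_norm Lnorm.unlock mu_gt0; split=> [/ess_supP|H].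
  by apply: filterS => x; rewrite /= lee_fin ger0_norm// enorm_ge0.
apply/ess_supP; apply: filterS H => x H.
by rewrite /= lee_fin ger0_norm// enorm_ge0.
Qed.

Lemma enorm_le_coord (x : E) (M : R) : 0 <= M -> (forall i, `|x 0 i| <= M) ->
  enorm x <= d%:R * M.
Proof.
move=> M0 H; apply: le_trans (enorm_le j0 x) _; rewrite ler_wpM2l//.
rewrite [leLHS]mx_normrE; apply: bigmax_le => //= -[i j] _.
by rewrite ord1; exact: H.
Qed.

Lemma Linfty_coord f (M : R) i : (Linfty_norm f <= M%:E)%E -> {ae mu, forall x, `|f x 0 i| <= M}.
Proof. by move/Linfty_normP; apply: filterS => x /(le_trans (coord_le_enorm _ _)). Qed.

Lemma coord_Linfty f (M : R) : 0 <= M -> (forall i, {ae mu, forall x, `|f x 0 i| <= M}) ->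
  (Linfty_norm f <= (d%:R * M)%:E)%E.
Proof.
move=> M0 H; apply/Linfty_normP; have : {ae mu, forall x, forall i, `|f x 0 i| <= M} by apply: filter_forall.
by apply: filterS => x Hx; exact: enorm_le_coord.
Qed.

Lemma Linfty_norm_ge0 f : (0 <= Linfty_norm f)%E.
Proof. exact: Lnorm_ge0. Qed.

Lemma in_LinftyP f : in_Linfty f <-> forall i, measurable_fun setT (fun x => f x 0 i) /\
  exists M : R, {ae mu, forall x, `|f x 0 i| <= M}.
Proof.
split=> [[mf nf] i|H].
  split; first exact: (measurableT_comp (measurable_rV_coord i) mf).
  exists (fine (Linfty_norm f)); apply: Linfty_coord.
  by rewrite fineK// ge0_fin_numE// Linfty_norm_ge0.
split; first by apply: measurable_fun_rVP => i; have [] := H i.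
have /choice[M HM] := fun i => (H i).2.
apply: le_lt_trans (ltry (d%:R * \sum_i `|M i|)); apply: coord_Linfty.
  by apply: sumr_ge0 => i _.
move=> i; apply: filterS (HM i) => x /le_trans; apply; apply: (le_trans (ler_norm _)).
by rewrite (bigD1 i)//= lerDl sumr_ge0.
Qed.

(** Continuity in time with values in the space of bounded fields can be
    read on components. *)
Lemma C0_Linfty_coord T v i : C0_Linfty T v -> cbt T (component v i).
Proof.
move=> H; split=> t tT.
  by have [/in_LinftyP /(_ i)] := H t tT.
move=> e e0; have [_ /fine_cvgP[F C]] := H t tT.
have /cvgrPdist_lt /(_ e e0) {}C := C.
have : \forall s \near within `[0, T[ (nbhs t), (Linfty_norm (v s \- v t)%R <= e%:E)%E.
  near=> s; have sF : Linfty_norm (v s \- v t)%R \is a fin_num by near: s.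
  have : `|0 - fine (Linfty_norm (v s \- v t)%R)| < e by near: s.
  rewrite sub0r normrN ger0_norm; last by rewrite fine_ge0// Linfty_norm_ge0.
  by move=> /ltW; rewrite -lee_fin fineK.
rewrite near_withinE => /nbhs_ballP[r r0 Hr]; exists r => // s sT st.
have := Hr s; rewrite /= /ball/= distrC => /(_ st).
rewrite in_itv/= => /(_ sT) /(Linfty_coord i); apply: filterS => x.
by rewrite /component /= !mxE.
Unshelve. all: by end_near. Qed.

Lemma Linfty_continuous T v : (forall i, cbt T (component v i)) ->
  forall t, 0 <= t < T -> forall e : R, 0 < e -> exists2 r : R, 0 < r &
  forall s, 0 <= s < T -> `|s - t| < r -> (Linfty_norm (v s \- v t)%R <= e%:E)%E.
Proof.
move=> H t tT e e0; have e1 : 0 < e / d.+1%:R by rewrite divr_gt0.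
have /choice[r Hr] : forall i, exists r : R, 0 < r /\ forall s, 0 <= s < T -> `|s - t| < r ->
    {ae mu, forall x, `|component v i s x - component v i t x| <= e / d.+1%:R}.
  by move=> i; have [r r0 Hr] := (H i).2 t tT _ e1; exists r.
exists (\big[Num.min/1]_i r i).
  by apply: lt_bigmin => // i _; have [] := Hr i.
move=> s sT st; apply: (@le_trans _ _ (d%:R * (e / d.+1%:R))%:E).
  apply: coord_Linfty => [|i]; first exact: ltW.
  have st' : `|s - t| < r i by apply: (lt_le_trans st); exact: bigmin_le_cond.
  by apply: filterS ((Hr i).2 s sT st') => x; rewrite /component /= !mxE.
rewrite lee_fin mulrCA; apply: ler_piMr; first exact: ltW.
by rewrite ler_pdivrMr// mul1r ler_nat.
Qed.

Lemma in_Linfty_time T v t : (forall i, cbt T (component v i)) -> 0 <= t < T -> in_Linfty (v t).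
Proof. by move=> H tT; apply/in_LinftyP => i; have [/(_ t tT)] := H i. Qed.

(** The norm of a field may fail to be measurable in time; monotonicity
    comes from the definition of the integral of a nonnegative function as a
    supremum over simple functions. *)
Lemma ge0_integral_le_cst (D : set R) (h : R -> \bar R) (C : R) : measurable D ->
  (forall t, D t -> 0 <= h t <= C%:E)%E -> (\int[leb]_(t in D) h t <= C%:E * leb D)%E.
Proof.
move=> mD H; have [->|/set0P[t0 Dt0]] := eqVneq D set0.
  by rewrite integral_set0 measure0 mule0.
rewrite -(integral_cst leb mD) [leLHS]integral_mkcond [leRHS]integral_mkcond.
rewrite [leLHS]ge0_integralTE; last first.
  by move=> t; rewrite patchE; case: ifPn => // /set_mem /H /andP[].
rewrite [leRHS]ge0_integralTE; last first.
  by move=> t; rewrite patchE; case: ifPn => // /set_mem /H /andP[]; exact: le_trans.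
apply: le_ereal_sup => _ [h' Hh <-]; exists h' => // t; apply: (le_trans (Hh t)).
by rewrite !patchE; case: ifPn => // /set_mem /H /andP[].
Qed.

(** Step functions in time on a regular grid approximate a continuous field;
    its norm is bounded on compact intervals. *)
Lemma C0_L2loc T v : 0 < T -> (forall i, cbt T (component v i)) -> L2loc_Linfty T v.
Proof.
move=> T0 H; split.
- by apply: aeW => t tT; exact: in_Linfty_time H tT.
- pose grid n (i : nat) : R := i%:R * (T / n.+1%:R).
  pose A n (i : 'I_n.+1) := `[grid n i, grid n i.+1[%classic : set R.
  exists (fun n t x => \sum_(i < n.+1) \1_(A n i) t *: v (grid n i) x).
    move=> n; exists n.+1, (A n), (fun i => v (grid n i)); split=> // i; split.
      exact: measurable_itv.
    apply: in_Linfty_time H _; rewrite mulr_ge0//= ?divr_ge0 ?(ltW T0)//.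
    by rewrite /grid mulrCA gtr_pMr// ltr_pdivrMr// mul1r ltr_nat.
  apply: aeW => t tT; have /andP[t0 tT'] := tT.
  have step n : exists i : nat, [/\ 0 <= grid n i < T, `|grid n i - t| <= T / n.+1%:R &
      forall x, \sum_(i < n.+1) \1_(A n i) t *: v (grid n i) x = v (grid n i) x].
    have h0 : 0 < T / n.+1%:R by rewrite divr_gt0.
    have q0 : 0 <= t / (T / n.+1%:R) by rewrite divr_ge0// ltW.
    have /andP[k1 k2] := truncn_itv q0; set k := Num.truncn _ in k1 k2.
    have kn : (k < n.+1)%N.
      rewrite -(ltr_nat R); apply: le_lt_trans k1 _; rewrite ltr_pdivrMr//.
      by rewrite mulrC divfK.
    rewrite ler_pdivlMr// in k1; rewrite ltr_pdivrMr// in k2.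
    have gS (i : nat) : grid n i.+1 = grid n i + T / n.+1%:R by rewrite /grid mulrSr mulrDl mul1r.
    exists k; split => /=.
    - by rewrite mulr_ge0 ?(ltW h0)//= (le_lt_trans k1).
    - rewrite -/(grid n k) in k1; rewrite -/(grid n k.+1) gS in k2.
      rewrite ler0_norm ?subr_le0// opprB lerBlDl; exact: ltW.
    have AE i : A n i t <-> grid n i <= t < grid n i.+1 by rewrite /A/= in_itv.
    move=> x; rewrite (bigD1 (Ordinal kn))//= big1 ?addr0.
      by rewrite indicE mem_set ?scale1r//; apply/AE/andP.
    move=> i ik; rewrite indicE memNset ?scale0r// => /AE/andP[i1 i2].
    have lt_grid (a b : nat) : grid n a < grid n b -> (a < b)%N by rewrite ltr_pM2r// ltr_nat.
    have h1 : (i < k.+1)%N := lt_grid _ _ (le_lt_trans i1 k2).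
    have h2 : (k < i.+1)%N := lt_grid _ _ (le_lt_trans k1 i2).
    have e : i = Ordinal kn by apply: ord_inj; apply: anti_leq; apply/andP; split.
    by rewrite e eqxx in ik.
  have /choice[k Hk] := step.
  have -> : (fun n => Linfty_norm ((fun x => \sum_(i < n.+1) \1_(A n i) t *: v (grid n i) x) \- v t)) =
      (fun n => Linfty_norm (v (grid n (k n)) \- v t)%R).
    apply/funext => n; congr Linfty_norm; apply/funext => x /=; have [_ _ ->] := Hk n.
    by [].
  have key (e : R) : 0 < e -> \forall n \near \oo, (Linfty_norm (v (grid n (k n)) \- v t)%R <= e%:E)%E.
    move=> e0; have [r r0 Hr] := Linfty_continuous H tT e0.
    near=> n; have [kT kt _] := Hk n; apply: Hr => //; apply: (le_lt_trans kt).
    rewrite ltr_pdivrMr// -ltr_pdivrMl//; apply: le_lt_trans (_ : n%:R < _).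
      by near: n; exact: nbhs_infty_ger.
    by rewrite ltr_nat.
  apply/fine_cvgP; split.
    apply: filterS (key 1 ltr01) => n Hn.
    by rewrite ge0_fin_numE ?Linfty_norm_ge0// (le_lt_trans Hn)// ltry.
  apply/cvgrPdist_le => e e0; apply: filterS (key e e0) => n Hn /=.
  rewrite sub0r normrN ger0_norm; last by rewrite fine_ge0// Linfty_norm_ge0.
  by rewrite -lee_fin fineK// ge0_fin_numE ?Linfty_norm_ge0// (le_lt_trans Hn)// ltry.
- move=> T' T'T.
  have /choice[M HM] : forall i, exists M : R, 0 <= M /\
      forall t, 0 <= t <= T' -> {ae mu, forall x, `|component v i t x| <= M}.
    by move=> i; have [M M0 HM] := cbt_bounded T'T (H i); exists M.
  pose C := d%:R * \sum_i M i.
  have C0 : 0 <= C by rewrite mulr_ge0// sumr_ge0// => i _; have [] := HM i.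
  apply: (@le_lt_trans _ _ ((C ^+ 2)%:E * leb `[0%R, T']))%E.
    apply: ge0_integral_le_cst; first exact: measurable_itv.
    move=> t; rewrite /= in_itv/= => tI.
    have b : (Linfty_norm (v t) <= C%:E)%E.
      apply: coord_Linfty => [|i]; first by apply: sumr_ge0 => i _; have [] := HM i.
      apply: filterS ((HM i).2 t tI) => x /le_trans; apply.
      by rewrite (bigD1 i)//= lerDl sumr_ge0// => j _; have [] := HM j.
    have n0 := Linfty_norm_ge0 (v t).
    have fn : Linfty_norm (v t) \is a fin_num by rewrite ge0_fin_numE// (le_lt_trans b)// ltry.
    move: b n0; rewrite -(fineK fn) !lee_fin => b n0.
    by rewrite mulr_ge0//= expr2 ler_pM.
  have [HH|HH] := ltP 0 T'.
    by rewrite lebesgue_measure_itv/= lte_fin HH -EFinB -EFinM ltry.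
  by rewrite lebesgue_measure_itv/= lte_fin (le_gtF HH) mule0 ltry.
Unshelve. all: by end_near. Qed.

End bounded_fields.

(** * Test functions and linear combinations of equations *)

Section test_functions.
Context {R : realType} {d : nat}.
Local Notation E := 'rV[R]_d.
Local Notation mu := (@lebesgue_rV R d).
Local Notation leb := (@lebesgue_measure R).
Variables (chi : E -> R) (j0 : 'I_d).
Hypothesis Hchi : cutoff chi.
Implicit Types (phi psi : R * E -> R).

Lemma compact_norm (V : normedModType R) (K : set V) : compact K ->
  exists2 A : R, 0 <= A & forall z, K z -> `|z| <= A.
Proof.
move=> /compact_bounded [A [_ HA]]; exists (`|A| + 1); first by rewrite addr_ge0.
by move=> z Kz; apply: (HA (`|A| + 1)) => //; rewrite (le_lt_trans (ler_norm _))// ltrDl.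
Qed.

(** The continuous function [1 / (T - t)] is bounded on a compact set. *)
Lemma compact_time (T : R) (K : set (R * E)) : compact K -> (forall z, K z -> z.1 < T) ->
  exists2 t1 : R, t1 < T & forall z, K z -> z.1 <= t1.
Proof.
move=> cK KT; pose h (z : R * E) := (T - z.1)^-1.
have ch : {within K, continuous h}.
  apply: continuous_in_subspaceT => z /set_mem Kz.
  have zT := KT z Kz; apply: (@continuousV _ _ (fun z : R * E => T - z.1)).
    by rewrite subr_eq0 gt_eqF.
  by apply: cvgB; [exact: cvg_cst|exact: cvg_fst].
have [B B0 HB] := compact_norm (continuous_compact ch cK).
exists (T - (B + 1)^-1); first by rewrite ltrBlDr ltrDl invr_gt0 ltr_wpDl.
move=> z Kz; have zT := KT z Kz; rewrite lerBrDr -lerBrDl.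
have := HB (h z); rewrite /h/= => /(_ (ex_intro2 _ _ z Kz erefl)).
have p0 : 0 < T - z.1 by rewrite subr_gt0.
rewrite normfV (gtr0_norm p0) => H.
have B1 : 0 < B + 1 by rewrite ltr_wpDl.
rewrite -[leRHS]invrK lef_pV2 ?posrE ?invr_gt0//.
by apply: (le_trans H); rewrite lerDl.
Qed.

Lemma compact_slab (A a b : R) : compact [set z : R * E | `|z| <= A /\ a <= z.1 <= b].
Proof.
have -> : [set z : R * E | `|z| <= A /\ a <= z.1 <= b] =
    [set z : R * E | `|z| <= A] `&` (fst @^-1` `[a, b]%classic).
  by apply/seteqP; split=> z /=; rewrite in_itv.
apply: (subclosed_compact _ (@heine_borel_prod R d A)); last by move=> z [].
apply: closedI; first exact: compact_closed (@norm_hausdorff _ _) (@heine_borel_prod R d A).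
by apply: preimage_closed; [move=> z _; exact: cvg_fst|exact: itv_closed].
Qed.

Lemma ctest_test T phi : ctest T phi -> test_function T phi.
Proof.
move=> [sp [A HA] [t1 t1T vt]]; split=> //.
exists [set z : R * E | `|z| <= A /\ 0 <= z.1 <= t1]; split; first exact: compact_slab.
  by move=> z [_ /andP[z0 zt]]; rewrite /= z0 (le_lt_trans zt).
move=> z z0 Kz; have [Az|Az] := ltP A `|z|; first exact: HA.
by apply: vt; rewrite ltNge; apply/negP => zt; apply: Kz; split=> //; rewrite z0.
Qed.

Lemma ctest_test_pos T phi : ctest T phi -> (exists2 t0, 0 < t0 & forall p, p.1 < t0 -> phi p = 0) ->
  test_function_pos T phi.
Proof.
move=> [sp [A HA] [t1 t1T vt]] [t0 t00 v0]; split=> //.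
exists [set z : R * E | `|z| <= A /\ t0 <= z.1 <= t1]; split; first exact: compact_slab.
  by move=> z [_ /andP[z0 zt]]; rewrite /= (lt_le_trans t00 z0) (le_lt_trans zt).
move=> z Kz; have [Az|Az] := ltP A `|z|; first exact: HA.
have [zt|zt] := ltP t1 z.1; first exact: vt.
by apply: v0; rewrite ltNge; apply/negP => z0; apply: Kz; split=> //; rewrite z0.
Qed.

Lemma test_pos_test T phi : test_function_pos T phi -> test_function T phi.
Proof.
move=> [sp [K [cK KT vK]]]; split=> //; exists K; split=> //; last by move=> z _; exact: vK.
by move=> z /KT /= /andP[/ltW -> ->].
Qed.

Lemma test_pos_ctest T phi : test_function_pos T phi -> ctest T phi.
Proof.
move=> [sp [K [cK KT vK]]]; have [A A0 HA] := compact_norm cK.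
split=> //.
  by exists A => z Az; apply: vK => /HA; rewrite leNgt Az.
have [t1 t1T Ht1] := compact_time cK (fun z Kz => proj2 (andP (KT z Kz))).
by exists t1 => // z zt; apply: vK => /Ht1; rewrite leNgt zt.
Qed.

Lemma test_pos_0 T phi x : test_function_pos T phi -> phi (0, x) = 0.
Proof. by move=> [sp [K [cK KT vK]]]; apply: vK => /KT /=; rewrite ltxx. Qed.

(** Multiplying by a cutoff equal to 1 on the support modifies the function
    at negative times only. *)
Lemma normalized_test T phi : 0 < T -> test_function T phi ->
  exists2 psi, ctest T psi & forall p, 0 <= p.1 -> psi p = phi p.
Proof.
move=> T0 [sp [K [cK KT vK]]]; have [A A0 HA] := compact_norm cK.
have [t1 t1T Ht1] := compact_time cK (fun z Kz => proj2 (andP (KT z Kz))).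
pose s := (d%:R * A + 1)^-1 : R.
have dA : 0 < d%:R * A + 1 by rewrite ltr_wpDl// mulr_ge0.
have s0 : 0 < s by rewrite invr_gt0.
(* The scale [s] makes the spatial cutoff equal to 1 on the cube of radius [A]. *)
pose c := tens (fun r => sstep chi j0 (r + 2)) (fun x => chi (s *: x)).
have sc : smooth c.
  apply: smooth_tens; last exact: smooth_chiZ.
  apply: (smooth_comp_affine (V := R) (W := R) (L := fun s => s + 2) (L0 := fun s => s))
    (smooth_sstep j0 Hchi); first by move=> h y w; rewrite /GRing.scale/=; ring.
  have ci : continuous (fun s : R => s) by move=> x; exact: cvg_id.
  exact: (@contD _ _ _ _ ci (@contC _ _ 2)).
have c1 p : 0 <= p.1 -> `|p| <= A -> c p = 1.
  move=> p0 pA; rewrite /c /tens (sstep1 j0 Hchi); last by lra.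
  rewrite mul1r (chiZ_one j0 Hchi)// /s mulrC ler_pdivrMr// mul1r.
  apply: (@le_trans _ _ (d%:R * A)); last by rewrite lerDl.
  by rewrite ler_wpM2l//; apply: le_trans pA; rewrite prod_normE/= le_max lexx orbT.
exists (fun p => phi p * c p).
  split; first exact: smoothM.
    exists (A + 2 + 2 / s) => p pA.
    have s2 : 0 <= 2 / s by rewrite divr_ge0// ltW.
    have [p0|p0] := leP 0 p.1.
      by rewrite vK ?mul0r// => /HA; rewrite leNgt; case/negP; apply: le_lt_trans pA; lra.
    move: pA; rewrite prod_normE/= lt_max => /orP[pA|pA].
      by rewrite /c /tens (sstep0 j0 Hchi) ?mul0r ?mulr0//; move: pA; rewrite ltr0_norm//; lra.
    by rewrite /c /tens (chiZ_supp Hchi) ?mulr0//; apply: le_lt_trans pA; lra.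
  exists (Num.max t1 (T / 2)).
    by rewrite gt_max t1T ltr_pdivrMr// ltr_pMr// ltr1n.
  move=> p; rewrite gt_max => /andP[p1 p2]; rewrite vK ?mul0r//.
    by apply: le_trans (ltW p2); rewrite divr_ge0// ltW.
  by move=> /Ht1; rewrite leNgt p1.
move=> p p0; have [/HA pA|Kp] := pselect (K p); first by rewrite c1// mulr1.
by rewrite vK// mul0r.
Qed.

(** At positive times the two functions agree in a neighbourhood, hence so
    do their derivatives. *)
Lemma rd_normalized T f phi psi v : cbt T f -> ctest T psi ->
  (forall p, 0 <= p.1 -> psi p = phi p) ->
  regular_dist T f (fun p => 'D_v phi p) = regular_dist T f (fun p => 'D_v psi p).
Proof.
move=> cf tp e; have [cc bc tc] := ctest_cpair (ctest_derive v tp).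
apply: tint_eq; first exact: pair_tL1 cf cc bc tc.
move=> t /andP[t0 _]; apply: eq_Rintegral => x _; apply: (congr1 (fun r => f t x * r)).
apply: near_eq_derive.
near=> y; apply: esym; apply: e; apply: ltW; near: y.
by apply: (@cvgr_gt _ _ _ _ (@fst R E) t) => //; exact: cvg_fst.
Unshelve. all: by end_near. Qed.

(** The left-hand side of an evolution equation, without pressure; all
    equations considered are linear combinations of such expressions at the
    same test function. *)
Definition evol T (f : R -> E -> R) (g : 'I_d -> R -> E -> R) : functional := fun phi =>
  ddiff (@dir_t R d) (regular_dist T f) phi +
  \sum_k ddiff (dir_x k) (regular_dist T (g k)) phi.

Lemma evol_normalized T f g phi psi : cbt T f -> (forall k, cbt T (g k)) -> ctest T psi ->
  (forall p, 0 <= p.1 -> psi p = phi p) -> evol T f g phi = evol T f g psi.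
Proof.
move=> cf cg tp e; rewrite /evol /ddiff (rd_normalized _ cf tp e).
by apply: (congr1 (fun r => _ + r)); apply: eq_bigr => k _; rewrite (rd_normalized _ (cg k) tp e).
Qed.

Lemma delta0_normalized (f0 : E -> R) phi psi : (forall p, 0 <= p.1 -> psi p = phi p) ->
  delta0 f0 phi = delta0 f0 psi.
Proof. by move=> e; apply: eq_Rintegral => x _; rewrite e. Qed.

Lemma evol_Qf T f g f0 phi : evol T f g phi - delta0 f0 phi = Qf T f g f0 phi.
Proof.
rewrite /Qf rdD.unlock pair0.unlock /evol /ddiff /delta0.
apply: (congr1 (fun r => r - _)); apply: (congr1 (fun r => _ + r)).
exact: sumrN.
Qed.

Lemma rd_comb T (a b : R) f1 f2 phi v : cbt T f1 -> cbt T f2 -> ctest T phi ->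
  regular_dist T (fun t x => a * f1 t x + b * f2 t x) (fun p => 'D_v phi p) =
  a * regular_dist T f1 (fun p => 'D_v phi p) + b * regular_dist T f2 (fun p => 'D_v phi p).
Proof.
move=> c1 c2 tp; have cp := ctest_cpair (ctest_derive v tp).
by rewrite (rd_addf (cbtZ a c1) (cbtZ b c2) cp) (rd_scalef a c1 cp) (rd_scalef b c2 cp).
Qed.

Lemma evol_comb T (a b : R) f f1 f2 (g g1 g2 : 'I_d -> R -> E -> R) phi : 0 < T ->
  cbt T f1 -> cbt T f2 -> (forall k, cbt T (g1 k)) -> (forall k, cbt T (g2 k)) ->
  (forall t x, f t x = a * f1 t x + b * f2 t x) ->
  (forall k t x, g k t x = a * g1 k t x + b * g2 k t x) -> test_function T phi ->
  evol T f g phi = a * evol T f1 g1 phi + b * evol T f2 g2 phi.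
Proof.
move=> T0 c1 c2 d1 d2 ef eg tphi; have [psi tp e] := normalized_test T0 tphi.
have eF : f = (fun t x => a * f1 t x + b * f2 t x).
  by apply/funext => t; apply/funext => x; exact: ef.
have eG k : g k = (fun t x => a * g1 k t x + b * g2 k t x).
  by apply/funext => t; apply/funext => x; exact: eg.
have cF : cbt T f by rewrite eF; exact: cbtD (cbtZ a c1) (cbtZ b c2).
have cG k : cbt T (g k) by rewrite eG; exact: cbtD (cbtZ a (d1 k)) (cbtZ b (d2 k)).
rewrite (evol_normalized cF cG tp e) (evol_normalized c1 d1 tp e) (evol_normalized c2 d2 tp e).
have alg (A B x y : R) (r1 r2 : 'I_d -> R) :
    - (A * x + B * y) + \sum_k - (A * r1 k + B * r2 k) =
    A * (- x + \sum_k - r1 k) + B * (- y + \sum_k - r2 k).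
  rewrite !sumrN big_split/= -!mulr_sumr; ring.
rewrite /evol /ddiff; apply: eq_trans (alg _ _ _ _ _ _).
apply: (f_equal2 (fun r1 r2 : R => - r1 + r2)); first by rewrite eF; exact: rd_comb.
by apply: eq_bigr => k _; apply: (congr1 (fun r : R => - r)); rewrite eG; exact: rd_comb.
Qed.

Lemma div_comb T (a b : R) (g g1 g2 : 'I_d -> R -> E -> R) phi : 0 < T ->
  (forall k, cbt T (g1 k)) -> (forall k, cbt T (g2 k)) ->
  (forall k t x, g k t x = a * g1 k t x + b * g2 k t x) -> test_function T phi ->
  \sum_k ddiff (dir_x k) (regular_dist T (g k)) phi =
  a * \sum_k ddiff (dir_x k) (regular_dist T (g1 k)) phi +
  b * \sum_k ddiff (dir_x k) (regular_dist T (g2 k)) phi.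
Proof.
move=> T0 d1 d2 eg tphi; have c0 := @cbt_cst R d T 0.
have ef0 (t : R) (x : E) : (0 : R) = a * 0 + b * 0 by rewrite !mulr0 addr0.
have H := evol_comb T0 c0 c0 d1 d2 ef0 eg tphi.
have alg (x s s1 s2 : R) : x = 0 -> x + s = a * (x + s1) + b * (x + s2) -> s = a * s1 + b * s2.
  by move=> ->; rewrite !add0r.
apply: alg H.
rewrite /ddiff /regular_dist; under eq_Rintegral do
  (under eq_Rintegral do rewrite mul0r; rewrite Rintegral_cst// mul0r).
by rewrite Rintegral_cst ?mul0r ?oppr0//; exact: measurable_itv.
Qed.

Lemma div_vec_comb T (a b : R) (f f1 f2 : R -> E -> E) phi : 0 < T ->
  (forall k, cbt T (component f1 k)) -> (forall k, cbt T (component f2 k)) ->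
  (forall k t x, component f k t x = a * component f1 k t x + b * component f2 k t x) ->
  test_function T phi -> div_vec T f1 phi = 0 -> div_vec T f2 phi = 0 -> div_vec T f phi = 0.
Proof.
move=> T0 c1 c2 e tp z1 z2; apply: (eq_trans (div_comb T0 c1 c2 e tp)).
have alg (x y : R) : x = 0 -> y = 0 -> a * x + b * y = 0 by move=> -> ->; rewrite !mulr0 addr0.
exact: alg z1 z2.
Qed.

Lemma delta0_comb T (a b : R) (h h1 h2 : E -> R) phi : 0 < T ->
  measurable_fun setT h1 -> (exists M : R, {ae mu, forall x, `|h1 x| <= M}) ->
  measurable_fun setT h2 -> (exists M : R, {ae mu, forall x, `|h2 x| <= M}) ->
  (forall x, h x = a * h1 x + b * h2 x) -> test_function T phi ->
  delta0 h phi = a * delta0 h1 phi + b * delta0 h2 phi.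
Proof.
move=> T0 m1 [M1 H1] m2 [M2 H2] eh tphi; have [psi tp e] := normalized_test T0 tphi.
rewrite !(delta0_normalized _ e); have [cp bp _] := ctest_cpair tp.
have lp := L1_tslice 0 cp bp.
have [l1 _] := L1_pair m1 H1 lp; have [l2 _] := L1_pair m2 H2 lp.
rewrite /delta0 -RintegralZl// -RintegralZl// -RintegralD//; [|exact: L1Z..].
by apply: eq_Rintegral => x _; rewrite eh; ring.
Qed.

(** There are finitely many derivatives up to a given order, so that bounds
    and supports can be chosen uniformly. *)
Lemma iter_derive_bsupp n (p : E -> R) : smooth p -> bsupp p -> exists S A : R, [/\ 0 <= S, 0 <= A &
  forall js : seq 'I_d, (size js <= n)%N -> forall x,
    `|iter_derive (map unit_vec js) p x| <= S /\
    (A < `|x| -> iter_derive (map unit_vec js) p x = 0)].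
Proof.
elim: n p => [|n IH] p sp bp.
  have [S S0 HS] := bsupp_bounded (@heine_borel_rV R d) (smooth_continuous sp) bp.
  have [A HA] := bp; exists S, `|A|; split=> // js; rewrite leqn0 size_eq0 => /eqP -> x.
  by split; [exact: HS|move=> /(le_lt_trans (ler_norm _)) /HA].
have [S [A [S0 A0 HS]]] := IH p sp bp.
have /choice[F HF] : forall j : 'I_d, exists SA : R * R, [/\ 0 <= SA.1, 0 <= SA.2 &
    forall js : seq 'I_d, (size js <= n)%N -> forall x,
    `|iter_derive (map unit_vec js) (fun y => 'D_(unit_vec j) p y) x| <= SA.1 /\
    (SA.2 < `|x| -> iter_derive (map unit_vec js) (fun y => 'D_(unit_vec j) p y) x = 0)].
  move=> j; have [S' [A' H]] := IH _ (smooth_derive (unit_vec j) sp) (bsupp_derive (unit_vec j) bp).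
  by exists (S', A').
have F1 : 0 <= \sum_j (F j).1 by apply: sumr_ge0 => j _; have [] := HF j.
have F2 : 0 <= \sum_j (F j).2 by apply: sumr_ge0 => j _; have [] := HF j.
exists (S + \sum_j (F j).1), (A + \sum_j (F j).2); split; [exact: addr_ge0..|].
move=> js; case/lastP: js => [_ x|js j].
  have [H1 H2] := HS [::] isT x; split; first by apply: (le_trans H1); rewrite lerDl.
  by move=> H; apply: H2; apply: le_lt_trans H; rewrite lerDl.
rewrite size_rcons ltnS => sn x.
have -> : iter_derive (map unit_vec (rcons js j)) p =
    iter_derive (map unit_vec js) (fun y => 'D_(unit_vec j) p y).
  by rewrite map_rcons /iter_derive foldr_rcons.
have [_ _ /(_ js sn x)[H1 H2]] := HF j.
have le1 : (F j).1 <= \sum_j (F j).1.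
  by rewrite (bigD1 j)//= lerDl sumr_ge0// => i _; have [] := HF i.
have le2 : (F j).2 <= \sum_j (F j).2.
  by rewrite (bigD1 j)//= lerDl sumr_ge0// => i _; have [] := HF i.
split; first by apply: (le_trans H1); apply: (le_trans le1); rewrite lerDr.
by move=> H; apply: H2; apply: le_lt_trans H; apply: (le_trans le2); rewrite lerDr.
Qed.

Lemma weighted_bsupp k (p : E -> R) : smooth p -> bsupp p -> exists M, weighted_le k M p.
Proof.
move=> sp bp; have [S [A [S0 A0 H]]] := iter_derive_bsupp k sp bp.
exists ((1 + d%:R * A) ^+ k * S) => js sk x; have [H1 H2] := H js sk x.
have e0 : 0 <= 1 + enorm x by rewrite addr_ge0// enorm_ge0.
have d0 : 0 <= 1 + d%:R * A by rewrite addr_ge0// mulr_ge0.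
have [Ax|xA] := ltP A `|x|; first by rewrite H2// normr0 mulr0 mulr_ge0// exprn_ge0.
apply: ler_pM => //; first exact: exprn_ge0.
rewrite lerXn2r ?nnegrE// lerD2l; apply: (le_trans (enorm_le j0 x)).
by rewrite ler_wpM2l.
Qed.

(** The weights are bounded on a bounded support. *)
Lemma schwartz_bsupp (p : E -> R) : smooth p -> bsupp p -> schwartz (fun x => (p x)%:C%C).
Proof.
move=> sp bp; have z0 : smooth (fun _ : E => 0 : R) := smooth_cst _ 0.
split=> // k; have [M HM] := weighted_bsupp k sp bp.
have [M' HM'] : exists M', weighted_le k M' (fun _ : E => 0 : R).
  by apply: weighted_bsupp => //; exists 0.
exists (`|M| + `|M'|); split=> js sk x.
  by apply: (le_trans (HM js sk x)); apply: (le_trans (ler_norm M)); rewrite lerDl.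
by apply: (le_trans (HM' js sk x)); apply: (le_trans (ler_norm M')); rewrite lerDr.
Qed.

End test_functions.

(** * The divergence constraint and the pressure *)

Section divergence_constraint.
Context {R : realType} {d : nat}.
Local Notation E := 'rV[R]_d.
Local Notation mu := (@lebesgue_rV R d).
Local Notation leb := (@lebesgue_measure R).
Implicit Types (phi psi : R * E -> R).

Lemma weak_divergence (f : E -> E) : divergence_free f -> forall z, smooth z -> bsupp z ->
  \sum_k \int[mu]_x (f x 0 k * 'D_(unit_vec k) z x) = 0.
Proof.
move=> H z sz [A HA]; have := H z sz; rewrite sumrN => /(_ _)/eqP; rewrite oppr_eq0 => K.
apply/eqP/K; exists [set x : E | `|x| <= A]; first exact: heine_borel_rV.
by move=> x /= /negP; rewrite -ltNge; exact: HA.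
Qed.

Lemma divergence_weak (f : E -> E) : (forall z, smooth z -> bsupp z ->
  \sum_k \int[mu]_x (f x 0 k * 'D_(unit_vec k) z x) = 0) -> divergence_free f.
Proof.
move=> H z sz [K cK vK]; rewrite sumrN H ?oppr0//; have [A A0 HA] := compact_norm cK.
by exists A => x Ax; apply: vK => /HA; rewrite leNgt Ax.
Qed.

Variables (T : R) (b : 'I_d -> R -> E -> R) (g : 'I_d -> 'I_d -> R -> E -> R) (b0 : 'I_d -> E -> R).
Hypotheses (T0 : 0 < T) (cb : forall k, cbt T (b k)) (cg : forall k l, cbt T (g k l)).
Hypothesis asym : forall k l t x, g k l t x = - g l k t x.
Hypothesis div0 : forall z, smooth z -> bsupp z ->
  \sum_k \int[mu]_x (b0 k x * 'D_(unit_vec k) z x) = 0.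
Local Notation Q l := (Qf T (b l) (fun k => g k l) (b0 l)).

(** The flux is antisymmetric and second derivatives are symmetric. *)
Lemma antisymmetric_flux phi : ctest T phi -> \sum_l \sum_k
  regular_dist T (g k l) (fun p => 'D_(dir_x k) (fun q => 'D_(dir_x l) phi q) p) = 0.
Proof.
move=> tp; have sp := let: And3 s _ _ := tp in s.
pose S k l := regular_dist T (g k l) (fun p => 'D_(dir_x k) (fun q => 'D_(dir_x l) phi q) p).
have SS k l : S k l = - S l k.
  have e1 := derive_comm (dir_x l) (dir_x k) sp.
  apply: (eq_trans (congr1 (regular_dist T (g k l)) (esym e1))).
  have eg : g k l = (fun t x => (-1) * g l k t x).
    by apply/funext => t; apply/funext => x; rewrite mulN1r.
  apply: (eq_trans (congr1 (fun h => regular_dist T h _) eg)).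
  have cp := ctest_cpair (ctest_derive (dir_x l) (ctest_derive (dir_x k) tp)).
  by apply: (eq_trans (rd_scalef (-1) (cg l k) cp)); exact: mulN1r.
have : \sum_l \sum_k S k l = - \sum_l \sum_k S k l.
  rewrite [in LHS]exchange_big/= -sumrN; apply: eq_bigr => l _.
  by rewrite -sumrN; apply: eq_bigr => k _; exact: SS.
have alg (x : R) : x = - x -> x = 0 by move=> e; lra.
exact: alg.
Qed.

(** The flux terms cancel by antisymmetry and the initial term by the
    divergence constraint on [b0]. *)
Lemma Qf_gradient phi : ctest T phi -> \sum_l Q l (fun p => 'D_(dir_x l) phi p) =
  - \sum_l regular_dist T (b l) (fun p => 'D_(dir_x l) (fun q => 'D_(@dir_t R d) phi q) p).
Proof.
move=> tp; have [sp bp _] := tp.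
have Z : \sum_l delta0 (b0 l) (fun p => 'D_(dir_x l) phi p) = 0.
  rewrite -[RHS](div0 (smooth_tslice 0 sp) (bsupp_tslice 0 bp)); apply: eq_bigr => l _.
  apply: eq_Rintegral => x _; apply: (congr1 (fun r => b0 l x * r)).
  exact: esym (derive_tslice phi 0 l x).
have alg (a c : 'I_d -> R) (s : 'I_d -> 'I_d -> R) : \sum_l \sum_k s k l = 0 ->
    \sum_l c l = 0 -> \sum_l (- a l - \sum_k s k l - c l) = - \sum_l a l.
  by move=> s0 c0; rewrite !sumrB sumrN s0 c0 !subr0.
rewrite /Qf rdD.unlock pair0.unlock.
apply: (eq_trans (alg _ _ _ (antisymmetric_flux tp) Z)).
apply: (congr1 (fun r : R => - r)); apply: eq_bigr => l _; apply: (congr1 (regular_dist T (b l))).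
exact: (derive_comm (@dir_t R d) (dir_x l) sp).
Qed.

(** The functional vanishes on gradients [D_l psi]; choosing for [psi] a
    primitive of [phi] in time, with [D_t psi = - phi] at nonnegative times,
    tests the divergence of [b] with [phi]. *)
Lemma induction_divergence : (forall l phi, ctest T phi -> Q l phi = 0) ->
  forall phi, ctest T phi -> \sum_l regular_dist T (b l) (fun p => 'D_(dir_x l) phi p) = 0.
Proof.
move=> H phi tp; have [sp bp [t1 t1T vt]] := tp.
(* The length [T] of the integration interval brings the upper end beyond the support. *)
pose psi := lineint phi (@dir_t R d) 0 T.
have fstT (z : R * E) (s : R) : (z + s *: dir_t).1 = z.1 + s.
  by rewrite -[LHS]/(z.1 + s * 1) mulr1.
have tpsi : ctest T psi.
  split; [exact: smooth_lineint (ltW T0) sp|exact: bsupp_lineint (ltW T0) bp|].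
  exists t1 => // p pt; rewrite /psi /lineint.
  transitivity (\int[leb]_(r in `[0, T]) (fun=> 0 : R) r); last by rewrite Rintegral_cst// mul0r.
  apply: eq_Rintegral => r; rewrite inE/= in_itv/= => /andP[r0 _].
  by apply: vt; rewrite fstT ltr_wpDr.
have dpsi p : 0 <= p.1 -> 'D_(@dir_t R d) psi p = - phi p.
  move=> p0; apply: (eq_trans (derive_lineint_shift (@dir_t R d) p T0 sp)).
  by rewrite vt ?sub0r// fstT (lt_le_trans t1T)// lerDr.
have := Qf_gradient tpsi; rewrite big1; last by move=> l _; apply: H; exact: ctest_derive.
move=> /esym/eqP; rewrite oppr_eq0 => /eqP E0.
have : \sum_l - regular_dist T (b l) (fun p => 'D_(dir_x l) phi p) = 0.
  rewrite -[RHS]E0; apply: eq_bigr => l _.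
  have cp := ctest_cpair (ctest_derive (dir_x l) tp).
  rewrite -mulN1r -(rd_scalephi (-1) (cb l) cp).
  apply: eq_Rintegral => t; rewrite inE/= in_itv/= => /andP[t0 _].
  apply: eq_Rintegral => x _; apply: (congr1 (fun r => b l t x * r)); rewrite mulN1r.
  apply: (eq_trans (congr1 (fun r : R => - r) (esym (derive_tslice phi t l x)))).
  apply: eq_trans (derive_tslice (fun q => 'D_(@dir_t R d) psi q) t l x).
  have -> : (fun y => 'D_(@dir_t R d) psi (t, y)) = (fun y => (-1) * phi (t, y)).
    by apply/funext => y; rewrite mulN1r; exact: dpsi.
  apply: esym; apply: (eq_trans (congr1 (fun F => F x) (deriveZf (-1) (unit_vec l) (smooth_tslice t sp)))).
  by rewrite mulN1r.
by rewrite sumrN => /eqP; rewrite oppr_eq0 => /eqP.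
Qed.

Hypothesis divt : forall t z, 0 <= t < T -> smooth z -> bsupp z ->
  \sum_k \int[mu]_x (b k t x * 'D_(unit_vec k) z x) = 0.

Lemma fixed_time_rd phi : ctest T phi ->
  \sum_k regular_dist T (b k) (fun p => 'D_(dir_x k) phi p) = 0.
Proof.
move=> tp; have [sp bp _] := tp.
have lk k : tL1 T (pair (b k) (fun p => 'D_(dir_x k) phi p)).
  by have [c1 c2 c3] := ctest_cpair (ctest_derive (dir_x k) tp); exact: pair_tL1.
have [_ e] := tint_sum (index_enum 'I_d) lk.
apply: (eq_trans (esym e)).
transitivity (\int[leb]_(t in `[0, T[) (fun=> 0 : R) t).
  apply: eq_Rintegral => t; rewrite inE/= in_itv/= => tT.
  rewrite -[RHS](divt tT (smooth_tslice t sp) (bsupp_tslice t bp)); apply: eq_bigr => k _.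
  apply: eq_Rintegral => x _; apply: (congr1 (fun r => b k t x * r)).
  exact: esym (derive_tslice phi t k x).
by rewrite Rintegral_cst ?mul0r//; exact: measurable_itv.
Qed.

Hypotheses (mb0 : forall l, measurable_fun setT (b0 l))
  (bb0 : forall l, exists M : R, {ae mu, forall x, `|b0 l x| <= M}).

(** Exchanging derivatives, [Q_l (D_k D_k phi) = P (D_l D_k D_k phi) = Q_k
    (D_k D_l phi)], and the sum over [k] of the last terms vanishes; hence
    the functional annihilates Laplacians. *)
Lemma pressure_trivial (P : functional) : (forall l phi, ctest T phi ->
    Q l phi = P (fun p => 'D_(dir_x l) phi p)) ->
  forall l phi j, ctest T phi -> Q l (fun p => 'D_(dir_x j) phi p) = 0.
Proof.
move=> HP l phi j tp.
have cgl k : cbt T (g k l) := cg k l.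
apply: (Qf_liouville T0 (cb l) cgl (mb0 l) (bb0 l)) => // {tp}psi tp.
have [sp _ _] := tp.
have tdd k l' : ctest T (fun p => 'D_(dir_x k) (fun q => 'D_(dir_x l') psi q) p).
  by do 2 apply: ctest_derive.
rewrite (Qf_sum (cb l) cgl (mb0 l) (bb0 l)) => [|k]; last exact: tdd.
have tl := ctest_derive (dir_x l) tp.
have E0 : \sum_k Q k (fun p => 'D_(dir_x k) (fun q => 'D_(dir_x l) psi q) p) = 0.
  apply: (eq_trans (Qf_gradient tl)); apply/eqP; rewrite oppr_eq0; apply/eqP.
  exact: fixed_time_rd (ctest_derive _ tl).
apply: eq_trans E0; apply: eq_bigr => k _.
apply: (eq_trans (HP l _ (tdd k k))).
apply: eq_trans (esym (HP k _ (ctest_derive (dir_x k) tl))); apply: (congr1 P).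
have e1 := derive_comm (dir_x l) (dir_x k) (smooth_derive (dir_x k) sp).
have e2 := derive_comm (dir_x l) (dir_x k) sp.
apply: (eq_trans e1); apply/funext => p.
exact: (congr1 (fun F : R * E -> R => 'D_(dir_x k) F p) e2).
Qed.

End divergence_constraint.

(** * The low-frequency condition in terms of the kernel *)

Section mean_zero.
Context {R : realType} {d : nat}.
Local Notation E := 'rV[R]_d.
Local Notation mu := (@lebesgue_rV R d).
Variables (chi : E -> R) (j0 : 'I_d).
Hypothesis Hchi : cutoff chi.

(** Real test functions along integer scales; the real part of the
    multiplier is the convolution with the kernel. *)
Lemma Sh_kernel (h p : E -> R) : Sh chi (tempered_of h) -> smooth p -> bsupp p ->
  (fun n => \int[mu]_x (h x * \int[mu]_y (p y * kernel chi n.+1%:R (y - x)))) @ \oo --> (0 : R).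
Proof.
move=> [_ H] sp bp; have sch := schwartz_bsupp j0 sp bp; have := H _ sch.
set N := (N in N @ +oo%R --> _) => cN.
have lim : (fun n : nat => n.+1%:R : R) @ \oo --> +oo%R.
  apply/cvgryPge => A; near=> n; apply: (@le_trans _ _ n%:R); last by rewrite ler_nat.
  by near: n; exact: nbhs_infty_ger.
have cn : (fun n : nat => N n.+1%:R) @ \oo --> (0 : R) := cvg_comp _ _ lim cN.
apply: norm_cvg0; apply: (@squeeze_cvgr _ _ _ _ (fun=> 0) (fun n => N n.+1%:R)) => //; last exact: cvg_cst.
apply: nearW => n; rewrite normr_ge0/=; apply: le_trans (Re_le_normc _).
have n0 : (0 : R) < n.+1%:R by rewrite ltr0n.
have [lr li _ _] := schwartz_parts sch.
by rewrite (multiplier_kernel Hchi h n0 lr li).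
Unshelve. all: by end_near. Qed.

Lemma kernel_Sh (h : E -> R) (M C : R) : measurable_fun setT h -> {ae mu, forall x, `|h x| <= M} ->
  0 <= C -> (forall l p, 0 < l -> L1 mu p ->
    `|\int[mu]_x (h x * \int[mu]_y (p y * kernel chi l (y - x)))| <= C / l * \int[mu]_x `|p x|) ->
  Sh chi (tempered_of h).
Proof.
move=> mh hM C0 H; split; first exact: tempered_bounded mh hM.
move=> phi sch; have [lr li _ _] := schwartz_parts sch.
pose D := \int[mu]_x `|Re_fun phi x| + \int[mu]_x `|Im_fun phi x|.
apply: (@squeeze_cvgr _ _ _ _ (fun=> 0) (fun l => l^-1 * (C * D))).
- near=> l; have l0 : 0 < l by near: l; exact: nbhs_pinfty_gt.
  apply/andP; split.
    by rewrite (le_trans _ (Re_le_normc _)).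
  rewrite (multiplier_kernel Hchi h l0 lr li); apply: (le_trans (normc_le _)) => /=.
  have -> : l^-1 * (C * D) = C / l * \int[mu]_x `|Re_fun phi x| + C / l * \int[mu]_x `|Im_fun phi x|.
    by rewrite -mulrDr -/D; ring.
  by apply: lerD; exact: H.
- exact: cvg_cst.
- rewrite -[X in _ --> X](mul0r (C * D)); apply: cvgMl.
  apply/cvgrPdist_lt => e e0; near=> l.
  have l0 : 0 < l by near: l; exact: nbhs_pinfty_gt.
  rewrite sub0r normrN gtr0_norm ?invr_gt0// -[ltRHS]invrK ltf_pV2 ?posrE ?invr_gt0//.
  by near: l; apply: nbhs_pinfty_gt; exact: num_real.
Unshelve. all: by end_near. Qed.

End mean_zero.

(** * Elsasser and MHD variables *)

Section elsasser_variables.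
Context {R : realType} {d : nat}.
Local Notation E := 'rV[R]_d.
Local Notation mu := (@lebesgue_rV R d).
Variables (T : R) (chi : E -> R) (j0 : 'I_d) (al0 be0 : E -> E) (al be : R -> E -> E).
Hypotheses (T0 : 0 < T) (Hchi : cutoff chi).
Hypotheses (nal0 : in_Linfty al0) (nbe0 : in_Linfty be0).
Hypotheses (dal0 : divergence_free al0) (dbe0 : divergence_free be0).
Hypotheses (Cal : C0_Linfty T al) (Cbe : C0_Linfty T be).

Let u t x := 2^-1 *: (al t x + be t x).
Let b t x := 2^-1 *: (al t x - be t x).
Let u0 x := 2^-1 *: (al0 x + be0 x).
Let b0 x := 2^-1 *: (al0 x - be0 x).

Let cal i : cbt T (component al i). Proof. exact: C0_Linfty_coord. Qed.
Let cbe i : cbt T (component be i). Proof. exact: C0_Linfty_coord. Qed.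

Let uE i t x : component u i t x = 2^-1 * component al i t x + 2^-1 * component be i t x.
Proof. by rewrite /component !mxE mulrDr. Qed.

Let bE i t x : component b i t x = 2^-1 * component al i t x + (- 2^-1) * component be i t x.
Proof. by rewrite /component !mxE mulrBr mulNr. Qed.

Let cu i : cbt T (component u i).
Proof.
apply: (cbt_ext (f := fun t x => 2^-1 * component al i t x + 2^-1 * component be i t x)).
  by move=> t x; rewrite uE.
exact: cbtD (cbtZ _ (cal i)) (cbtZ _ (cbe i)).
Qed.

Let cb i : cbt T (component b i).
Proof.
apply: (cbt_ext (f := fun t x => 2^-1 * component al i t x + (- 2^-1) * component be i t x)).
  by move=> t x; rewrite bE.
exact: cbtD (cbtZ _ (cal i)) (cbtZ _ (cbe i)).
Qed.

Let ct (v w : R -> E -> E) k l : (forall i, cbt T (component v i)) -> (forall i, cbt T (component w i)) ->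
  cbt T (fun t x => tensor v w t x k l).
Proof. by move=> cv cw; apply: cbt_ext (cbtM (cv k) (cw l)) => t x; rewrite mxE. Qed.

Let ctB (v w v' w' : R -> E -> E) k l : (forall i, cbt T (component v i)) ->
  (forall i, cbt T (component w i)) -> (forall i, cbt T (component v' i)) ->
  (forall i, cbt T (component w' i)) ->
  cbt T (fun t x => (tensor v w t x - tensor v' w' t x) k l).
Proof.
move=> c1 c2 c3 c4; apply: cbt_ext (cbtB (ct k l c1 c2) (ct k l c3 c4)) => t x.
by rewrite !mxE.
Qed.

Let Ha1 l t x : component al l t x = 1 * component u l t x + 1 * component b l t x.
Proof. by rewrite uE bE; field. Qed.
Let Hb1 l t x : component be l t x = 1 * component u l t x + (-1) * component b l t x.
Proof. by rewrite uE bE; field. Qed.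
Let Hf1 l k t x : tensor be al t x k l =
  1 * (tensor u u t x - tensor b b t x) k l + 1 * (tensor u b t x - tensor b u t x) k l.
Proof. by rewrite !mxE; field. Qed.
Let Hf2 l k t x : tensor al be t x k l =
  1 * (tensor u u t x - tensor b b t x) k l + (-1) * (tensor u b t x - tensor b u t x) k l.
Proof. by rewrite !mxE; field. Qed.
Let Hg1 l k t x : (tensor u u t x - tensor b b t x) k l =
  2^-1 * tensor be al t x k l + 2^-1 * tensor al be t x k l.
Proof. by rewrite !mxE; field. Qed.
Let Hg2 l k t x : (tensor u b t x - tensor b u t x) k l =
  2^-1 * tensor be al t x k l + (- 2^-1) * tensor al be t x k l.
Proof. by rewrite !mxE; field. Qed.

Let mom l := evol T (component u l) (fun k t x => (tensor u u t x - tensor b b t x) k l).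
Let ind l := evol T (component b l) (fun k t x => (tensor u b t x - tensor b u t x) k l).
Let ev1 l := evol T (component al l) (fun k t x => tensor be al t x k l).
Let ev2 l := evol T (component be l) (fun k t x => tensor al be t x k l).

Let ev1E l phi : test_function T phi -> ev1 l phi = 1 * mom l phi + 1 * ind l phi.
Proof. by move=> tp; apply: (evol_comb j0 Hchi T0 _ _ _ _ (Ha1 l) (Hf1 l) tp) => // k; exact: ctB. Qed.
Let ev2E l phi : test_function T phi -> ev2 l phi = 1 * mom l phi + (-1) * ind l phi.
Proof. by move=> tp; apply: (evol_comb j0 Hchi T0 _ _ _ _ (Hb1 l) (Hf2 l) tp) => // k; exact: ctB. Qed.
Let momE l phi : test_function T phi -> mom l phi = 2^-1 * ev1 l phi + 2^-1 * ev2 l phi.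
Proof. by move=> tp; apply: (evol_comb j0 Hchi T0 _ _ _ _ (uE l) (Hg1 l) tp) => // k; exact: ct. Qed.
Let indE l phi : test_function T phi -> ind l phi = 2^-1 * ev1 l phi + (- 2^-1) * ev2 l phi.
Proof. by move=> tp; apply: (evol_comb j0 Hchi T0 _ _ _ _ (bE l) (Hg2 l) tp) => // k; exact: ct. Qed.

Let m1 l : measurable_fun setT (fun x => al0 x 0 l). Proof. by have [] := (in_LinftyP j0 al0).1 nal0 l. Qed.
Let M1 l : exists M : R, {ae mu, forall x, `|al0 x 0 l| <= M}.
Proof. by have [] := (in_LinftyP j0 al0).1 nal0 l. Qed.
Let m2 l : measurable_fun setT (fun x => be0 x 0 l). Proof. by have [] := (in_LinftyP j0 be0).1 nbe0 l. Qed.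
Let M2 l : exists M : R, {ae mu, forall x, `|be0 x 0 l| <= M}.
Proof. by have [] := (in_LinftyP j0 be0).1 nbe0 l. Qed.

Let u0E l x : u0 x 0 l = 2^-1 * al0 x 0 l + 2^-1 * be0 x 0 l.
Proof. by rewrite !mxE mulrDr. Qed.
Let b0E l x : b0 x 0 l = 2^-1 * al0 x 0 l + (- 2^-1) * be0 x 0 l.
Proof. by rewrite !mxE mulrBr mulNr. Qed.

Let comb_Linfty (h : E -> E) (p q : R) : (forall l x, h x 0 l = p * al0 x 0 l + q * be0 x 0 l) ->
  initial_datum h.
Proof.
move=> hE; split.
  apply/(in_LinftyP j0) => l; split.
    have -> : (fun x => h x 0 l) = (fun x => p * al0 x 0 l + q * be0 x 0 l) by apply/funext.
    by apply: measurable_funD; apply: measurable_funM => //; exact: measurable_cst.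
  have [A HA] := M1 l; have [B HB] := M2 l; exists (`|p| * A + `|q| * B).
  near=> x; rewrite hE; apply: (le_trans (ler_normD _ _)); rewrite !normrM.
  by apply: lerD; rewrite ler_wpM2l//; near: x.
apply: divergence_weak => z sz bz.
have lz k := L1_smooth_bsupp (smooth_derive (unit_vec k) sz) (bsupp_derive (unit_vec k) bz).
transitivity (p * (\sum_k \int[mu]_x (al0 x 0 k * 'D_(unit_vec k) z x)) +
    q * (\sum_k \int[mu]_x (be0 x 0 k * 'D_(unit_vec k) z x))); last first.
  by rewrite !weak_divergence// !mulr0 addr0.
rewrite !mulr_sumr -big_split/=; apply: eq_bigr => k _.
have [A HA] := M1 k; have [B HB] := M2 k.
have [l1 _] := L1_pair (m1 k) HA (lz k); have [l2 _] := L1_pair (m2 k) HB (lz k).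
rewrite -RintegralZl// -RintegralZl// -RintegralD//; [|exact: L1Z..].
by apply: eq_Rintegral => x _; rewrite hE mulrDl !mulrA.
Unshelve. all: by end_near. Qed.

Let iu0 : initial_datum u0. Proof. exact: comb_Linfty u0E. Qed.
Let ib0 : initial_datum b0. Proof. exact: comb_Linfty b0E. Qed.

Let mu0 l : measurable_fun setT (fun x => u0 x 0 l). Proof. by have [] := (in_LinftyP j0 u0).1 iu0.1 l. Qed.
Let Mu0 l : exists M : R, {ae mu, forall x, `|u0 x 0 l| <= M}.
Proof. by have [] := (in_LinftyP j0 u0).1 iu0.1 l. Qed.
Let mb0 l : measurable_fun setT (fun x => b0 x 0 l). Proof. by have [] := (in_LinftyP j0 b0).1 ib0.1 l. Qed.
Let Mb0 l : exists M : R, {ae mu, forall x, `|b0 x 0 l| <= M}.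
Proof. by have [] := (in_LinftyP j0 b0).1 ib0.1 l. Qed.

Let flux k l t x := (tensor u b t x - tensor b u t x) k l.
Let cflux k l : cbt T (flux k l). Proof. exact: ctB. Qed.
Let aflux k l t x : flux k l t x = - flux l k t x.
Proof. by rewrite /flux !mxE; ring. Qed.

Let indQ l phi f0 : ind l phi - delta0 f0 phi = Qf T (component b l) (fun k => flux k l) f0 phi.
Proof. exact: evol_Qf. Qed.

(** Once [div b = 0] is known, the Elsasser equations are the sum and the
    difference of the MHD equations. *)
Theorem elsasser_of_MHD p : MHD_with_pressure T u0 b0 u b p ->
  Elsasser_with_pressures T al0 be0 al be p p.
Proof.
move=> H.
have I l phi : test_function T phi -> ind l phi = delta0 (fun x => b0 x 0 l) phi.
  exact: MHD_induction H l phi.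
have Mo l phi : test_function T phi -> mom l phi + grad p l phi = delta0 (fun x => u0 x 0 l) phi.
  exact: MHD_momentum H l phi.
have divb phi : ctest T phi -> div_vec T b phi = 0.
  move=> tp; rewrite /div_vec /ddiff sumrN.
  rewrite (induction_divergence T0 cb cflux aflux (b0 := fun l x => b0 x 0 l)) ?oppr0//.
    exact: weak_divergence ib0.2.
  by move=> l psi tpsi; rewrite -indQ I ?subrr//; exact: ctest_test.
have e1 l x : al0 x 0 l = 1 * u0 x 0 l + 1 * b0 x 0 l by rewrite u0E b0E; field.
have e2 l x : be0 x 0 l = 1 * u0 x 0 l + (-1) * b0 x 0 l by rewrite u0E b0E; field.
split.
- by split.
- by split.
- exact: C0_L2loc.
- exact: C0_L2loc.
- exact: MHD_p H.
- exact: MHD_p H.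
- move=> l phi tp.
  rewrite (delta0_comb j0 Hchi T0 (mu0 l) (Mu0 l) (mb0 l) (Mb0 l) (e1 l) tp) -I// -Mo//.
  by rewrite -[LHS]/(ev1 l phi + grad p l phi) ev1E//; ring.
- move=> l phi tp.
  rewrite (delta0_comb j0 Hchi T0 (mu0 l) (Mu0 l) (mb0 l) (Mb0 l) (e2 l) tp) -I// -Mo//.
  by rewrite -[LHS]/(ev2 l phi + grad p l phi) ev2E//; ring.
- move=> phi tp; apply: (div_vec_comb j0 Hchi T0 cu cb Ha1 (test_pos_test tp) (MHD_div H tp)).
  exact: divb (test_pos_ctest tp).
- move=> phi tp; apply: (div_vec_comb j0 Hchi T0 cu cb Hb1 (test_pos_test tp) (MHD_div H tp)).
  exact: divb (test_pos_ctest tp).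
Qed.

Section pressures.
Variables p1 p2 : @functional R d.
Hypothesis H : Elsasser_with_pressures T al0 be0 al be p1 p2.

Let eq1 l phi : test_function T phi -> ev1 l phi + grad p1 l phi = delta0 (fun x => al0 x 0 l) phi.
Proof. exact: Els_eq1 H l phi. Qed.
Let eq2 l phi : test_function T phi -> ev2 l phi + grad p2 l phi = delta0 (fun x => be0 x 0 l) phi.
Proof. exact: Els_eq2 H l phi. Qed.

Let divu phi : test_function_pos T phi -> div_vec T u phi = 0.
Proof.
move=> tp.
exact: (div_vec_comb j0 Hchi T0 cal cbe uE (test_pos_test tp) (Els_div1 H tp) (Els_div2 H tp)).
Qed.

Let divt t z : 0 <= t < T -> smooth z -> bsupp z ->
  \sum_k \int[mu]_x (component b k t x * 'D_(unit_vec k) z x) = 0.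
Proof.
apply: (fixed_time_divergence j0 Hchi cb) => phi tp t00.
have tpos := ctest_test_pos tp t00.
have : div_vec T b phi = 0.
  exact: (div_vec_comb j0 Hchi T0 cal cbe bE (test_pos_test tpos) (Els_div1 H tpos) (Els_div2 H tpos)).
by rewrite /div_vec /ddiff sumrN => /eqP; rewrite oppr_eq0 => /eqP.
Qed.

Let Q l f0 := Qf T (component b l) (fun k => flux k l) f0.

Let Q_trivial l phi j : ctest T phi -> Q l (fun x => b0 x 0 l) (fun q => 'D_(dir_x j) phi q) = 0.
Proof.
apply: (pressure_trivial (b := component b) T0 cb cflux aflux (weak_divergence ib0.2) divt mb0 Mb0
  (P := fun psi => 2^-1 * p1 psi - 2^-1 * p2 psi)) => {}l {}phi tp.
have tt := ctest_test tp.
rewrite -indQ indE// (delta0_comb j0 Hchi T0 (m1 l) (M1 l) (m2 l) (M2 l) (b0E l) tt).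
rewrite -eq1// -eq2//.
have alg (A B x y : R) : 2^-1 * A + (- 2^-1) * B - (2^-1 * (A + - x) + (- 2^-1) * (B + - y)) =
  2^-1 * x - 2^-1 * y by ring.
exact: alg.
Qed.

Let zT : (0 : R) <= 0 < T. Proof. by rewrite lexx. Qed.
Let mB l : measurable_fun setT (component b l 0). Proof. by have [] := (cb l).1 0 zT. Qed.
Let MB l : exists M : R, {ae mu, forall x, `|component b l 0 x| <= M}.
Proof. by have [] := (cb l).1 0 zT. Qed.

Let initial l z j : smooth z -> bsupp z ->
  \int[mu]_x (component b l 0 x * 'D_(unit_vec j) z x) = \int[mu]_x (b0 x 0 l * 'D_(unit_vec j) z x).
Proof.
exact: (Qf_initial j0 Hchi T0 (cb l) (fun k => cflux k l) (fun psi i tp => Q_trivial l i tp)).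
Qed.

Let Q_trivial0 l phi j : ctest T phi -> Q l (component b l 0) (fun q => 'D_(dir_x j) phi q) = 0.
Proof.
move=> tp; have := Q_trivial l j tp; rewrite /Q /Qf pair0.unlock.
have [sp bp _] := tp.
suff -> : \int[mu]_x (b0 x 0 l * 'D_(dir_x j) phi (0, x)) =
    \int[mu]_x (component b l 0 x * 'D_(dir_x j) phi (0, x)) by [].
have e (h : E -> R) : \int[mu]_x (h x * 'D_(dir_x j) phi (0, x)) =
    \int[mu]_x (h x * 'D_(unit_vec j) (fun y => phi (0, y)) x).
  by apply: eq_Rintegral => x _; apply: (congr1 (fun r => h x * r)); exact: esym (derive_tslice phi 0 j x).
rewrite (e (fun x => b0 x 0 l)) (e (component b l 0)).
exact: esym (initial l j (smooth_tslice 0 sp) (bsupp_tslice 0 bp)).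
Qed.

(** At time 0 the induction functional only sees gradients, so that each
    component of the offset has zero gradient. *)
Lemma magnetic_offset : exists c : E, {ae mu, forall x, b 0 x - b0 x = c}.
Proof.
have /choice[c Hc] : forall l, exists c : R, {ae mu, forall x, component b l 0 x - b0 x 0 l = c}.
  move=> l; have [A HA] := MB l; have [B HB] := Mb0 l.
  apply: (weak_constant j0 Hchi (M := A + B)).
  - exact: measurable_funB.
  - by near=> x; apply: (le_trans (ler_normB _ _)); apply: lerD; near: x.
  move=> z j sz bz.
  have lz := L1_smooth_bsupp (smooth_derive (unit_vec j) sz) (bsupp_derive (unit_vec j) bz).
  have [l1 _] := L1_pair (mB l) HA lz; have [l2 _] := L1_pair (mb0 l) HB lz.
  transitivity (\int[mu]_x (component b l 0 x * 'D_(unit_vec j) z x) -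
    \int[mu]_x (b0 x 0 l * 'D_(unit_vec j) z x)); last by rewrite initial// subrr.
  by rewrite -RintegralB//; apply: eq_Rintegral => x _; rewrite mulrBl.
exists (\row_l c l).
have : {ae mu, forall x, forall l, component b l 0 x - b0 x 0 l = c l} by apply: filter_forall.
by apply: filterS => x Hx; apply/rowP => l; rewrite [RHS]mxE -Hx [LHS]mxE [X in _ + X]mxE.
Unshelve. all: by end_near. Qed.

Let distr_comb (x : R) : distribution_on T p1 -> distribution_on T p2 ->
  distribution_on T (fun phi => x * p1 phi + x * p2 phi).
Proof.
move=> [L1 B1] [L2 B2]; split=> [a phi psi tp tq|K cK KT].
  by rewrite L1// L2//; ring.
have [N1 [C1 H1]] := B1 K cK KT; have [N2 [C2 H2]] := B2 K cK KT.
exists (maxn N1 N2), (`|x| * C1 + `|x| * C2) => phi M sp kp HM.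
apply: (le_trans (ler_normD _ _)); rewrite !normrM mulrDl -!mulrA.
apply: lerD; rewrite ler_wpM2l//; [apply: H1|apply: H2] => // js jn z z0; apply: HM => //.
  by rewrite (leq_trans jn)// leq_maxl.
by rewrite (leq_trans jn)// leq_maxr.
Qed.

Lemma ind_of_Sh : (forall t, 0 <= t < T -> Sh_field chi (b t \- b 0)) ->
  forall l phi, ctest T phi -> Q l (component b l 0) phi = 0.
Proof.
move=> HS l; apply: (Qf_zero j0 Hchi T0 (cb l) (fun k => cflux k l)) => //.
  by move=> psi j tp; exact: Q_trivial0.
move=> t p tT sp bp.
have e : (fun x : E => (b t \- b 0) x 0 l) = (fun x => component b l t x - component b l 0 x).
  by apply/funext => x; rewrite [LHS]mxE [X in _ + X]mxE.
have HSl : Sh chi (tempered_of (fun x => component b l t x - component b l 0 x)).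
  by rewrite -e; exact: HS t tT l.

have HH := Sh_kernel j0 Hchi HSl sp bp.
exact: HH.
Qed.

(** The momentum equation is half the sum of the Elsasser equations, with
    half the sum of the pressures. *)
Lemma MHD_of_ind : (forall l phi, ctest T phi -> Q l (component b l 0) phi = 0) ->
  MHD_weak_solution T u0 (b 0) u b.
Proof.
move=> HQ; exists (fun phi => 2^-1 * p1 phi + 2^-1 * p2 phi); split.
- exact: iu0.
- split; first by apply: (in_Linfty_time j0 cb).
  by apply: divergence_weak => z sz bz; exact: divt.
- exact: C0_L2loc.
- exact: C0_L2loc.
- exact: distr_comb (Els_p1 H) (Els_p2 H).
- move=> l phi tp.
  rewrite (delta0_comb j0 Hchi T0 (m1 l) (M1 l) (m2 l) (M2 l) (u0E l) tp) -eq1// -eq2//.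
  set pr := grad _ l phi.
  rewrite -[LHS]/(mom l phi + pr) momE// {}/pr /grad /ddiff; ring.
- move=> l phi tp; have [psi tpsi e] := normalized_test j0 Hchi T0 tp.
  rewrite -[LHS]/(ind l phi) (delta0_normalized _ e).
  rewrite /ind (evol_normalized (cb l) (fun k => cflux k l) tpsi e).
  by apply/eqP; rewrite -subr_eq0 evol_Qf; apply/eqP; exact: HQ.
- exact: divu.
Qed.

Lemma ind_of_MHD : MHD_weak_solution T u0 (b 0) u b ->
  forall l phi, test_function T phi -> ind l phi = delta0 (component b l 0) phi.
Proof. by move=> [p Hp] l phi; exact: MHD_induction Hp l phi. Qed.

Lemma Sh_of_MHD : MHD_weak_solution T u0 (b 0) u b ->
  forall t, 0 <= t < T -> Sh_field chi (b t \- b 0).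
Proof.
move=> /ind_of_MHD HI t tT l.
have HQ phi : ctest T phi -> Q l (component b l 0) phi = 0.
  by move=> tp; rewrite /Q -indQ HI ?subrr//; exact: ctest_test.
have [C C0 HC] := Qf_zero_conv j0 Hchi (cb l) (fun k => cflux k l) (fun=> erefl) tT HQ.
have [mt [Mt Ht]] := (cb l).1 t tT; have [M HM] := MB l.
have -> : (fun x : E => (b t \- b 0) x 0 l) = (fun x => component b l t x - component b l 0 x).
  by apply/funext => x; rewrite [LHS]mxE [X in _ + X]mxE.
apply: (kernel_Sh Hchi (M := Mt + M) (C := C)) => //.
  exact: measurable_funB.
by near=> x; apply: (le_trans (ler_normB _ _)); apply: lerD; near: x.
Unshelve. all: by end_near. Qed.

(** The initial terms vanish for test functions supported in positive times,
    and half the difference of the Elsasser equations is the induction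
    equation up to the pressures. *)
Lemma equal_pressure_gradients : MHD_weak_solution T u0 (b 0) u b ->
  forall l phi, test_function_pos T phi -> grad p1 l phi = grad p2 l phi.
Proof.
move=> /ind_of_MHD HI l phi tpos; have tp := test_pos_test tpos.
have d0 (h : E -> R) : delta0 h phi = 0.
  transitivity (\int[mu]_x (fun=> 0 : R) x); last by rewrite Rintegral_cst// mul0r.
  by apply: eq_Rintegral => x _; rewrite (test_pos_0 _ tpos) mulr0.
have I := HI l phi tp; have A := eq1 l tp; have B := eq2 l tp.
rewrite indE// d0 in I; rewrite d0 in A; rewrite d0 in B.
lra.
Qed.

End pressures.
End elsasser_variables.

Theorem theorem52 (R : realType) (d : nat) (T : R) (chi : 'rV[R]_d -> R)
    (alpha0 beta0 : 'rV[R]_d -> 'rV[R]_d)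
    (alpha beta : R -> 'rV[R]_d -> 'rV[R]_d) :
  (2 <= d)%N -> 0 < T -> cutoff chi ->
  in_Linfty alpha0 -> in_Linfty beta0 ->
  divergence_free alpha0 -> divergence_free beta0 ->
  C0_Linfty T alpha -> C0_Linfty T beta ->
  let u := fun t x => 2^-1 *: (alpha t x + beta t x) in
  let b := fun t x => 2^-1 *: (alpha t x - beta t x) in
  let u0 := fun x => 2^-1 *: (alpha0 x + beta0 x) in
  let b0 := fun x => 2^-1 *: (alpha0 x - beta0 x) in
  (forall p, MHD_with_pressure T u0 b0 u b p ->
     Elsasser_with_pressures T alpha0 beta0 alpha beta p p) /\
  (forall p1 p2, Elsasser_with_pressures T alpha0 beta0 alpha beta p1 p2 ->
     let cond_i :=
       MHD_weak_solution T u0 (b 0) u b /\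
       exists c : 'rV[R]_d,
         {ae @lebesgue_rV R d, forall x, b 0 x - b0 x = c} in
     let cond_ii :=
       forall t, 0 <= t < T -> Sh_field chi (b t \- b 0) in
     (cond_i <-> cond_ii) /\
     (cond_i \/ cond_ii ->
       forall l phi, test_function_pos T phi -> grad p1 l phi = grad p2 l phi)).
Proof.
move=> d2 T0 Hchi nal0 nbe0 dal0 dbe0 Cal Cbe u b u0 b0.
have j0 : 'I_d := Ordinal (leq_trans (isT : (0 < 2)%N) d2).
split=> [p|p1 p2 H cond_i cond_ii]; first
  by move=> Hp; apply: (elsasser_of_MHD j0 T0 Hchi nal0 nbe0 dal0 dbe0 Cal Cbe Hp).
have offset := magnetic_offset j0 T0 Hchi nal0 nbe0 dal0 dbe0 Cal Cbe H.
have i_ii : cond_i -> cond_ii.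
  by case=> + _; exact: (Sh_of_MHD j0 T0 Hchi Cal Cbe).
have ii_i : cond_ii -> cond_i.
  move=> Hii; split=> //; apply: (MHD_of_ind j0 T0 Hchi nal0 nbe0 dal0 dbe0 Cal Cbe H).
  exact: (ind_of_Sh j0 T0 Hchi nal0 nbe0 dal0 dbe0 Cal Cbe H).
split=> // Hor; have [Hi _] : cond_i by case: Hor => [|/ii_i].
exact: (equal_pressure_gradients j0 T0 Hchi Cal Cbe H Hi).
Qed.
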